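(* Let $G_n$ be the random geometric graph described in the context, with $r=r(n)$ an arbitrary sequence of positive reals tending to $0$, and put $t(n):=\sigma nr^d/\ln n$. Then $$\frac{\chi(G_n)}{\omega(G_n)\, f_{\mathrm{rat}}(t(n))}\to1\quad\text{almost surely},$$ where $f_{\mathrm{rat}}(t):=\dfrac{\sup_{\varphi\in\mathcal F}\xi(\varphi,t)}{\xi(\mathbf 1_{B(0;1/2)},t)}$ for $t\in(0,\infty)$.
   Context: Standing setup: $d\ge1$, a norm $\|\cdot\|$ on $\mathbb R^d$, $B(x;\rho)=\{y:\|x-y\|<\rho\}$. $\nu$ is a probability distribution on $\mathbb R^d$ with bounded density $f$, $\sigma:=\sup\{s:\mathrm{vol}(\{f>s\})>0\}$. $X_1,X_2,\dots$ i.i.d. $\sim\nu$; $G_n$ has vertices $1,\dots,n$, $i\ne j$ adjacent iff $\|X_i-X_j\|\le r(n)$. $\chi$ = chromatic number, $\omega$ = clique number. Weighted integral: $H(x)=x\ln x-x+1$; for nonnegative bounded measurable $\varphi$ with $0<\int\varphi<\infty$ and $0<t<\infty$, $s(\varphi,t)$ is the unique $s\ge0$ with $\int H(e^{s\varphi})=1/t$ and $\xi(\varphi,t)=\int\varphi e^{s(\varphi,t)\varphi}$; $\xi(\varphi,t)=0$ if $\int\varphi=0$. A set $S$ is well-spread if $\|v-w\|>1$ for distinct $v,w\in S$; a nonnegative measurable $\varphi$ is feasible if $\sum_{v\in S}\varphi(v)\le1$ for each well-spread $S$; $\mathcal F$ is the set of feasible functions. *)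

(* Defs.v *)
From HB Require Import structures.
From mathcomp Require Import all_boot all_order all_algebra.
From mathcomp Require Import all_classical all_reals all_analysis.
Set Implicit Arguments. Unset Strict Implicit. Unset Printing Implicit Defensive.
Import Order.TTheory GRing.Theory Num.Theory.
Import numFieldNormedType.Exports.
Local Open Scope classical_set_scope.
Local Open Scope ring_scope.

Section RGG.
Variables (R : realType) (d : nat).

(* points of R^d are d-tuples (carrying the product Borel sigma-algebra) *)
Definition tvec (x : d.-tuple R) : 'rV[R]_d := \row_i tnth x i.

Definition is_norm (N : 'rV[R]_d -> R) : Prop :=
  [/\ forall x, N x = 0 -> x = 0,
      forall (a : R) x, N (a *: x) = `|a| * N x
    & forall x y, N (x + y) <= N x + N y].

Definition dist (N : 'rV[R]_d -> R) (x y : d.-tuple R) : R := N (tvec x - tvec y).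

Definition Ball (N : 'rV[R]_d -> R) (x : d.-tuple R) (rho : R) : set (d.-tuple R) :=
  [set y | dist N x y < rho].

Definition origin : d.-tuple R := [tuple of nseq d 0].

(* leb is the d-dimensional Lebesgue measure: it gives every half-open box
   its volume (this characterizes it uniquely on the product Borel sets) *)
Definition is_lebesgue (leb : {measure set (d.-tuple R) -> \bar R}) : Prop :=
  forall a b : d.-tuple R, (forall i, tnth a i <= tnth b i) ->
    leb [set x | forall i, tnth a i <= tnth x i < tnth b i] =
    (\prod_(i < d) (tnth b i - tnth a i))%:E.

Definition ess_sigma (leb : {measure set (d.-tuple R) -> \bar R})
  (f : d.-tuple R -> R) : R :=
  sup [set s : R | (0 < leb [set x | (s < f x)%R])%E].

Definition Hfun (x : R) : R := x * ln x - x + 1.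

(* s(phi,t): the unique s >= 0 with int H(e^{s phi}) = 1/t *)
Definition s_wi (leb : {measure set (d.-tuple R) -> \bar R})
  (phi : d.-tuple R -> R) (t : R) : R :=
  xget 0 [set s : R | 0 <= s /\
    (\int[leb]_x (Hfun (expR (s * phi x)%R))%:E = (t^-1)%:E)%E].

Definition xi (leb : {measure set (d.-tuple R) -> \bar R})
  (phi : d.-tuple R -> R) (t : R) : R :=
  if (\int[leb]_x (phi x)%:E == 0)%E then 0
  else fine (\int[leb]_x (phi x * expR (s_wi leb phi t * phi x))%R%:E)%E.

Definition well_spread (N : 'rV[R]_d -> R) (S : set (d.-tuple R)) : Prop :=
  forall v w, S v -> S w -> v <> w -> 1 < dist N v w.

Definition feasible (N : 'rV[R]_d -> R) (phi : d.-tuple R -> R) : Prop :=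
  [/\ forall x, 0 <= phi x,
      measurable_fun setT phi
    & forall S, well_spread N S -> (\esum_(v in S) (phi v)%:E <= 1)%E].

Definition f_rat (N : 'rV[R]_d -> R) (leb : {measure set (d.-tuple R) -> \bar R})
  (t : R) : R :=
  fine (ereal_sup [set (xi leb phi t)%:E | phi in feasible N]) /
  xi leb (\1_(Ball N origin (1/2)) : d.-tuple R -> R) t.

End RGG.

Definition colorable (n : nat) (adj : rel 'I_n) (k : nat) : bool :=
  [exists c : {ffun 'I_n -> 'I_k},
    [forall i, forall j, ((i != j) && adj i j) ==> (c i != c j)]].

Lemma colorable_n (n : nat) (adj : rel 'I_n) : exists k, colorable adj k.
Proof.
exists n; apply/existsP; exists [ffun i => i].
apply/forallP => i; apply/forallP => j; apply/implyP => /andP[ij _].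
by rewrite !ffunE.
Qed.

Definition chromatic_number (n : nat) (adj : rel 'I_n) : nat :=
  ex_minn (colorable_n adj).

Definition is_clique (n : nat) (adj : rel 'I_n) (S : {set 'I_n}) : bool :=
  [forall i in S, forall j in S, (i != j) ==> adj i j].

Definition clique_number (n : nat) (adj : rel 'I_n) : nat :=
  \max_(S : {set 'I_n} | is_clique adj S) #|S|.

Definition mutually_independent (R : realType) (d0 : measure_display)
  (Omega : measurableType d0) (P : probability Omega R) (d : nat)
  (X : nat -> Omega -> d.-tuple R) : Prop :=
  forall (s : seq nat) (A : nat -> set (d.-tuple R)),
    uniq s -> (forall i, measurable (A i)) ->
    P (\big[setI/setT]_(i <- s) (X i @^-1` A i)) =
    (\prod_(i <- s) P (X i @^-1` A i))%E.

(* Main.v *)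
(* By convexity, xi(phi,t) is the minimum over s > 0 of (1/t + int (e^(s phi) - 1)) / s. This dual
   formula makes chi and omega instances of one scheme. To chi belongs the class G of all feasible
   weights, to omega the class G = {1_B(0;1/2)}. The parameter is at least every sum of
   phi((X_i - y)/r), phi in G. Up to a factor 1 + eps and an additive constant, it is also at most
   the largest of all translates of finitely many sums of psi(cell of X_i), where each psi has its
   exponential integral dominated by that of a member of G. For chi the psi are the extreme duals of
   fractional colouring of the cells of a large window, and for omega they are indicators of
   shapes W of cliques, which satisfy 2^d |W| <= |W - W + {0,1}^d|.

   Exponential moments bound all translated sums from above. Conversely, an exponential tilt and
   Chebyshev's inequality give each of about r^(-d) disjoint windows, placed where f is close to
   sigma, a fair chance to reach the bound. So the parameter is close to
   mu sup_G xi(., t), with mu = sigma n r^d, along polynomially growing n and a grid of radii.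
   Monotonicity in n and r extends this to all n as long as t stays away from 0.

   For small t the quotient f_rat is close to 1. A degree argument gives chi <= max(omega, A - 1),
   where A is the largest number of points in a two-step neighbourhood. Both omega and A - 1
   agree up to a factor 1 + eps with the clique size predicted by the first moment. *)

Require Import Defs.
From HB Require Import structures.
From mathcomp Require Import all_boot all_order all_algebra.
From mathcomp Require Import ring lra zify.

Set Implicit Arguments. Unset Strict Implicit. Unset Printing Implicit Defensive.
Import Order.TTheory GRing.Theory Num.Theory.
Local Open Scope ring_scope.

(** * Fractional colourings, chromatic and clique numbers *)

(** Since r is arbitrary, t(n) may wander through all scales, so every estimate has to be organised
    by the value of t and not by n. For t in a compact range the estimates fail with probability
    n^(-delta), delta small, which is not summable; they are summable only along n = j^k, so between
    consecutive powers the argument rests on bounds that hold for all radii at once. For large t the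
    failure probability is n^(-2) and the given r(n) is treated directly. Near t = 0 no finite grid
    of values of t exists; there the grid consists of about ln n radii, and chi is compared with
    omega itself.

    An upper bound can afford a fixed finite union and an additive constant, nothing more. Hence
    space is cut into cells of side proportional to r, and the test functions come from an
    elimination whose multipliers depend on the cell graph only, never on the sample. For cliques
    finiteness comes from the finitely many sets of cells in a box; cells have thickness, which is
    the role of {0,1}^d in the isodiametric step. Many events range over uncountably many radii or
    translates, which is why outer probabilities are used throughout. *)

Section FourierMotzkin.
Variable R : realFieldType.

Lemma separating_point (I : finType) (P Q : pred I) (u : I -> R) :
  (forall i j, P i -> Q j -> u j <= u i) ->
  exists x, (forall i, P i -> x <= u i) /\ (forall j, Q j -> u j <= x).
Proof.
move=> le; case: (pickP Q) => [j0 Qj0|Q0].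
  exists (u [arg max_(j > j0 | Q j) u j]%O).
  by case: arg_maxP => // j Qj jmax; split=> [i Pi|i Qi]; [exact: le|exact: jmax].
case: (pickP P) => [i0 Pi0|P0].
  exists (u [arg min_(i < i0 | P i) u i]%O).
  by case: arg_minP => // i Pi imin; split=> [k Pk|k]; [exact: imin|rewrite Q0].
by exists 0; split=> k; rewrite ?Q0 ?P0.
Qed.

(** A Farkas lemma with the quantifiers arranged so that the finite list [L] depends on the matrix
    only: one list of multipliers decides solvability for every right-hand side [b]. The proof
    eliminates the last variable. *)
Lemma fourier_motzkin n (I : finType) (a : I -> nat -> R) :
  exists L : seq {ffun I -> R},
    (forall lam, lam \in L -> (forall i, 0 <= lam i) /\
       forall j, (j < n)%N -> \sum_i lam i * a i j = 0) /\
    (forall b : I -> R, (forall lam, lam \in L -> 0 <= \sum_i lam i * b i) ->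
       exists y : nat -> R, forall i, \sum_(j < n) a i j * y j <= b i).
Proof.
elim: n I a => [|n IH] I a.
  exists [seq [ffun i => (i == k)%:R] | k : I]; split=> [lam /mapP[k _ ->]|b hb].
    by split=> [i|//]; rewrite ffunE ler0n.
  exists (fun=> 0) => i; rewrite big_ord0.
  have := hb [ffun j => (j == i)%:R] (map_f _ (mem_enum I i)).
  rewrite (bigD1 i) //= ffunE eqxx mul1r big1 ?addr0 // => j /negPf ji.
  by rewrite ffunE ji mul0r.
(* Rows of the system without the variable [n]: [inl] keeps a row in which it is absent, [inr] adds
   a row with positive and one with negative coefficient after scaling. All other indices give the
   zero row, so that the index type does not depend on the signs. *)
pose coef (k : I + I * I) (i : I) : R := match k with
  | inl i0 => if a i0 n == 0 then (i == i0)%:R else 0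
  | inr (i1, i2) => if (0 < a i1 n) && (a i2 n < 0)
      then (i == i1)%:R / a i1 n + (i == i2)%:R / - a i2 n else 0 end.
have coef0 k i : 0 <= coef k i.
  case: k => [i0|[i1 i2]] /=; first by case: ifP.
  case: ifP => // /andP[p1 p2].
  by rewrite addr_ge0 // divr_ge0 ?ler0n // ?(ltW p1) // oppr_ge0 ltW.
have sumd i0 (c : I -> R) : \sum_i (i == i0)%:R * c i = c i0.
  rewrite (bigD1 i0) //= eqxx mul1r big1 ?addr0 // => j /negPf ->.
  by rewrite mul0r.
have sumc k (c : I -> R) : \sum_i coef k i * c i = match k with
  | inl i0 => if a i0 n == 0 then c i0 else 0
  | inr (i1, i2) => if (0 < a i1 n) && (a i2 n < 0)
      then c i1 / a i1 n + c i2 / - a i2 n else 0 end.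
  case: k => [i0|[i1 i2]] /=; case: ifP => _.
  - exact: sumd.
  - by apply: big1 => i _; rewrite mul0r.
  - under eq_bigr => i _ do rewrite mulrDl mulrAC [X in _ + X]mulrAC.
    by rewrite big_split /= -!mulr_suml !sumd.
  - by apply: big1 => i _; rewrite mul0r.
have [L [L1 L2]] := IH _ (fun k j => \sum_i coef k i * a i j).
pose back (lam : {ffun I + I * I -> R}) : {ffun I -> R} :=
  [ffun i => \sum_k lam k * coef k i].
have backE lam (c : I -> R) :
    \sum_i back lam i * c i = \sum_k lam k * \sum_i coef k i * c i.
  under eq_bigr => i _ do rewrite ffunE mulr_suml.
  rewrite exchange_big; apply: eq_bigr => k _.
  by rewrite mulr_sumr; apply: eq_bigr => i _; rewrite mulrA.
exists [seq back lam | lam <- L]; split=> [lam /mapP[mu muL ->]|b hb].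
  have [mu0 muE] := L1 _ muL; split=> [i|j].
    by rewrite ffunE sumr_ge0 // => k _; rewrite mulr_ge0.
  rewrite ltnS leq_eqVlt => /orP[/eqP ->|jn]; rewrite backE; last exact: muE.
  apply: big1 => k _; rewrite sumc; case: k => [i0|[i1 i2]].
    by case: ifP => [/eqP ->|]; rewrite mulr0.
  case: ifP => [/andP[p1 p2]|]; last by rewrite mulr0.
  by rewrite invrN mulrN !divff ?subrr ?mulr0 // ?(lt_eqF p2) ?(gt_eqF p1).
have [|y yb] := L2 (fun k => \sum_i coef k i * b i).
  by move=> mu muL; rewrite -backE; apply: hb; exact: map_f.
have yb' k : \sum_i coef k i * (\sum_(j < n) a i j * y j) <= \sum_i coef k i * b i.
  apply: le_trans (yb k); rewrite le_eqVlt; apply/orP; left; apply/eqP.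
  under eq_bigr => i _ do rewrite mulr_sumr.
  rewrite exchange_big; apply: eq_bigr => j _.
  by rewrite mulr_suml; apply: eq_bigr => i _; rewrite mulrA.
(* The bound that row [i] puts on the eliminated variable: an upper bound if the coefficient is
   positive, a lower bound if it is negative. *)
pose u i := (b i - \sum_(j < n) a i j * y j) / a i n.
have [|x [xP xQ]] := @separating_point I (fun i => 0 < a i n) (fun i => a i n < 0) u.
  move=> i j pi nj; have := yb' (inr (i, j)); rewrite !sumc pi nj /=.
  by rewrite /u !invrN !mulrN !mulrBl; lra.
exists (fun j => if j == n then x else y j) => i.
rewrite big_ord_recr /= eqxx (eq_bigr (fun j : 'I_n => a i j * y j)); last first.
  by move=> j _; rewrite ltn_eqF.
case: (ltgtP (a i n) 0) => [lt0|gt0|e0].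
- have := xQ _ lt0; rewrite /u ler_ndivrMr // => h; lra.
- have := xP _ gt0; rewrite /u ler_pdivlMr // => h; lra.
- by have := yb' (inl i); rewrite !sumc e0 eqxx mul0r addr0.
Qed.

End FourierMotzkin.

Section FractionalColoring.
Variables (R : archiRealFieldType) (V : finType) (e : rel V).

Definition stable (S : {set V}) := [forall v in S, forall w in S, (v != w) ==> ~~ e v w].

Lemma stableP (S : {set V}) :
  reflect (forall v w, v \in S -> w \in S -> v != w -> ~~ e v w) (stable S).
Proof.
apply: (iffP forall_inP) => [h v w vS wS vw|h v vS].
  by have /forall_inP/(_ _ wS)/implyP := h v vS; apply.
by apply/forall_inP => w wS; apply/implyP => vw; apply: h.
Qed.

(* The finitely many [psi] are the duals produced by Fourier-Motzkin elimination applied to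
   the fractional colouring program, rounding costs one colour per stable set. *)
Lemma fractional_coloring : exists (L : seq {ffun V -> R}) (C : nat),
  (forall psi, psi \in L -> (forall v, 0 <= psi v) /\
     forall S, stable S -> \sum_(v in S) psi v <= 1) /\
  (forall (m : V -> nat) (a : R), 0 <= a ->
     (forall psi, psi \in L -> \sum_v psi v * (m v)%:R <= a) ->
     exists s : seq {set V}, [/\ all stable s, (size s)%:R <= a + C%:R
       & forall v, (m v <= count (fun S : {set V} => v \in S) s)%N]).
Proof.
pose st := enum [pred S | stable S].
pose n := size st.
pose S_ j := nth set0 st j.
have stS j : (j < n)%N -> stable (S_ j).
  by move=> jn; have := mem_nth set0 jn; rewrite mem_enum.
(* One unknown per stable set; the rows say that each vertex [v] is covered at least [m v] times,
   that the total weight is at most the budget, and that weights are nonnegative. *)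
pose I := (V + unit + 'I_n)%type.
pose a (i : I) (j : nat) : R := match i with
  | inl (inl v) => - (v \in S_ j)%:R
  | inl (inr _) => 1
  | inr k => - (val k == j)%:R end.
have [L [L1 L2]] := fourier_motzkin n a.
have sumI (F : I -> R) : \sum_i F i =
    \sum_v F (inl (inl v)) + F (inl (inr tt)) + \sum_k F (inr k).
  rewrite !big_sumType /=; congr (_ + _ + _).
  by rewrite (big_pred1 tt) // => -[].
exists [seq [ffun v => lam (inl (inl v)) / lam (inl (inr tt))] | lam : {ffun I -> R} <- L], n.
split=> [psi /mapP[lam lamL ->]|m c c0 hm].
  have [lam0 lamE] := L1 _ lamL; split=> [v|S]; first by rewrite ffunE divr_ge0.
  move=> stb; have Sst : S \in st by rewrite mem_enum.
  have jn : (index S st < n)%N by rewrite index_mem.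
  have := lamE _ jn; rewrite sumI /= mulr1 /S_ nth_index //.
  under eq_bigr do rewrite mulrN.
  under [X in _ + _ + X = _]eq_bigr do rewrite mulrN.
  rewrite !sumrN => E.
  have le1 : \sum_(v in S) lam (inl (inl v)) <= lam (inl (inr tt)).
    have -> : \sum_(v in S) lam (inl (inl v)) = \sum_v lam (inl (inl v)) * (v \in S)%:R.
      by rewrite big_mkcond; apply: eq_bigr => v _; case: (v \in S); rewrite ?mulr1 ?mulr0.
    have : 0 <= \sum_(k < n) lam (inr k) * (val k == index S st)%:R.
      by apply: sumr_ge0 => k _; rewrite mulr_ge0.
    lra.
  under eq_bigr do rewrite ffunE.
  rewrite -mulr_suml; have [z|nz] := eqVneq (lam (inl (inr tt))) 0.
    by rewrite z invr0 mulr0.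
  by rewrite ler_pdivrMr ?mul1r // lt0r nz lam0.
pose b (i : I) : R := match i with
  | inl (inl v) => - (m v)%:R | inl (inr _) => c | inr k => 0 end.
have [|y yb] := L2 b.
  move=> lam lamL; have [lam0 lamE] := L1 _ lamL.
  rewrite sumI /= [X in _ + X]big1 => [|k _]; last by rewrite mulr0.
  under eq_bigr do rewrite mulrN.
  rewrite sumrN addr0.
  have := hm _ (map_f _ lamL).
  rewrite (eq_bigr (fun v => lam (inl (inl v)) * (m v)%:R / lam (inl (inr tt)))); last first.
    by move=> v _; rewrite ffunE mulrAC.
  rewrite -mulr_suml; have [z|nz] := eqVneq (lam (inl (inr tt))) 0.
    (* If the budget multiplier vanishes, the column of the stable set {v} forces the multiplier of
       [v] to vanish too; so normalising by the budget multiplier, with x / 0 = 0, loses nothing. *)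
    have lz v : lam (inl (inl v)) = 0.
      have Sst : [set v] \in st.
        by rewrite mem_enum; apply/stableP => x w /set1P -> /set1P ->; rewrite eqxx.
      have jn : (index [set v] st < n)%N by rewrite index_mem.
      have := lamE _ jn; rewrite sumI /= mulr1 /S_ nth_index // z addr0.
      have : 0 <= \sum_(k < n) lam (inr k) * (val k == index [set v] st)%:R.
        by apply: sumr_ge0 => k _; rewrite mulr_ge0.
      under [X in _ + X = _]eq_bigr do rewrite mulrN.
      rewrite sumrN (bigD1 v) //= set11 [X in _ + X - _]big1 => [|w /negPf wv]; last first.
        by rewrite inE wv oppr0 mulr0.
      by have := lam0 (inl (inl v)); rewrite mulr1n mulrN1; lra.
    by rewrite z mul0r addr0 big1 ?oppr0 // => v _; rewrite lz mul0r.
  rewrite ler_pdivrMr; last by rewrite lt0r nz lam0.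
  by lra.
have y0 (k : 'I_n) : 0 <= y k.
  have := yb (inr k); rewrite /= (bigD1 k) //= eqxx big1 => [|j /negPf jk].
    by rewrite mulN1r addr0; lra.
  rewrite (_ : (k == j :> nat) = false) ?oppr0 ?mul0r //.
  by move: jk; rewrite -val_eqE /= eq_sym.
have iotaE (F : nat -> nat) : (\sum_(j <- iota 0 n) F j = \sum_(j < n) F j)%N.
  by rewrite -{1}[n]subn0 -/(index_iota 0 n) big_mkord.
exists (flatten [seq nseq (Num.truncn (y j)).+1 (S_ j) | j <- iota 0 n]); split.
- apply/allP => S /flattenP[q /mapP[j]]; rewrite mem_iota add0n => jn -> /nseqP[-> _].
  exact: stS.
- rewrite size_flatten sumnE /shape -map_comp big_map /= iotaE natr_sum.
  have := yb (inl (inr tt)); rewrite /= => h.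
  apply: (@le_trans _ _ (\sum_(j < n) (y j + 1))).
    apply: ler_sum => j _; rewrite size_nseq -natr1 lerD2r.
    by have /andP[] := truncn_itv (y0 j).
  rewrite big_split /= sumr_const card_ord lerD2r; apply: le_trans h.
  by apply: ler_sum => j _; rewrite mul1r.
move=> v; rewrite count_flatten sumnE -map_comp big_map /= iotaE -(ler_nat R) natr_sum.
have := yb (inl (inl v)); rewrite /= => h.
apply: (@le_trans _ _ (\sum_(j < n) (v \in S_ j)%:R * y j)).
  by move: h; under eq_bigr do rewrite mulNr; rewrite sumrN lerN2.
apply: ler_sum => j _.
rewrite -[X in _ <= X%:R]/(count (fun S : {set V} => v \in S) (nseq (Num.truncn (y j)).+1 (S_ j))).
rewrite count_nseq natrM ler_wpM2l //.
by have /andP[_ /ltW] := truncn_itv (y0 j).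
Qed.

End FractionalColoring.

(* The index of the [i]-th member of [s] containing [v]; it serves as a colour. *)
Definition slot (V : finType) (s : seq {set V}) (v : V) (i : nat) : nat :=
  nth 0%N [seq c <- iota 0 (size s) | v \in nth set0 s c] i.

Lemma size_slots (V : finType) (s : seq {set V}) (v : V) :
  size [seq c <- iota 0 (size s) | v \in nth set0 s c] = count (fun S : {set V} => v \in S) s.
Proof.
rewrite size_filter -[in RHS](mkseq_nth set0 s) /mkseq count_map.
by apply: eq_count.
Qed.

Lemma slotP (V : finType) (s : seq {set V}) (v : V) i :
  (i < count (fun S : {set V} => v \in S) s)%N ->
  (slot s v i < size s)%N /\ v \in nth set0 s (slot s v i).
Proof.
rewrite -size_slots => /(mem_nth 0%N); rewrite mem_filter mem_iota add0n.
by rewrite -/(slot s v i) => /andP[? ?].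
Qed.

Lemma slot_inj (V : finType) (s : seq {set V}) (v : V) i j :
  (i < count (fun S : {set V} => v \in S) s)%N ->
  (j < count (fun S : {set V} => v \in S) s)%N -> slot s v i = slot s v j -> i = j.
Proof.
rewrite -size_slots => hi hj /eqP; rewrite nth_uniq //; first by move/eqP.
by rewrite filter_uniq // iota_uniq.
Qed.

(** * Monotonicity and comparison of the chromatic and clique numbers *)

Section GraphParameters.

Lemma chromatic_number_colorable n (adj : rel 'I_n) : colorable adj (chromatic_number adj).
Proof. by rewrite /chromatic_number; case: ex_minnP. Qed.

Lemma chromatic_number_le n (adj : rel 'I_n) k : colorable adj k -> (chromatic_number adj <= k)%N.
Proof. by rewrite /chromatic_number; case: ex_minnP => m _ h /h. Qed.

Lemma colorableP n (adj : rel 'I_n) k :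
  reflect (exists c : 'I_n -> nat, (forall i, (c i < k)%N) /\
     forall i j, i != j -> adj i j -> c i != c j) (colorable adj k).
Proof.
apply: (iffP existsP) => [[c /forallP h]|[c [ck h]]].
  exists (fun i => val (c i)); split=> [i|i j ij aij]; first exact: ltn_ord.
  have /forallP/(_ j)/implyP := h i.
  by rewrite ij aij => /(_ isT).
exists [ffun i => Ordinal (ck i)]; apply/forallP => i; apply/forallP => j.
by apply/implyP => /andP[ij aij]; rewrite !ffunE -val_eqE /=; exact: h.
Qed.

Lemma is_cliqueP n (adj : rel 'I_n) (S : {set 'I_n}) :
  reflect (forall i j, i \in S -> j \in S -> i != j -> adj i j) (is_clique adj S).
Proof.
apply: (iffP forall_inP) => [h v w vS wS vw|h v vS].
  by have /forall_inP/(_ _ wS)/implyP := h v vS; apply.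
by apply/forall_inP => w wS; apply/implyP => vw; apply: h.
Qed.

Lemma clique_number_ge n (adj : rel 'I_n) (S : {set 'I_n}) :
  is_clique adj S -> (#|S| <= clique_number adj)%N.
Proof. by move=> cS; rewrite /clique_number (bigD1 S) //= leq_maxl. Qed.

Lemma clique_number_le n (adj : rel 'I_n) k :
  (forall S, is_clique adj S -> (#|S| <= k)%N) -> (clique_number adj <= k)%N.
Proof. by move=> h; apply/bigmax_leqP. Qed.

Lemma chromatic_number_mono n m (adj : rel 'I_n) (adj' : rel 'I_m) (f : 'I_n -> 'I_m) :
  injective f -> (forall i j, adj i j -> adj' (f i) (f j)) ->
  (chromatic_number adj <= chromatic_number adj')%N.
Proof.
move=> finj fadj; apply: chromatic_number_le.
have /colorableP[c [ck h]] := chromatic_number_colorable adj'.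
apply/colorableP; exists (c \o f); split=> [i|i j ij aij] /=; first exact: ck.
by apply: h; [rewrite (inj_eq finj)|exact: fadj].
Qed.

Lemma clique_number_mono n m (adj : rel 'I_n) (adj' : rel 'I_m) (f : 'I_n -> 'I_m) :
  injective f -> (forall i j, adj i j -> adj' (f i) (f j)) ->
  (clique_number adj <= clique_number adj')%N.
Proof.
move=> finj fadj; apply: clique_number_le => S /is_cliqueP cS.
rewrite -(card_imset _ finj); apply: clique_number_ge.
apply/is_cliqueP => _ _ /imsetP[i iS ->] /imsetP[j jS ->] ij.
by apply/fadj/cS => //; apply: contraNneq ij => ->.
Qed.

Lemma clique_le_chromatic n (adj : rel 'I_n) : (clique_number adj <= chromatic_number adj)%N.
Proof.
apply: clique_number_le => S /is_cliqueP cS.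
have /existsP[c /forallP h] := chromatic_number_colorable adj.
have cinj : {in S &, injective c}.
  move=> i j iS jS ceq; apply/eqP/negPn/negP => ij.
  by have /forallP/(_ j) := h i; rewrite ij (cS _ _ iS jS ij) ceq eqxx.
by rewrite -(card_in_imset cinj) (leq_trans (max_card _)) ?card_ord.
Qed.

Lemma clique_number_gt0 n (adj : rel 'I_n) : (0 < n)%N -> (0 < clique_number adj)%N.
Proof.
case: n adj => // n adj _; apply: leq_trans (clique_number_ge (S := [set ord0]) _).
  by rewrite cards1.
by apply/is_cliqueP => i j /set1P -> /set1P ->; rewrite eqxx.
Qed.

(* In a subgraph all of whose degrees are at least the claimed bound, every closed
   neighbourhood fills its whole two-step ball, so all of them coincide locally and form a clique. *)
Lemma chromatic_le_two_step n (adj : rel 'I_n) A :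
  (forall i, adj i i) -> (forall i j, adj i j = adj j i) ->
  (forall v, (#|[set w | [exists u, adj v u && adj u w]]| <= A)%N) ->
  (chromatic_number adj <= maxn (clique_number adj) A.-1)%N.
Proof.
move=> arefl asym hA; set b := maxn _ _; apply: chromatic_number_le.
suff H : forall k (U : {set 'I_n}), (#|U| <= k)%N -> exists c : 'I_n -> nat,
    (forall i, i \in U -> (c i < b)%N) /\
    forall i j, i \in U -> j \in U -> i != j -> adj i j -> c i != c j.
  have [|c [c1 c2]] := H n [set: 'I_n]; first by rewrite cardsT card_ord.
  by apply/colorableP; exists c; split=> [i|i j]; [apply: c1|apply: c2]; rewrite ?inE.
elim=> [|k IH] U Uk.
  exists (fun=> 0%N); have U0 i : i \in U = false.
    by apply/negbTE; move: Uk; rewrite leqn0 cards_eq0 => /eqP ->; rewrite inE.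
  by split=> [i|i j]; rewrite U0.
pose N v := [set w in U | adj v w].
have [v0 v0U|U0] := pickP (mem U); last first.
  exists (fun=> 0%N); have U0' i : i \in U = false by exact: U0.
  by split=> [i|i j]; rewrite U0'.
case: (pickP [pred v in U | (#|N v| <= b)%N]) => [v /andP[/= vU Nvb]|big].
  have [|c [c1 c2]] := IH (U :\ v).
    by move: Uk; rewrite (cardsD1 v U) vU add1n ltnS.
  have vN : v \in N v by rewrite inE vU arefl.
  have [x xb xN] : exists2 x, (x < b)%N & forall w, w \in N v :\ v -> c w != x.
    pose s := [seq c w | w <- enum (N v :\ v)].
    have ss : (size s < b)%N.
      by rewrite size_map -cardE; move: Nvb; rewrite (cardsD1 v (N v)) vN.
    have : has (fun x => x \notin s) (iota 0 b).
      apply/negPn/negP; rewrite -all_predC => /allP al.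
      have : (size (iota 0 b) <= size s)%N.
        apply: uniq_leq_size; first exact: iota_uniq.
        by move=> x /al /=; rewrite negbK.
      by rewrite size_iota leqNgt ss.
    move=> /hasP[x]; rewrite mem_iota add0n => xb xs; exists x => // w wN.
    by apply: contraNneq xs => <-; apply/map_f; rewrite mem_enum.
  exists (fun i => if i == v then x else c i); split=> [i iU|i j iU jU ij aij].
    by case: eqVneq => // iv; apply: c1; rewrite !inE iv.
  have [iv|iv] := eqVneq i v; have [jv|jv] := eqVneq j v.
  - by move: ij; rewrite iv jv eqxx.
  - by rewrite eq_sym xN // !inE jv jU -iv.
  - by rewrite xN // !inE iv iU -jv asym.
  - by apply: c2 => //; rewrite !inE ?iv ?jv.
exfalso.
have bigN v : v \in U -> (b < #|N v|)%N.
  by move=> vU; rewrite ltnNge; have := big v; rewrite /= vU => /= ->.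
pose B v := [set w | [exists u, adj v u && adj u w]].
have NB v x : v \in U -> adj v x -> N x \subset B v.
  move=> vU avx; apply/subsetP => w; rewrite !inE => /andP[_ axw].
  by apply/existsP; exists x; rewrite avx.
have bA : (A <= b.+1)%N.
  by rewrite -ltnS /b; have := leq_maxr (clique_number adj) A.-1; case: (A) => //= *; rewrite ltnS.
have NE v x : v \in U -> x \in N v -> N x = B v.
  move=> vU; rewrite inE => /andP[xU avx]; apply/eqP; rewrite eqEcard NB //=.
  by apply: leq_trans (hA v) _; apply: leq_trans bA _; exact: bigN.
have {}v0U : v0 \in U by [].
have v0N : v0 \in N v0 by rewrite inE v0U arefl.
have : (#|N v0| <= clique_number adj)%N.
  apply: clique_number_ge; apply/is_cliqueP => x y xN yN _.
  have : y \in N x by rewrite (NE _ _ v0U xN) -(NE _ _ v0U v0N).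
  by rewrite inE => /andP[].
by rewrite leqNgt (leq_ltn_trans (leq_maxl _ A.-1)) ?bigN.
Qed.

End GraphParameters.

(** * A discrete isodiametric inequality *)

Section DiscreteBrunnMinkowski.

Lemma big_count_undup (T : eqType) (h : T -> int) (A : seq T) :
  (\sum_(x <- undup (map h A)) count (fun a => h a == x) A = size A)%N.
Proof.
under eq_bigr do rewrite -sum1_count big_mkcond.
rewrite exchange_big /= -sum1_size !big_seq; apply: eq_bigr => a aA.
rewrite -big_mkcond /= sum1_count (eq_count (a2 := pred1 (h a))); last by move=> x /=; rewrite eq_sym.
by rewrite count_uniq_mem ?undup_uniq // mem_undup map_f.
Qed.

(** With x1 the maximum of [X] and y0 the minimum of [Y], the translates X + y0 and x1 + Y + 1 are
    disjoint, the first ending before the second begins. The extra unit repairs the usual defect of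
    one in |X + Y| >= |X| + |Y| - 1. *)
Lemma sumset_size (X Y Z : seq int) : uniq X -> uniq Y -> uniq Z -> X != [::] -> Y != [::] ->
  (forall x y, x \in X -> y \in Y -> x + y \in Z /\ x + y + 1 \in Z) ->
  (size X + size Y <= size Z)%N.
Proof.
move=> uX uY uZ X0 Y0 h.
have maxX : exists2 x, x \in X & forall x', x' \in X -> x' <= x.
  elim: X X0 {uX h} => // x [|x' X] IH _; first by exists x; rewrite ?inE // => ? /[!inE] /eqP ->.
  have [//|m mX mmax] := IH.
  have [xm|mx] := leP x m; [exists m|exists x]; rewrite ?inE ?eqxx //.
  - by rewrite -in_cons mX orbT.
  - by move=> z; rewrite inE => /predU1P[->//|/mmax].
  - by move=> z; rewrite inE => /predU1P[->//|/mmax/le_trans]; apply; exact: ltW.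
have minY : exists2 y, y \in Y & forall y', y' \in Y -> y <= y'.
  elim: Y Y0 {uY h} => // x [|x' Y] IH _; first by exists x; rewrite ?inE // => ? /[!inE] /eqP ->.
  have [//|m mX mmax] := IH.
  have [xm|mx] := leP m x; [exists m|exists x]; rewrite ?inE ?eqxx //.
  - by rewrite -in_cons mX orbT.
  - by move=> z; rewrite inE => /predU1P[->//|/mmax].
  - move=> z; rewrite inE => /predU1P[->//|/mmax]; apply: le_trans; exact: ltW.
case: maxX => x1 x1X xmax; case: minY => y0 y0Y ymin.
rewrite -(size_map (fun x => x + y0) X) -(size_map (fun y => x1 + y + 1) Y) -size_cat.
apply: uniq_leq_size.
  rewrite cat_uniq !map_inj_uniq ?uX ?uY /= ?andbT; last 2 first.
  - by move=> a b /addIr/addrI.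
  - by move=> a b /addIr.
  apply/hasPn => _ /mapP[y yY ->]; apply/negP => /mapP[x xX].
  by have := xmax _ xX; have := ymin _ yY; lia.
move=> z; rewrite mem_cat => /orP[] /mapP[w wW ->].
  by case: (h _ _ wW y0Y).
by case: (h _ _ x1X wW).
Qed.

Lemma sum_ltn (T m : nat) : (m <= T)%N -> (\sum_(l < T) (l < m)%N = m)%N.
Proof.
move=> mT; rewrite -[RHS]card_ord -sum1_card (big_ord_widen _ (fun=> 1%N) mT) [RHS]big_mkcond.
by apply: eq_bigr => i _; case: ifP.
Qed.

(** Summation of sqrt(K) N <= c sqrt(T), written without square roots; the cross terms are
    multiplied out. *)
Lemma sum_square_le (I : Type) (Z : seq I) (N c : I -> nat) (K T : nat) :
  (forall z, K * N z ^ 2 <= c z ^ 2 * T)%N ->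
  (K * (\sum_(z <- Z) N z) ^ 2 <= (\sum_(z <- Z) c z) ^ 2 * T)%N.
Proof.
move=> h; elim: Z => [|z Z IH]; first by rewrite !big_nil muln0.
rewrite !big_cons; set S := (\sum_(j <- Z) N j)%N in IH *.
set S' := (\sum_(j <- Z) c j)%N in IH *.
have cross : (K * N z * S <= c z * S' * T)%N.
  rewrite -leq_sqr (_ : (_ ^ 2 = K * N z ^ 2 * (K * S ^ 2))%N); last by ring.
  rewrite (_ : ((c z * S' * T) ^ 2 = c z ^ 2 * T * (S' ^ 2 * T))%N); last by ring.
  exact: leq_mul.
rewrite (_ : (_ * _ = K * N z ^ 2 + K * S ^ 2 + (K * N z * S + K * N z * S))%N); last by ring.
rewrite (_ : (_ * T = c z ^ 2 * T + S' ^ 2 * T + (c z * S' * T + c z * S' * T))%N); last by ring.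
by rewrite leq_add ?leq_add ?h.
Qed.

(** A Prékopa-Leindler inequality on the integers. [sumset_size] is applied to the superlevel sets
    of [f] and [g] and summed over the levels; the factor 4 is the inequality of arithmetic and
    geometric means at the end. *)
Lemma prekopa_leindler_int (X Y Z : seq int) (f g c : int -> nat) (K : nat) :
  uniq X -> uniq Y -> uniq Z ->
  (forall (x y : int) (e : bool), x \in X -> y \in Y -> (0 < f x)%N -> (0 < g y)%N ->
     x + y + e%:Z \in Z /\ (K * (f x * g y) <= c (x + y + e%:Z)%R ^ 2)%N) ->
  (4 * K * ((\sum_(x <- X) f x) * (\sum_(y <- Y) g y)) <= (\sum_(z <- Z) c z) ^ 2)%N.
Proof.
move=> uX uY uZ h.
pose F := (\max_(x <- X) f x)%N; pose G := (\max_(y <- Y) g y)%N.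
have fF x : x \in X -> (f x <= F)%N by move=> xX; exact: leq_bigmax_seq.
have gG y : y \in Y -> (g y <= G)%N by move=> yY; exact: leq_bigmax_seq.
have maxim (S : seq int) (w : int -> nat) : (0 < \max_(x <- S) w x)%N ->
    exists2 x, x \in S & w x = (\max_(x <- S) w x)%N.
  elim: S => [|s S IH]; rewrite ?big_nil // big_cons.
  case: (leqP (w s) (\max_(j <- S) w j)) => [le|lt] pos; last by exists s; rewrite ?mem_head.
  by have [x xS xE] := IH pos; exists x; rewrite // inE xS orbT.
have [F0|Fpos] := posnP F.
  by rewrite big_seq big1 ?mul0n ?muln0 // => x /fF; rewrite F0 leqn0 => /eqP.
have [G0|Gpos] := posnP G.
  by rewrite [X in (_ * (_ * X))%N]big_seq [X in (_ * (_ * X))%N]big1 ?muln0 // => y /gG; rewrite G0 leqn0 => /eqP.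
pose T := (F * G)%N; have Tpos : (0 < T)%N by rewrite muln_gt0 Fpos.
(* Crosswise scaling gives both functions the same maximum [T], so at every level below [T] both
   superlevel sets are nonempty, as [sumset_size] requires. *)
pose f' x := (f x * G)%N; pose g' y := (g y * F)%N.
have f'T x : x \in X -> (f' x <= T)%N by move=> /fF; rewrite leq_mul2r orbC => ->.
have g'T y : y \in Y -> (g' y <= T)%N by move=> /gG; rewrite /g' /T mulnC leq_mul2l orbC => ->.
pose hit (l : nat) (z : int) := has (fun x => has (fun y => [&& (l < f' x)%N, (l < g' y)%N &
    (z == x + y) || (z == x + y + 1)]) Y) X.
pose N z := (\sum_(l < T) hit l z)%N.
have NE z : (N z = 0)%N \/ exists x y (e : bool), [/\ x \in X, y \in Y, z = x + y + e%:Z,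
    (N z <= f' x)%N & (N z <= g' y)%N].
  have [l0 hl0|nohit] := pickP (fun l : 'I_T => hit l z); last first.
    by left; apply: big1 => l _; rewrite nohit.
  right; case: (@arg_maxnP _ l0 (fun l : 'I_T => hit l z) (fun l => val l) hl0) => l /hasP[x xX /hasP[y yY]].
  move=> /and3P[lf lg zE] lmax.
  have Nl : (N z <= l.+1)%N.
    rewrite -(sum_ltn (ltn_ord l)); apply: leq_sum => k _.
    by case hk: (hit k z) => //; have /= := lmax _ hk; rewrite ltnS => ->.
  exists x, y, (z == x + y + 1); split=> //; last 2 first.
  - exact: leq_trans Nl lf.
  - exact: leq_trans Nl lg.
  by case: (z == _ + 1) / eqP zE => [->//|_]; rewrite orbF addr0 => /eqP.
have NK z : (K * N z ^ 2 <= c z ^ 2 * T)%N.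
  case: (NE z) => [->|[x [y [e [xX yY zE Nf Ng]]]]]; first by rewrite muln0.
  have [->|Np] := posnP (N z); first by rewrite muln0.
  have fp : (0 < f x)%N by have := leq_trans Np Nf; rewrite /f' muln_gt0 => /andP[].
  have gp : (0 < g y)%N by have := leq_trans Np Ng; rewrite /g' muln_gt0 => /andP[].
  have [_ hc] := h x y e xX yY fp gp; rewrite -zE in hc.
  apply: (@leq_trans (K * (f' x * g' y))); first by rewrite leq_mul2l leq_mul ?orbT.
  rewrite /f' /g' /T (_ : K * _ = K * (f x * g y) * (F * G))%N; last by ring.
  by rewrite leq_mul2r hc orbT.
have sumN : (\sum_(x <- X) f' x + \sum_(y <- Y) g' y <= \sum_(z <- Z) N z)%N.
  rewrite exchange_big /=.
  have layer (S : seq int) (w : int -> nat) : {in S, forall x, (w x <= T)%N} ->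
      (\sum_(x <- S) w x = \sum_(l < T) count (fun x => l < w x)%N S)%N.
    move=> wT; rewrite (eq_bigr (fun l : 'I_T => \sum_(x <- S) (l < w x)%N)%N); last first.
      by move=> l _; rewrite -sum1_count big_mkcond; apply: eq_bigr => x _; case: ifP.
    by rewrite exchange_big /= !big_seq; apply: eq_bigr => x xS; rewrite sum_ltn ?wT.
  rewrite (layer X f') // (layer Y g') // -big_split /=; apply: leq_sum => l _.
  rewrite (eq_bigr (fun z => (hit l z : nat))) // -!size_filter.
  have -> : (\sum_(z <- Z) hit l z = size (filter (hit l) Z))%N.
    by rewrite size_filter -sum1_count [RHS]big_mkcond; apply: eq_bigr => z _; case: (hit l z).
  apply: sumset_size; rewrite ?filter_uniq //.
  - have [x xX xF] := maxim X f Fpos; apply/eqP => e.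
    have : x \in [seq x <- X | (l < f' x)%N] by rewrite mem_filter xX andbT /f' xF.
    by rewrite e.
  - have [y yY yG] := maxim Y g Gpos; apply/eqP => e.
    have : y \in [seq y <- Y | (l < g' y)%N] by rewrite mem_filter yY andbT /g' yG mulnC.
    by rewrite e.
  move=> x y; rewrite !mem_filter => /andP[lf xX] /andP[lg yY].
  have fp : (0 < f x)%N by have := leq_ltn_trans (leq0n l) lf; rewrite /f' muln_gt0 => /andP[].
  have gp : (0 < g y)%N by have := leq_ltn_trans (leq0n l) lg; rewrite /g' muln_gt0 => /andP[].
  have [z1 _] := h x y false xX yY fp gp; have [z2 _] := h x y true xX yY fp gp.
  rewrite addr0 in z1; rewrite z1 z2 !andbT.
  by split; apply/hasP; exists x => //; apply/hasP; exists y; rewrite // lf lg eqxx ?orbT.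
have sq : (K * (\sum_(z <- Z) N z) ^ 2 <= (\sum_(z <- Z) c z) ^ 2 * T)%N.
  by apply: sum_square_le => z; exact: NK.
rewrite -(leq_pmul2r Tpos); apply: leq_trans sq.
rewrite -!big_distrl /= in sumN.
set sf := (\sum_(x <- X) f x)%N in sumN *; set sg := (\sum_(y <- Y) g y)%N in sumN *.
rewrite (_ : _ * T = K * (4 * (sf * G * (sg * F))))%N; last by rewrite /T; ring.
rewrite leq_mul2l; apply/orP; right.
apply: (@leq_trans ((sf * G + sg * F) ^ 2)); last by rewrite leq_sqr.
by have [h4 _] := nat_AGM2 (sf * G) (sg * F).
Qed.

Fixpoint addl (a b : seq int) (e : seq bool) : seq int :=
  match a, b, e with
  | x :: a', y :: b', t :: e' => (x + y + (t : nat)%:Z) :: addl a' b' e'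
  | _, _, _ => [::] end.

(** Induction on the dimension: the statement for the fibres over the first coordinates x, y, x + y
    + e is the hypothesis of [prekopa_leindler_int] for the fibre sizes, with K = 4 ^ d. *)
Lemma brunn_minkowski_int d (A B C : seq (seq int)) :
  uniq A -> uniq B -> uniq C -> (forall a, a \in A -> size a = d) ->
  (forall b, b \in B -> size b = d) ->
  (forall a b e, a \in A -> b \in B -> size e = d -> addl a b e \in C) ->
  (4 ^ d * (size A * size B) <= size C ^ 2)%N.
Proof.
elim: d A B C => [|d IH] A B C uA uB uC sA sB h.
  have small (S : seq (seq int)) : uniq S -> (forall a, a \in S -> size a = 0%N) ->
      (size S <= 1)%N.
    case: S => [|s [|t S]] //= /andP[]; rewrite inE negb_or => /andP[/eqP st _] _ s0.
    by have := s0 s; have := s0 t; rewrite !inE !eqxx ?orbT => /(_ isT)/size0nil ? /(_ isT)/size0nil ?; subst.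
  have := small A uA sA; have := small B uB sB.
  case: A B {uA uB} sA sB h => [|a [|? ?]] [|b [|? ?]] // sA sB h _ _.
  have := h a b [::]; rewrite !mem_head => /(_ isT isT erefl).
  by case: C {uC h} => // c C _; rewrite expn_gt0.
pose fib (S : seq (seq int)) (x : int) : seq (seq int) := [seq behead a | a <- S & head 0 a == x].
have fibs S x : size (fib S x) = count (fun a => head 0 a == x) S.
  by rewrite size_map size_filter.
have fibU S x : uniq S -> (forall a, a \in S -> size a = d.+1) -> uniq (fib S x).
  move=> uS sS; rewrite map_inj_in_uniq ?filter_uniq // => a b.
  rewrite !mem_filter => /andP[/eqP ha /sS sa] /andP[/eqP hb /sS sb].
  by case: a b ha hb sa sb => [|? ?] [|? ?] //= -> -> _ _ ->.
have fibP S x a : a \in fib S x -> (forall a, a \in S -> size a = d.+1) -> x :: a \in S.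
  move=> /mapP[b]; rewrite mem_filter => /andP[/eqP hb bS] -> sS.
  by have := sS _ bS; case: b hb bS => //= ? ? ->.
pose C' := [seq c <- C | size c == d.+1].
have uC' : uniq C' by rewrite filter_uniq.
have sC' c : c \in C' -> size c = d.+1 by rewrite mem_filter => /andP[/eqP].
have CC' : (size C' <= size C)%N by rewrite size_filter count_size.
have size_addl a b e : size a = d.+1 -> size b = d.+1 -> size e = d.+1 -> size (addl a b e) = d.+1.
  elim: d.+1 a b e => [|k IHk] [|? a] [|? b] [|? e] //= [sa] [sb] [se].
  by rewrite IHk.
have h' a b e : a \in A -> b \in B -> size e = d.+1 -> addl a b e \in C'.
  move=> aA bB se; rewrite mem_filter h // andbT; apply/eqP.
  by apply: size_addl => //; [apply: sA|apply: sB].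
apply: (@leq_trans (size C' ^ 2)); last by rewrite leq_sqr.
rewrite -(big_count_undup (head 0) A) -(big_count_undup (head 0) B).
rewrite -(big_count_undup (head 0) C') expnS.
apply: prekopa_leindler_int; rewrite ?undup_uniq // => x y e _ _ fp gp.
have : (4 ^ d * (size (fib A x) * size (fib B y)) <= size (fib C' (x + y + e%:Z)%R) ^ 2)%N.
  apply: IH; [exact: fibU|exact: fibU|exact: fibU|by move=> a /fibP/(_ sA)/sA []
    |by move=> b /fibP/(_ sB)/sB []|move=> a b e'].
  move=> /fibP/(_ sA) aA /fibP/(_ sB) bB se.
  have := h' _ _ (e :: e') aA bB; rewrite /= se => /(_ erefl) abC.
  by apply/mapP; exists (x + y + e%:Z :: addl a b e'); rewrite // mem_filter /= eqxx.
rewrite !fibs => ->; split=> //.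
have : (0 < size (fib A x))%N by rewrite fibs.
have : (0 < size (fib B y))%N by rewrite fibs.
case fB: (fib B y) => [//|b ?] _; case fA: (fib A x) => [//|a ?] _.
have aA : x :: a \in A by apply: fibP sA; rewrite fA mem_head.
have bB : y :: b \in B by apply: fibP sB; rewrite fB mem_head.
have := h' _ _ (e :: nseq d false) aA bB; rewrite /= size_nseq => /(_ erefl) abC.
by rewrite mem_undup; apply/mapP; exists (x + y + e%:Z :: addl a b (nseq d false)).
Qed.

(** Brunn-Minkowski for [W] and -W, with the square root taken. This replaces the isodiametric
    inequality for arbitrary norms. *)
Lemma difference_set_size d (W U : seq {ffun 'I_d -> int}) : uniq W -> uniq U ->
  (forall v w (e : {ffun 'I_d -> bool}), v \in W -> w \in W ->
     [ffun i => v i - w i + (e i : nat)%:Z] \in U) ->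
  (2 ^ d * size W <= size U)%N.
Proof.
move=> uW uU h.
pose cod (v : {ffun 'I_d -> int}) := [seq v i | i <- enum 'I_d].
pose ncod (v : {ffun 'I_d -> int}) := [seq - v i | i <- enum 'I_d].
have cinj : injective cod.
  move=> v w /eq_in_map vw; apply/ffunP => i; apply: vw; exact: mem_enum.
have ninj : injective ncod.
  move=> v w /eq_in_map vw; apply/ffunP => i; apply: oppr_inj; apply: vw; exact: mem_enum.
have sz : size (enum 'I_d) = d by rewrite size_enum_ord.
have : (4 ^ d * (size (map cod W) * size (map ncod W)) <= size (map cod U) ^ 2)%N; last first.
  rewrite !size_map => H; rewrite -leq_sqr; apply: leq_trans H.
  by rewrite expnMn mulnn -expnM mulnC [(d * 2)%N]mulnC expnM mulnC.
apply: brunn_minkowski_int; rewrite ?map_inj_uniq //.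
- by move=> _ /mapP[v _ ->]; rewrite size_map.
- by move=> _ /mapP[v _ ->]; rewrite size_map.
move=> _ _ e /mapP[v vW ->] /mapP[w wW ->] se.
apply/mapP; exists [ffun i => v i - w i + (nth false e i : nat)%:Z].
  have := h v w [ffun i : 'I_d => nth false e i] vW wW.
  by under eq_ffun do rewrite ffunE.
have add_map (I : Type) (s : seq I) (p q : I -> int) (t : I -> bool) :
    addl (map p s) (map q s) (map t s) = [seq p i + q i + (t i : nat)%:Z | i <- s].
  by elim: s => //= i s ->.
rewrite /cod /ncod -{1}(mkseq_nth false e) /mkseq se -val_enum_ord -map_comp add_map.
by apply: eq_map => i; rewrite ffunE.
Qed.

End DiscreteBrunnMinkowski.

From mathcomp Require Import all_classical all_reals all_analysis measurable_realfun.
Import Order.TTheory GRing.Theory Num.Theory.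
Import numFieldNormedType.Exports.
Local Open Scope classical_set_scope.
Local Open Scope ring_scope.

(** * Independent samples from a finite set *)

Section IidExpectation.
Variables (R : realType) (C : finType).
Implicit Types (p psi : C -> R) (h g : seq C -> R) (s a x u eta : R).

(** The mean of [h] over words of [n] independent letters with law [p], defined by averaging over
    the first letter; each identity below becomes an induction on [n]. *)
Fixpoint Ex p n h : R :=
  if n is n'.+1 then \sum_c p c * Ex p n' (fun l => h (c :: l)) else h [::].

Definition is_pmf p := (forall c, 0 <= p c) /\ \sum_c p c = 1.

Definition Sm psi (l : seq C) : R := \sum_(c <- l) psi c.

Lemma Sm_cons psi c l : Sm psi (c :: l) = psi c + Sm psi l.
Proof. by rewrite /Sm big_cons. Qed.

Lemma Sm_ge0 psi l : (forall c, 0 <= psi c) -> 0 <= Sm psi l.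
Proof. by move=> h; apply: sumr_ge0. Qed.

Lemma eq_Ex p n h g : h =1 g -> Ex p n h = Ex p n g.
Proof.
elim: n h g => [|n IH] h g e /=; first exact: e.
by apply: eq_bigr => c _; congr (_ * _); apply: IH => l; exact: e.
Qed.

Lemma Ex_le p n h g : (forall c, 0 <= p c) ->
  (forall l, h l <= g l) -> Ex p n h <= Ex p n g.
Proof.
move=> p0; elim: n h g => [|n IH] h g le /=; first exact: le.
by apply: ler_sum => c _; apply: ler_wpM2l => //; apply: IH => l; exact: le.
Qed.

Lemma ExZ p n a h : Ex p n (fun l => a * h l) = a * Ex p n h.
Proof.
elim: n h => [//|n IH] h /=.
by rewrite mulr_sumr; apply: eq_bigr => c _; rewrite (IH (fun l => h (c :: l))) mulrCA.
Qed.

Lemma ExD p n h g : Ex p n (fun l => h l + g l) = Ex p n h + Ex p n g.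
Proof.
elim: n h g => [//|n IH] h g /=.
rewrite -big_split; apply: eq_bigr => c _ /=.
by rewrite (IH (fun l => h (c :: l)) (fun l => g (c :: l))) mulrDr.
Qed.

Lemma Ex0 p n : Ex p n (fun=> 0) = 0.
Proof. by elim: n => [//|n IH] /=; apply: big1 => c _; rewrite IH mulr0. Qed.

Lemma Ex_sum p n (I : Type) (s : seq I) (h : I -> seq C -> R) :
  Ex p n (fun l => \sum_(i <- s) h i l) = \sum_(i <- s) Ex p n (h i).
Proof.
elim: s => [|i s IH].
  rewrite big_nil; apply: etrans (Ex0 p n).
  by apply: eq_Ex => l; rewrite big_nil.
by rewrite big_cons -IH -ExD; apply: eq_Ex => l; rewrite big_cons.
Qed.

Lemma Ex_cst p n a : is_pmf p -> Ex p n (fun=> a) = a.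
Proof.
move=> [_ p1]; elim: n => [//|n IH] /=.
rewrite (eq_bigr (fun c => p c * a)); last by move=> c _; rewrite IH.
by rewrite -mulr_suml p1 mul1r.
Qed.

Lemma Ex_ge0 p n h : (forall c, 0 <= p c) -> (forall l, 0 <= h l) -> 0 <= Ex p n h.
Proof. by move=> p0 h0; rewrite -(Ex0 p n); apply: Ex_le. Qed.

Lemma Ex_prod p n (g : C -> R) :
  Ex p n (fun l => \prod_(c <- l) g c) = (\sum_c p c * g c) ^+ n.
Proof.
elim: n => [|n IH] /=; first by rewrite big_nil expr0.
rewrite exprS mulr_suml; apply: eq_bigr => c _.
rewrite -IH -mulrA -(ExZ _ _ (g c)); congr (_ * _); apply: eq_Ex => l.
by rewrite big_cons.
Qed.

Lemma expR_Sm s psi l : expR (s * Sm psi l) = \prod_(c <- l) expR (s * psi c).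
Proof.
elim: l => [|c l IH]; first by rewrite /Sm !big_nil mulr0 expR0.
by rewrite Sm_cons big_cons mulrDr expRD IH.
Qed.

Lemma Ex_expR p n s psi :
  Ex p n (fun l => expR (s * Sm psi l)) = (\sum_c p c * expR (s * psi c)) ^+ n.
Proof. by rewrite -Ex_prod; apply: eq_Ex => l; exact: expR_Sm. Qed.

(* Subtracting 1 on both sides of the exponential Markov inequality keeps the bound
   proportional to the mass seen by [psi]; it can then be summed over infinitely many windows. *)
Lemma Ex_chernoff p n s a psi : is_pmf p -> (forall c, 0 <= psi c) -> 0 < s -> 0 < a ->
  Ex p n (fun l => (a <= Sm psi l)%R%:R) <=
  ((\sum_c p c * expR (s * psi c)) ^+ n - 1) / (expR (s * a) - 1).
Proof.
move=> pp psi0 s0 a0.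
have e1 : 0 < expR (s * a) - 1 by rewrite subr_gt0 expR_gt1 mulr_gt0.
rewrite ler_pdivlMr // mulrC -ExZ -Ex_expR lerBrDr -[X in _ + X](Ex_cst n 1 pp) -ExD.
apply: Ex_le => [|l]; first by case: pp.
case: (leP a (Sm psi l)) => al; rewrite ?mulr1 ?mulr0 ?add0r.
  by rewrite subrK ler_expR ler_pM2l.
by rewrite -expR0 ler_expR mulr_ge0 ?(ltW s0) ?Sm_ge0.
Qed.

Lemma Ex_chernoff_lower p n u a psi : is_pmf p -> 0 < u ->
  Ex p n (fun l => (Sm psi l < a)%R%:R) <=
  expR (u * a) * (\sum_c p c * expR (- u * psi c)) ^+ n.
Proof.
move=> [p0 p1] u0; rewrite -Ex_expR -ExZ; apply: Ex_le => // l.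
rewrite -expRD; case: ltP => al; last exact: expR_ge0.
by rewrite -expR0 ler_expR; nra.
Qed.

(** The shift [x] absorbs the first letter of the word, which makes the induction go through. *)
Lemma Ex_second_moment p n psi x : is_pmf p ->
  let m := \sum_c p c * psi c in
  Ex p n (fun l => (Sm psi l + x) ^+ 2) =
  n%:R * (\sum_c p c * psi c ^+ 2 - m ^+ 2) + (n%:R * m + x) ^+ 2.
Proof.
move=> [_ p1] m; elim: n x => [|n IH] x /=.
  by rewrite /Sm big_nil; ring.
rewrite (eq_bigr (fun c => p c * (n%:R * (\sum_c p c * psi c ^+ 2 - m ^+ 2)
   + (n%:R * m + x) ^+ 2) + ((2 * (n%:R * m + x)) * (p c * psi c) + p c * psi c ^+ 2))).
  rewrite !big_split /= -mulr_suml p1 -mulr_sumr -/m.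
  set M2 := \sum_c p c * psi c ^+ 2.
  by rewrite -[n.+1]addn1 natrD; ring.
move=> c _; rewrite (eq_Ex _ _ (g := fun l => (Sm psi l + (psi c + x)) ^+ 2)).
  by rewrite IH; ring.
by move=> l; rewrite Sm_cons; congr (_ ^+ 2); ring.
Qed.

(** For summands in [0, 1] the variance is at most the mean [m], so the relative deviation is
    controlled by 1 / m. *)
Lemma Ex_chebyshev p n psi eta : is_pmf p -> (forall c, 0 <= psi c <= 1) -> 0 < eta ->
  let m := n%:R * \sum_c p c * psi c in 0 < m ->
  1 - (eta ^+ 2 * m)^-1 <=
  Ex p n (fun l => ((1 - eta) * m <= Sm psi l <= (1 + eta) * m)%R%:R).
Proof.
move=> pp psi01 e0 m m0; have [p0 p1] := pp.
pose k := ((eta * m) ^+ 2)^-1.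
have k0 : 0 < k by rewrite invr_gt0 exprn_gt0 // mulr_gt0.
have var : Ex p n (fun l => (Sm psi l - m) ^+ 2) <= m.
  rewrite Ex_second_moment // /m subrr expr0n /= addr0 ler_wpM2l //.
  rewrite lerBlDr -[leLHS]addr0 lerD ?sqr_ge0 //; apply: ler_sum => c _.
  by rewrite ler_wpM2l //; have /andP[? ?] := psi01 c; nra.
have -> : 1 - (eta ^+ 2 * m)^-1 = Ex p n (fun=> 1) + (- k) * m.
  by rewrite Ex_cst // /k; field; rewrite !gt_eqF.
apply: (@le_trans _ _ (Ex p n (fun=> 1) + (- k) * Ex p n (fun l => (Sm psi l - m) ^+ 2))).
  by rewrite lerD2l !mulNr lerN2 ler_pM2l.
rewrite -ExZ -ExD; apply: Ex_le => // l.
case: (boolP (_ <= Sm psi l <= _)) => [_|nb].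
  by have := mulr_ge0 (ltW k0) (sqr_ge0 (Sm psi l - m)); rewrite mulNr /=; lra.
suff : 1 <= k * (Sm psi l - m) ^+ 2 by rewrite mulNr /=; lra.
have em : 0 < eta * m by exact: mulr_gt0.
rewrite mulrC ler_pdivlMr ?mul1r ?(exprn_gt0 _ em) //.
by move: nb; rewrite negb_and -!ltNge => /orP[] ?; nra.
Qed.

(** Change of measure to the law with weights p e^(s psi) / Z, one letter at a time. *)
Lemma Ex_tilt p n s psi h :
  let Z := \sum_c p c * expR (s * psi c) in 0 < Z ->
  Ex p n h = Z ^+ n *
    Ex (fun c => p c * expR (s * psi c) / Z) n (fun l => expR (- s * Sm psi l) * h l).
Proof.
move=> Z Z0; elim: n h => [|n IH] h /=.
  by rewrite /Sm big_nil mulr0 expR0 !mul1r.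
rewrite exprS -mulrA !mulr_sumr; apply: eq_bigr => c _.
rewrite IH.
have -> : Ex (fun c => p c * expR (s * psi c) / Z) n
    (fun l => expR (- s * Sm psi l) * h (c :: l)) = expR (s * psi c) *
  Ex (fun c => p c * expR (s * psi c) / Z) n
    (fun l => expR (- s * Sm psi (c :: l)) * h (c :: l)).
  rewrite -ExZ; apply: eq_Ex => l.
  by rewrite Sm_cons mulrA -expRD; congr (expR _ * _); ring.
by field; rewrite gt_eqF.
Qed.

(** The lower half of Cramér's theorem. Under the tilted law the mean is [m], Chebyshev keeps the
    sum within a factor 1 + eta of it, and there the density of the original law is at least Z^n
    e^(-s (1 + eta) m). *)
Lemma Ex_tilt_lower p n s psi eta : is_pmf p -> (forall c, 0 <= psi c <= 1) ->
  0 <= s -> 0 < eta ->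
  let Z := \sum_c p c * expR (s * psi c) in
  let m := n%:R * (\sum_c p c * psi c * expR (s * psi c)) / Z in 0 < m ->
  Z ^+ n * expR (- s * ((1 + eta) * m)) * (1 - (eta ^+ 2 * m)^-1) <=
  Ex p n (fun l => ((1 - eta) * m <= Sm psi l)%R%:R).
Proof.
move=> pp psi01 s0 e0 Z m m0; have [p0 p1] := pp.
have Z1 : 1 <= Z.
  rewrite -p1; apply: ler_sum => c _; rewrite -[leLHS]mulr1 ler_wpM2l //.
  by rewrite -expR0 ler_expR mulr_ge0 //; case/andP: (psi01 c).
have Z0 : 0 < Z by apply: lt_le_trans Z1.
pose q c := p c * expR (s * psi c) / Z.
have qp : is_pmf q.
  split=> [c|]; first by rewrite !mulr_ge0 ?expR_ge0 ?invr_ge0 ?(ltW Z0).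
  by rewrite -mulr_suml divff // gt_eqF.
have mE : m = n%:R * \sum_c q c * psi c.
  rewrite /m -mulrA mulr_suml; congr (_ * _); apply: eq_bigr => c _.
  by rewrite /q; ring.
rewrite (Ex_tilt _ _ Z0) -/q -mulrA ler_pM2l ?exprn_gt0 //.
apply: (@le_trans _ _ (expR (- s * ((1 + eta) * m)) *
   Ex q n (fun l => ((1 - eta) * m <= Sm psi l <= (1 + eta) * m)%R%:R))).
  rewrite ler_wpM2l ?expR_ge0 // mE; apply: Ex_chebyshev => //.
  by rewrite -mE.
rewrite -ExZ; apply: Ex_le => [|l]; first by case: qp.
case: (boolP (_ <= Sm psi l <= _)) => [/andP[-> h2]|_].
  by rewrite ler_wpM2r // ler_expR; nra.
by rewrite mulr0 mulr_ge0 ?expR_ge0.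
Qed.

(** Only the term of exactly [k] successes is kept; the induction is Pascal's rule, split by whether
    the first letter is a success. *)
Lemma Ex_binomial_lower p n k psi w : is_pmf p -> (forall c, psi c = 0 \/ psi c = 1) ->
  w = \sum_c p c * psi c ->
  'C(n, k)%:R * w ^+ k * (1 - w) ^+ (n - k) <=
  Ex p n (fun l => (k%:R <= Sm psi l)%R%:R).
Proof.
move=> pp psi01 wE; have [p0 p1] := pp.
have psi0 c : 0 <= psi c by case: (psi01 c) => ->.
have w0 : 0 <= w by rewrite wE; apply: sumr_ge0 => c _; rewrite mulr_ge0.
have w1E : 1 - w = \sum_c p c * (1 - psi c).
  by rewrite wE -[X in X - _]p1 -sumrB; apply: eq_bigr => c _; ring.
have w1 : 0 <= 1 - w.
  by rewrite w1E; apply: sumr_ge0 => c _; rewrite mulr_ge0 //; case: (psi01 c) => ->; lra.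
elim: n k => [|n IH] [|k].
- by rewrite /= bin0 /Sm big_nil lexx expr0 subnn expr0 !mul1r.
- by rewrite bin0n /= !mul0r ler0n.
- rewrite bin0 expr0 !mul1r subn0.
  rewrite (eq_Ex _ _ (g := fun=> 1)) ?Ex_cst //; last by move=> l; rewrite Sm_ge0.
  by rewrite exprn_ile1 // lerBlDr lerDl.
rewrite /= (eq_bigr (fun c => p c * psi c * Ex p n (fun l => (k%:R <= Sm psi l)%R%:R)
   + p c * (1 - psi c) * Ex p n (fun l => (k.+1%:R <= Sm psi l)%R%:R))); last first.
  move=> c _; case: (psi01 c) => e; rewrite e.
    rewrite mulr0 mul0r add0r subr0 mulr1; congr (_ * _); apply: eq_Ex => l.
    by rewrite Sm_cons e add0r.
  rewrite mulr1 subrr mulr0 mul0r addr0; congr (_ * _); apply: eq_Ex => l.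
  by rewrite Sm_cons e -[k.+1]add1n natrD lerD2l.
rewrite big_split /= -!mulr_suml -wE -w1E binS natrD subSS (mulrDl _%:R) (mulrDl (_ * _)) [leRHS]addrC.
apply: lerD; last first.
  rewrite exprS (_ : _ * _ = w * ('C(n, k)%:R * w ^+ k * (1 - w) ^+ (n - k))); last by ring.
  by rewrite ler_wpM2l.
have [kn|kn] := ltnP k n.
  rewrite -(subnSK kn) [_ ^+ (n - k.+1).+1]exprS.
  by rewrite mulrCA ler_wpM2l.
rewrite bin_small // !mul0r mulr_ge0 //.
by apply: Ex_ge0 => // l; rewrite ler0n.
Qed.

(** Since (GA - A)(GB - B) vanishes identically, E[AB] = GA E[B] + GB E[A] - GA GB, and this is at
    most E[A] E[B] because (GA - E[A])(GB - E[B]) >= 0. *)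
Lemma sum_prod_two p (A B : C -> R) GA GB : is_pmf p ->
  (forall c, A c <= GA) -> (forall c, B c <= GB) ->
  (forall c, A c = GA \/ B c = GB) ->
  \sum_c p c * (A c * B c) <= (\sum_c p c * A c) * (\sum_c p c * B c).
Proof.
move=> [p0 p1] AG BG AB.
set EA := \sum_c p c * A c; set EB := \sum_c p c * B c.
have le1 (D : C -> R) G : (forall c, D c <= G) -> \sum_c p c * D c <= G.
  move=> DG; rewrite -[leRHS]mul1r -p1 mulr_suml; apply: ler_sum => c _.
  exact: ler_wpM2l.
have -> : \sum_c p c * (A c * B c) = GA * EB + GB * EA - GA * GB.
  rewrite /EA /EB -[GA * GB]mul1r -p1 mulr_suml !mulr_sumr -sumrN -!big_split /=.
  by apply: eq_bigr => c _; case: (AB c) => ->; ring.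
by have := le1 _ _ AG; have := le1 _ _ BG; rewrite -/EA -/EB; nra.
Qed.

Lemma sum_prod_disjoint p (J : eqType) (js : seq J) (a : J -> C -> R) (G : J -> R) :
  is_pmf p -> uniq js -> (forall j c, 0 <= a j c <= G j) ->
  (forall c i j, a i c != G i -> a j c != G j -> i = j) ->
  \sum_c p c * \prod_(j <- js) a j c <= \prod_(j <- js) \sum_c p c * a j c.
Proof.
move=> pp; have [p0 p1] := pp; move=> + aG disj.
have a0 j c : 0 <= a j c by case/andP: (aG j c).
have a1 j c : a j c <= G j by case/andP: (aG j c).
elim: js => [|j js IH] /=.
  move=> _; rewrite big_nil (eq_bigr p) ?p1 // => c _.
  by rewrite big_nil mulr1.
move=> /andP[jjs ujs]; rewrite big_cons.
apply: (@le_trans _ _ ((\sum_c p c * a j c) * (\sum_c p c * \prod_(j <- js) a j c))).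
  rewrite (eq_bigr (fun c => p c * (a j c * \prod_(j <- js) a j c))); last first.
    by move=> c _; rewrite big_cons.
  apply: (@sum_prod_two p _ _ (G j) (\prod_(i <- js) G i)) => // [c|c].
    by apply: ler_prod => i _; exact: aG.
  have [->|neq] := eqVneq (a j c) (G j); [by left|right].
  rewrite !big_seq; apply: eq_bigr => i ijs; apply/eqP/negPn/negP => neq2.
  by move: jjs; rewrite (disj c j i neq neq2) ijs.
by rewrite ler_wpM2l ?IH //; apply: sumr_ge0 => c _; rewrite mulr_ge0.
Qed.

(* Negative association of the counts in disjoint windows. *)
Lemma Ex_prod_disjoint p n (J : eqType) (js : seq J) (phi : J -> C -> R) (g : J -> R -> R) :
  is_pmf p -> uniq js -> (forall j c, 0 <= phi j c) ->
  (forall c i j, phi i c != 0 -> phi j c != 0 -> i = j) ->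
  (forall j x, 0 <= g j x) -> (forall j x y, x <= y -> g j y <= g j x) ->
  Ex p n (fun l => \prod_(j <- js) g j (Sm (phi j) l)) <=
  \prod_(j <- js) Ex p n (fun l => g j (Sm (phi j) l)).
Proof.
move=> pp ujs phi0 disj; have [p0 p1] := pp.
elim: n g => [|n IH] g g0 gmono //=.
(* Averaging over the first letter leaves each factor nonnegative and nonincreasing, so the
   induction hypothesis applies to [g']. What remains concerns one letter: it moves at most one of
   the counts, all other factors staying at their maximum. *)
pose g' j x := \sum_c p c * g j (phi j c + x).
have -> : \prod_(j <- js) \sum_c p c * Ex p n (fun l => g j (Sm (phi j) (c :: l))) =
   \prod_(j <- js) Ex p n (fun l => g' j (Sm (phi j) l)).
  apply: eq_bigr => j _; rewrite Ex_sum; apply: eq_bigr => c _.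
  by rewrite ExZ; congr (_ * _); apply: eq_Ex => l; rewrite Sm_cons.
apply: le_trans (IH g' _ _); last 2 first.
- by move=> j x; apply: sumr_ge0 => c _; rewrite mulr_ge0.
- by move=> j x y xy; apply: ler_sum => c _; rewrite ler_wpM2l // gmono // lerD2l.
rewrite -(eq_bigr _ (fun c _ => ExZ p n (p c) _)) -Ex_sum; apply: Ex_le => // l.
rewrite (eq_bigr (fun c => p c * \prod_(j <- js) g j (phi j c + Sm (phi j) l))); last first.
  by move=> c _; congr (_ * _); apply: eq_bigr => j _; rewrite Sm_cons.
apply: (@sum_prod_disjoint p _ js (fun j c => g j (phi j c + Sm (phi j) l))
   (fun j => g j (Sm (phi j) l))) => // [j c|c i j ni nj].
  by rewrite g0 /= gmono // lerDr.
apply: (disj c).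
  by apply: contraNneq ni => ->; rewrite add0r.
by apply: contraNneq nj => ->; rewrite add0r.
Qed.

End IidExpectation.

(** * Boxes, cells and their density points *)

Section EuclideanCells.
Variables (R : realType) (d : nat).
Implicit Types (x y a b u : d.-tuple R) (l r : R) (A B : set (d.-tuple R)).

Lemma measurable_tnth_lt (i : 'I_d) (c : R) : measurable [set x : d.-tuple R | tnth x i < c].
Proof.
rewrite (_ : [set _ | _] = [set: d.-tuple R] `&` (fun x => tnth x i) @^-1` `]-oo, c[%classic).
  by apply: measurable_tnth.
by rewrite setTI; apply/seteqP; split=> x /=; rewrite in_itv.
Qed.

Lemma measurable_tnth_ge (i : 'I_d) (c : R) : measurable [set x : d.-tuple R | c <= tnth x i].
Proof.
rewrite (_ : [set _ | _] = ~` [set x : d.-tuple R | tnth x i < c]).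
  by apply: measurableC; exact: measurable_tnth_lt.
by apply/seteqP; split=> x /=; rewrite leNgt => /negP.
Qed.

Lemma measurable_forall (P : 'I_d -> set (d.-tuple R)) : (forall i, measurable (P i)) ->
  measurable [set x | forall i, P i x].
Proof.
move=> mP; rewrite (_ : [set _ | _] = \bigcap_(i in [set: 'I_d]) P i).
  by apply: fin_bigcap_measurable => //; exact: finite_finset.
by apply/seteqP; split=> [x h i _|x h i]; exact: h.
Qed.

Definition box a b : set (d.-tuple R) := [set x | forall i, tnth a i <= tnth x i < tnth b i].

Lemma measurable_box a b : measurable (box a b).
Proof.
apply: measurable_forall => i.
rewrite (_ : (fun x => _) = [set x : d.-tuple R | tnth a i <= tnth x i] `&`
   [set x : d.-tuple R | tnth x i < tnth b i]).
  by apply: measurableI; [exact: measurable_tnth_ge|exact: measurable_tnth_lt].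
by apply/seteqP; split=> x /=; [move/andP|move=> [-> ->]].
Qed.

Lemma sigma_algebra_halfspaces (S : set (set (d.-tuple R))) : sigma_algebra setT S ->
  (forall i c, S [set x | tnth x i < c]) -> forall A, measurable A -> S A.
Proof.
move=> sS hS; suff : @measurable _ (d.-tuple R) `<=` S by [].
apply: smallest_sub => // A; rewrite /= -bigcup_seq => -[i _ [B mB <-]]; rewrite setTI.
suff : @measurable _ R `<=` [set B | S ((fun x => tnth x i) @^-1` B)] by apply.
have [S0 SC SU] := sS.
have -> : @measurable _ R = (@ocitv R).-sigma.-measurable by [].
rewrite RGenInftyO.measurableE; apply: smallest_sub.
  split=> /=; first by rewrite preimage_set0.
    by move=> C SCC; rewrite setTD preimage_setC -setTD; exact: SC.
  by move=> F SF; rewrite preimage_bigcup; exact: SU.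
move=> _ [c ->] /=; have := hS i c; congr S.
Qed.

(** Boxes are stable under intersection and generate the Borel sets, and integer cubes exhaust the
    space. All properties of [leb] are drawn from its values on boxes through this lemma. *)
Lemma measure_unique_boxes (m1 m2 : {measure set (d.-tuple R) -> \bar R}) :
  (forall a b, m1 (box a b) = m2 (box a b)) -> (forall a b, (m1 (box a b) < +oo)%E) ->
  forall A, measurable A -> m1 A = m2 A.
Proof.
move=> eqm fin A mA.
pose G := [set box a b | a in setT & b in setT].
pose g (k : nat) := box [tuple - k%:R | i < d] [tuple k%:R | i < d].
have gcov : \bigcup_k g k = setT.
  apply/seteqP; split=> // x _.
  exists (\max_(i < d) (Num.truncn `|tnth x i|).+1)%N => // i; rewrite !tnth_mktuple.
  have h : `|tnth x i| < (\max_(i < d) (Num.truncn `|tnth x i|).+1)%N%:R.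
    apply: lt_le_trans (truncnS_gt _) _; rewrite ler_nat.
    exact: (leq_bigmax (F := fun i => (Num.truncn `|tnth x i|).+1)).
  by move: h; rewrite ltr_norml => /andP[/ltW -> ->].
have Gg k : G (g k) by exists [tuple - k%:R | i < d] => //; exists [tuple k%:R | i < d].
apply: (g_sigma_algebra_measure_unique G _ _ Gg gcov m1 m2) => //.
- by move=> _ [a _ [b _ <-]]; exact: measurable_box.
- move=> _ _ [a _ [b _ <-]] [a' _ [b' _ <-]].
  exists [tuple Num.max (tnth a i) (tnth a' i) | i < d] => //.
  exists [tuple Num.min (tnth b i) (tnth b' i) | i < d] => //.
  apply/seteqP; split=> [x h|x [h h'] i]; last first.
    rewrite !tnth_mktuple ge_max lt_min; have /andP[-> ->] := h i.
    by have /andP[-> ->] := h' i.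
  by split=> i; have := h i; rewrite !tnth_mktuple ge_max lt_min =>
    /andP[/andP[h1 h2] /andP[h3 h4]]; apply/andP.
- by move=> _ [a _ [b _ <-]]; exact: eqm.
- by move=> k; exact: fin.
apply: sigma_algebra_halfspaces mA; first exact: smallest_sigma_algebra.
move=> i c.
pose h (k : nat) := box [tuple - k%:R | j < d] [tuple if j == i then c else k%:R | j < d].
rewrite (_ : [set _ | _] = \bigcup_k h k).
  apply: sigma_algebra_bigcup => k; apply: sub_sigma_algebra.
  by exists [tuple - k%:R | j < d] => //; exists [tuple if j == i then c else k%:R | j < d].
apply/seteqP; split=> [x xc|x [k _ /(_ i)]]; last first.
  by rewrite !tnth_mktuple eqxx => /andP[].
have : (\bigcup_k g k) x by rewrite gcov.
move=> [k _ gk]; exists k => // j; have := gk j; rewrite !tnth_mktuple.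
by case: eqP => [->|//] /andP[-> _].
Qed.

Definition aff r u x : d.-tuple R := [tuple tnth u i + r * tnth x i | i < d].

Lemma measurable_aff r u : measurable_fun setT (aff r u).
Proof.
apply/measurable_fun_tnthP => i.
rewrite (_ : _ \o _ = fun x => tnth u i + r * tnth x i); last first.
  by apply/funext => x /=; rewrite tnth_mktuple.
by apply: measurable_funD => //; apply: measurable_funM => //; exact: measurable_tnth.
Qed.

Variables (leb : {measure set (d.-tuple R) -> \bar R}).
Hypothesis hleb : is_lebesgue leb.

Lemma leb_box a b : (forall i, tnth a i <= tnth b i) ->
  leb (box a b) = (\prod_(i < d) (tnth b i - tnth a i))%:E.
Proof. exact: hleb. Qed.

Lemma leb_box_max a b :
  leb (box a b) = (\prod_(i < d) Num.max 0 (tnth b i - tnth a i))%:E.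
Proof.
have [/forallP ab|] := boolP [forall i, tnth a i <= tnth b i].
  by rewrite leb_box //; congr (_%:E); apply: eq_bigr => i _; rewrite (max_idPr _) ?subr_ge0.
rewrite negb_forall => /existsP[i]; rewrite -ltNge => ba.
rewrite (_ : box a b = set0); last first.
  by apply/seteqP; split=> x //= /(_ i)/andP[] /le_lt_trans h /h /lt_trans/(_ ba); rewrite ltxx.
by rewrite measure0 (bigD1 i) //= (max_idPl _) ?mul0r // subr_le0 ltW.
Qed.

(** The image of [leb] under [aff r u] and the measure r^(-d) [leb] agree on boxes. *)
Lemma leb_aff r u A : 0 < r -> measurable A ->
  leb (aff r u @^-1` A) = ((r ^- d)%:E * leb A)%E.
Proof.
move=> r0 mA.
have k0 : 0 <= r ^- d by rewrite invr_ge0 exprn_ge0 // ltW.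
pose m1 := measure_function_pushforward__canonical__measure_function_Measure leb (measurable_aff r u).
pose m2 := mscale (NngNum k0) leb.
suff : m1 A = m2 A by [].
have pre a b : aff r u @^-1` box a b =
    box [tuple (tnth a i - tnth u i) / r | i < d] [tuple (tnth b i - tnth u i) / r | i < d].
  apply/seteqP; split=> x h i; have := h i; rewrite /aff !tnth_mktuple;
    by rewrite ler_pdivrMr // ltr_pdivlMr // lerBlDr ltrBrDr addrC [r * _]mulrC.
have E a b : m1 (box a b) = m2 (box a b).
  rewrite /m1 /m2 /= /pushforward /mscale /= pre !leb_box_max -EFinM; congr (_%:E).
  rewrite (_ : r ^- d = \prod_(i < d) r^-1); last first.
    by rewrite prodr_const card_ord exprVn.
  rewrite -big_split; apply: eq_bigr => i _ /=; rewrite !tnth_mktuple.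
  rewrite maxr_pMr ?invr_ge0 ?(ltW r0) // mulr0; congr Num.max; field; rewrite gt_eqF //.
apply: (measure_unique_boxes E) => // a b.
by rewrite /m1 /= /pushforward pre leb_box_max ltry.
Qed.

Definition cidx l x : {ffun 'I_d -> int} := [ffun i => Num.floor (tnth x i / l)].

Definition cell l (z : {ffun 'I_d -> int}) : set (d.-tuple R) := [set x | cidx l x = z].

Lemma cellE l z : 0 < l ->
  cell l z = box [tuple (z i)%:~R * l | i < d] [tuple (z i + 1)%:~R * l | i < d].
Proof.
move=> l0; apply/seteqP; split=> x /=.
  move=> <- i; rewrite !tnth_mktuple !ffunE -ler_pdivlMr // -ltr_pdivrMr //.
  by rewrite floor_le_tmp floorD1_gt.
move=> h; apply/ffunP => i; rewrite ffunE; apply/floor_def.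
by have := h i; rewrite !tnth_mktuple -ler_pdivlMr // -ltr_pdivrMr.
Qed.

Lemma measurable_cell l z : 0 < l -> measurable (cell l z).
Proof. by move=> l0; rewrite cellE //; exact: measurable_box. Qed.

Lemma leb_cell l z : 0 < l -> leb (cell l z) = (l ^+ d)%:E.
Proof.
move=> l0; rewrite cellE // leb_box_max; congr (_%:E).
rewrite (eq_bigr (fun=> l)) ?prodr_const ?card_ord // => i _.
by rewrite !tnth_mktuple intrD mulrDl mul1r addrC addKr (max_idPr _) // ltW.
Qed.

Lemma measure_cells (mu : {measure set (d.-tuple R) -> \bar R}) l (s : seq {ffun 'I_d -> int}) B :
  0 < l -> measurable B -> uniq s ->
  measurable (B `&` [set x | cidx l x \in s]) /\
  mu (B `&` [set x | cidx l x \in s]) = (\sum_(z <- s) mu (B `&` cell l z))%E.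
Proof.
move=> l0 mB; elim: s => [_|z s IH /= /andP[zs us]].
  by rewrite big_nil (_ : [set _ | _] = set0) ?setI0 ?measure0 //; apply/seteqP; split.
have [ms es] := IH us.
have E : B `&` [set x | cidx l x \in z :: s] = (B `&` cell l z) `|` (B `&` [set x | cidx l x \in s]).
  rewrite -setIUr; congr (_ `&` _); apply/seteqP; split=> x /=.
    by rewrite inE => /predU1P.
  by rewrite inE => h; apply/predU1P.
have mz : measurable (B `&` cell l z) by apply: measurableI => //; exact: measurable_cell.
split; first by rewrite E; exact: measurableU.
rewrite big_cons -es E measureU //.
by apply/seteqP; split=> x //= [[_ ->] [_ zs']]; move: zs; rewrite zs'.
Qed.


Lemma cell_subset_finite (l : R) (M : nat) : 0 < l ->
  exists2 s : seq {ffun 'I_d -> int}, uniq s &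
    forall x, (forall i, - M%:R <= tnth x i < M%:R) -> cidx l x \in s.
Proof.
move=> l0; pose K := absz (Num.floor (M%:R / l) + 1).
pose s := [seq [ffun i => (f i : nat)%:Z - K%:Z] | f : {ffun 'I_d -> 'I_(K + K).+1}].
exists (undup s); first exact: undup_uniq.
move=> x hx; rewrite mem_undup.
have KE : K%:Z = Num.floor (M%:R / l) + 1.
  by rewrite /K gez0_abs // addr_ge0 // floor_ge0 divr_ge0 // ltW.
have lo i : - K%:Z <= Num.floor (tnth x i / l).
  rewrite KE floor_ge_int intrN ler_pdivlMr // mulNr.
  have /andP[h _] := hx i; apply: le_trans h; rewrite lerN2 -ler_pdivrMr //.
  by rewrite ltW // floorD1_gt.
have hi i : Num.floor (tnth x i / l) <= K%:Z.
  rewrite KE (@le_trans _ _ (Num.floor (M%:R / l))) // ?lerDl //.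
  rewrite floor_ge_int (le_trans (floor_le_tmp _)) //.
  by have /andP[_ /ltW h] := hx i; rewrite ler_pM2r ?invr_gt0.
have bd i : (absz (Num.floor (tnth x i / l) + K%:Z)%R < (K + K).+1)%N.
  by have := lo i; have := hi i; clearbody K; lia.
apply/mapP; exists [ffun i => Ordinal (bd i)]; first by rewrite mem_enum.
apply/ffunP => i; rewrite !ffunE /= gez0_abs ?addrK //.
by rewrite -lerBlDr sub0r lo.
Qed.

Definition level (k : nat) : R := 2 ^- k.

Lemma level_gt0 k : 0 < level k.
Proof. by rewrite invr_gt0 exprn_gt0. Qed.

Lemma cidx_level_le k j x y : (k <= j)%N -> cidx (level j) x = cidx (level j) y ->
  cidx (level k) x = cidx (level k) y.
Proof.
move=> kj; rewrite -(subnK kj) /level; move: (j - k)%N => m {kj j}.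
move=> /ffunP h; apply/ffunP => i; have := h i; rewrite !ffunE !invrK => e.
have p : (0 : R) < 2 ^+ m by rewrite exprn_gt0.
suff F (a : R) : Num.floor (a * 2 ^+ k) = Num.floor ((Num.floor (a * 2 ^+ (m + k)))%:~R / 2 ^+ m : R).
  by rewrite (F (tnth x i)) (F (tnth y i)) e.
apply/esym/floor_def.
have h1 := floor_le_tmp (a * 2 ^+ k); have h2 := floorD1_gt (a * 2 ^+ k).
set n := Num.floor (a * 2 ^+ k) in h1 h2 *.
have h3 := floor_le_tmp (a * 2 ^+ (m + k)).
rewrite ler_pdivlMr // ltr_pdivrMr //; apply/andP; split.
  have -> : (n%:~R * 2 ^+ m : R) = (n * 2 ^+ m)%:~R by rewrite rmorphM /= rmorphXn.
  rewrite ler_int floor_ge_int rmorphM /= rmorphXn /= exprD mulrCA mulrC.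
  by rewrite ler_pM2l // -mulrA.
apply: le_lt_trans h3 _; rewrite exprD mulrCA mulrC ltr_pM2r //.
Qed.

(* Unions of dyadic cells of some fixed size form an algebra generating the Borel sets, hence
   they approximate every Borel set in measure inside a bounded box. *)
Definition dyadic (U : set (d.-tuple R)) :=
  exists k, forall x y, cidx (level k) x = cidx (level k) y -> U x -> U y.

Definition symdiff A B : set (d.-tuple R) := (A `\` B) `|` (B `\` A).

Definition approximable (Q : set (d.-tuple R)) A :=
  measurable A /\ forall e : R, 0 < e -> exists U,
    [/\ dyadic U, measurable U & (leb (Q `&` symdiff A U) <= e%:E)%E].

Lemma measure_small_tail (Q : set (d.-tuple R)) (B : nat -> set (d.-tuple R)) (e : R) :
  measurable Q -> (leb Q < +oo)%E -> (forall k, measurable (B k)) ->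
  (forall k, B k.+1 `<=` B k) -> \bigcap_k B k = set0 -> 0 < e ->
  exists k, (leb (Q `&` B k) <= e%:E)%E.
Proof.
move=> mQ Qfin mB dB B0 e0.
have : leb \o (fun k => Q `&` B k) @ \oo --> leb (\bigcap_k (Q `&` B k)).
  apply: nonincreasing_cvg_mu.
  - apply: le_lt_trans Qfin; apply: le_measure; rewrite ?inE //; exact: measurableI.
  - by move=> k; exact: measurableI.
  - by apply: bigcapT_measurable => k; exact: measurableI.
  - move=> j k jk; apply/subsetPset; apply: setIS.
    elim: k jk => [|k IH]; first by rewrite leqn0 => /eqP ->.
    rewrite leq_eqVlt => /predU1P[->//|]; rewrite ltnS => /IH; exact: subset_trans.
rewrite (_ : \bigcap_k _ = set0); last first.
  by apply/seteqP; split=> // x h; rewrite -B0 => k _; case: (h k Logic.I).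
rewrite measure0 => /fine_cvgP [fin /cvgrPdist_le/(_ e e0) h].
near \oo => k; exists k.
have fk : leb (Q `&` B k) \is a fin_num by near: k.
rewrite -(fineK fk) lee_fin.
have : `|0 - fine (leb (Q `&` B k))| <= e by near: k.
by rewrite sub0r normrN ger0_norm // fine_ge0.
Unshelve. all: by end_near.
Qed.

Lemma dyadicU U V : dyadic U -> dyadic V -> dyadic (U `|` V).
Proof.
move=> [j hU] [k hV]; exists (maxn j k) => x y e.
have e1 := cidx_level_le (leq_maxl j k) e; have e2 := cidx_level_le (leq_maxr j k) e.
by move=> [/(hU _ _ e1)|/(hV _ _ e2)]; [left|right].
Qed.

Lemma measurable_symdiff Q A B : measurable Q -> measurable A -> measurable B ->
  measurable (Q `&` symdiff A B).
Proof.
by move=> mQ mA mB; apply: measurableI => //; apply: measurableU; exact: measurableD.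
Qed.

Lemma approximableU Q A B : measurable Q -> approximable Q A -> approximable Q B ->
  approximable Q (A `|` B).
Proof.
move=> mQ [mA hA] [mB hB]; split; first exact: measurableU.
move=> e e0; have e2 : 0 < e / 2 by rewrite divr_gt0.
have [U [dU mU lU]] := hA _ e2; have [V [dV mV lV]] := hB _ e2.
exists (U `|` V); split; [exact: dyadicU|exact: measurableU|].
have -> : e = e / 2 + e / 2 by rewrite -splitr.
rewrite EFinD; apply: le_trans (leeD lU lV); apply: le_trans (measureU2 _ _ _);
  [|exact: measurable_symdiff|exact: measurable_symdiff].
apply: le_measure; rewrite ?inE; [|apply: measurableU; exact: measurable_symdiff|].
  by apply: measurable_symdiff => //; exact: measurableU.
by move=> x [Qx]; rewrite /symdiff /=; tauto.
Qed.

(** Approximable sets form a sigma-algebra, finiteness of [leb Q] serving to cut countable unions;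
    and a half-space is an increasing union of half-spaces with dyadic bounds. *)
Lemma approximable_measurable Q A : measurable Q -> (leb Q < +oo)%E -> measurable A ->
  approximable Q A.
Proof.
move=> mQ Qfin.
have a0 : approximable Q set0.
  split; first exact: measurable0.
  move=> e e0; exists set0; split; [by exists 0%N|exact: measurable0|].
  by rewrite /symdiff !setD0 setUid setI0 measure0 lee_fin ltW.
have abig (F : nat -> set (d.-tuple R)) : (forall k, approximable Q (F k)) ->
    approximable Q (\bigcup_k F k).
  move=> hF; have mF k : measurable (F k) by case: (hF k).
  split; first exact: bigcupT_measurable.
  move=> e e0; have e2 : 0 < e / 2 by rewrite divr_gt0.
  pose G k := \big[setU/set0]_(j < k) F j.
  have aG k : approximable Q (G k).
    elim: k => [|k IH]; first by rewrite /G big_ord0.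
    by rewrite /G big_ord_recr; exact: approximableU.
  have mG k : measurable (G k) by case: (aG k).
  have GF k : G k `<=` \bigcup_k F k.
    by rewrite /G -bigcup_mkord => x [j _ Fj]; exists j.
  have [|||k hk] := @measure_small_tail Q (fun k => \bigcup_k F k `\` G k) (e / 2) mQ Qfin _ _ _ e2.
  - by move=> k; apply: measurableD => //; exact: bigcupT_measurable.
  - by move=> k; apply: setDS; rewrite /G big_ord_recr; exact: subsetUl.
  - apply/seteqP; split=> // x h; have [[j _ Fj] _] := h 0%N Logic.I.
    have [_] := h j.+1 Logic.I; apply; rewrite /G -bigcup_mkord; exists j => //=.
  have [U [dU mU lU]] := (aG k).2 _ e2.
  exists U; split=> //; have -> : e = e / 2 + e / 2 by rewrite -splitr.
  have mF' : measurable (\bigcup_k F k) by exact: bigcupT_measurable.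
  rewrite EFinD; apply: le_trans (leeD hk lU); apply: le_trans (measureU2 _ _ _);
    [|by apply: measurableI => //; exact: measurableD|exact: measurable_symdiff].
  apply: le_measure; rewrite ?inE; first exact: measurable_symdiff.
    by apply: measurableU; [apply: measurableI => //; exact: measurableD|exact: measurable_symdiff].
  move=> x [Qx]; have := @GF k x; have [?|?] := pselect (G k x); rewrite /symdiff /=; tauto.
apply: sigma_algebra_halfspaces; first split=> //.
  move=> A' [mA' hA']; rewrite setTD; split; first exact: measurableC.
  move=> e e0; have [U [[k dU] mU lU]] := hA' e e0; exists (~` U); split.
  - by exists k => x y exy nU Uy; apply: nU; apply: (dU y).
  - exact: measurableC.
  - by rewrite /symdiff !setDE !setCK setUC [~` A' `&` _]setIC [~` U `&` _]setIC.
move=> i c.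
pose U k := [set x : d.-tuple R | tnth x i < (Num.floor (c / level k))%:~R * level k].
have -> : [set x : d.-tuple R | tnth x i < c] = \bigcup_k U k.
  apply/seteqP; split=> [x xc|x [k _]]; rewrite /U /=; last first.
    move=> /lt_le_trans; apply; rewrite -ler_pdivlMr ?level_gt0 //.
    exact: floor_le_tmp.
  have cx : 0 < c - tnth x i by rewrite subr_gt0.
  have [k hk] : exists k, level k < c - tnth x i.
    exists (Num.truncn (c - tnth x i)^-1).+1.
    rewrite /level -[ltRHS]invrK ltf_pV2 ?posrE ?exprn_gt0 ?invr_gt0 //.
    apply: lt_trans (truncnS_gt _) _; rewrite -natrX ltr_nat; exact: ltn_expl.
  exists k => //; have := floorD1_gt (c / level k).
  rewrite ltr_pdivrMr ?level_gt0 // intrD mulrDl mul1r /U /=; lra.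
apply: abig => k; split; first exact: measurable_tnth_lt.
move=> e e0; exists (U k); split; [|exact: measurable_tnth_lt|].
  exists k => x y /ffunP/(_ i); rewrite !ffunE /U /= => exy.
  by rewrite -!ltr_pdivrMr ?level_gt0 // -!floor_lt_int exy.
by rewrite /symdiff !setDv setUid setI0 measure0 lee_fin ltW.
Qed.

Definition cube (M : nat) := box [tuple - M%:R | i < d] [tuple M%:R | i < d].

Lemma cubeP M x : cube M x <-> forall i, - M%:R <= tnth x i < M%:R.
Proof. by split=> h i; have := h i; rewrite !tnth_mktuple. Qed.

Lemma cube_cover x : exists M, cube M x.
Proof.
exists (\max_(i < d) (Num.truncn `|tnth x i|).+1)%N; apply/cubeP => i.
have h : `|tnth x i| < (\max_(i < d) (Num.truncn `|tnth x i|).+1)%N%:R.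
  apply: lt_le_trans (truncnS_gt _) _; rewrite ler_nat.
  exact: (leq_bigmax (F := fun i => (Num.truncn `|tnth x i|).+1)).
by move: h; rewrite ltr_norml => /andP[/ltW -> ->].
Qed.

Lemma leb_cube_fin M : (leb (cube M) < +oo)%E.
Proof. by rewrite leb_box_max ltry. Qed.

(** Takes the place of Lebesgue's density theorem. A union of dyadic cells approximates [A] within a
    small fraction of its mass; if [A] filled at most 1 - eta of every cell, it would be too
    small. *)
Lemma dense_cell A (eta : R) : measurable A -> (0 < leb A)%E -> 0 < eta <= 1 ->
  exists k z, (((1 - eta) * level k ^+ d)%:E < leb (A `&` cell (level k) z))%E.
Proof.
move=> mA Apos /andP[e0 e1].
have mc M : measurable (cube M) by exact: measurable_box.
have [M Mpos] : exists M, (0 < leb (A `&` cube M))%E.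
  apply: contrapT => /forallNP h; move: Apos; apply/negP; rewrite -leNgt.
  have : (leb A <= \sum_(k <oo) leb (A `&` cube k))%E.
    apply: measure_sigma_subadditive => //; first by move=> k; exact: measurableI.
    by move=> x Ax; have [k ck] := cube_cover x; exists k.
  rewrite eseries0 // => k _ _; apply/eqP; rewrite eq_le measure_ge0 andbT leNgt.
  exact/negP/h.
have fA : leb (A `&` cube M) \is a fin_num.
  rewrite ge0_fin_numE // (le_lt_trans _ (leb_cube_fin M)) //.
  by apply: le_measure; rewrite ?inE //; exact: measurableI.
pose a := fine (leb (A `&` cube M)); have aE : leb (A `&` cube M) = a%:E by rewrite fineK.
have a0 : 0 < a by rewrite -lte_fin -aE.
(* With w the volume of the cells used, a <= (1 - eta) w + e and w <= a + e give eta a <= (2 - eta)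
   e, which fails for e = eta a / 4. *)
pose e := eta * a / 4; have e_gt0 : 0 < e by rewrite divr_gt0 // mulr_gt0.
have [_ /(_ e e_gt0) [U [[k dU] mU lU]]] := approximable_measurable (mc M) (leb_cube_fin M) mA.
apply: contrapT => /forallNP/(_ k)/forallNP h.
have lk := level_gt0 k; set l := level k in lk h dU.
have [s us hs] := cell_subset_finite M lk.
(* A cube with integer corners is a union of unit cells, hence of cells of every finer level, so [W]
   is still a union of cells of side [l]. *)
pose W := U `&` cube M.
have mW : measurable W by exact: measurableI.
have dW x y : cidx l x = cidx l y -> W x -> W y.
  move=> exy [Ux Mx]; split; first exact: dU Ux.
  have := cidx_level_le (leq0n k) exy => /ffunP e00; apply/cubeP => i.
  have := (cubeP M x).1 Mx i; have := e00 i; rewrite !ffunE /level expr0 invr1 !divr1 => ei.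
  have E (w : R) : (- M%:R <= w < M%:R) = (- M%:Z <= Num.floor w < M%:Z).
    by rewrite floor_ge_int floor_lt_int mulrNz.
  by rewrite !E ei.
pose s' := [seq z <- s | `[< exists2 x, cell l z x & W x >]].
have us' : uniq s' by rewrite filter_uniq.
have WE : W = [set x | cidx l x \in s'].
  apply/seteqP; split=> x /=; rewrite mem_filter.
    by move=> Wx; apply/andP; split; [apply/asboolP; exists x|case: Wx => _ /cubeP; exact: hs].
  by move=> /andP[/asboolP[y cy Wy] _]; apply: dW Wy.
have [_ lW] := measure_cells leb lk measurableT us'; rewrite setTI -WE in lW.
have [_ lAW] := measure_cells leb lk mA us'; rewrite -WE in lAW.
pose w := \sum_(z <- s') l ^+ d.
have wE : leb W = w%:E.
  by rewrite lW /w -sumEFin; apply: eq_bigr => z _; rewrite setTI leb_cell.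
have AWle : (leb (A `&` W) <= ((1 - eta) * w)%:E)%E.
  rewrite lAW /w mulr_sumr -sumEFin; apply: lee_sum => z _.
  by rewrite leNgt; apply/negP/h.
have mAD : measurable (cube M `&` symdiff A U) by exact: measurable_symdiff.
have h1 : (a%:E <= ((1 - eta) * w + e)%:E)%E.
  rewrite -aE EFinD; apply: le_trans (leeD AWle lU); apply: le_trans (measureU2 _ _ _) => //.
    apply: le_measure; rewrite ?inE; [exact: measurableI|by apply: measurableU => //; exact: measurableI|].
    by move=> x [Ax Mx]; have [Ux|Ux] := pselect (U x); [left|right; split=> //; left].
  exact: measurableI.
have h2 : (w%:E <= (a + e)%:E)%E.
  rewrite -wE EFinD -aE; apply: le_trans (leeD (lexx _) lU).
  apply: le_trans (measureU2 _ _ _) => //; last exact: measurableI.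
  apply: le_measure; rewrite ?inE //; first by apply: measurableU => //; exact: measurableI.
  by move=> x [Ux Mx]; have [Ax|Ax] := pselect (A x); [left|right; split=> //; right].
have w0 : 0 <= w by apply: sumr_ge0 => z _; rewrite exprn_ge0 // ltW.
rewrite lee_fin in h1; rewrite lee_fin in h2.
have h3 : (1 - eta) * w <= (1 - eta) * (a + e) by rewrite ler_wpM2l // subr_ge0.
have h4 : 0 <= eta * e by rewrite mulr_ge0 // ltW.
have h5 : 0 < eta * a by rewrite mulr_gt0.
have : e = eta * a / 4 by [].
by clearbody e a w; nra.
Qed.

End EuclideanCells.

(** * The weighted integral *)

Section WeightedIntegral.
Variables (R : realType) (d : nat) (leb : {measure set (d.-tuple R) -> \bar R}).
Implicit Types (phi : d.-tuple R -> R) (s t u v : R).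

Lemma max_lip a x y : `|Num.max a x - Num.max a y| <= `|x - y| :> R.
Proof.
have h1 := ler_norm (x - y); have := ler_norm (y - x); rewrite distrC => h2.
have h3 := normr_ge0 (x - y).
by rewrite ler_norml; case: (leP a x) => ?; case: (leP a y) => ?; apply/andP; split; lra.
Qed.

Lemma min_lip a x y : `|Num.min x a - Num.min y a| <= `|x - y| :> R.
Proof.
have h1 := ler_norm (x - y); have := ler_norm (y - x); rewrite distrC => h2.
have h3 := normr_ge0 (x - y).
by rewrite ler_norml; case: (leP x a) => ?; case: (leP y a) => ?; apply/andP; split; lra.
Qed.

Lemma Hfun_expR u : Hfun (expR u) = u * expR u - expR u + 1.
Proof. by rewrite /Hfun expRK mulrC. Qed.

Lemma expR_tangent u v : expR u * (1 + (v - u)) <= expR v.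
Proof.
rewrite -[leRHS](_ : expR u * expR (v - u) = _); last by rewrite -expRD addrC subrK.
by rewrite ler_pM2l ?expR_gt0 // expR_ge1Dx.
Qed.

Lemma Hfun_expR_mono u v : 0 <= u -> u <= v -> Hfun (expR u) <= Hfun (expR v).
Proof.
move=> u0 uv; rewrite !Hfun_expR lerD2r.
have h1 := expR_tangent v u; have h2 : expR u <= expR v by rewrite ler_expR.
have p1 := expR_gt0 u; have p2 := expR_gt0 v.
have [u1|u1] := leP 1 u; first by nra.
have [v1|v1] := leP 1 v; first by nra.
have : (1 - u) * (expR v * (1 + (u - v))) <= (1 - u) * expR u by rewrite ler_pM2l ?subr_gt0.
have : 0 <= u * (v - u) * expR v by rewrite !mulr_ge0 ?subr_ge0 // ltW.
nra.
Qed.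

(** Quadratic growth makes [Gint phi s] exceed any given 1/t for large s; together with
    [Hfun_expR_lip], which makes it continuous in s, it solves the defining equation of s(phi,
    t). *)
Lemma Hfun_expR_ge u : 0 <= u -> u ^+ 2 / 4 <= Hfun (expR u).
Proof.
move=> u0; rewrite Hfun_expR.
have h1 := expR_ge1Dx u; have p := expR_gt0 u.
have [u1|u1] := leP 1 u; first by nra.
have h2 := expR_ge1Dx (- (u / 2)).
have h3 : (1 + - (u / 2)) ^+ 2 * expR u <= 1.
  have -> : expR u = expR (u / 2) ^+ 2 by rewrite -expRM_natl; congr expR; field.
  rewrite -exprMn exprn_ile1 //; first by rewrite mulr_ge0 ?expR_ge0 //; lra.
  apply: (@le_trans _ _ (expR (- (u / 2)) * expR (u / 2))).
    by rewrite ler_pM2r ?expR_gt0.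
  by rewrite -expRD addNr expR0.
have : u ^+ 2 / 4 * 1 <= u ^+ 2 / 4 * expR u.
  by rewrite ler_wpM2l ?divr_ge0 ?sqr_ge0 //; lra.
nra.
Qed.

Lemma Hfun_expR_lip u v S : 0 <= u -> u <= v -> v <= S ->
  Hfun (expR v) - Hfun (expR u) <= (v - u) * ((1 + S) * expR S).
Proof.
move=> u0 uv vS; rewrite !Hfun_expR.
have h1 := expR_tangent v u; have h2 : expR u <= expR v by rewrite ler_expR.
have h3 : expR v <= expR S by rewrite ler_expR.
have p1 := expR_gt0 u.
have -> : v * expR v - expR v + 1 - (u * expR u - expR u + 1) =
  (v - 1) * (expR v - expR u) + (v - u) * expR u by ring.
have k1 : (v - u) * expR u <= (v - u) * expR S.
  by rewrite ler_wpM2l ?subr_ge0 // (le_trans h2).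
have [v1|v1] := leP 1 v; last first.
  have : (v - 1) * (expR v - expR u) <= 0 by rewrite mulr_le0_ge0 ?subr_ge0 // subr_le0 ltW.
  have : 0 <= (v - u) * (S * expR S).
    by rewrite !mulr_ge0 ?expR_ge0 ?subr_ge0 // (le_trans _ vS) // (le_trans u0).
  by nra.
have : (v - 1) * (expR v - expR u) <= v * ((v - u) * expR v).
  by rewrite ler_pM ?subr_ge0 //; [lra|nra].
have : v * ((v - u) * expR v) <= S * ((v - u) * expR S).
  apply: ler_pM => //; [lra|by rewrite mulr_ge0 ?expR_ge0 ?subr_ge0|].
  by rewrite ler_wpM2l ?subr_ge0.
by nra.
Qed.

Lemma expR_sub1_le (s x : R) : 0 <= s -> 0 <= x <= 1 -> 0 <= expR (s * x) - 1 <= s * expR s * x.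
Proof.
move=> s0 /andP[x0 x1]; rewrite subr_ge0 -{1}expR0 ler_expR mulr_ge0 //=.
have h := expR_tangent (s * x) 0; rewrite expR0 in h.
have h2 : expR (s * x) <= expR s by rewrite ler_expR; nra.
have : s * x * expR (s * x) <= s * x * expR s by rewrite ler_wpM2l ?mulr_ge0.
nra.
Qed.

Definition weight phi := [/\ measurable_fun setT phi, forall x, 0 <= phi x <= 1
  & leb.-integrable setT (EFin \o phi)].

(** [Jint] is the cumulant function of a weighted Poisson count with unit intensity, [Iint] is its
    derivative in [s], and [Gint], equal to s I - J, is its Legendre transform at the slope
    belonging to [s]. *)
Definition Jint phi s := \int[leb]_x (expR (s * phi x) - 1).
Definition Iint phi s := \int[leb]_x (phi x * expR (s * phi x)).
Definition Gint phi s := \int[leb]_x (Hfun (expR (s * phi x))).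

Lemma weight_measurable_expR phi s : measurable_fun setT phi ->
  measurable_fun setT (fun x => expR (s * phi x)).
Proof. by move=> mphi; apply: measurableT_comp => //; exact: measurable_funM. Qed.

Lemma integrable_subr (f g : d.-tuple R -> R) :
  leb.-integrable setT (EFin \o f) -> leb.-integrable setT (EFin \o g) ->
  leb.-integrable setT (EFin \o (fun x => f x - g x)).
Proof. by move=> i j; have := integrableB measurableT i j; apply: eq_integrable. Qed.

Lemma integrable_addr (f g : d.-tuple R -> R) :
  leb.-integrable setT (EFin \o f) -> leb.-integrable setT (EFin \o g) ->
  leb.-integrable setT (EFin \o (fun x => f x + g x)).
Proof. by move=> i j; have := integrableD measurableT i j; apply: eq_integrable. Qed.

Lemma integrable_mulr c (f : d.-tuple R -> R) :
  leb.-integrable setT (EFin \o f) -> leb.-integrable setT (EFin \o (fun x => c * f x)).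
Proof. by move=> i; have := integrableZl measurableT c i; apply: eq_integrable. Qed.

Lemma weight_bounded_integrable phi (h : d.-tuple R -> R) C : weight phi ->
  measurable_fun setT h -> (forall x, 0 <= h x <= C * phi x) ->
  leb.-integrable setT (EFin \o h).
Proof.
move=> [mphi phi01 iphi] mh hC.
have := integrableZl measurableT C iphi; apply: le_integrable => //.
  exact/measurable_EFinP.
move=> x _; rewrite /= lee_fin.
have /andP[h0 h1] := hC x.
by rewrite ger0_norm // ger0_norm // (le_trans h0).
Qed.

Lemma weight_Jint_integrable phi s : weight phi -> 0 <= s ->
  leb.-integrable setT (EFin \o (fun x => expR (s * phi x) - 1)).
Proof.
move=> w s0; have [mphi phi01 iphi] := w.
apply: (weight_bounded_integrable (C := s * expR s) w).
  by apply: measurable_funB => //; exact: weight_measurable_expR.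
by move=> x; exact: expR_sub1_le.
Qed.

Lemma weight_Iint_integrable phi s : weight phi -> 0 <= s ->
  leb.-integrable setT (EFin \o (fun x => phi x * expR (s * phi x))).
Proof.
move=> w s0; have [mphi phi01 iphi] := w.
apply: (weight_bounded_integrable (C := expR s) w).
  by apply: measurable_funM => //; exact: weight_measurable_expR.
move=> x; have /andP[p0 p1] := phi01 x.
by rewrite mulr_ge0 ?expR_ge0 //= mulrC ler_wpM2r // ler_expR ler_piMr.
Qed.

Lemma HfunE phi s x : Hfun (expR (s * phi x)) =
  s * (phi x * expR (s * phi x)) - (expR (s * phi x) - 1).
Proof. by rewrite Hfun_expR; ring. Qed.

Lemma weight_Gint_integrable phi s : weight phi -> 0 <= s ->
  leb.-integrable setT (EFin \o (fun x => Hfun (expR (s * phi x)))).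
Proof.
move=> w s0; have -> : (fun x => Hfun (expR (s * phi x))) =
    (fun x => s * (phi x * expR (s * phi x)) - (expR (s * phi x) - 1)).
  by apply/funext => x; exact: HfunE.
apply: integrable_subr; last exact: weight_Jint_integrable.
exact/integrable_mulr/weight_Iint_integrable.
Qed.

Lemma GintE phi s : weight phi -> 0 <= s -> Gint phi s = s * Iint phi s - Jint phi s.
Proof.
move=> w s0; rewrite /Gint; under eq_Rintegral do rewrite HfunE.
rewrite RintegralB //; last exact: weight_Jint_integrable.
  by rewrite RintegralZl //; exact: weight_Iint_integrable.
exact/integrable_mulr/weight_Iint_integrable.
Qed.

Lemma Jint_ge0 phi s : weight phi -> 0 <= s -> 0 <= Jint phi s.
Proof.
move=> [_ phi01 _] s0; apply: Rintegral_ge0 => x _.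
by case/andP: (expR_sub1_le s0 (phi01 x)).
Qed.

(** The supporting line of the convex function [Jint], with slope [Iint]; integrated from the
    tangent of the exponential. *)
Lemma Jint_convex phi s s' : weight phi -> 0 <= s -> 0 <= s' ->
  Jint phi s + (s' - s) * Iint phi s <= Jint phi s'.
Proof.
move=> w s0 s'0; have iI := weight_Iint_integrable w s0.
have iJ := weight_Jint_integrable w s0; have iJ' := weight_Jint_integrable w s'0.
rewrite /Jint /Iint -RintegralZl // -RintegralD //; last exact: integrable_mulr.
apply: le_Rintegral => //; first exact/integrable_addr/integrable_mulr.
move=> x _; have := expR_tangent (s * phi x) (s' * phi x).
by rewrite -mulrBl; nra.
Qed.

Lemma Iint_ge_integral phi s : weight phi -> 0 <= s -> \int[leb]_x phi x <= Iint phi s.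
Proof.
move=> w s0; have [_ phi01 iphi] := w; apply: le_Rintegral => //.
  exact: weight_Iint_integrable.
move=> x _; have /andP[p0 p1] := phi01 x.
by rewrite ler_peMr // -expR0 ler_expR mulr_ge0.
Qed.

Lemma Gint_solution phi t : weight phi -> 0 < \int[leb]_x phi x -> 0 < t ->
  exists2 s, 0 <= s & Gint phi s = t^-1.
Proof.
move=> w phipos t0; have [mphi phi01 iphi] := w.
set I := \int[leb]_x phi x in phipos *.
have i2 : leb.-integrable setT (EFin \o (fun x => phi x ^+ 2)).
  apply: (weight_bounded_integrable (C := 1) w); first exact: measurable_funX.
  by move=> x; have /andP[? ?] := phi01 x; rewrite sqr_ge0 /=; nra.
pose q := \int[leb]_x (phi x ^+ 2).
have q0 : 0 < q.
  rewrite lt_neqAle; apply/andP; split; last by apply: Rintegral_ge0 => x _; exact: sqr_ge0.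
  apply/eqP => q0; move: phipos.
  have : (\int[leb]_x `|(phi x ^+ 2)%:E| = 0)%E.
    rewrite (eq_integral (fun x => (phi x ^+ 2)%:E)); last first.
      by move=> x _; rewrite /= ger0_norm ?sqr_ge0.
    by have := integrable_fin_num measurableT i2; move/fineK => /= <-; rewrite -[fine _]/q -q0.
  move/ae_eq_integral_abs => /(_ measurableT) H.
  rewrite /I /Rintegral (@ae_eq_integral _ _ _ _ _ (cst 0%E)) ?integral0 ?ltxx //.
  - exact/measurable_EFinP.
  have {}H := H (measurable_int _ i2).
  apply: filterS H => x /= h _; have /eqP := h Logic.I; rewrite eqe expf_eq0 /= => /eqP ->.
  by [].
(* Chosen with S^2 q / 4 >= 1/t, so that the quadratic lower bound on [Gint phi S] reaches the
   target; the summand 1 gives S^2 >= S. *)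
pose S := 4 * (t * q)^-1 + 1.
have S0 : 0 <= S by rewrite addr_ge0 // mulr_ge0 // invr_ge0 mulr_ge0 ?ltW.
have S1 : 1 <= S by rewrite /S lerDr mulr_ge0 // invr_ge0 mulr_ge0 ?ltW.
(* The Lipschitz estimate holds on [0, S] only; clamping the argument extends [Gint] to a continuous
   function on the line for the intermediate value theorem. *)
pose clamp s := Num.max 0 (Num.min s S).
have clamp0 s : 0 <= clamp s by rewrite /clamp le_max lexx.
have clampS s : clamp s <= S by rewrite /clamp ge_max S0 ge_min lexx orbT.
pose K := (1 + S) * expR S.
have K0 : 0 < K by rewrite mulr_gt0 ?expR_gt0 //; lra.
have lip s s' : 0 <= s -> s <= s' -> s' <= S ->
    0 <= Gint phi s' - Gint phi s <= (s' - s) * K * I.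
  move=> s0 ss' s'S; have s'0 := le_trans s0 ss'.
  have i0 := weight_Gint_integrable w s0; have i1 := weight_Gint_integrable w s'0.
  rewrite /Gint -RintegralB // -RintegralZl //; apply/andP; split.
    apply: Rintegral_ge0 => x _; have /andP[p0 p1] := phi01 x.
    by rewrite subr_ge0 Hfun_expR_mono ?mulr_ge0 // ler_wpM2r.
  apply: le_Rintegral => //; [exact: integrable_subr|exact: integrable_mulr|].
  move=> x _; have /andP[p0 p1] := phi01 x.
  apply: le_trans (Hfun_expR_lip (S := S) _ _ _) _; first by rewrite mulr_ge0.
  - by rewrite ler_wpM2r.
  - by rewrite (le_trans _ s'S) // ler_piMr.
  by rewrite -mulrBl mulrAC.
pose f s := Gint phi (clamp s).
have cf : continuous f.
  move=> s; apply/cvgrPdist_le => e e0; near=> s'.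
  have dist_clamp : `|clamp s - clamp s'| <= `|s - s'|.
    by rewrite /clamp; apply: le_trans (max_lip _ _ _) (min_lip _ _ _).
  have near_s : `|s - s'| * (K * I) <= e.
    rewrite -ler_pdivlMr ?(mulr_gt0 K0 phipos) //; near: s'.
    apply/nbhs_ballP; exists (e / (K * I)); first exact: divr_gt0 e0 (mulr_gt0 K0 phipos).
    by move=> x; rewrite /ball /= => /ltW.
  apply: le_trans near_s; apply: (@le_trans _ _ (`|clamp s - clamp s'| * (K * I))); last first.
    by rewrite ler_wpM2r // mulr_ge0 // ltW.
  rewrite /f; case: (leP (clamp s) (clamp s')) => cc.
    have /andP[l0 l1] := lip _ _ (clamp0 s) cc (clampS s').
    by rewrite distrC ger0_norm // distrC ger0_norm ?subr_ge0 // mulrA.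
  have /andP[l0 l1] := lip _ _ (clamp0 s') (ltW cc) (clampS s).
  by rewrite ger0_norm // ger0_norm ?subr_ge0 ?(ltW cc) // mulrA.
have G0 : Gint phi 0 = 0.
  by rewrite GintE // mul0r sub0r /Jint; under eq_Rintegral do rewrite mul0r expR0 subrr;
     rewrite /Rintegral integral0 oppr0.
have GS : t^-1 <= Gint phi S.
  apply: (@le_trans _ _ (S ^+ 2 / 4 * q)).
    rewrite -ler_pdivrMr // -invfM; have : 4 * (t * q)^-1 <= S * S.
      by apply: (@le_trans _ _ S); [rewrite /S lerDl|rewrite ler_peMr].
    by rewrite expr2; lra.
  rewrite /q -RintegralZl //; apply: le_Rintegral => //.
  - exact: integrable_mulr.
  - exact: weight_Gint_integrable.
  move=> x _; have /andP[p0 p1] := phi01 x.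
  by apply: le_trans (Hfun_expR_ge _); rewrite ?mulr_ge0 // exprMn mulrAC.
have cl0 : clamp 0 = 0 by rewrite /clamp (min_idPl S0) maxxx.
have clS : clamp S = S by rewrite /clamp minxx (max_idPr S0).
have [|s sI fs] := @IVT R f 0 S t^-1 S0 (continuous_subspaceT cf).
  rewrite /f cl0 clS G0 le_max GS orbT andbT ge_min invr_ge0 ltW //.
by exists (clamp s).
Unshelve. all: by end_near.
Qed.

Lemma xi_null phi t : weight phi -> \int[leb]_x phi x = 0 -> xi leb phi t = 0.
Proof.
move=> [mphi phi01 iphi] i0; rewrite /xi; case: ifP => // /eqP []; move: i0.
by rewrite /Rintegral; have := integrable_fin_num measurableT iphi; move/fineK => /= {2}<- ->.
Qed.

(** [Gint_solution] guarantees that the choice in [s_wi] is a solution and not the default 0. The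
    equation G = 1/t then reads s I = 1/t + J: the dual objective takes the value xi at this [s]. *)
Lemma xi_attained phi t : weight phi -> 0 < \int[leb]_x phi x -> 0 < t ->
  exists2 s, 0 < s & xi leb phi t = Iint phi s /\ s * Iint phi s = t^-1 + Jint phi s.
Proof.
move=> w ipos t0; have [mphi phi01 iphi] := w.
have ge s : 0 <= s -> (\int[leb]_x (Hfun (expR (s * phi x)))%:E = (Gint phi s)%:E)%E.
  by move=> s0; rewrite /Gint /Rintegral fineK //; exact: (integrable_fin_num measurableT (weight_Gint_integrable w s0)).
have [s0 s00 s0E] := Gint_solution w ipos t0.
have : [set s : R | 0 <= s /\
    (\int[leb]_x (Hfun (expR (s * phi x)%R))%:E = (t^-1)%:E)%E] (s_wi leb phi t).
  by apply: (@xgetPex _ 0 _); exists s0; split=> //; rewrite ge // s0E.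
move=> [s1 s1E]; set s := s_wi leb phi t in s1 s1E *.
rewrite ge // in s1E; have {s1E} sE : Gint phi s = t^-1 by case: s1E.
exists s; last split.
- rewrite lt_neqAle s1 andbT; apply/eqP => s00'.
  have : Gint phi s = 0.
    by rewrite GintE // -s00' mul0r sub0r /Jint; under eq_Rintegral do rewrite mul0r expR0 subrr;
      rewrite /Rintegral integral0 oppr0.
  by rewrite sE => /eqP; rewrite invr_eq0 gt_eqF.
- rewrite /xi; case: ifP => // /eqP i0; move: ipos.
  by rewrite /Rintegral i0 ltxx.
by rewrite -sE GintE // subrK.
Qed.

(** The supporting line at the solution s' gives J(s) >= J(s') + (s - s') I(s'), and s' I(s') -
    J(s') = 1/t. *)
Lemma xi_le phi s t : weight phi -> 0 < s -> 0 < t ->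
  s * xi leb phi t <= t^-1 + Jint phi s.
Proof.
move=> w s0 t0; have ws : 0 <= \int[leb]_x phi x.
  by apply: Rintegral_ge0 => x _; case: w => _ /(_ x)/andP[].
have [i0|ipos] := leP (\int[leb]_x phi x) 0.
  rewrite xi_null ?mulr0 //; last by apply: le_anti; rewrite i0.
  by rewrite addr_ge0 ?invr_ge0 ?(ltW t0) // Jint_ge0 // ltW.
have [s' s'0 [-> h]] := xi_attained w ipos t0.
by have := Jint_convex w (ltW s'0) (ltW s0); rewrite mulrBl h; lra.
Qed.

Lemma xi_ge0 phi t : (forall x, 0 <= phi x) -> 0 <= xi leb phi t.
Proof.
move=> p0; rewrite /xi; case: ifP => // _.
by apply/fine_ge0/integral_ge0 => x _; rewrite lee_fin mulr_ge0 ?expR_ge0.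
Qed.

Lemma xi_ge_integral phi t : weight phi -> 0 < t -> \int[leb]_x phi x <= xi leb phi t.
Proof.
move=> w t0; have [i0|ipos] := leP (\int[leb]_x phi x) 0.
  by apply: le_trans i0 (xi_ge0 _ _) => x; case: w => _ /(_ x)/andP[].
by have [s s0 [-> _]] := xi_attained w ipos t0; rewrite Iint_ge_integral // ltW.
Qed.

Lemma expR_chord s x : 0 <= x <= 1 -> expR (s * x) - 1 <= (expR s - 1) * x.
Proof.
move=> /andP[x0 x1].
have h1 := expR_tangent (s * x) s; have h2 := expR_tangent (s * x) 0; rewrite expR0 in h2.
have k1 : x * (expR (s * x) * (1 + (s - s * x))) <= x * expR s by rewrite ler_wpM2l.
have k2 : (1 - x) * (expR (s * x) * (1 + (0 - s * x))) <= (1 - x) * 1 by rewrite ler_wpM2l // subr_ge0.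
have -> : expR (s * x) = x * (expR (s * x) * (1 + (s - s * x))) +
  (1 - x) * (expR (s * x) * (1 + (0 - s * x))) by ring.
lra.
Qed.

(** By the chord of the exponential over [0, 1], an indicator has the largest [Jint] among the
    weights of given mass. *)
Lemma Jint_le phi s : weight phi -> 0 <= s -> Jint phi s <= (expR s - 1) * \int[leb]_x phi x.
Proof.
move=> w s0; have [_ phi01 iphi] := w.
rewrite /Jint -RintegralZl //; apply: le_Rintegral => //.
- exact: weight_Jint_integrable.
- exact: integrable_mulr.
by move=> x _; exact: expR_chord.
Qed.

Lemma xi_antitone phi t t' : weight phi -> 0 < t -> t <= t' -> xi leb phi t' <= xi leb phi t.
Proof.
move=> w t0 tt'; have t'0 := lt_le_trans t0 tt'.
have [i0|ipos] := leP (\int[leb]_x phi x) 0.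
  rewrite (xi_null _ w) ?xi_ge0 // => [x|]; first by case: w => _ /(_ x)/andP[].
  by apply: le_anti; rewrite i0 Rintegral_ge0 // => x _; case: w => _ /(_ x)/andP[].
have [s s0 [xE sE]] := xi_attained w ipos t0.
rewrite -(ler_pM2l s0) xE sE; apply: le_trans (xi_le w s0 t'0) _.
by rewrite lerD2r lef_pV2.
Qed.

(** * Suprema of the weighted integral over a class of weights of bounded mass *)

Section WeightClass.
Variables (G : set (d.-tuple R -> R)) (C : R).
Hypothesis Gw : forall phi, G phi -> weight phi /\ \int[leb]_x phi x <= C.
Hypothesis Gpos : exists2 phi, G phi & 0 < \int[leb]_x phi x.

Definition xi_sup t := fine (ereal_sup [set (xi leb phi t)%:E | phi in G]).

Lemma xi_sup_fin t : 0 < t ->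
  ereal_sup [set (xi leb phi t)%:E | phi in G] \is a fin_num.
Proof.
move=> t0; rewrite fin_real //; apply/andP; split.
  have [phi Gphi _] := Gpos; apply: (@lt_le_trans _ _ (xi leb phi t)%:E); first exact: ltNyr.
  by apply: ereal_sup_ubound; exists phi.
apply: (@le_lt_trans _ _ (t^-1 + (expR 1 - 1) * C)%:E); last exact: ltry.
apply: ge_ereal_sup => _ [phi Gphi <-]; rewrite lee_fin.
have [w wC] := Gw Gphi; have := xi_le w ltr01 t0; rewrite mul1r => /le_trans; apply.
rewrite lerD2l; apply: le_trans (Jint_le w ler01) _.
by rewrite ler_wpM2l // subr_ge0 -{1}expR0 ler_expR.
Qed.

Lemma xi_sup_ge phi t : 0 < t -> G phi -> xi leb phi t <= xi_sup t.
Proof.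
move=> t0 Gphi; rewrite -lee_fin fineK ?xi_sup_fin //.
by apply: ereal_sup_ubound; exists phi.
Qed.

Lemma xi_sup_le t b : 0 < t -> (forall phi, G phi -> xi leb phi t <= b) -> xi_sup t <= b.
Proof.
move=> t0 h; rewrite -lee_fin fineK ?xi_sup_fin //.
by apply: ge_ereal_sup => _ [phi Gphi <-]; rewrite lee_fin h.
Qed.

Lemma xi_sup_gt0 t : 0 < t -> 0 < xi_sup t.
Proof.
move=> t0; have [phi Gphi ipos] := Gpos; apply: lt_le_trans (xi_sup_ge t0 Gphi).
by apply: lt_le_trans ipos _; apply: xi_ge_integral => //; case: (Gw Gphi).
Qed.

Lemma xi_sup_approx t eps : 0 < t -> 0 < eps ->
  exists2 phi, G phi & (1 - eps) * xi_sup t < xi leb phi t.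
Proof.
move=> t0 e0; apply: contrapT => /forall2NP h.
have : xi_sup t <= (1 - eps) * xi_sup t.
  by apply: xi_sup_le => // phi Gphi; case: (h phi) => // /negP; rewrite -leNgt.
by have := xi_sup_gt0 t0; nra.
Qed.

Lemma xi_sup_antitone t t' : 0 < t -> t <= t' -> xi_sup t' <= xi_sup t.
Proof.
move=> t0 tt'; apply: xi_sup_le => [|phi Gphi]; first exact: lt_le_trans tt'.
by apply: le_trans (xi_antitone _ t0 tt') (xi_sup_ge t0 Gphi); case: (Gw Gphi).
Qed.

(** The exponent at which Chernoff's bound will be used for test functions dominated by [phi]. Any
    exponent would be valid there; this one keeps the dual objective below the supremum over the
    whole class. *)
Lemma xi_sup_dual phi t : 0 < t -> G phi ->
  exists2 s, 0 < s & t^-1 + Jint phi s <= s * xi_sup t.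
Proof.
move=> t0 Gphi; have [w wC] := Gw Gphi.
have [i0|ipos] := leP (\int[leb]_x phi x) 0.
  (* A weight of mass zero has J = 0, so it suffices that s [xi_sup t] reaches 1/t. *)
  exists (t * xi_sup t)^-1; first by rewrite invr_gt0 mulr_gt0 // xi_sup_gt0.
  have s0 : 0 <= (t * xi_sup t)^-1 by rewrite invr_ge0 mulr_ge0 ?ltW // xi_sup_gt0.
  have := Jint_le w s0; set s := (_ * _)^-1 in s0 * => Js.
  have : Jint phi s <= 0.
    by apply: le_trans Js _; rewrite mulr_ge0_le0 // subr_ge0 -{1}expR0 ler_expR.
  have -> : s * xi_sup t = t^-1 by rewrite /s invfM mulfVK // gt_eqF // xi_sup_gt0.
  lra.
have [s s0 [xE sE]] := xi_attained w ipos t0.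
by exists s => //; rewrite -sE ler_pM2l // -xE xi_sup_ge.
Qed.

(** The limit of [xi_sup t] for t to infinity: [mass_sup_le_xi_sup] bounds it from one side and
    [xi_sup_le_mass], with s small and then t large, from the other. *)
Definition mass_sup := sup [set \int[leb]_x phi x | phi in G].

Lemma mass_sup_has_sup : has_sup [set \int[leb]_x phi x | phi in G].
Proof.
split; first by have [phi Gphi _] := Gpos; exists (\int[leb]_x phi x), phi.
by exists C => _ [phi Gphi <-]; case: (Gw Gphi).
Qed.

Lemma mass_sup_ge phi : G phi -> \int[leb]_x phi x <= mass_sup.
Proof. by move=> Gphi; apply: ub_le_sup; [case: mass_sup_has_sup|exists phi]. Qed.

Lemma mass_sup_gt0 : 0 < mass_sup.
Proof. by have [phi Gphi ipos] := Gpos; apply: lt_le_trans ipos (mass_sup_ge Gphi). Qed.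

Lemma mass_sup_approx eps : 0 < eps ->
  exists2 phi, G phi & (1 - eps) * mass_sup < \int[leb]_x phi x.
Proof.
move=> e0; have em : 0 < eps * mass_sup by rewrite mulr_gt0 // mass_sup_gt0.
have [_ [phi Gphi <-] h] := sup_adherent em mass_sup_has_sup.
by exists phi => //; rewrite mulrBl mul1r.
Qed.

Lemma mass_sup_le_xi_sup t : 0 < t -> mass_sup <= xi_sup t.
Proof.
move=> t0; apply: ge_sup => [|_ [phi Gphi <-]]; first by case: mass_sup_has_sup.
by apply: le_trans (xi_sup_ge t0 Gphi); apply: xi_ge_integral => //; case: (Gw Gphi).
Qed.

Lemma xi_sup_le_mass s t : 0 < s -> 0 < t -> xi_sup t <= (s * t)^-1 + (expR s - 1) / s * mass_sup.
Proof.
move=> s0 t0; apply: xi_sup_le => // phi Gphi; have [w _] := Gw Gphi.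
rewrite -(ler_pM2l s0) (le_trans (xi_le w s0 t0)) // mulrDr invfM mulrA divff ?gt_eqF // mul1r.
rewrite lerD2l (le_trans (Jint_le w (ltW s0))) //.
rewrite (_ : s * _ = (expR s - 1) * mass_sup); last by field; rewrite gt_eqF.
by rewrite ler_wpM2l ?mass_sup_ge // subr_ge0 -{1}expR0 ler_expR ltW.
Qed.

End WeightClass.

Lemma weight_indicator (B : set (d.-tuple R)) : measurable B -> (leb B < +oo)%E ->
  weight (\1_B) /\ \int[leb]_x (\1_B x : R) = fine (leb B).
Proof.
move=> mB Bfin; have E : (\int[leb]_x (\1_B x : R)%:E = leb B)%E.
  by rewrite integral_indic // setIT.
split; last by rewrite /Rintegral E.
split; first exact: measurable_indic.
  by move=> x; rewrite indicE; case: (x \in B) => /=; rewrite ?lexx ler01.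
apply/integrableP; split; first exact/measurable_EFinP/measurable_indic.
rewrite (eq_integral (fun x => (\1_B x : R)%:E)) ?E // => x _.
by rewrite /= ger0_norm // indicE.
Qed.

Lemma Jint_indicator (B : set (d.-tuple R)) s : measurable B -> (leb B < +oo)%E ->
  Jint (\1_B) s = (expR s - 1) * fine (leb B).
Proof.
move=> mB Bfin; have [[_ _ iB] <-] := weight_indicator mB Bfin.
rewrite /Jint -RintegralZl //; apply: eq_Rintegral => x _.
by rewrite indicE; case: (x \in B); rewrite /= ?mulr1 // !mulr0 expR0 subrr.
Qed.

Lemma Iint_indicator (B : set (d.-tuple R)) s : measurable B -> (leb B < +oo)%E ->
  Iint (\1_B) s = expR s * fine (leb B).
Proof.
move=> mB Bfin; have [[_ _ iB] <-] := weight_indicator mB Bfin.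
rewrite /Iint -RintegralZl //; apply: eq_Rintegral => x _.
by rewrite indicE; case: (x \in B); rewrite /= ?mul1r ?mulr1 // !mul0r mulr0.
Qed.

(* In the sparse limit the optimal exponent of the indicator tends to infinity, and any other
   weight of bounded mass does only marginally better with that exponent. *)
Lemma xi_le_indicator (B : set (d.-tuple R)) C eps : measurable B -> (leb B < +oo)%E ->
  0 < fine (leb B) -> 0 < eps ->
  exists2 tau, 0 < tau & forall t, 0 < t <= tau -> forall phi, weight phi ->
    \int[leb]_x phi x <= C -> xi leb phi t <= (1 + eps) * xi leb (\1_B) t.
Proof.
move=> mB Bfin v0 e0; set v := fine (leb B) in v0 *.
(* Once the optimal exponent s is at least [K], C <= s v eps, so a mass [C] in place of [v] changes
   the dual objective by the factor 1 + eps at most. The threshold for t below forces s >= K. *)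
pose K := Num.max 1 ((C + v) / (v * eps)).
have K1 : 1 <= K by rewrite le_max lexx.
exists (v * (K * expR K + 1))^-1.
  by rewrite invr_gt0 mulr_gt0 // addr_gt0 // mulr_gt0 ?expR_gt0 //; lra.
move=> t /andP[t0 tt] phi w wC; have [wB iB] := weight_indicator mB Bfin.
have ipos : 0 < \int[leb]_x (\1_B x : R) by rewrite iB.
have [s s0 [-> sE]] := xi_attained wB ipos t0.
rewrite Jint_indicator // !Iint_indicator // -/v in sE *.
have tinv : t^-1 = v * (s * expR s - expR s + 1) by move: sE; lra.
have sK : K <= s.
  rewrite leNgt; apply/negP => sK.
  have : v * (K * expR K + 1) <= t^-1 by rewrite -[leLHS]invrK lef_pV2 // posrE invr_gt0 mulr_gt0 // addr_gt0 // mulr_gt0 ?expR_gt0 //; lra.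
  have e1 : expR s <= expR K by rewrite ler_expR ltW.
  have : s * expR s <= K * expR K by apply: ler_pM; rewrite ?expR_ge0 ?(ltW s0) ?(ltW sK).
  have := expR_gt0 s; rewrite tinv ler_pM2l //; lra.
rewrite -(ler_pM2l s0) (le_trans (xi_le w s0 t0)) // tinv.
have C0 : 0 <= C.
  by apply: le_trans wC; apply: Rintegral_ge0 => x _; case: w => _ /(_ x)/andP[].
have J1 : Jint phi s <= (expR s - 1) * C.
  apply: le_trans (Jint_le w (ltW s0)) _.
  by rewrite ler_wpM2l // subr_ge0 -{1}expR0 ler_expR ltW.
have Cs : C <= s * (v * eps).
  rewrite -ler_pdivrMr ?mulr_gt0 //; apply: le_trans sK; rewrite /K le_max; apply/orP; right.
  by rewrite ler_pM2r ?invr_gt0 ?mulr_gt0 // lerDl ltW.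
have es : 1 <= expR s by rewrite -{1}expR0 ler_expR ltW.
have : C * expR s <= s * (v * eps) * expR s by rewrite ler_wpM2r ?expR_ge0.
have : v * 1 <= v * expR s by rewrite ler_wpM2l // ltW.
nra.
Qed.

End WeightedIntegral.

(** * Norm balls and near-maximal level sets *)

Section NormGeometry.
Variables (R : realType) (d : nat).
Hypothesis hd : (1 <= d)%N.
Variable N : 'rV[R]_d -> R.
Hypothesis hN : is_norm N.
Implicit Types (u v w : 'rV[R]_d) (x y : d.-tuple R).

Lemma normZ (a : R) v : N (a *: v) = `|a| * N v. Proof. by case: hN. Qed.
Lemma normD u v : N (u + v) <= N u + N v. Proof. by case: hN. Qed.
Lemma norm_0 : N 0 = 0. Proof. by rewrite -(scale0r (0 : 'rV_d)) normZ normr0 mul0r. Qed.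
Lemma norm_opp v : N (- v) = N v. Proof. by rewrite -scaleN1r normZ normrN1 mul1r. Qed.
Lemma norm_sub u v : N (u - v) = N (v - u). Proof. by rewrite -norm_opp opprB. Qed.
Lemma norm_ge0 v : 0 <= N v.
Proof. by have := normD v (- v); rewrite subrr norm_0 norm_opp; lra. Qed.

Lemma norm_triangle u v w : N (u - w) <= N (u - v) + N (v - w).
Proof. by have := normD (u - v) (v - w); rewrite addrA subrK. Qed.

Lemma norm_le_coord : exists2 D : R, 0 < D &
  forall v (e : R), (forall i, `|v 0 i| <= e) -> N v <= D * e.
Proof.
exists (\sum_(i < d) N (delta_mx 0 i) + 1).
  by apply: ltr_wpDl => //; apply: sumr_ge0 => i _; exact: norm_ge0.
move=> v e ve; have e0 : 0 <= e by apply: le_trans (ve (Ordinal hd)).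
have nsum (I : Type) (s : seq I) (F : I -> 'rV[R]_d) : N (\sum_(i <- s) F i) <= \sum_(i <- s) N (F i).
  elim: s => [|i s IH]; first by rewrite !big_nil norm_0.
  by rewrite !big_cons; apply: le_trans (normD _ _) _; rewrite lerD2l.
rewrite {1}[v]row_sum_delta; apply: le_trans (nsum _ _ _) _.
rewrite mulrDl mul1r mulr_suml -[leLHS]addr0; apply: lerD => //.
by apply: ler_sum => i _; rewrite normZ mulrC ler_wpM2l // norm_ge0.
Qed.

(** Equivalence of norms: [N] is continuous by [norm_le_coord], so it attains on the compact unit
    sphere of the maximum norm a minimum, positive by definiteness, whose inverse is [K]. *)
Lemma coord_le_norm : exists2 K : R, 0 < K & forall v i, `|v 0 i| <= K * N v.
Proof.
have [D D0 hD] := norm_le_coord.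
have entry v i : `|v 0 i| <= `|v|.
  by rewrite [leRHS]/Num.Def.normr /= mx_normrE; apply/bigmax_geP; right => /=; exists (0, i).
have ND v : N v <= D * `|v| by apply: hD => i; exact: entry.
pose S := [set v : 'rV[R]_d | `|v| = 1].
have S0 : S !=set0.
  exists (const_mx 1); apply/eqP; rewrite /S /= eq_le; apply/andP; split.
    rewrite [leLHS]/Num.Def.normr /= mx_normrE; apply/bigmax_leP; split=> // i _.
    by rewrite mxE normr1.
  by apply: le_trans (entry _ (Ordinal hd)); rewrite mxE normr1.
have cS : compact S.
  apply: bounded_closed_compact.
    by exists 1; split; [exact: num_real|move=> M M1 v /= ->; exact: ltW].
  rewrite (_ : S = (fun v => `|v|) @^-1` [set 1]) //.
  apply: closed_comp; last exact: closed_eq.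
  by move=> v _; exact: norm_continuous.
have cN : continuous N.
  move=> v A /nbhs_ballP[e e0 eA].
  suff : nbhs v (N @^-1` A) by [].
  apply/nbhs_ballP; exists (e / D); first exact: divr_gt0.
  move=> v'; rewrite -ball_normE /= => h; apply: eA; rewrite -ball_normE /=.
  have h2 : N (v - v') < e.
    by apply: le_lt_trans (ND _) _; rewrite -ltr_pdivlMl // mulrC.
  rewrite ltr_norml; have := norm_triangle v v' 0; have := norm_triangle v' v 0.
  by rewrite !subr0 (norm_sub v' v); move=> *; apply/andP; split; lra.
have [c cS1 cmin] := EVT_min_rV S0 cS (continuous_subspaceT cN).
move: cS1; rewrite inE /S /= => c1.
have Nc : 0 < N c.
  rewrite lt_neqAle norm_ge0 andbT eq_sym; apply/eqP => Nc0.
  have c0 : c = 0 by case: hN => h _ _; exact: h.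
  by move: c1; rewrite c0 normr0 => /eqP; rewrite eq_sym oner_eq0.
exists (N c)^-1; first by rewrite invr_gt0.
move=> v i; apply: le_trans (entry v i) _.
rewrite mulrC ler_pdivlMr //.
have [->|v0] := eqVneq v 0; first by rewrite normr0 mul0r norm_ge0.
have nv : 0 < `|v| by rewrite normr_gt0.
have : N c <= N (`|v|^-1 *: v).
  by apply: cmin; rewrite inE /S /= normrZ ger0_norm ?invr_ge0 // mulVf // gt_eqF.
by rewrite normZ ger0_norm ?invr_ge0 // -(ler_pM2l nv) mulrA divff ?gt_eqF // mul1r.
Qed.

Lemma tvecB x y i : (tvec x - tvec y) 0 i = tnth x i - tnth y i.
Proof. by rewrite !mxE. Qed.

Lemma dist_sym x y : dist N x y = dist N y x.
Proof. exact: norm_sub. Qed.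

Lemma dist_triangle x y z : dist N x z <= dist N x y + dist N y z.
Proof. exact: norm_triangle. Qed.

Lemma dist_refl x : dist N x x = 0.
Proof. by rewrite /dist subrr norm_0. Qed.

Lemma dist_aff (r : R) (u x y : d.-tuple R) : dist N (aff r u x) (aff r u y) = `|r| * dist N x y.
Proof.
rewrite /dist -normZ; congr N; apply/rowP => i; rewrite !mxE !tnth_mktuple; ring.
Qed.

Definition zvec (z : {ffun 'I_d -> int}) : 'rV[R]_d := \row_i (z i)%:~R.

Lemma dist_cells (D : R) (l : R) (x y : d.-tuple R) : 0 < l ->
  (forall v (e : R), (forall i, `|v 0 i| <= e) -> N v <= D * e) ->
  `|dist N x y - l * N (zvec (cidx l x) - zvec (cidx l y))| <= D * l.
Proof.
move=> l0 hD.
set w := _ - zvec _.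
have -> : l * N w = N (l *: w) by rewrite normZ ger0_norm // ltW.
have h : N (tvec x - tvec y - l *: w) <= D * l.
  apply: hD => i; rewrite !mxE !ffunE.
  have h1 := floor_le_tmp (tnth x i / l); have h2 := floorD1_gt (tnth x i / l).
  have h3 := floor_le_tmp (tnth y i / l); have h4 := floorD1_gt (tnth y i / l).
  move: h1 h2 h3 h4; rewrite !intrD !ler_pdivlMr // !ltr_pdivrMr //.
  set a := (Num.floor _)%:~R; set b := (Num.floor _)%:~R => *.
  by rewrite ler_norml; apply/andP; split; lra.
rewrite /dist ler_norml.
have := normD (tvec x - tvec y - l *: w) (l *: w); rewrite subrK.
have := normD (l *: w - (tvec x - tvec y)) (tvec x - tvec y).
have E := norm_sub (l *: w) (tvec x - tvec y).
by rewrite subrK E => *; apply/andP; split; lra.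
Qed.

Lemma dyadic_measurable (U : set (d.-tuple R)) : dyadic U -> measurable U.
Proof.
move=> [k hU].
pose F (z : {ffun 'I_d -> int}) := [set x | cell (level R k) z x /\ U x].
have -> : U = \bigcup_z F z.
  by apply/seteqP; split=> [x Ux|x [z _ []//]]; exists (cidx (level R k) x).
apply: countable_bigcupT_measurable => [|z]; first exact: countableP.
have [[x [cx Ux]]|none] := pselect (exists x, F z x).
  rewrite (_ : F z = cell (level R k) z); first exact: measurable_cell (level_gt0 R k).
  by apply/seteqP; split=> [y []//|y cy]; split=> //; apply: hU Ux; rewrite cx cy.
rewrite (_ : F z = set0); first exact: measurable0.
by apply/seteqP; split=> // x Fx; apply: none; exists x.
Qed.

(** The open ball is the union over k of the sets of points whose whole cell of level k lies in the
    ball; each of these is a countable union of cells. *)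
Lemma measurable_Ball x rho : measurable (Ball N x rho).
Proof.
have [D D0 hD] := norm_le_coord.
pose U k := [set y | forall y', cidx (level R k) y = cidx (level R k) y' -> dist N x y' < rho].
have -> : Ball N x rho = \bigcup_k U k.
  apply/seteqP; split=> [y xy|y [k _]]; last by apply.
  have e0 : 0 < (rho - dist N x y) / D by rewrite divr_gt0 // subr_gt0.
  have [k hk] : exists k, level R k < (rho - dist N x y) / D.
    exists (Num.truncn ((rho - dist N x y) / D)^-1).+1.
    rewrite /level -[ltRHS]invrK ltf_pV2 ?posrE ?exprn_gt0 ?invr_gt0 //.
    apply: lt_trans (truncnS_gt _) _; rewrite -natrX ltr_nat; exact: ltn_expl.
  exists k => // y' yy'; apply: le_lt_trans (dist_triangle x y y') _.
  rewrite -ltrBrDl; move: hk; rewrite ltr_pdivlMr // mulrC; apply: le_lt_trans.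
  have := dist_cells y y' (level_gt0 R k) hD.
  rewrite yy' subrr norm_0 mulr0 subr0; apply: le_trans.
  exact: ler_norm.
apply: bigcupT_measurable => k; apply: dyadic_measurable; exists k => y y' yy' Uy y'' y'y''.
by apply: Uy; rewrite yy'.
Qed.

Variable leb : {measure set (d.-tuple R) -> \bar R}.
Hypothesis hleb : is_lebesgue leb.

Lemma tnth_origin i : tnth (origin R d) i = 0.
Proof. by rewrite /origin (tnth_nth 0) /= nth_nseq ltn_ord. Qed.

Lemma leb_Ball_fin rho : (leb (Ball N (origin R d) rho) < +oo)%E.
Proof.
have [K K0 hK] := coord_le_norm.
pose M := (Num.truncn (K * rho)).+1.
apply: le_lt_trans (leb_cube_fin hleb M); apply: le_measure; rewrite ?inE.
- exact: measurable_Ball.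
- exact: measurable_box.
move=> y; rewrite /Ball /= => hy; apply/cubeP => i.
have : `|(tvec (origin R d) - tvec y) 0 i| < M%:R.
  apply: le_lt_trans (hK _ i) _; apply: lt_trans (truncnS_gt _).
  by rewrite ltr_pM2l.
by rewrite tvecB tnth_origin sub0r normrN ltr_norml => /andP[/ltW -> ->].
Qed.

Lemma leb_Ball_gt0 rho : 0 < rho -> 0 < fine (leb (Ball N (origin R d) rho)).
Proof.
move=> rho0; have [D D0 hD] := norm_le_coord.
pose l := rho / (2 * D); have l0 : 0 < l by rewrite divr_gt0 // mulr_gt0.
rewrite fine_gt0 // leb_Ball_fin andbT.
apply: (@lt_le_trans _ _ (leb (cell l 0))).
  by rewrite (leb_cell hleb) // lte_fin exprn_gt0.
apply: le_measure; rewrite ?inE; [exact: measurable_cell|exact: measurable_Ball|].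
move=> y; rewrite cellE // => hy; rewrite /Ball /= /dist.
apply: (@le_lt_trans _ _ (D * l)).
  apply: hD => i; rewrite tvecB tnth_origin sub0r normrN.
  have := hy i; rewrite !tnth_mktuple !ffunE mul0r add0r mul1r => /andP[h1 h2].
  by rewrite ger0_norm // ltW.
have -> : D * l = rho / 2 by rewrite /l; field; rewrite gt_eqF.
lra.
Qed.

Lemma leb_Ball_scale (c rho : R) : 0 < c ->
  leb (Ball N (origin R d) (c * rho)) = ((c ^+ d)%:E * leb (Ball N (origin R d) rho))%E.
Proof.
move=> c0.
have := leb_aff hleb (origin R d) (r := c^-1) (A := Ball N (origin R d) rho).
rewrite invr_gt0 exprVn invrK => /(_ c0 (measurable_Ball _ _)) <-; congr (leb _).
have a0 : aff c^-1 (origin R d) (origin R d) = origin R d.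
  by apply: eq_from_tnth => i; rewrite tnth_mktuple !tnth_origin mulr0 addr0.
have aE y : dist N (origin R d) (aff c^-1 (origin R d) y) = c^-1 * dist N (origin R d) y.
  by rewrite -{1}a0 dist_aff ger0_norm // invr_ge0 ltW.
by apply/seteqP; split=> y; rewrite /Ball /= aE ltr_pdivrMl.
Qed.

End NormGeometry.

(** * The bounded density, its essential supremum and its near-maximal level sets *)

Section Density.
Variables (R : realType) (d : nat) (leb : {measure set (d.-tuple R) -> \bar R}).
Hypothesis hleb : is_lebesgue leb.
Variable f : d.-tuple R -> R.
Hypotheses (mf : measurable_fun setT f) (f0 : forall x, 0 <= f x).
Hypothesis fbd : exists M : R, forall x, f x <= M.
Variable nu : {measure set (d.-tuple R) -> \bar R}.
Hypothesis nuE : forall A, measurable A -> nu A = (\int[leb]_(x in A) (f x)%:E)%E.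
Hypothesis nuT : nu setT = 1%E.

Let sigma := ess_sigma leb f.

Lemma measurable_superlevel (c : R) : measurable [set x | c < f x].
Proof.
rewrite (_ : [set _ | _] = [set: d.-tuple R] `&` f @^-1` `]c, +oo[%classic); first exact: mf.
by rewrite setTI; apply/seteqP; split=> x /=; rewrite in_itv /= andbT.
Qed.

Lemma sigma_has_sup : has_sup [set s : R | (0 < leb [set x | (s < f x)%R])%E].
Proof.
split.
  exists (- 1) => /=; apply: (@lt_le_trans _ _ (leb (cell 1 0))).
    by rewrite (leb_cell hleb) // lte_fin exprn_gt0.
  apply: le_measure; rewrite ?inE; [exact: measurable_cell|exact: measurable_superlevel|].
  by move=> x _ /=; apply: lt_le_trans (f0 x); rewrite ltrN10.
have [M hM] := fbd; exists M => s /= h; rewrite leNgt; apply/negP => Ms; move: h.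
rewrite (_ : [set _ | _] = set0) ?measure0 ?ltxx //.
by apply/seteqP; split=> x //= sf; have := lt_trans Ms sf; rewrite ltNge hM.
Qed.

Lemma leb_superlevel_gt0 (c : R) : c < sigma -> (0 < leb [set x | (c < f x)%R])%E.
Proof.
move=> cs; have [s hs cs'] := sup_gt sigma_has_sup.1 cs.
apply: lt_le_trans hs _; apply: le_measure; rewrite ?inE; try exact: measurable_superlevel.
by move=> x /=; exact: lt_trans.
Qed.

Lemma leb_superlevel_sigma : leb [set x | (sigma < f x)%R] = 0%E.
Proof.
pose F (k : nat) := [set x | sigma + k.+1%:R^-1 < f x].
have F0 k : leb (F k) = 0%E.
  apply/eqP; rewrite eq_le measure_ge0 andbT leNgt; apply/negP => h.
  have : sigma + k.+1%:R^-1 <= sigma.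
    by apply: ub_le_sup => //; case: sigma_has_sup.
  by rewrite gerDl leNgt invr_gt0 ltr0Sn.
apply/eqP; rewrite eq_le measure_ge0 andbT.
apply: (@le_trans _ _ (\sum_(k <oo) leb (F k))%E).
  apply: measure_sigma_subadditive; [|exact: measurable_superlevel|].
    by move=> k; exact: measurable_superlevel.
  move=> x /= sf; have p : 0 < f x - sigma by rewrite subr_gt0.
  exists (Num.truncn (f x - sigma)^-1) => //; rewrite /F /= -ltrBrDl.
  by rewrite -[ltRHS]invrK ltf_pV2 ?posrE ?invr_gt0 // truncnS_gt.
by rewrite eseries0.
Qed.

Lemma sigma_ge0 : 0 <= sigma.
Proof.
rewrite leNgt; apply/negP => s0.
have := leb_superlevel_sigma; apply/eqP; rewrite gt_eqF //.
apply: (@lt_le_trans _ _ (leb (cell 1 0))).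
  by rewrite (leb_cell hleb) // lte_fin exprn_gt0.
apply: le_measure; rewrite ?inE; [exact: measurable_cell|exact: measurable_superlevel|].
by move=> x _ /=; exact: lt_le_trans (f0 x).
Qed.

Lemma nu_le (A : set (d.-tuple R)) : measurable A -> (nu A <= sigma%:E * leb A)%E.
Proof.
move=> mA; rewrite nuE // -(integral_cst leb mA).
apply: ae_ge0_le_integral => //.
- by move=> x _; rewrite lee_fin.
- by apply/measurable_EFinP; exact: measurable_funTS.
- by move=> x _; rewrite lee_fin sigma_ge0.
exists [set x | (sigma < f x)%R]; split; [exact: measurable_superlevel|exact: leb_superlevel_sigma|].
by move=> x /= /not_implyP[_ /negP]; rewrite lee_fin -ltNge.
Qed.

Lemma sigma_gt0 : 0 < sigma.
Proof.
rewrite lt_neqAle sigma_ge0 andbT; apply/eqP => s0.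
have := nu_le measurableT; rewrite nuT -s0 mul0e lee_fin.
by rewrite leNgt ltr01.
Qed.

Lemma nu_ge (A : set (d.-tuple R)) (c : R) : 0 <= c -> measurable A ->
  (c%:E * leb (A `&` [set x | c < f x]%R) <= nu A)%E.
Proof.
move=> c0 mA; have mB := measurable_superlevel c.
have mAB : measurable (A `&` [set x | c < f x]) by exact: measurableI.
rewrite -(integral_cst leb mAB) nuE //.
apply: (@le_trans _ _ (\int[leb]_(x in A `&` [set x | (c < f x)%R]) (f x)%:E)%E).
  apply: ge0_le_integral => //; try by move=> x _; rewrite lee_fin.
    by apply/measurable_EFinP; exact: measurable_funTS.
  by move=> x [_ /= /ltW]; rewrite lee_fin.
apply: ge0_subset_integral => //; try by move=> x _; rewrite lee_fin.
by apply/measurable_EFinP; exact: measurable_funTS.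
Qed.

(* Inside a dyadic cell almost filled by a near-maximal level set of [f], at least half of the
   windows of side [m * r] have only a small part outside that level set. *)
Lemma good_windows (eps eta : R) (m : nat) : 0 < eps -> 0 < eta -> (0 < m)%N ->
  exists c0 r0 : R, [/\ 0 < c0, 0 < r0 & forall r, 0 < r <= r0 ->
    exists s : seq {ffun 'I_d -> int}, [/\ uniq s, c0 * r ^- d <= (size s)%:R &
      forall z, z \in s ->
        (leb (cell (m%:R * r) z `\` [set x | ((1 - eps) * sigma < f x)%R]) <= (eta * r ^+ d)%:E)%E]].
Proof.
move=> e0 eta0 m0; have s0 := sigma_gt0.
have cs : (1 - eps) * sigma < sigma by rewrite -subr_gt0; nra.
set A := [set x | _].
have mA : measurable A by exact: measurable_superlevel.
have mpos : (0 : R) < m%:R by rewrite ltr0n.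
(* Each bad window wastes more than eta r^d, while the large cell wastes at most eta' b^d in all.
   With this [eta'] the bad windows number at most half of (b / (2 m r))^d, which is a lower bound
   for the number of all windows. *)
pose eta' : R := Num.min (eta * (2 * m%:R) ^- d / 2) 1.
have q0 : (0 : R) < (2 * m%:R) ^- d by rewrite invr_gt0 exprn_gt0 // mulr_gt0.
have eta'0 : 0 < eta' <= 1.
  by rewrite /eta' lt_min ltr01 andbT ge_min lexx orbT andbT divr_gt0 // mulr_gt0.
have [k [z0 dens]] := dense_cell hleb mA (leb_superlevel_gt0 cs) eta'0.
set b := level R k in dens; have b0 : 0 < b := level_gt0 R k.
have mQ : measurable (cell b z0) by exact: measurable_cell.
have lQ := leb_cell hleb z0 b0.
have QA : (leb (cell b z0 `\` A) <= (eta' * b ^+ d)%:E)%E.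
  have : leb (cell b z0) = (leb (cell b z0 `\` A) + leb (A `&` cell b z0))%E.
    by rewrite [A `&` _]setIC; exact: measureDI.
  rewrite lQ.
  have : leb (cell b z0 `\` A) \is a fin_num.
    rewrite ge0_fin_numE // (@le_lt_trans _ _ (leb (cell b z0))) //; last by rewrite lQ ltry.
    by apply: le_measure; rewrite ?inE //; exact: measurableD.
  have : leb (A `&` cell b z0) \is a fin_num.
    rewrite ge0_fin_numE // (@le_lt_trans _ _ (leb (cell b z0))) //; last by rewrite lQ ltry.
    by apply: le_measure; rewrite ?inE //; exact: measurableI.
  move=> /fineK E1 /fineK E2; rewrite -E1 -E2 -EFinD => -[h].
  by move: dens; rewrite -E1 lte_fin lee_fin; lra.
exists (b ^+ d * (2 * m%:R) ^- d / 2), (b / (4 * m%:R)); split.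
- by rewrite divr_gt0 // mulr_gt0 // exprn_gt0.
- by rewrite divr_gt0 // mulr_gt0.
move=> r /andP[r_gt0 rb]; set l := m%:R * r.
have l0 : 0 < l by rewrite mulr_gt0.
have bl : 4 <= b / l.
  by rewrite ler_pdivlMr // /l mulrA -ler_pdivlMl ?mulr_gt0 // mulrC.
(* The grid of side [l] need not be aligned with the large cell, so in each coordinate one window is
   sacrificed and [base] starts at the floor plus one; b / l >= 4 still gives n >= b / (2 l). *)
pose n := (Num.truncn (b / l)).-1.
have tb : (0 < Num.truncn (b / l))%N by rewrite truncn_gt0; lra.
have nS : n.+1%:R <= b / l < n.+2%:R.
  by rewrite /n prednK //; apply: truncn_itv; lra.
pose base : {ffun 'I_d -> int} := [ffun i => Num.floor ((z0 i)%:~R * b / l) + 1].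
pose w (v : {ffun 'I_d -> 'I_n}) : {ffun 'I_d -> int} := [ffun i => base i + (v i : nat)%:Z].
have winj : injective w.
  move=> v v' /ffunP h; apply/ffunP => i; apply/val_inj.
  by have := h i; rewrite !ffunE => /addrI [].
pose s := [seq w v | v : {ffun 'I_d -> 'I_n}].
have us : uniq s by rewrite map_inj_uniq ?enum_uniq.
have ss : (size s = n ^ d)%N by rewrite size_map -cardE card_ffun !card_ord.
have sQ z : z \in s -> cell l z `<=` cell b z0.
  move=> /mapP[v _ ->]; rewrite !cellE // => x hx i; have := hx i.
  rewrite !tnth_mktuple !ffunE.
  have h1 := floor_le_tmp ((z0 i)%:~R * b / l); have h2 := floorD1_gt ((z0 i)%:~R * b / l).
  move: h1 h2; rewrite !intrD; set F := (Num.floor _)%:~R; rewrite ler_pdivlMr // ltr_pdivrMr //.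
  move=> h1 h2 /andP[h3 h4].
  have vn : ((v i : nat)%:~R : R) + 1 <= n%:R by rewrite natr1 ler_nat.
  have v0 : 0 <= ((v i : nat)%:~R : R) by exact: ler0n.
  have /andP[nS1 _] := nS; rewrite ler_pdivlMr // -natr1 in nS1.
  have k1 : 0 <= (v i : nat)%:~R * l by rewrite mulr_ge0 // ltW.
  have k2 : ((v i : nat)%:~R + 1) * l <= n%:R * l by rewrite ler_pM2r.
  by apply/andP; split; nra.
pose bad := [seq z <- s | (eta * r ^+ d)%:E < leb (cell l z `\` A)]%E.
pose good := [seq z <- s | ~~ ((eta * r ^+ d)%:E < leb (cell l z `\` A))%E].
have rd : 0 < r ^+ d by rewrite exprn_gt0.
have sizebad : (size bad)%:R * (eta * r ^+ d) <= eta' * b ^+ d.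
  rewrite -lee_fin; apply: le_trans QA.
  have ub : uniq bad by rewrite filter_uniq.
  have mB : measurable (cell b z0 `\` A) by exact: measurableD.
  have [mI E] := measure_cells leb l0 mB ub.
  apply: (@le_trans _ _ (leb ((cell b z0 `\` A) `&` [set x | cidx l x \in bad]))); last first.
    by apply: le_measure; rewrite ?inE.
  have -> : (size bad)%:R * (eta * r ^+ d) = \sum_(z <- bad) (eta * r ^+ d).
    by rewrite big_const_seq count_predT iter_addr_0 mulr_natl.
  rewrite E -sumEFin.
  rewrite big_seq [leRHS]big_seq; apply: lee_sum => z; rewrite mem_filter => /andP[/ltW h zs].
  apply: le_trans h _; apply: le_measure; rewrite ?inE.
  - by apply: measurableD => //; exact: measurable_cell.
  - by apply: measurableI => //; exact: measurable_cell.
  - by move=> x [cx nA]; split=> //; split=> //; exact: (sQ z).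
exists good; split; first by rewrite filter_uniq.
  have sgb : (size s = size bad + size good)%N by rewrite !size_filter count_predC.
  have : b / l / 2 <= n%:R.
    have h2 : b / l < n%:R + 2 by have /andP[_] := nS; rewrite -[n.+2]addn2 natrD.
    by move: bl h2; set q := b / l => *; lra.
  move=> hn; have h0 : 0 <= b / l / 2 by lra.
  have := ler_pXn2r; have : (b / l / 2) ^+ d <= n%:R ^+ d.
    by rewrite lerXn2r // nnegrE.
  rewrite -natrX -ss sgb natrD => h1 _.
  have E1 : (b / l / 2) ^+ d = b ^+ d * (2 * m%:R) ^- d * r ^- d.
    by rewrite -!exprVn -!exprMn /l; congr (_ ^+ _); field; rewrite !gt_eqF.
  have h2 : (size bad)%:R <= b ^+ d * (2 * m%:R) ^- d / 2 * r ^- d.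
    rewrite ler_pdivlMr // -(ler_pM2l eta0) mulrCA; apply: le_trans sizebad _.
    have : eta' <= eta * (2 * m%:R) ^- d / 2 by rewrite /eta' ge_min lexx.
    move=> /(ler_wpM2r (ltW (exprn_gt0 d b0))) /le_trans; apply.
    by rewrite le_eqVlt; apply/orP; left; apply/eqP; ring.
  move: h1; rewrite E1; lra.
by move=> z; rewrite mem_filter -leNgt => /andP[].
Qed.

End Density.

(** * Counting sample points in windows *)

Section NumericBounds.
Variable R : realType.

Lemma exprn_sub1_le (x : R) n : 0 <= x -> (1 + x) ^+ n - 1 <= n%:R * x * expR (n%:R * x).
Proof.
move=> x0; have h : (1 + x) ^+ n <= expR (n%:R * x).
  rewrite expRM_natl; apply: lerXn2r; rewrite ?nnegrE ?expR_ge0 ?addr_ge0 //.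
  exact: expR_ge1Dx.
have := expR_ge1Dx (- (n%:R * x)); rewrite expRN => h2.
have e0 := expR_gt0 (n%:R * x); set E := expR _ in h h2 e0 *.
have : 1 * E <= (E^-1 + n%:R * x) * E by rewrite ler_pM2r //; lra.
by rewrite mulrDl mulVf ?gt_eqF // mul1r; lra.
Qed.

Lemma expR_quadratic (x : R) : 0 <= x -> expR (x * (1 - x)) <= 1 + x.
Proof.
move=> x0; have h := expR_ge1Dx (- (x * (1 - x))).
have h2 : 0 < 1 + - (x * (1 - x)) by nra.
rewrite -[leLHS]invrK -expRN.
apply: (@le_trans _ _ (1 + - (x * (1 - x)))^-1).
  by rewrite lef_pV2 // posrE expR_gt0.
by rewrite -div1r ler_pdivrMr //; nra.
Qed.

Lemma expRN_quadratic (x : R) : 0 <= x -> expR (- x) <= 1 - x * (1 - x).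
Proof.
move=> x0; have h := expR_ge1Dx x; rewrite expRN.
apply: (@le_trans _ _ (1 + x)^-1); first by rewrite lef_pV2 // posrE ?expR_gt0 //; lra.
by rewrite -div1r ler_pdivrMr; nra.
Qed.

Lemma exprn_1sub_le (q : R) k : 0 < q <= 1 -> (0 < k)%N -> (1 - q) ^+ k <= (k%:R * q)^-1.
Proof.
move=> /andP[q0 q1] k0; have k1 : 0 < k%:R :> R by rewrite ltr0n.
apply: (@le_trans _ _ (expR (k%:R * - q))).
  rewrite expRM_natl; apply: lerXn2r; rewrite ?nnegrE ?expR_ge0 //; first by lra.
  exact: expR_ge1Dx.
rewrite mulrN expRN lef_pV2 ?posrE ?expR_gt0 ?mulr_gt0 //.
by have := expR_ge1Dx (k%:R * q); lra.
Qed.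

Lemma near_ln_ge (A : R) : \forall n \near \oo, A <= ln (n%:R : R).
Proof.
near=> n; have e0 := expR_gt0 A; have : expR A <= n%:R by near: n; exact: nbhs_infty_ger.
by move=> h; rewrite -[A]expRK ler_ln ?posrE //; exact: lt_le_trans h.
Unshelve. all: by end_near. Qed.

Lemma near_ln_le (c : R) : 0 < c -> \forall n \near \oo, ln (n%:R : R) <= c * n%:R.
Proof.
move=> c0; near=> n; have n0 : 0 < n%:R :> R by near: n; exact: nbhs_infty_gtr.
have h : Num.max 0 (2 / c) <= ln (n%:R : R) by near: n; exact: near_ln_ge.
move: h; rewrite ge_max => /andP[h0 h2].
have := expR_ge1Dxn 1 h0; rewrite lnK ?posrE // => h.
have h3 : 2 <= ln n%:R * c by rewrite -ler_pdivrMr.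
have : (2%N)`!%:R = 2 :> R by [].
move=> f2; rewrite f2 in h.
have : ln n%:R * ln n%:R / 2 <= n%:R :> R by rewrite -expr2; lra.
rewrite ler_pdivrMr // => h4.
have := ler_wpM2r (ltW c0) h4; have := ler_wpM2l h0 h3; nra.
Unshelve. all: by end_near. Qed.

(** Perturbation step for the tilted lower bound: [J1], [I1] belong to the weight itself, [J], [I]
    to a window in which the density is only close to sigma, and y = sigma r^d. The last hypothesis
    makes the Chebyshev factor at least 1/2. *)
Lemma tilt_numeric (n : nat) (J I J1 I1 ep eta e s y mu : R) :
  0 <= s -> 0 < eta <= e / 4 -> 0 < ep <= e / 4 -> ep <= e * I1 / 4 -> 0 < e < 1 ->
  0 < I1 -> 0 <= J <= ep -> y * (J1 - ep) <= J -> y * (I1 - ep) <= I <= y * I1 ->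
  0 < y -> 0 < n%:R :> R -> mu = n%:R * y -> 2 <= eta ^+ 2 * ((1 - e) * (mu * I1)) ->
  let m := n%:R * I / (1 + J) in
  [/\ 0 < m, (1 - e) * (mu * I1) <= (1 - eta) * m &
    expR (mu * ((J1 - ep) * (1 - ep) - s * ((1 + eta) * I1))) / 2 <=
    (1 + J) ^+ n * expR (- s * ((1 + eta) * m)) * (1 - (eta ^+ 2 * m)^-1)].
Proof.
move=> s0 /andP[eta0 eta1] /andP[ep0 ep1] ep2 /andP[e0 e1] I0 /andP[Jp Jep] JE /andP[IE IE2].
move=> y0 n0 muE L2 m; have mu0 : 0 < mu by rewrite muE mulr_gt0.
have I1ep : 0 < I1 - ep by nra.
have Ip : 0 < I by apply: lt_le_trans IE; rewrite mulr_gt0.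
have J1p : 0 < 1 + J by lra.
have mJ : m * (1 + J) = n%:R * I by rewrite /m divfK // gt_eqF.
have m0 : 0 < m by rewrite divr_gt0 // mulr_gt0.
have nI1 : mu * (I1 - ep) <= n%:R * I by rewrite muE -mulrA ler_pM2l.
have nI2 : n%:R * I <= mu * I1 by rewrite muE -mulrA ler_pM2l.
clearbody m; have mle : m <= mu * I1 by nra.
have eta1' : 0 <= 1 - eta by lra.
have am : (1 - e) * (mu * I1) <= (1 - eta) * m.
  have key : (1 - e) * I1 * (1 + ep) <= (1 - eta) * (I1 - ep).
    have a1 : (1 - e / 4) * I1 <= I1 - ep by lra.
    have a2 : (1 - e / 4) * ((1 - e / 4) * I1) <= (1 - eta) * (I1 - ep).
      apply: ler_pM => //; [lra| |lra]; rewrite mulr_ge0 ?(ltW I0) //; lra.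
    have a3 : (1 - e) * I1 * (1 + ep) <= (1 - e) * I1 * (1 + e / 4).
      rewrite ler_wpM2l ?mulr_ge0 ?(ltW I0) //; lra.
    apply: le_trans a3 (le_trans _ a2).
    have -> : (1 - e / 4) * ((1 - e / 4) * I1) = (1 - e / 4) ^+ 2 * I1 by ring.
    have -> : (1 - e) * I1 * (1 + e / 4) = (1 - e) * (1 + e / 4) * I1 by ring.
    rewrite ler_pM2r //; nra.
  have ep1' : 0 < 1 + ep by lra.
  rewrite -(ler_pM2r ep1').
  have -> : (1 - e) * (mu * I1) * (1 + ep) = mu * ((1 - e) * I1 * (1 + ep)) by ring.
  apply: (@le_trans _ _ (mu * ((1 - eta) * (I1 - ep)))); first by rewrite ler_pM2l.
  have m1 : mu * (I1 - ep) <= m * (1 + ep).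
    by apply: le_trans nI1 _; rewrite -mJ ler_pM2l // lerD2l.
  have := ler_wpM2l eta1' m1; lra.
split=> //.
have half : 1 / 2 <= 1 - (eta ^+ 2 * m)^-1.
  have : 2 <= eta ^+ 2 * m.
    apply: le_trans L2 _; rewrite ler_wpM2l ?exprn_ge0 ?(ltW eta0) //.
    apply: le_trans am _; rewrite ler_piMl ?(ltW m0) //; lra.
  move=> h2; have : (eta ^+ 2 * m)^-1 <= 2^-1 by rewrite lef_pV2 // posrE //; lra.
  lra.
set E := mu * _.
have big : expR E <= (1 + J) ^+ n * expR (- s * ((1 + eta) * m)).
  apply: (@le_trans _ _ (expR (n%:R * (J * (1 - J))) * expR (- s * ((1 + eta) * m)))).
    rewrite -expRD ler_expR /E mulrBr.
    have t1 : mu * ((J1 - ep) * (1 - ep)) <= n%:R * (J * (1 - J)).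
      apply: (@le_trans _ _ (n%:R * (J * (1 - ep)))); last first.
        by rewrite ler_pM2l // ler_wpM2l //; lra.
      rewrite muE -mulrA ler_pM2l // mulrA ler_wpM2r //; lra.
    have t2 : s * ((1 + eta) * m) <= mu * (s * ((1 + eta) * I1)).
      have -> : mu * (s * ((1 + eta) * I1)) = s * ((1 + eta) * (mu * I1)) by ring.
      by rewrite ler_wpM2l // ler_wpM2l //; lra.
    by lra.
  rewrite ler_wpM2r ?expR_ge0 // expRM_natl; apply: lerXn2r; rewrite ?nnegrE ?expR_ge0 ?(ltW J1p) //.
  exact: expR_quadratic.
rewrite -[2^-1]mul1r; apply: ler_pM => //; rewrite ?expR_ge0 //; lra.
Qed.

(** Half of the margin 4 delta in t G < 1 is spent on the errors [eta] and [ep]; the success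
    probability of a window is then at least of order n^(-(1 - 2 delta)). *)
Lemma exponent_numeric (L t s I1 J1 eta ep delta e2 : R) : 0 <= L -> 0 < t ->
  t * (s * I1 - J1) = 1 - 4 * delta -> t * e2 = 2 * delta -> 0 < eta ->
  eta * (s * I1 + 1) <= e2 / 2 -> ep * (1 + J1) <= e2 / 2 ->
  - (1 - 2 * delta) * L <= t * L * ((J1 - ep) * (1 - ep) - s * ((1 + eta) * I1)).
Proof.
move=> L0 t0 td te2 eta0 h1 h2.
have h : - (s * I1 - J1) - e2 <= (J1 - ep) * (1 - ep) - s * ((1 + eta) * I1).
  by have := sqr_ge0 ep; rewrite expr2; nra.
have -> : - (1 - 2 * delta) = t * (- (s * I1 - J1) - e2) by rewrite mulrBr mulrN td te2; ring.
by rewrite [leRHS]mulrAC ler_wpM2r // ler_pM2l.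
Qed.

Lemma chernoff_numeric (u x : R) : 0 < u -> 0 <= x -> x <= 1 ->
  expR (- u * x) - 1 <= - (u * (1 - u)) * x.
Proof.
move=> u0 x0 x1; have := @expRN_quadratic (u * x) (mulr_ge0 (ltW u0) x0); rewrite -mulNr.
have x1' : 0 <= 1 - x by lra.
have := mulr_ge0 (mulr_ge0 (ltW u0) x0) (mulr_ge0 (ltW u0) x1'); nra.
Qed.

End NumericBounds.

Section FiniteLabels.
Context {disp : measure_display} {T : measurableType disp} {R : realType}.
Variable mu : {measure set T -> \bar R}.

Lemma measure_fibres (K : eqType) (g : T -> K) (s : seq K) (B : set T) :
  (forall k, measurable [set x | g x = k]) -> measurable B -> uniq s ->
  measurable (B `&` [set x | g x \in s]) /\
  mu (B `&` [set x | g x \in s]) = (\sum_(k <- s) mu (B `&` [set x | g x = k]))%E.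
Proof.
move=> mg mB; elim: s => [_|z s IH /= /andP[zs us]].
  by rewrite big_nil (_ : [set _ | _] = set0) ?setI0 ?measure0 //; apply/seteqP; split.
have [ms es] := IH us.
have E : B `&` [set x | g x \in z :: s] = (B `&` [set x | g x = z]) `|` (B `&` [set x | g x \in s]).
  rewrite -setIUr; congr (_ `&` _); apply/seteqP; split=> x /=.
    by rewrite inE => /predU1P.
  by rewrite inE => h; apply/predU1P.
have mz : measurable (B `&` [set x | g x = z]) by exact: measurableI.
split; first by rewrite E; exact: measurableU.
rewrite big_cons -es E measureU //.
by apply/seteqP; split=> x //= [[_ ->] [_ zs']]; move: zs; rewrite zs'.
Qed.

Lemma Rintegral_labels (K : eqType) (g : T -> K) (s : seq K) (h : K -> R) :
  (forall k, measurable [set x | g x = k]) ->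
  (forall k, k \in s -> (mu [set x | g x = k] < +oo)%E) -> uniq s ->
  (forall x, g x \notin s -> h (g x) = 0) ->
  \int[mu]_x h (g x) = \sum_(k <- s) h k * fine (mu [set x | g x = k]).
Proof.
move=> mg fg us hs.
have integrable_ind k : k \in s ->
    mu.-integrable setT (EFin \o (\1_[set x | g x = k] : T -> R)).
  move=> ks; apply/integrableP; split; first by apply/measurable_EFinP; exact: measurable_indic.
  rewrite (eq_integral (fun x => (\1_[set x | g x = k] x)%:E)); last first.
    by move=> t _; rewrite /= ger0_norm // lee_fin.
  by rewrite integral_indic // setIT fg.
have iind k : k \in s -> mu.-integrable setT (EFin \o (fun x => h k * (\1_[set x | g x = k] x : R))).
  move=> ks; have := integrableZl measurableT (h k) (integrable_ind k ks).
  by apply: eq_integrable.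
have E : (fun x => h (g x)) = (fun x => \sum_(k <- s) h k * (\1_[set x | g x = k] x : R)).
  apply/funext => x; have [gs|gs] := boolP (g x \in s).
    rewrite (bigD1_seq (g x)) //= indicE mem_set // mulr1 big1 ?addr0 // => k /eqP kg.
    by rewrite indicE memNset ?mulr0 //= => /esym.
  rewrite hs // big_seq big1 // => k ks; rewrite indicE memNset ?mulr0 //= => e.
  by move: gs; rewrite e ks.
rewrite E; have sub : {subset s <= s} by [].
suff H : forall s', {subset s' <= s} ->
    mu.-integrable setT (EFin \o (fun x => \sum_(k <- s') h k * (\1_[set x | g x = k] x : R))) /\
    \int[mu]_x (\sum_(k <- s') h k * (\1_[set x | g x = k] x : R)) =
    \sum_(k <- s') h k * fine (mu [set x | g x = k]) by case: (H s sub).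
elim=> [_|k s' IH ss].
  rewrite big_nil; split.
    have := @integrable0 _ T R mu setT; apply: eq_integrable => // x _ /=.
    by rewrite big_nil.
  under eq_Rintegral do rewrite big_nil.
  by rewrite /Rintegral integral0.
have ks : k \in s by apply: ss; rewrite mem_head.
have [|i1 e1] := IH; first by move=> z zs; apply: ss; rewrite inE zs orbT.
have ik := iind k ks.
split.
  have := integrableD measurableT ik i1; apply: eq_integrable => // x _ /=.
  by rewrite big_cons.
under eq_Rintegral do rewrite big_cons.
rewrite RintegralD // big_cons e1; congr (_ + _).
rewrite RintegralZl //; last exact: integrable_ind.
by rewrite /Rintegral integral_indic // setIT.
Qed.

End FiniteLabels.

(** * Finitely labelled samples, outer probabilities and the upper tail over all translates *)

Section Sampling.
Variables (R : realType) (d : nat).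
Context {d0 : measure_display} {Omega : measurableType d0} (P : probability Omega R).
Variable X : nat -> Omega -> d.-tuple R.
Hypothesis hX_meas : forall i, measurable_fun setT (X i).
Variable nu : {measure set (d.-tuple R) -> \bar R}.
Hypothesis nuX : forall i A, measurable A -> P (X i @^-1` A) = nu A.
Hypothesis hX_indep : mutually_independent P X.

Lemma measurable_X i A : measurable A -> measurable (X i @^-1` A).
Proof. by move=> mA; rewrite -[X in measurable X]setTI; exact: hX_meas. Qed.

Lemma nu_setT : nu setT = 1%E.
Proof. by rewrite -(nuX 0 measurableT) preimage_setT probability_setT. Qed.

Lemma nu_fin A : measurable A -> nu A \is a fin_num.
Proof.
move=> mA; rewrite ge0_fin_numE // (@le_lt_trans _ _ (nu setT)) //; last by rewrite nu_setT ltry.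
by apply: le_measure; rewrite ?inE.
Qed.

Section Labels.
Variables (C : finType) (lab : d.-tuple R -> C).
Hypothesis mlab : forall c, measurable [set x | lab x = c].

Definition label_pmf (c : C) : R := fine (nu [set x | lab x = c]).

Lemma label_pmfE c : nu [set x | lab x = c] = (label_pmf c)%:E.
Proof. by rewrite /label_pmf fineK // nu_fin. Qed.

Lemma label_pmfP : is_pmf label_pmf.
Proof.
split=> [c|]; first exact: fine_ge0.
have [_] := measure_fibres nu mlab measurableT (index_enum_uniq C).
rewrite (_ : [set x | _] = setT) ?setTI ?nu_setT; last first.
  by apply/seteqP; split=> x //= _; exact: mem_index_enum.
by under eq_bigr do rewrite setTI label_pmfE; rewrite sumEFin => -[].
Qed.

Lemma label_sum (h : C -> R) : \sum_c label_pmf c * h c = \int[nu]_x h (lab x).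
Proof.
rewrite (Rintegral_labels (s := index_enum C) mlab) ?index_enum_uniq //.
- by apply: eq_bigr => c _; rewrite mulrC.
- by move=> c _; rewrite label_pmfE ltry.
- by move=> x; rewrite mem_index_enum.
Qed.

Lemma label_sum_expR s (psi : C -> R) :
  \sum_c label_pmf c * expR (s * psi c) = 1 + \sum_c label_pmf c * (expR (s * psi c) - 1).
Proof.
have [_ p1] := label_pmfP; rewrite -[X in X + _]p1 -big_split /=.
by apply: eq_bigr => c _; rewrite -[X in _ = X + _]mulr1 -mulrDr addrC subrK.
Qed.

Definition labels m n (w : Omega) := [seq lab (X i w) | i <- iota m n].

(** The passage from the probability space to the finite model: an event that depends on finitely
    many labels is measurable and its probability is a mean [Ex]. *)
Lemma labels_law n (ev : pred (seq C)) :
  measurable [set w | ev (labels 0 n w)] /\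
  P [set w | ev (labels 0 n w)] = (Ex label_pmf n (fun l => (ev l)%:R))%:E.
Proof.
(* The induction carries the event [B] that the earlier points lie in prescribed sets. Fixing the
   label of the next point adds one condition of the same kind, so mutual independence applies to
   it. *)
suff H : forall n m (A : nat -> set (d.-tuple R)) (ev : pred (seq C)),
   (forall i, measurable (A i)) ->
   let B := \big[setI/setT]_(i <- iota 0 m) (X i @^-1` A i) in
   measurable (B `&` [set w | ev (labels m n w)]) /\
   P (B `&` [set w | ev (labels m n w)]) = (P B * (Ex label_pmf n (fun l => (ev l)%:R))%:E)%E.
  have := H n 0%N (fun=> setT) ev (fun=> measurableT).
  by rewrite /= big_nil setTI probability_setT mul1e.
move=> {ev} {}n; elim: n => [|n IH] m A ev mA B.
  have mB : measurable B by apply: bigsetI_measurable => i _; exact: measurable_X.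
  rewrite (_ : B `&` _ = if ev [::] then B else set0) /=.
    by case: (ev [::]); rewrite ?mule1 ?measure0 ?mule0; split=> //; exact: measurable0.
  by rewrite /labels /=; apply/seteqP; split=> w /=; case: (ev [::]) => //= -[].
have mB : measurable B by apply: bigsetI_measurable => i _; exact: measurable_X.
pose A' c i := if i == m then [set x | lab x = c] else A i.
have mA' c i : measurable (A' c i) by rewrite /A'; case: ifP.
pose B' c := \big[setI/setT]_(i <- iota 0 m.+1) (X i @^-1` A' c i).
have B'E c : B' c = B `&` [set w | lab (X m w) = c].
  rewrite /B' -[m.+1]addn1 iotaD big_cat /= big_seq1 add0n; congr (_ `&` _).
    rewrite /B !big_seq; apply: eq_bigr => i; rewrite mem_iota add0n /A' => im.
    by rewrite ltn_eqF.
  by rewrite /A' eqxx.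
have PB' c : P (B' c) = (P B * (label_pmf c)%:E)%E.
  rewrite /B' hX_indep ?iota_uniq // -[m.+1]addn1 iotaD big_cat /= big_seq1 add0n.
  rewrite /B hX_indep ?iota_uniq //; congr (_ * _)%E.
    rewrite !big_seq; apply: eq_bigr => i; rewrite mem_iota add0n /A' => im.
    by rewrite ltn_eqF.
  by rewrite nuX // /A' eqxx label_pmfE.
pose D := [set w | ev (labels m n.+1 w)].
have mD c : measurable (B `&` D `&` [set w | lab (X m w) = c]) /\
    P (B `&` D `&` [set w | lab (X m w) = c]) =
    (P B * (label_pmf c * Ex label_pmf n (fun l => (ev (c :: l))%:R))%:E)%E.
  have -> : B `&` D `&` [set w | lab (X m w) = c] =
      B' c `&` [set w | ev (c :: labels m.+1 n w)].
    rewrite B'E; apply/seteqP; split=> w /=; rewrite /D /labels /=.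
      by move=> [[Bw Dw] lw]; rewrite -lw.
    by move=> [[Bw lw] Dw]; rewrite lw.
  have [mm ->] := IH m.+1 (A' c) (fun l => ev (c :: l)) (mA' c).
  by split=> //; rewrite -/(B' c) PB' EFinM muleA.
have mfib c : measurable [set w | lab (X m w) = c] by exact: (measurable_X m (mlab c)).
have EBD : B `&` D = \big[setU/set0]_(c <- index_enum C) (B `&` D `&` [set w | lab (X m w) = c]).
  apply/seteqP; split=> w; rewrite -bigcup_seq.
    by move=> BDw; exists (lab (X m w)); rewrite //= mem_index_enum.
  by move=> [c _ []].
have mBD : measurable (B `&` D).
  by rewrite EBD; apply: bigsetU_measurable => c _; case: (mD c).
split=> //.
have [_] := measure_fibres P mfib mBD (index_enum_uniq C).
rewrite (_ : [set w | _] = setT); last by apply/seteqP; split=> w //= _; exact: mem_index_enum.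
rewrite setIT => ->; rewrite (eq_bigr (fun c => P B * (label_pmf c * Ex label_pmf n (fun l => (ev (c :: l))%:R))%:E)%E).
  rewrite -ge0_sume_distrr; first by rewrite sumEFin.
  move=> c _; rewrite lee_fin mulr_ge0 //; first exact: fine_ge0.
  by apply: Ex_ge0 => [c'|l]; [exact: fine_ge0|exact: ler0n].
by move=> c _; case: (mD c).
Qed.

End Labels.

(* [Pbound B x]: the (possibly non-measurable) event [B] has outer probability at most [x]. *)
Definition Pbound (B : set Omega) (x : R) :=
  exists E, [/\ measurable E, B `<=` E & (P E <= x%:E)%E].

Lemma Pbound_le B B' x x' : B' `<=` B -> x <= x' -> Pbound B x -> Pbound B' x'.
Proof.
move=> BB' xx' [E [mE BE PE]]; exists E; split=> //; first exact: subset_trans BB' BE.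
by apply: le_trans PE _; rewrite lee_fin.
Qed.

Lemma Pbound_big (I : eqType) (s : seq I) (B : I -> set Omega) (x : I -> R) :
  (forall i, i \in s -> Pbound (B i) (x i)) ->
  Pbound [set w | exists2 i, i \in s & B i w] (\sum_(i <- s) x i).
Proof.
elim: s => [|i s IH] h.
  exists set0; split; [exact: measurable0|by move=> w []|by rewrite measure0 big_nil].
have [E [mE BE PE]] := h i (mem_head _ _).
have [|E' [mE' BE' PE']] := IH; first by move=> j js; apply: h; rewrite inE js orbT.
exists (E `|` E'); split; first exact: measurableU.
  move=> w [j]; rewrite inE => /predU1P[->|js] Bj; [left; exact: BE|right; apply: BE'].
  by exists j.
by rewrite big_cons EFinD; apply: le_trans (measureU2 _ _ _) (leeD PE PE').
Qed.

Lemma Pbound_countable (I : countType) (B : I -> set Omega) (x : I -> R) (c : R) :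
  (forall i, Pbound (B i) (x i)) -> (forall i, 0 <= x i) ->
  (forall s, uniq s -> \sum_(i <- s) x i <= c) ->
  Pbound [set w | exists i, B i w] c.
Proof.
move=> hB x0 hx; have /choice[E hE] := hB.
have mE i : measurable (E i) by case: (hE i).
pose F k := if pickle_inv k is Some i then E i else set0.
have mF k : measurable (F k) by rewrite /F; case: pickle_inv => [i|]; [exact: mE|exact: measurable0].
exists (\bigcup_k F k); split; first exact: bigcupT_measurable.
  move=> w [i Bi]; exists (pickle i) => //; rewrite /F pickleK_inv.
  by case: (hE i) => _ + _; exact.
apply: (@le_trans _ _ (\sum_(k <oo) P (F k))%E).
  by apply: measure_sigma_subadditive => //; exact: bigcupT_measurable.
apply: lime_le; first exact: is_cvg_nneseries.
apply: nearW => K; rewrite /=.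
pose s := pmap (@pickle_inv I) (iota 0 K).
have us : uniq s by apply: (pmap_uniq (@pickle_invK I)); exact: iota_uniq.
apply: (@le_trans _ _ (\sum_(i <- s) (x i)%:E)%E); last by rewrite sumEFin lee_fin hx.
rewrite /s big_mkord -(big_mkord xpredT (fun k => P (F k))) /index_iota subn0.
elim: (iota 0 K) => [|k t IH] /=; first by rewrite !big_nil.
rewrite big_cons /F; case: (pickle_inv k) => [i|] /=.
  by rewrite big_cons leeD //; case: (hE i).
by rewrite measure0 add0e.
Qed.

Lemma Pbound_borel_cantelli (B : nat -> set Omega) (x : nat -> R) (c : R) :
  (\forall n \near \oo, Pbound (B n) (x n)) -> (forall n, 0 <= x n) ->
  (forall n, \sum_(0 <= k < n) x k <= c) ->
  {ae P, forall w, \forall n \near \oo, ~ B n w}.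
Proof.
move=> [n0 _ hB] x0 hx.
have /choice[E hE] : forall n, exists E, [/\ measurable E, (n0 <= n)%N -> B n `<=` E & (P E <= (x n)%:E)%E].
  move=> n; have [n0n|nn0] := leqP n0 n; last first.
    by exists set0; split=> //; rewrite ?measure0 ?lee_fin // => h; move: nn0; rewrite ltnNge h.
  by have [E [mE BE PE]] := hB n n0n; exists E; split.
have mE n : measurable (E n) by case: (hE n).
exists (lim_sup_set E); split.
- by apply: bigcap_measurable => // k _; apply: bigcup_measurable => j _.
- apply: lim_sup_set_cvg0 => //; apply: (@le_lt_trans _ _ c%:E); last exact: ltry.
  apply: lime_le; first by apply: is_cvg_nneseries => n _ _; exact: measure_ge0.
  apply: nearW => K; apply: (@le_trans _ _ (\sum_(0 <= k < K) (x k)%:E)%E).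
    by apply: lee_sum => k _; case: (hE k).
  by rewrite sumEFin lee_fin.
- move=> w /= hw k _; apply: contrapT => hk; apply: hw.
  exists (maxn k n0) => // n /=; rewrite geq_max => /andP[kn n0n] Bn; apply: hk.
  by exists n => //; case: (hE n) => _ /(_ n0n) + _; exact.
Qed.

Lemma measurable_cidx_pred l (Q : pred {ffun 'I_d -> int}) (A : {ffun 'I_d -> int} -> set (d.-tuple R)) :
  0 < l -> (forall z, measurable (A z)) -> measurable [set x | Q (cidx l x) /\ A (cidx l x) x].
Proof.
move=> l0 mA; pose B z := if Q z then cell l z `&` A z else set0.
rewrite (_ : [set _ | _] = \bigcup_z B z); last first.
  apply/seteqP; split=> x /=; first by move=> [Qx Ax]; exists (cidx l x); rewrite // /B Qx.
  move=> [z _]; rewrite /B; case: ifPn => [Qz [cz Az]|_ []].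
  by split; rewrite cz.
apply: countable_bigcupT_measurable => [|z]; first exact: countableP.
rewrite /B; case: ifP => // _.
by apply: measurableI => //; exact: measurable_cell.
Qed.

Variable leb : {measure set (d.-tuple R) -> \bar R}.
Hypothesis hleb : is_lebesgue leb.
Variable sigma : R.
Hypothesis sigma0 : 0 <= sigma.
Hypothesis nu_le : forall A, measurable A -> (nu A <= sigma%:E * leb A)%E.

Lemma nu_cell_le l z : 0 < l -> fine (nu (cell l z)) <= sigma * l ^+ d.
Proof.
move=> l0; have mc := measurable_cell z l0.
by rewrite -lee_fin fineK ?nu_fin // EFinM -(leb_cell hleb z l0); exact: nu_le.
Qed.

Lemma nu_cells_le1 l (s : seq {ffun 'I_d -> int}) : 0 < l -> uniq s ->
  \sum_(z <- s) fine (nu (cell l z)) <= 1.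
Proof.
move=> l0 us; have [ms es] := measure_cells nu l0 measurableT us.
have mc (z : {ffun 'I_d -> int}) : measurable (cell l z) by exact: measurable_cell.
rewrite -lee_fin -sumEFin.
rewrite (eq_bigr (fun z => nu (setT `&` cell l z))) => [|z _]; last by rewrite setTI fineK ?nu_fin.
rewrite -es -nu_setT; apply: le_measure; rewrite ?inE //.
Qed.

(** The bound for the translate [z] is a constant times [J z]. Summed over [z], each offset in [V]
    meets every cell at most once and so total mass at most 1; the infinitely many translates cost
    only the factor n B. *)
Lemma exceedance_bound n l s a (V : seq {ffun 'I_d -> int}) (psi : {ffun 'I_d -> int} -> R) :
  0 < l -> 0 < s -> 0 < a -> uniq V -> (forall v, 0 <= psi v) ->
  (forall v, v \notin V -> psi v = 0) ->
  let B := \sum_(v <- V) (expR (s * psi v) - 1) in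
  Pbound [set w | exists z, a <= \sum_(i < n) psi (cidx l (X i w) - z)]
    (n%:R * B * expR (n%:R * (sigma * l ^+ d * B)) / (expR (s * a) - 1)).
Proof.
move=> l0 s0 a0 uV psi0 psiV B.
have e1 v : 0 <= expR (s * psi v) - 1.
  by rewrite subr_ge0 -expR0 ler_expR mulr_ge0 // ltW.
pose J z := \sum_(v <- V) (expR (s * psi v) - 1) * fine (nu (cell l (v + z))).
have J0 z : 0 <= J z by apply: sumr_ge0 => v _; rewrite mulr_ge0 // fine_ge0.
have JB z : J z <= sigma * l ^+ d * B.
  by rewrite /J /B mulr_sumr; apply: ler_sum => v _; rewrite mulrC ler_wpM2r // nu_cell_le.
have den : 0 < expR (s * a) - 1 by rewrite subr_gt0 expR_gt1 mulr_gt0.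
pose x z := n%:R * expR (n%:R * (sigma * l ^+ d * B)) / (expR (s * a) - 1) * J z.
apply: (@Pbound_countable _ _ x).
(* One label for each cell of the translate and the additional label [size V], the value of [index]
   on a missing element, for all other points; there [nth] returns 0. *)
- move=> z; pose C := 'I_(size V).+1.
  pose lab y : C := inord (index (cidx l y - z) V).
  have labE y : lab y = index (cidx l y - z) V :> nat by rewrite inordK // ltnS index_size.
  have mlab c : measurable [set y | lab y = c].
    have := measurable_cidx_pred (fun w => (inord (index (w - z) V) : C) == c) l0
      (fun=> measurableT).
    by congr measurable; apply/seteqP; split=> y /=; [move=> [/eqP]|move/eqP; split].
  pose psi' (c : C) : R := nth 0 [seq psi v | v <- V] c.
  have psiE y : psi' (lab y) = psi (cidx l y - z).
    rewrite /psi' labE; have [yV|yV] := boolP (cidx l y - z \in V).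
      by rewrite (nth_map 0) ?index_mem // nth_index.
    by rewrite nth_default ?psiV // size_map leqNgt index_mem.
  have psi'0 c : 0 <= psi' c.
    rewrite /psi'; have [cV|cV] := ltnP c (size V); first by rewrite (nth_map 0).
    by rewrite nth_default // size_map.
  pose ev (t : seq C) := (a <= Sm psi' t).
  have [mE PE] := labels_law mlab n ev.
  exists [set w | ev (labels lab 0 n w)]; split=> //.
    move=> w /=; rewrite /ev /Sm /labels big_map.
    by under [X in _ -> _ <= X]eq_bigr do rewrite psiE; rewrite -(big_mkord xpredT
      (fun i => psi (cidx l (X i w) - z))) /index_iota subn0.
  rewrite PE lee_fin; apply: le_trans (Ex_chernoff n (label_pmfP mlab) psi'0 s0 a0) _.
  have -> : \sum_c label_pmf lab c * expR (s * psi' c) = 1 + J z.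
    rewrite (label_sum_expR mlab) (label_sum mlab); congr (_ + _).
    transitivity (\int[nu]_y (expR (s * psi (cidx l y - z)) - 1)).
      by apply: eq_Rintegral => y _; rewrite psiE.
    have mg v : measurable [set y | cidx l y - z = v].
      have := measurable_cell (v + z) l0; congr measurable; apply/seteqP; split=> y /=.
        by move=> ->; rewrite addrK.
      by move=> <-; rewrite subrK.
    rewrite (@Rintegral_labels _ _ _ nu _ (fun y => cidx l y - z) V
      (fun v => expR (s * psi v) - 1) mg) //.
    + apply: eq_bigr => v _; congr (_ * fine (nu _)); apply/seteqP; split=> y /=.
        by move=> <-; rewrite /cell /= subrK.
      by move=> ->; rewrite addrK.
    + by move=> v _; rewrite -ge0_fin_numE ?measure_ge0 // nu_fin.
    + by move=> y yV; rewrite psiV // mulr0 expR0 subrr.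
  rewrite /x mulrAC ler_pM2r ?invr_gt0 //.
  apply: le_trans (exprn_sub1_le n (J0 z)) _; rewrite mulrAC.
  by rewrite ler_wpM2r // ler_wpM2l // ler_expR ler_wpM2l.
- by move=> z; rewrite /x mulr_ge0 // divr_ge0 ?mulr_ge0 ?expR_ge0 // ltW.
- move=> S uS; rewrite /x -mulr_sumr.
  rewrite [leRHS](_ : _ = n%:R * expR (n%:R * (sigma * l ^+ d * B)) / (expR (s * a) - 1) * B); last first.
    by rewrite -!mulrA; congr (_ * _); rewrite [RHS]mulrA [RHS]mulrC.
  rewrite ler_wpM2l //; first by rewrite divr_ge0 ?mulr_ge0 ?expR_ge0 // ltW.
  rewrite /J exchange_big /= /B; apply: ler_sum => v _.
  rewrite -mulr_sumr -[leRHS]mulr1 ler_wpM2l //.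
  have := @nu_cells_le1 l [seq v + z | z <- S] l0; rewrite big_map; apply.
  by rewrite map_inj_uniq // => z1 z2 /addrI.
Qed.

(** * Lower bounds for step weights from many disjoint windows *)

Section Windows.
Variable F : R -> set (d.-tuple R).
Hypothesis mF : forall eps, measurable (F eps).
Hypothesis nu_ge : forall eps A, 0 < eps < 1 -> measurable A ->
  (((1 - eps) * sigma)%:E * leb (A `&` F eps) <= nu A)%E.
Hypothesis good_cells : forall eps eta m, 0 < eps -> 0 < eta -> (0 < m)%N ->
  exists c0 r0 : R, [/\ 0 < c0, 0 < r0 & forall r, 0 < r <= r0 ->
    exists s : seq {ffun 'I_d -> int}, [/\ uniq s, c0 * r ^- d <= (size s)%:R &
      forall z, z \in s -> (leb (cell (m%:R * r) z `\` F eps) <= (eta * r ^+ d)%:E)%E]].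
Variables (Q M : nat) (g : d.-tuple R -> 'I_Q.+1).
Hypotheses (Q0 : (0 < Q)%N) (M0 : (0 < M)%N).
Hypothesis mg : forall k, measurable [set x | g x = k].
Hypothesis gM : forall x, g x != ord0 -> cube M x.

Definition lam k : R := fine (leb [set x | g x = k]).

(** The shift for which [win r z] carries the cell [z] of side 2 M r onto [cube M], the box
    supporting the step weight. Different [z] then see disjoint sets of points. *)
Definition wcorner (z : {ffun 'I_d -> int}) : d.-tuple R :=
  [tuple - ((z i)%:~R * (M.*2)%:R + M%:R) | i < d].

Definition win r z : d.-tuple R -> d.-tuple R := aff r^-1 (wcorner z).

Definition side r : R := (M.*2)%:R * r.

Lemma side_gt0 r : 0 < r -> 0 < side r.
Proof. by move=> r0; rewrite mulr_gt0 // ltr0n double_gt0. Qed.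

Lemma win_cube r z x : 0 < r -> cube M (win r z x) <-> cell (side r) z x.
Proof.
move=> r0; rewrite cubeP (cellE z (side_gt0 r0)) /box /=.
have D0 : 0 < (M.*2)%:R :> R by rewrite ltr0n double_gt0.
have DE : (M.*2)%:R = M%:R + M%:R :> R by rewrite -addnn natrD.
have E i : (- M%:R <= tnth (win r z x) i < M%:R) =
  ((z i)%:~R * side r <= tnth x i < (z i + 1)%:~R * side r).
  rewrite tnth_mktuple tnth_mktuple intrD mulrDl mul1r /side mulrA.
  have -> : tnth x i = r * (r^-1 * tnth x i) by rewrite mulrA divff ?mul1r // gt_eqF.
  rewrite mulrA (mulVf (lt0r_neq0 r0)) mul1r.
  rewrite -!(mulrC r) -mulrDr ler_pM2l // ltr_pM2l // DE; congr (_ && _); apply/idP/idP; lra.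
by split=> h i; have := h i; rewrite E !tnth_mktuple.
Qed.

Lemma measurable_win r z k : measurable [set x | g (win r z x) = k].
Proof.
have := measurable_aff r^-1 (wcorner z) measurableT (mg k).
by rewrite setTI.
Qed.

Lemma lamE k : k != ord0 -> leb [set x | g x = k] = (lam k)%:E.
Proof.
move=> k0; rewrite /lam fineK // ge0_fin_numE //.
apply: le_lt_trans (leb_cube_fin hleb M); apply: le_measure; rewrite ?inE //.
  exact: measurable_box.
by move=> x /= gx; apply: gM; rewrite gx.
Qed.

Lemma lam_ge0 k : 0 <= lam k. Proof. exact: fine_ge0. Qed.

Lemma leb_win r z k : 0 < r -> k != ord0 ->
  leb [set x | g (win r z x) = k] = (r ^+ d * lam k)%:E.
Proof.
move=> r0 k0; have := leb_aff hleb (wcorner z) (A := [set x | g x = k]) (r := r^-1).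
rewrite invr_gt0 => /(_ r0 (mg k)) => ->.
by rewrite exprVn invrK lamE.
Qed.

Definition wmass r z k : R := fine (nu [set x | g (win r z x) = k]).

Lemma wmass_le r z k : 0 < r -> k != ord0 -> wmass r z k <= sigma * r ^+ d * lam k.
Proof.
move=> r0 k0; rewrite -lee_fin (fineK (nu_fin (measurable_win r z k))).
apply: le_trans (nu_le (measurable_win _ _ _)) _.
by rewrite leb_win // -EFinM mulrA.
Qed.

Lemma wsum_le r z (h : 'I_Q.+1 -> R) : 0 < r -> h ord0 = 0 -> (forall k, 0 <= h k) ->
  \sum_k h k * wmass r z k <= sigma * r ^+ d * \sum_k h k * lam k.
Proof.
move=> r0 h0 hp; rewrite mulr_sumr; apply: ler_sum => k _.
have [->|k0] := eqVneq k ord0; first by rewrite h0 !mul0r mulr0.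
by rewrite mulrCA ler_wpM2l // wmass_le.
Qed.

(** The windows are chosen before [h], so the same windows serve for the exponential integral and
    for its derivative. *)
Lemma good_wins K e0 : 0 < K -> 0 < e0 ->
  exists c0 r0 : R, [/\ 0 < c0, 0 < r0 & forall r, 0 < r <= r0 ->
    exists s : seq {ffun 'I_d -> int}, [/\ uniq s, c0 * r ^- d <= (size s)%:R &
      forall z, z \in s -> forall h : 'I_Q.+1 -> R, h ord0 = 0 -> (forall k, 0 <= h k <= K) ->
        sigma * r ^+ d * (\sum_k h k * lam k - e0) <= \sum_k h k * wmass r z k]].
Proof.
move=> K0 e00; pose L : R := \sum_k lam k.
have L0 : 0 <= L by apply: sumr_ge0 => k _; exact: lam_ge0.
(* [eps] is the loss in density and [eta] the lost volume in each of the Q + 1 levels; either costs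
   at most e0 / 2. *)
pose eps := Num.min (e0 / (2 * (K * L + 1))) (1/2).
pose eta := e0 / (2 * (Q.+1%:R * K)).
have KL : 0 < 2 * (K * L + 1) by rewrite mulr_gt0 // ltr_pwDr // mulr_ge0 // ltW.
have eps0 : 0 < eps by rewrite lt_min divr_gt0 //=; lra.
have eps1 : eps < 1 by rewrite gt_min; apply/orP; right; lra.
have QK : 0 < 2 * (Q.+1%:R * K) by rewrite !mulr_gt0.
have eta0 : 0 < eta by rewrite divr_gt0.
have D0 : (0 < M.*2)%N by rewrite double_gt0.
have [c0 [r0 [c00 r00 H]]] := good_cells eps0 eta0 D0.
exists c0, r0; split=> // r rr; have [s [us ss hs]] := H r rr.
have r1 : 0 < r by case/andP: rr.
exists s; split=> // z zs h h0 hK.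
have rd : 0 < r ^+ d by rewrite exprn_gt0.
have low k : k != ord0 -> (1 - eps) * sigma * (r ^+ d * (lam k - eta)) <= wmass r z k.
  move=> k0; have mA := measurable_win r z k; set A := [set x | _] in mA *.
  have e01 : 0 < eps < 1 by rewrite eps0.
  have Ac : A `<=` cell (side r) z.
    by move=> x /= gx; apply/(win_cube _ _ r1); apply: gM; rewrite gx.
  have mc : measurable (cell (side r) z) by apply: measurable_cell; exact: side_gt0.
  have AD : (leb (A `\` F eps) <= (eta * r ^+ d)%:E)%E.
    apply: le_trans (hs z zs); apply: le_measure; rewrite ?inE; try exact: measurableD.
    by move=> x [Ax Fx]; split=> //; exact: Ac.
  have lA : leb A = (r ^+ d * lam k)%:E by exact: leb_win.
  have EA : leb A = (leb (A `\` F eps) + leb (A `&` F eps))%E := measureDI leb mA (mF eps).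
  rewrite lA in EA.
  have fAF : leb (A `&` F eps) \is a fin_num.
    rewrite ge0_fin_numE //; apply: (@le_lt_trans _ _ (leb A)).
      by apply: le_measure; rewrite ?inE //; exact: measurableI.
    by rewrite lA ltry.
  rewrite -lee_fin fineK ?nu_fin //; apply: le_trans (nu_ge e01 mA).
  rewrite -(fineK fAF) -EFinM lee_fin ler_wpM2l ?mulr_ge0 //; first by lra.
  have fAD : leb (A `\` F eps) \is a fin_num.
    by rewrite ge0_fin_numE //; apply: le_lt_trans AD _; rewrite ltry.
  move: EA AD; rewrite -(fineK fAF) -(fineK fAD) -EFinD lee_fin => -[EA] AD.
  rewrite mulrBr EA; lra.
have step : (1 - eps) * sigma * r ^+ d * (\sum_k h k * (lam k - eta)) <= \sum_k h k * wmass r z k.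
  rewrite mulr_sumr; apply: ler_sum => k _.
  have [->|k0] := eqVneq k ord0; first by rewrite h0 !mul0r mulr0.
  have /andP[hk0 _] := hK k.
  by rewrite mulrCA ler_wpM2l //; apply: le_trans (low k k0); rewrite !mulrA.
apply: le_trans step; rewrite -!mulrA (mulrCA (1 - eps)) ler_wpM2l // mulrCA ler_wpM2l ?ltW //.
have hL : \sum_k h k * lam k <= K * L.
  by rewrite mulr_sumr; apply: ler_sum => k _; rewrite ler_wpM2r ?lam_ge0 //; case/andP: (hK k).
have hL0 : 0 <= \sum_k h k * lam k.
  by apply: sumr_ge0 => k _; rewrite mulr_ge0 ?lam_ge0 //; case/andP: (hK k).
have he : \sum_k h k * eta <= e0 / 2.
  apply: (@le_trans _ _ (\sum_(k < Q.+1) K * eta)).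
    by apply: ler_sum => k _; rewrite ler_wpM2r ?(ltW eta0) //; case/andP: (hK k).
  rewrite sumr_const card_ord -[leLHS]mulr_natl /eta.
  have -> : Q.+1%:R * (K * (e0 / (2 * (Q.+1%:R * K)))) = e0 / 2 by field; rewrite ?gt_eqF //= ltr0n.
  by [].
have he0 : 0 <= \sum_k h k * eta.
  by apply: sumr_ge0 => k _; rewrite mulr_ge0 ?(ltW eta0) //; case/andP: (hK k).
have -> : \sum_k h k * (lam k - eta) = \sum_k h k * lam k - \sum_k h k * eta.
  by rewrite -sumrB; apply: eq_bigr => k _; rewrite mulrBr.
have epsL : eps * (\sum_k h k * lam k) <= e0 / 2.
  apply: (@le_trans _ _ (e0 / (2 * (K * L + 1)) * (K * L))).
    by rewrite ler_pM ?(ltW eps0) // ge_min lexx.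
  rewrite mulrAC ler_pdivrMr //; nra.
nra.
Qed.

Definition step x : R := (g x)%:R / Q%:R.

Lemma frac_ge0_le1 (k : 'I_Q.+1) : 0 <= (k%:R / Q%:R : R) <= 1.
Proof.
have Q1 : 0 < Q%:R :> R by rewrite ltr0n.
by rewrite divr_ge0 //= ler_pdivrMr // mul1r ler_nat -ltnS.
Qed.

Section WindowLabels.
Variables (r : R) (s : seq {ffun 'I_d -> int}) (n : nat).
Hypotheses (r0 : 0 < r) (us : uniq s).

(** One label serves all windows together: the cell of the point, if it is one of the windows, and
    the level of the step weight there. Because windows are disjoint this determines the value in
    every window. *)
Let C : finType := (option (seq_sub s) * 'I_Q.+1)%type.
Let lab x : C := (insub (cidx (side r) x), g (win r (cidx (side r) x) x)).
Definition wvalue z (c : C) : R := if omap val c.1 == Some z then c.2%:R / Q%:R else 0.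

Let mlab c : measurable [set x | lab x = c].
Proof.
have := measurable_cidx_pred (fun z => (insub z : option (seq_sub s)) == c.1) (side_gt0 r0)
  (fun z => measurable_win r z c.2).
congr measurable; apply/seteqP; split=> x /=; first by move=> [/eqP e1 e2]; rewrite /lab e1 e2 -surjective_pairing.
by move=> <-.
Qed.

Lemma wvalueE z x : z \in s -> wvalue z (lab x) = step (win r z x).
Proof.
move=> zs; rewrite /wvalue /lab /=.
have [cz|cz] := eqVneq (cidx (side r) x) z.
  by rewrite cz insubT /= eqxx.
have -> : (omap val (insub (cidx (side r) x) : option (seq_sub s)) == Some z) = false.
  by case: insubP => [u _ uE|_] //=; apply/negbTE; rewrite uE; apply: contra cz => /eqP [->].
rewrite /step; have [->|gx] := eqVneq (g (win r z x)) ord0; first by rewrite mul0r.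
by move/gM: gx => /(win_cube _ _ r0) /eqP; rewrite (negPf cz).
Qed.

Lemma wvalue_bound z c : 0 <= wvalue z c <= 1.
Proof. by rewrite /wvalue; case: ifP => _; [exact: frac_ge0_le1|rewrite lexx ler01]. Qed.

Let p := label_pmf lab.

Lemma wvalue_sum z (h : R -> R) : z \in s -> h 0 = 0 ->
  \sum_c p c * h (wvalue z c) = \sum_(k < Q.+1) h (k%:R / Q%:R) * wmass r z k.
Proof.
move=> zs h0; rewrite (label_sum mlab (fun c => h (wvalue z c))).
under eq_Rintegral do rewrite wvalueE //.
rewrite (@Rintegral_labels _ _ _ nu _ (fun x => g (win r z x)) (index_enum 'I_Q.+1)
  (fun k => h (k%:R / Q%:R))) ?index_enum_uniq //.
- exact: measurable_win.
- by move=> k _; rewrite -ge0_fin_numE ?measure_ge0 // nu_fin //; exact: measurable_win.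
- by move=> x; rewrite mem_index_enum.
Qed.

Definition wprob z a : R := Ex p n (fun l => (a <= Sm (wvalue z) l)%R%:R).

Lemma wprob_le1 z a : wprob z a <= 1.
Proof.
rewrite -(@Ex_cst R C p n 1 (label_pmfP mlab)); apply: Ex_le => [c|l].
  by case: (label_pmfP mlab).
by rewrite lern1 leq_b1.
Qed.

Lemma wprob_antitone z a b : a <= b -> wprob z b <= wprob z a.
Proof.
move=> ab; apply: Ex_le => [c|l]; first by case: (label_pmfP mlab).
by rewrite ler_nat; case: (lerP b) => // /(le_trans ab) ->.
Qed.

Lemma window_tilt z th eta : z \in s -> 0 <= th -> 0 < eta ->
  let J := \sum_(k < Q.+1) (expR (th * (k%:R / Q%:R)) - 1) * wmass r z k in
  let I := \sum_(k < Q.+1) (k%:R / Q%:R * expR (th * (k%:R / Q%:R))) * wmass r z k in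
  let m := n%:R * I / (1 + J) in 0 < m ->
  (1 + J) ^+ n * expR (- th * ((1 + eta) * m)) * (1 - (eta ^+ 2 * m)^-1) <=
  wprob z ((1 - eta) * m).
Proof.
move=> zs th0 eta0 J I m m0.
have := @Ex_tilt_lower R C p n th (wvalue z) eta (label_pmfP mlab) (wvalue_bound z) th0 eta0.
have -> : \sum_c p c * expR (th * wvalue z c) = 1 + J.
  rewrite (label_sum_expR mlab) (@wvalue_sum z (fun x => expR (th * x) - 1)) //.
  by rewrite mulr0 expR0 subrr.
have -> : \sum_c p c * wvalue z c * expR (th * wvalue z c) = I.
  under eq_bigr do rewrite -mulrA.
  by rewrite (@wvalue_sum z (fun x => x * expR (th * x))) // mul0r.
exact.
Qed.

Lemma window_chernoff z u a : z \in s -> 0 < u ->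
  let W := \sum_(k < Q.+1) (expR (- u * (k%:R / Q%:R)) - 1) * wmass r z k in
  0 <= 1 + W /\ 1 - expR (u * a) * (1 + W) ^+ n <= wprob z a.
Proof.
move=> zs u0 W; have [p0 _] := label_pmfP mlab.
have WE : \sum_c p c * expR (- u * wvalue z c) = 1 + W.
  rewrite (label_sum_expR mlab) (@wvalue_sum z (fun x => expR (- u * x) - 1)) //.
  by rewrite mulr0 expR0 subrr.
split; first by rewrite -WE; apply: sumr_ge0 => c _; rewrite mulr_ge0 ?expR_ge0.
have := @Ex_chernoff_lower R C p n u a (wvalue z) (label_pmfP mlab) u0.
rewrite WE.
have : Ex p n (fun l => (Sm (wvalue z) l < a)%R%:R + (a <= Sm (wvalue z) l)%R%:R) = 1.
  transitivity (Ex p n (fun=> 1)); last by rewrite Ex_cst //; exact: label_pmfP.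
  by apply: eq_Ex => l; rewrite ltNge; case: (a <= _); rewrite ?addr0 ?add0r.
by rewrite ExD -/(wprob z a); lra.
Qed.

Lemma window_binomial z k : Q = 1%N -> z \in s ->
  let w := \sum_(j < Q.+1) (j%:R / Q%:R) * wmass r z j in
  'C(n, k)%:R * w ^+ k * (1 - w) ^+ (n - k) <= wprob z k%:R.
Proof.
move=> Q1 zs; cbv zeta; apply: Ex_binomial_lower (label_pmfP mlab) _ _ => [c|]; last first.
  by rewrite (@wvalue_sum z id).
rewrite /wvalue; case: ifP => _; last by left.
have := ltn_ord c.2; case: (nat_of_ord c.2) => [|[|j]]; first by left; rewrite mul0r.
  by right; rewrite Q1 divr1.
by rewrite Q1.
Qed.

(** Counts in disjoint windows are not independent, the sample size being fixed, but their lower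
    tails are negatively correlated by [Ex_prod_disjoint], which is the required direction. *)
Lemma windows_fail a q : 0 <= q <= 1 ->
  (forall z, z \in s -> q <= wprob z a) ->
  Pbound [set w | forall z, z \in s -> \sum_(i < n) step (win r z (X i w)) < a]
    ((1 - q) ^+ size s).
Proof.
move=> q01 hq; pose ev (l : seq C) := all (fun z => Sm (wvalue z) l < a) s.
have [mE PE] := labels_law mlab n ev.
exists [set w | ev (labels lab 0 n w)]; split=> //.
  move=> w /= hw; apply/allP => z zs; rewrite /Sm /labels big_map.
  under eq_bigr do rewrite wvalueE //.
  have := hw z zs; rewrite -(big_mkord xpredT (fun i => step (win r z (X i w)))).
  by rewrite /index_iota subn0.
rewrite PE lee_fin; pose gg (z : {ffun 'I_d -> int}) (x : R) : R := (x < a)%R%:R.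
rewrite (@eq_Ex _ _ _ _ _ (fun l => \prod_(z <- s) gg z (Sm (wvalue z) l))); last first.
  move=> l; rewrite /ev /gg; elim: s => [|z t IH]; first by rewrite big_nil.
  by rewrite big_cons -IH /= -natrM mulnb.
apply: le_trans (Ex_prod_disjoint n (label_pmfP mlab) us _ _ _ _) _.
- by move=> z c; case/andP: (wvalue_bound z c).
- move=> c i j; rewrite /wvalue; case: (omap val c.1 =P Some i) => [->|_]; last by rewrite eqxx.
  by case: (Some i =P Some j) => [[->]|_] //; rewrite eqxx.
- by move=> z x; rewrite /gg ler0n.
- move=> z x y xy; rewrite /gg ler_nat; case: (ltP y a) => // ya.
  by rewrite (le_lt_trans xy ya).
have : {subset s <= s} by [].
elim: {-2}s => [|z t IH] ts; first by rewrite big_nil.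
rewrite big_cons exprS; have zs : z \in s by apply: ts; rewrite mem_head.
have [p0 p1] := label_pmfP mlab.
apply: ler_pM; last by apply: IH => y yt; apply: ts; rewrite inE yt orbT.
- by apply: Ex_ge0 => // l; rewrite ler0n.
- by apply: prodr_ge0 => y _; apply: Ex_ge0 => // l; rewrite ler0n.
have : Ex p n (fun l => gg z (Sm (wvalue z) l) + (a <= Sm (wvalue z) l)%R%:R) = 1.
  transitivity (Ex p n (fun=> 1)); last by rewrite Ex_cst //; exact: label_pmfP.
  apply: eq_Ex => l; rewrite /gg ltNge.
  by case: (a <= _); rewrite ?addr0 ?add0r.
by rewrite ExD; have := hq z zs; rewrite /wprob /p; lra.
Qed.

End WindowLabels.

Hypotheses (sigma_gt0 : 0 < sigma) (hd : (0 < d)%N).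

Definition stepJ s : R := \sum_(k < Q.+1) (expR (s * (k%:R / Q%:R)) - 1) * lam k.
Definition stepI s : R := \sum_(k < Q.+1) (k%:R / Q%:R * expR (s * (k%:R / Q%:R))) * lam k.

Lemma stepJ_ge0 s : 0 <= s -> 0 <= stepJ s.
Proof.
move=> s0; apply: sumr_ge0 => k _; rewrite mulr_ge0 ?lam_ge0 //.
by rewrite subr_ge0 -expR0 ler_expR mulr_ge0 //; case/andP: (frac_ge0_le1 k).
Qed.

(** A window succeeds with probability about n^(-t G), where t G < 1, and there are about n / ln n
    windows; so the expected number of successes is a positive power of n, and the probability of no
    success is at most its inverse. *)
Lemma step_lower_mid s t e : 0 <= s -> 0 < t -> 0 < stepI s ->
  t * (s * stepI s - stepJ s) < 1 -> 0 < e < 1 ->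
  exists C delta : R, 0 < delta /\ \forall n \near \oo, forall r, 0 < r ->
    sigma * n%:R * r ^+ d = t * ln n%:R ->
    Pbound [set w | forall u, \sum_(i < n) step (aff r^-1 u (X i w)) <
      (1 - e) * (t * ln n%:R * stepI s)] (C * expR (- delta * ln n%:R)).
Proof.
move=> s0 t0 I0 tG /andP[e0 e1]; have J0 := stepJ_ge0 s0.
set I1 := stepI s in I0 tG *; set J1 := stepJ s in tG J0 *.
(* Of the margin 4 delta, 2 delta pays for the approximations in the tilt and delta for the
   logarithm in the number of windows; the final rate is n^(-delta). *)
pose delta := (1 - t * (s * I1 - J1)) / 4.
have dl0 : 0 < delta by rewrite divr_gt0 // subr_gt0.
pose e2 := 2 * delta / t; have e20 : 0 < e2 by rewrite divr_gt0 // mulr_gt0.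
have te2 : t * e2 = 2 * delta by rewrite /e2 mulrCA divff ?mulr1 // gt_eqF.
have sI : 0 <= s * I1 by rewrite mulr_ge0 // ltW.
clearbody e2.
pose eta := Num.min (e / 4) (e2 / (2 * (s * I1 + 1))).
pose ep := Num.min (Num.min (e / 4) (e * I1 / 4)) (e2 / (2 * (1 + J1))).
have D1 : 0 < 2 * (s * I1 + 1) by lra.
have D2 : 0 < 2 * (1 + J1) by lra.
have eta0 : 0 < eta by rewrite lt_min !divr_gt0.
have ep0 : 0 < ep by rewrite !lt_min !divr_gt0 // mulr_gt0.
have eta1 : eta <= e / 4 by rewrite ge_min lexx.
have eta2 : eta * (s * I1 + 1) <= e2 / 2.
  have : eta <= e2 / (2 * (s * I1 + 1)) by rewrite ge_min lexx orbT.
  by rewrite ler_pdivlMr //; lra.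
have ep1 : ep <= e / 4 by rewrite !ge_min lexx.
have ep2 : ep <= e * I1 / 4 by rewrite !ge_min lexx orbT.
have ep3 : ep * (1 + J1) <= e2 / 2.
  have : ep <= e2 / (2 * (1 + J1)) by rewrite !ge_min lexx !orbT.
  by rewrite ler_pdivlMr //; lra.
clearbody eta ep.
have e01 : 0 < e < 1 by rewrite e0.
have eta01 : 0 < eta <= e / 4 by rewrite eta0.
have ep01 : 0 < ep <= e / 4 by rewrite ep0.
have [c0 [r0 [c00 r00 Hg]]] := good_wins (expR_gt0 s) ep0.
exists (2 * t / (c0 * sigma * delta)), delta; split=> //.
(* y = sigma r^d = t ln n / n tends to 0. Below [y0] the radius is at most [r0], and the normaliser
   1 + J of the tilt exceeds 1 by at most [ep]. *)
pose y0 := Num.min (sigma * r0 ^+ d) (ep / (J1 + 1)).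
have y00 : 0 < y0 by rewrite lt_min mulr_gt0 ?exprn_gt0 //= divr_gt0 //; lra.
have A0 : 0 < eta ^+ 2 * ((1 - e) * (t * I1)).
  by rewrite mulr_gt0 ?exprn_gt0 // mulr_gt0 ?mulr_gt0 ?subr_gt0.
near=> n => r rpos hr.
have n0 : 0 < n%:R :> R by near: n; exact: nbhs_infty_gtr.
have L1 : 1 <= ln (n%:R : R) by near: n; exact: near_ln_ge.
have L2 : 2 / (eta ^+ 2 * ((1 - e) * (t * I1))) <= ln (n%:R : R) by near: n; exact: near_ln_ge.
have L3 : ln (n%:R : R) <= y0 / t * n%:R by near: n; apply: near_ln_le; exact: divr_gt0.
have nE : n%:R = expR (ln n%:R) :> R by rewrite lnK.
set L := ln (n%:R : R) in hr L1 L2 L3 nE *.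
have L0 : 0 < L := lt_le_trans ltr01 L1.
pose y := sigma * r ^+ d.
have ny : n%:R * y = t * L by rewrite -hr /y; ring.
have yy0 : y <= y0.
  rewrite -(ler_pM2l n0) ny; move: L3; rewrite mulrAC ler_pdivlMr //; lra.
have rd : 0 < r ^+ d by rewrite exprn_gt0.
have yp : 0 < y by rewrite mulr_gt0.
have rr0 : 0 < r <= r0.
  have : r ^+ d <= r0 ^+ d.
    by rewrite -(ler_pM2l sigma_gt0); apply: le_trans yy0 _; rewrite ge_min lexx.
  by rewrite rpos ler_pXn2r ?nnegrE ?(ltW rpos) ?(ltW r00).
have yJ : y * J1 <= ep.
  have : y <= ep / (J1 + 1) by apply: le_trans yy0 _; rewrite ge_min lexx orbT.
  rewrite ler_pdivlMr ?ltr_wpDl // mulrDr mulr1; apply: le_trans.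
  by rewrite lerDl ltW.
have [S [uS sS gS]] := Hg r rr0.
have tL : 0 < t * L by rewrite mulr_gt0.
pose E := t * L * ((J1 - ep) * (1 - ep) - s * ((1 + eta) * I1)).
pose q := expR E / 2.
have q0 : 0 < q by rewrite divr_gt0 // expR_gt0.
have size0 : 0 < (size S)%:R :> R by apply: lt_le_trans sS; rewrite mulr_gt0 // invr_gt0.
have hq z : z \in S -> q <= wprob r S n z ((1 - e) * (t * L * I1)).
  move=> zS; have gz := gS z zS.
  have := window_tilt (n := n) rpos zS s0 eta0.
  set J := \sum_k _; set I := \sum_k _ => /=; set m := n%:R * I / (1 + J).
  have h1 k : 0 <= (k%:R / Q%:R : R) <= 1 -> 1 <= expR (s * (k%:R / Q%:R)) <= expR s.
    move=> /andP[k0 k1]; rewrite -{1}expR0 !ler_expR mulr_ge0 //=.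
    by rewrite -[leRHS]mulr1 ler_wpM2l.
  have h2 k : 0 <= (k%:R / Q%:R : R) <= 1 -> 0 <= expR (s * (k%:R / Q%:R)) - 1 <= expR s.
    by move=> /h1 /andP[e1' e2']; rewrite subr_ge0 e1' (le_trans _ e2') // gerBl.
  have JE : y * (J1 - ep) <= J.
    apply: (gz (fun k => expR (s * (k%:R / Q%:R)) - 1)); first by rewrite mul0r mulr0 expR0 subrr.
    by move=> k; exact: h2 (frac_ge0_le1 k).
  have JE2 : J <= y * J1.
    apply: (wsum_le z rpos (h := fun k => expR (s * (k%:R / Q%:R)) - 1)).
      by rewrite mul0r mulr0 expR0 subrr.
    by move=> k; case/andP: (h2 _ (frac_ge0_le1 k)).
  have IE : y * (I1 - ep) <= I.
    apply: (gz (fun k => k%:R / Q%:R * expR (s * (k%:R / Q%:R)))); first by rewrite !mul0r.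
    move=> k; have /andP[k0 k1] := frac_ge0_le1 k.
    have /andP[hl hu] := h1 _ (frac_ge0_le1 k).
    rewrite mulr_ge0 ?expR_ge0 //=; apply: le_trans hu.
    by rewrite ler_piMl ?expR_ge0.
  have IE2 : I <= y * I1.
    apply: (wsum_le z rpos (h := fun k => k%:R / Q%:R * expR (s * (k%:R / Q%:R)))).
      by rewrite !mul0r.
    move=> k; have /andP[k0 k1] := frac_ge0_le1 k; by rewrite mulr_ge0 ?expR_ge0.
  have Jp : 0 <= J.
    apply: sumr_ge0 => k _; apply: mulr_ge0; last exact: fine_ge0.
    by case/andP: (h2 _ (frac_ge0_le1 k)).
  have Jep : J <= ep := le_trans JE2 yJ.
  have J01 : 0 <= J <= ep by rewrite Jp.
  have I01 : y * (I1 - ep) <= I <= y * I1 by rewrite IE.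
  have [|m0 am hm] := tilt_numeric s0 eta01 ep01 ep2 e01 I0 J01 JE I01 yp n0 (esym ny).
    move: L2; rewrite ler_pdivrMr //; set u := eta ^+ 2; congr (_ <= _).
    by ring.
  move=> /(_ m0) H; apply: le_trans (wprob_antitone _ _ _ _ am) => //.
  exact: le_trans hm H.
have [z zS] : exists z, z \in S.
  by move: size0; case: S {uS sS gS hq} => [|z S] /=; [rewrite ltxx|exists z; rewrite mem_head].
have q1 : q <= 1 by apply: le_trans (hq z zS) _; apply: wprob_le1.
have q01 : 0 <= q <= 1 by rewrite ltW.
apply: Pbound_le (windows_fail rpos uS q01 hq).
  by move=> w /= hw z' z'S; exact: hw.
apply: le_trans (exprn_1sub_le (k := size S) _ _) _; rewrite ?q0 ?q1 //; first by rewrite -(ltr_nat R).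
have Eb : - (1 - 2 * delta) * L <= E.
  apply: (@exponent_numeric _ _ _ _ _ _ _ _ _ e2) => //; first exact: ltW.
  by rewrite /delta; field.
have Lexp : delta * L <= expR (delta * L) by apply: le_trans (expR_ge1Dx _); rewrite lerDr.
have rdE : r ^+ d = t * L / (sigma * n%:R).
  by rewrite -hr mulrC mulrA mulVf ?mul1r // mulf_neq0 ?gt_eqF.
have low : c0 * sigma * delta / (2 * t) * expR (delta * L) <= (size S)%:R * q.
  have s1 : c0 * (r ^+ d)^-1 * q <= (size S)%:R * q by rewrite ler_pM2r.
  apply: le_trans s1.
  have q2 : expR (- (1 - 2 * delta) * L) / 2 <= q by rewrite /q ler_pM2r ?invr_gt0 // ler_expR.
  apply: (@le_trans _ _ (c0 * (r ^+ d)^-1 * (expR (- (1 - 2 * delta) * L) / 2))); last first.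
    by rewrite ler_pM2l // mulr_gt0 // invr_gt0.
  have -> : expR (- (1 - 2 * delta) * L) = expR (delta * L) * expR (delta * L) / n%:R.
    by rewrite nE -expRN -!expRD; congr expR; ring.
  rewrite rdE.
  have -> : c0 * (t * L / (sigma * n%:R))^-1 * (expR (delta * L) * expR (delta * L) / n%:R / 2) =
    c0 * sigma / (2 * t) * (expR (delta * L) * expR (delta * L) / L).
    by field; rewrite ?gt_eqF.
  have -> : c0 * sigma * delta / (2 * t) * expR (delta * L) = c0 * sigma / (2 * t) * (delta * expR (delta * L)).
    by ring.
  rewrite ler_pM2l ?divr_gt0 ?mulr_gt0 // ler_pdivlMr // -mulrA mulrCA mulrC.
  by rewrite mulrC ler_wpM2l ?expR_ge0.
have C0 : 0 < c0 * sigma * delta / (2 * t) by apply: divr_gt0; do !apply: mulr_gt0 => //.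
have -> : 2 * t / (c0 * sigma * delta) * expR (- delta * L) =
   (c0 * sigma * delta / (2 * t) * expR (delta * L))^-1.
  by rewrite [RHS]invfM (invf_div (c0 * sigma * delta)) mulNr expRN.
by rewrite lef_pV2 // posrE mulr_gt0 // expR_gt0.
Unshelve. all: by end_near. Qed.

(** When the mean count is a large multiple of ln n, a single window concentrates with failure
    probability n^(-2). [stepI 0] is the integral of the step weight. *)
Lemma step_lower_large e : 0 < stepI 0 -> 0 < e < 1 ->
  exists T r0 : R, [/\ 0 < T, 0 < r0 & forall n r, 0 < r <= r0 -> 0 < ln (n%:R : R) ->
    T * ln n%:R <= sigma * n%:R * r ^+ d ->
    Pbound [set w | forall u, \sum_(i < n) step (aff r^-1 u (X i w)) <
      (1 - e) * (sigma * n%:R * r ^+ d * stepI 0)] (expR (- 2 * ln n%:R))].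
Proof.
move=> I0 /andP[e0 e1]; set I1 := stepI 0 in I0 *.
pose ep := e * I1 / 4; have ep0 : 0 < ep by rewrite divr_gt0 // mulr_gt0.
have [c0 [r0 [c00 r00 Hg]]] := good_wins ltr01 ep0.
(* With exponent u = e / 4 the lower tail is at most exp(-e^2 mu I1 / 8), and this [T] makes the
   exponent at least 2 ln n. *)
exists (16 / (e ^+ 2 * I1)), r0; split=> //; first by rewrite divr_gt0 // mulr_gt0 // exprn_gt0.
move=> n r rr0 L0 hT; set L := ln _ in L0 hT *; set mu := sigma * n%:R * r ^+ d in hT *.
have rpos : 0 < r by case/andP: rr0.
have rd : 0 < r ^+ d by rewrite exprn_gt0.
have [S [uS sS gS]] := Hg r rr0.
have size0 : 0 < (size S)%:R :> R by apply: lt_le_trans sS; rewrite mulr_gt0 // invr_gt0.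
have [z zS] : exists z, z \in S.
  by move: size0; case: S {uS sS gS} => [|z S] /=; [rewrite ltxx|exists z; rewrite mem_head].
pose q := 1 - expR (- 2 * L).
have q01 : 0 <= q <= 1.
  by rewrite /q subr_ge0 gerBl expR_ge0 andbT expR_le1 mulNr oppr_le0 mulr_ge0 // ltW.
pose u := e / 4; have u0 : 0 < u by rewrite divr_gt0.
have gz := gS z zS.
have z1 : z \in [:: z] by rewrite mem_head.
have hq : q <= wprob r [:: z] n z ((1 - e) * (mu * I1)).
  have [WR WE] := window_chernoff n rpos ((1 - e) * (mu * I1)) z1 u0.
  apply: le_trans WE; rewrite lerD2l lerN2.
  set W := \sum_k _ in WR *.
  pose V := \sum_(k < Q.+1) k%:R / Q%:R * wmass r z k.
  have VE : sigma * r ^+ d * (I1 - ep) <= V.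
    have -> : I1 = \sum_(k < Q.+1) k%:R / Q%:R * lam k.
      by apply: eq_bigr => k _; rewrite mul0r expR0 mulr1.
    apply: (gz (fun k : 'I_Q.+1 => k%:R / Q%:R)); first by rewrite mul0r.
    exact: frac_ge0_le1.
  have WV : W <= - (u * (1 - u)) * V.
    rewrite /V mulr_sumr; apply: ler_sum => k _; rewrite [leRHS]mulrA ler_wpM2r ?fine_ge0 //.
    have /andP[k0 k1] := frac_ge0_le1 k; set x := k%:R / Q%:R in k0 k1 *.
    exact: chernoff_numeric.
  have h : 1 + W <= expR (- (u * (1 - u)) * V) by apply: le_trans (expR_ge1Dx _); lra.
  apply: (@le_trans _ _ (expR (u * ((1 - e) * (mu * I1))) * expR (n%:R * (- (u * (1 - u)) * V)))).
    rewrite ler_wpM2l ?expR_ge0 // expRM_natl; apply: lerXn2r; rewrite ?nnegrE ?expR_ge0 //.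
  rewrite -expRD ler_expR.
  have nV : mu * (I1 - ep) <= n%:R * V.
    have -> : mu * (I1 - ep) = n%:R * (sigma * r ^+ d * (I1 - ep)) by rewrite /mu; ring.
    by rewrite ler_wpM2l.
  have mu2 : 16 * L <= e ^+ 2 * I1 * mu.
    by move: hT; rewrite mulrAC ler_pdivrMr ?mulr_gt0 ?exprn_gt0 //; lra.
  have uu : 0 <= u * (1 - u) by rewrite mulr_ge0 // /u; lra.
  have := ler_wpM2l uu nV.
  have mu0 : 0 <= mu by rewrite !mulr_ge0 // ltW.
  have m1 : 0 <= mu * I1 by rewrite mulr_ge0 // ltW.
  have -> : mu * (I1 - ep) = mu * I1 * (1 - e / 4) by rewrite /ep; field.
  have : u * ((1 - e) * (mu * I1)) - u * (1 - u) * (mu * I1 * (1 - e / 4)) <= - (e ^+ 2 / 8) * (mu * I1).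
    have -> : u * ((1 - e) * (mu * I1)) - u * (1 - u) * (mu * I1 * (1 - e / 4)) =
      (mu * I1) * (u * ((1 - e) - (1 - u) * (1 - e / 4))) by ring.
    rewrite mulrC ler_wpM2r // /u; nra.
  lra.
apply: Pbound_le (windows_fail (s := [:: z]) rpos _ q01 _) => //.
- by move=> w /= hw z' _; exact: hw.
- by rewrite /q /= expr1; lra.
- by move=> z'; rewrite inE => /eqP ->.
Qed.

End Windows.

End Sampling.

(** * Lower bounds for weighted counts *)

Lemma half_defect (R : realFieldType) (e A x y : R) : 0 <= A -> 0 <= x -> 0 < e < 1 ->
  (1 - e / 2) * x <= y -> (1 - e) * (A * x) <= (1 - e / 2) * (A * y).
Proof.
move=> A0 x0 /andP[e0 e1] h; have e2 : 0 <= 1 - e / 2 by lra.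
apply: (@le_trans _ _ ((1 - e / 2) * (A * ((1 - e / 2) * x)))); last first.
  by rewrite ler_wpM2l // ler_wpM2l.
have -> : (1 - e / 2) * (A * ((1 - e / 2) * x)) = (1 - e / 2) ^+ 2 * (A * x) by ring.
rewrite ler_wpM2r ?mulr_ge0 //; nra.
Qed.

Lemma defect_numeric (R : realFieldType) (e D I I' x y : R) : 0 < D -> I - I' <= D * (x - y) ->
  x - e / 2 * I / D <= y -> (1 - e / 2) * I <= I'.
Proof.
move=> D0 h1 h2.
have h3 : D * (x - y) <= D * (e / 2 * I / D) by rewrite ler_pM2l // lerBlDr -lerBlDl.
rewrite [leRHS]mulrC divfK ?gt_eqF // in h3; lra.
Qed.

Section StepWeights.
Variables (R : realType) (d : nat) (leb : {measure set (d.-tuple R) -> \bar R}).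
Hypothesis hleb : is_lebesgue leb.

Section Step.
Variables (Q M : nat) (g : d.-tuple R -> 'I_Q.+1).
Hypothesis Q0 : (0 < Q)%N.
Hypothesis mg : forall k, measurable [set x | g x = k].
Hypothesis gM : forall x, g x != ord0 -> cube M x.

Lemma step_sum (h : R -> R) : h 0 = 0 ->
  \int[leb]_x h (step g x) = \sum_(k < Q.+1) h (k%:R / Q%:R) * lam leb g k.
Proof.
move=> h0.
rewrite (@Rintegral_labels _ _ _ leb _ g [seq k <- index_enum 'I_Q.+1 | k != ord0]
  (fun k => h (k%:R / Q%:R)) mg).
- rewrite big_filter big_mkcond; apply: eq_bigr => k _.
  by case: eqVneq => [->|] //=; rewrite mul0r h0 mul0r.
- by move=> k; rewrite mem_filter => /andP[k0 _]; rewrite (lamE hleb mg gM k0) ltry.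
- by rewrite filter_uniq ?index_enum_uniq.
- by move=> x; rewrite mem_filter mem_index_enum andbT negbK => /eqP ->; rewrite mul0r.
Qed.

Lemma measurable_step : measurable_fun setT (step g).
Proof.
rewrite (_ : step g = fun x => \sum_(k < Q.+1) k%:R / Q%:R * \1_[set y | g y = k] x).
  apply: measurable_sum => k; apply: measurable_funM; first exact: measurable_cst.
  exact: measurable_indic.
apply/funext => x; rewrite (bigD1 (g x)) //= indicE mem_set // mulr1 big1 ?addr0 // => k kg.
by rewrite indicE memNset ?mulr0 //= => e; rewrite e eqxx in kg.
Qed.

Lemma step_ge0_le1 x : 0 <= step g x <= 1. Proof. exact: frac_ge0_le1. Qed.

Lemma weight_step : weight leb (step g).
Proof.
have mc := measurable_box [tuple - M%:R | i < d] [tuple M%:R : R | i < d].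
have [wc _] := weight_indicator mc (leb_cube_fin hleb M).
split; [exact: measurable_step|exact: step_ge0_le1|].
apply: (weight_bounded_integrable (C := 1) wc); first exact: measurable_step.
move=> x; rewrite mul1r; have /andP[-> h1] := step_ge0_le1 x; rewrite indicE.
have [gx|gx] := eqVneq (g x) ord0; first by rewrite /step gx mul0r ler0n.
by rewrite mem_set //; exact: gM.
Qed.

Lemma step_IJ s : stepI leb g s = Iint leb (step g) s /\ stepJ leb g s = Jint leb (step g) s.
Proof.
rewrite /stepI /stepJ /Iint /Jint (step_sum (h := fun x => x * expR (s * x))) ?mul0r //.
by rewrite (step_sum (h := fun x => expR (s * x) - 1)) // mulr0 expR0 subrr.
Qed.

End Step.

Lemma weight_tail phi eta : weight leb phi -> 0 < eta ->
  exists2 M, (0 < M)%N & \int[leb]_x phi x - eta <= \int[leb]_x (phi x * \1_(@cube R d M) x).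
Proof.
move=> [mp p01 ip] eta0.
have cvg := @ge0_nondecreasing_set_cvg_integral _ _ R (fun M => @cube R d M)
  (EFin \o phi) leb.
have bigE : \bigcup_i @cube R d i = setT.
  by apply/seteqP; split=> x // _; have [M hM] := cube_cover x; exists M.
have sq M M' : (M <= M')%N -> @cube R d M `<=` cube M'.
  move=> MM x /cubeP hx; apply/cubeP => i; have /andP[h1 h2] := hx i.
  have : M%:R <= M'%:R :> R by rewrite ler_nat.
  by move=> h; rewrite (le_trans _ h1) ?lerN2 // (lt_le_trans h2).
have := cvg _ _ _ _; rewrite bigE => {}cvg.
have c1 : (\int[leb]_(x in @cube R d i) (EFin \o phi) x)%E @[i --> \oo] --> (\int[leb]_x phi x)%:E.
  rewrite /Rintegral fineK; last exact: integrable_fin_num.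
  apply: cvg => [M M' MM|M|M|M x _].
  - by rewrite subsetEset; exact: sq.
  - exact: measurable_box.
  - by apply: (@measurable_funS _ _ _ _ setT) => //; exact/measurable_EFinP.
  - by rewrite lee_fin; case/andP: (p01 x).
have hnear := (cvgrPdist_le _ _).1 (fine_cvg c1) eta eta0.
have [M [M0 hM]] : exists M, (0 < M)%N /\
   `|\int[leb]_x phi x - fine (\int[leb]_(x in @cube R d M) (EFin \o phi) x)%E| <= eta.
  case: hnear => K _ hK; exists K.+1; split=> //; exact: hK K.+1 (leqnSn K).
exists M => //.
have -> : \int[leb]_x (phi x * \1_(@cube R d M) x) = fine (\int[leb]_(x in @cube R d M) (EFin \o phi) x)%E.
  rewrite /Rintegral [in RHS]integral_mkcond; congr fine; apply: eq_integral => x _.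
  rewrite /patch indicE; case: ifP => _ /=; first by rewrite mulr1.
  by rewrite mulr0.
by move: hM; rewrite ler_norml => /andP[_]; lra.
Qed.

(** Rounding down to multiples of 1/Q inside a large cube: half of [eta] is the tail outside the
    cube, the other half the rounding error, at most 1/Q times the volume of the cube. *)
Lemma weight_step_approx phi eta : weight leb phi -> 0 < eta ->
  exists (Q M : nat) (g : d.-tuple R -> 'I_Q.+1),
    [/\ (0 < Q)%N, (0 < M)%N, forall k, measurable [set x | g x = k],
        forall x, g x != ord0 -> cube M x &
        (forall x, step g x <= phi x) /\ \int[leb]_x phi x - eta <= \int[leb]_x step g x].
Proof.
move=> wp eta0; have [mp p01 ip] := wp.
have eta2 : 0 < eta / 2 by rewrite divr_gt0.
have [M M0 hM] := weight_tail wp eta2.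
pose v := fine (leb (@cube R d M)); have v0 : 0 <= v by exact: fine_ge0.
have vE : leb (@cube R d M) = v%:E by rewrite fineK // ge0_fin_numE // leb_cube_fin.
pose Q := (Num.truncn (2 * v / eta)).+1.
have QE : v / Q%:R <= eta / 2.
  have : 2 * v / eta < Q%:R by have /andP[] := truncn_itv (divr_ge0 (mulr_ge0 (ler0n _ 2) v0) (ltW eta0)).
  rewrite ltr_pdivrMr // => h; rewrite ler_pdivrMr ?ltr0n //; lra.
have Q1 : 0 < Q%:R :> R by rewrite ltr0n.
have tle x : (Num.truncn (Q%:R * phi x) <= Q)%N.
  have /andP[p0 p1] := p01 x; rewrite -ltnS truncn_lt_nat ?mulr_ge0 //.
  apply: (@le_lt_trans _ _ (Q%:R * 1)); first by rewrite ler_wpM2l.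
  by rewrite mulr1 ltr_nat.
pose g x : 'I_Q.+1 := if x \in @cube R d M then inord (Num.truncn (Q%:R * phi x)) else ord0.
have mc : measurable (@cube R d M) by exact: measurable_box.
have mt k : measurable [set x | Num.truncn (Q%:R * phi x) = k].
  have mq : measurable_fun setT (fun x => Q%:R * phi x) by exact: measurable_funM.
  have := mq measurableT _ (measurable_itv `[k%:R, k.+1%:R[); rewrite setTI; congr measurable.
  apply/seteqP; split=> x /=; have q0 : 0 <= Q%:R * phi x by rewrite mulr_ge0 //; case/andP: (p01 x).
    by rewrite in_itv /= -truncn_eq // => /eqP.
  by rewrite in_itv /= => <-; exact: truncn_itv.
have gM x : g x != ord0 -> cube M x by rewrite /g; case: ifP => [/set_mem|]; rewrite ?eqxx.
have mg k : measurable [set x | g x = k].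
  rewrite (_ : [set x | g x = k] = (@cube R d M `&` [set x | Num.truncn (Q%:R * phi x) = k])
      `|` (if k == ord0 then ~` @cube R d M else set0)).
    by apply: measurableU; [exact: measurableI|case: ifP => _; [exact: measurableC|exact: measurable0]].
  apply/seteqP; split=> x; rewrite /g /=.
    case: (boolP (x \in _)) => [/set_mem cx <-|/negP cx <-].
      by left; split=> //; rewrite inordK // ltnS.
    by right; rewrite eqxx => /mem_set.
  move=> [[cx tx]|]; first by rewrite mem_set //; apply/val_inj; rewrite /= inordK // ltnS.
  by case: eqP => [->|_ []] // cx; rewrite memNset.
exists Q, M, g; split=> //.
have gE x : cube M x -> step g x = (Num.truncn (Q%:R * phi x))%:R / Q%:R.
  by move=> cx; rewrite /step /g mem_set // inordK // ltnS.
split.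
  move=> x; have /andP[p0 p1] := p01 x; rewrite /step /g; case: ifP => _; last by rewrite mul0r.
  by rewrite inordK ?ltnS // ler_pdivrMr // mulrC truncn_le mulr_ge0.
have [_ _ iS] := weight_step (ltn0Sn _) mg gM.
have [[_ _ ic] cE] := weight_indicator mc (leb_cube_fin hleb M).
have mono : \int[leb]_x (phi x * \1_(@cube R d M) x) <=
    \int[leb]_x (step g x + Q%:R^-1 * \1_(@cube R d M) x).
  apply: le_Rintegral => //.
  - apply: (weight_bounded_integrable (C := 1) wp).
      by apply: measurable_funM => //; exact: measurable_indic.
    move=> x; have /andP[p0 p1] := p01 x; rewrite indicE mul1r.
    by case: (x \in _); rewrite ?mulr1 ?mulr0 ?p0 lexx.
  - by apply: integrable_addr => //; exact: integrable_mulr.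
  move=> x _; rewrite indicE; have [cx|cx] := pselect (cube M x).
    rewrite mem_set // !mulr1 gE // -[X in _ + X]mul1r -mulrDl ler_pdivlMr // mulrC natr1.
    have /andP[p0 _] := p01 x.
    by have /andP[_ /ltW] := truncn_itv (mulr_ge0 (ler0n _ Q) p0).
  rewrite memNset // !mulr0 addr0; exact: divr_ge0.
have : \int[leb]_x (step g x + Q%:R^-1 * \1_(@cube R d M) x) = \int[leb]_x step g x + v / Q%:R.
  rewrite RintegralD //; last exact: integrable_mulr.
  by rewrite RintegralZl // cE mulrC.
lra.
Qed.

Lemma Iint_lip phi psi s : weight leb phi -> weight leb psi -> (forall x, psi x <= phi x) -> 0 <= s ->
  Iint leb phi s - Iint leb psi s <= (1 + s) * expR s * (\int[leb]_x phi x - \int[leb]_x psi x).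
Proof.
move=> wp wq le s0; have [_ p01 ip] := wp; have [_ q01 iq] := wq.
have iP := weight_Iint_integrable wp s0; have iQ := weight_Iint_integrable wq s0.
rewrite /Iint -!RintegralB // -RintegralZl //; last exact: integrable_subr.
apply: le_Rintegral => //; [exact: integrable_subr|by apply: integrable_mulr; exact: integrable_subr|].
move=> x _; have /andP[p0 p1] := p01 x; have /andP[q0 q1] := q01 x; have pq := le x.
have t := expR_tangent (s * phi x) (s * psi x).
have E1 : expR (s * phi x) <= expR s by rewrite ler_expR ler_piMr.
have E0 := expR_gt0 (s * phi x).
set a := expR (s * phi x) in t E1 E0 *; set b := expR (s * psi x) in t *.
have h1 : phi x * a - psi x * b <= (phi x - psi x) * a + psi x * (a * (s * (phi x - psi x))) by nra.
have d0 : 0 <= phi x - psi x by rewrite subr_ge0.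
have h2 : psi x * (a * (s * (phi x - psi x))) <= a * (s * (phi x - psi x)).
  by rewrite ler_piMl ?mulr_ge0 // ltW.
have h3 : (phi x - psi x) * a + a * (s * (phi x - psi x)) <= (1 + s) * expR s * (phi x - psi x).
  have -> : (phi x - psi x) * a + a * (s * (phi x - psi x)) = (1 + s) * a * (phi x - psi x) by ring.
  by rewrite ler_wpM2r // ler_wpM2l // addr_ge0.
lra.
Qed.

Lemma Gint_mono phi psi s : weight leb phi -> weight leb psi -> (forall x, psi x <= phi x) -> 0 <= s ->
  Gint leb psi s <= Gint leb phi s.
Proof.
move=> wp wq le s0; apply: le_Rintegral => //; try exact: weight_Gint_integrable.
move=> x _; have [_ q01 _] := wq; have /andP[q0 _] := q01 x.
by apply: Hfun_expR_mono; [rewrite mulr_ge0|rewrite ler_wpM2l].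
Qed.

End StepWeights.

(** All that the asymptotics use of the density: the law [nu] is at most sigma times [leb], and it
    is nearly that large on the level sets [F], which almost fill many small cells. *)
Record sampling (R : realType) (d : nat) (leb : {measure set (d.-tuple R) -> \bar R})
    (d0 : measure_display) (Omega : measurableType d0) (P : probability Omega R)
    (X : nat -> Omega -> d.-tuple R) (nu : {measure set (d.-tuple R) -> \bar R})
    (sigma : R) (F : R -> set (d.-tuple R)) : Prop := Sampling {
  samp_dim : (0 < d)%N;
  samp_leb : is_lebesgue leb;
  samp_meas : forall i, measurable_fun setT (X i);
  samp_law : forall i A, measurable A -> P (X i @^-1` A) = nu A;
  samp_indep : mutually_independent P X;
  samp_gt0 : 0 < sigma;
  samp_le : forall A, measurable A -> (nu A <= sigma%:E * leb A)%E;
  samp_levels : forall eps, measurable (F eps);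
  samp_ge : forall eps A, 0 < eps < 1 -> measurable A ->
    (((1 - eps) * sigma)%:E * leb (A `&` F eps) <= nu A)%E;
  samp_good : forall eps eta m, 0 < eps -> 0 < eta -> (0 < m)%N ->
    exists c0 r0 : R, [/\ 0 < c0, 0 < r0 & forall r, 0 < r <= r0 ->
      exists s : seq {ffun 'I_d -> int}, [/\ uniq s, c0 * r ^- d <= (size s)%:R &
        forall z, z \in s -> (leb (cell (m%:R * r) z `\` F eps) <= (eta * r ^+ d)%:E)%E]]
}.

Section RandomPoints.
Variables (R : realType) (d : nat) (leb : {measure set (d.-tuple R) -> \bar R}).
Variables (d0 : measure_display) (Omega : measurableType d0) (P : probability Omega R).
Variables (X : nat -> Omega -> d.-tuple R) (nu : {measure set (d.-tuple R) -> \bar R}).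
Variables (sigma : R) (F : R -> set (d.-tuple R)).
Hypothesis hS : sampling leb P X nu sigma F.

(** Rounding [phi] down can only decrease [Gint], so t G < 1 survives, while [Iint] changes by an
    arbitrarily small fraction. *)
Lemma weight_lower_mid phi s t e : weight leb phi -> 0 <= s -> 0 < t -> 0 < Iint leb phi s ->
  t * Gint leb phi s < 1 -> 0 < e < 1 ->
  exists C delta : R, 0 < delta /\ \forall n \near \oo, forall r, 0 < r ->
    sigma * n%:R * r ^+ d = t * ln n%:R ->
    Pbound P [set w | forall u, \sum_(i < n) phi (aff r^-1 u (X i w)) <
      (1 - e) * (t * ln n%:R * Iint leb phi s)] (C * expR (- delta * ln n%:R)).
Proof.
have hleb := samp_leb hS; move=> wp s0 t0 I0 tG /andP[e0 e1].
have e2 : 0 < e / 2 < 1 by apply/andP; split; lra.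
have e3 : 0 < 1 - e / 2 by lra.
have e01 : 0 < e < 1 by rewrite e0.
pose D := (1 + s) * expR s; have D0 : 0 < D by rewrite mulr_gt0 ?expR_gt0 // ltr_pwDl.
have eta0 : 0 < e / 2 * Iint leb phi s / D by rewrite !divr_gt0 // mulr_gt0 // divr_gt0.
have [Q [M [g [Q0 M0 mg gM [gle gint]]]]] := weight_step_approx hleb wp eta0.
have wg := weight_step hleb Q0 mg gM.
have [eI eJ] := step_IJ hleb mg gM s.
have Ig := defect_numeric D0 (Iint_lip wp wg gle s0) gint.
have Ig0 : 0 < Iint leb (step g) s := lt_le_trans (mulr_gt0 e3 I0) Ig.
have tg : t * (s * stepI leb g s - stepJ leb g s) < 1.
  rewrite eI eJ -(GintE wg s0); apply: le_lt_trans tG; rewrite (ler_pM2l t0).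
  exact: Gint_mono wp wg gle s0.
have Is0 : 0 < stepI leb g s by rewrite eI.
have [C [delta [dl0 H]]] := @step_lower_mid R d d0 Omega P X (samp_meas hS) nu (samp_law hS)
  (samp_indep hS) leb hleb sigma (ltW (samp_gt0 hS)) (samp_le hS) F (samp_levels hS) (samp_ge hS)
  (samp_good hS) Q M g Q0 M0 mg gM (samp_gt0 hS) (samp_dim hS) s t (e / 2) s0 t0 Is0 tg e2.
exists C, delta; split=> //; near=> n => r r0 hr.
have L0 : 0 <= ln (n%:R : R) by near: n; exact: near_ln_ge.
have Hn : forall r, 0 < r -> sigma * n%:R * r ^+ d = t * ln n%:R ->
  Pbound P [set w | forall u, \sum_(i < n) step g (aff r^-1 u (X i w)) <
      (1 - e / 2) * (t * ln n%:R * stepI leb g s)] (C * expR (- delta * ln n%:R)).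
  by near: n; exact: H.
apply: Pbound_le (Hn r r0 hr) => // w /= hw u.
apply: le_lt_trans (lt_le_trans (hw u) _); first by apply: ler_sum => i _; exact: gle.
rewrite eI; exact: half_defect (mulr_ge0 (ltW t0) L0) (ltW I0) e01 Ig.
Unshelve. all: by end_near. Qed.

Lemma weight_lower_large phi e : weight leb phi -> 0 < \int[leb]_x phi x -> 0 < e < 1 ->
  exists T r0 : R, [/\ 0 < T, 0 < r0 & forall n r, 0 < r <= r0 -> 0 < ln (n%:R : R) ->
    T * ln n%:R <= sigma * n%:R * r ^+ d ->
    Pbound P [set w | forall u, \sum_(i < n) phi (aff r^-1 u (X i w)) <
      (1 - e) * (sigma * n%:R * r ^+ d * \int[leb]_x phi x)] (expR (- 2 * ln n%:R))].
Proof.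
have hleb := samp_leb hS; move=> wp I0 /andP[e0 e1]; set I := \int[leb]_x phi x in I0 *.
have e2 : 0 < e / 2 < 1 by apply/andP; split; lra.
have e3 : 0 < 1 - e / 2 by lra.
have e01 : 0 < e < 1 by rewrite e0.
have eta0 : 0 < e / 2 * I by rewrite mulr_gt0 // divr_gt0.
have [Q [M [g [Q0 M0 mg gM [gle gint]]]]] := weight_step_approx hleb wp eta0.
have [eI eJ] := step_IJ hleb mg gM 0.
have Ig : (1 - e / 2) * I <= stepI leb g 0.
  rewrite eI /Iint; under eq_Rintegral do rewrite mul0r expR0 mulr1.
  by rewrite mulrBl mul1r.
have Is0 : 0 < stepI leb g 0 := lt_le_trans (mulr_gt0 e3 I0) Ig.
have [T [r0 [T0 r00 H]]] := @step_lower_large R d d0 Omega P X (samp_meas hS) nu (samp_law hS)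
  (samp_indep hS) leb hleb sigma (ltW (samp_gt0 hS)) F (samp_levels hS) (samp_ge hS)
  (samp_good hS) Q M g Q0 M0 mg gM (e / 2) Is0 e2.
exists T, r0; split=> // n r rr L0 hT; have r1 : 0 < r by case/andP: rr.
apply: Pbound_le (H n r rr L0 hT) => // w /= hw u.
apply: le_lt_trans (lt_le_trans (hw u) _); first by apply: ler_sum => i _; exact: gle.
have mu0 : 0 <= sigma * n%:R * r ^+ d.
  by rewrite !mulr_ge0 ?exprn_ge0 ?(ltW (samp_gt0 hS)) ?(ltW r1).
exact: half_defect mu0 (ltW I0) e01 Ig.
Qed.

End RandomPoints.

(** * Asymptotics of monotone parameters *)

Section RateNumerics.
Variable R : realType.
Implicit Types (e t s L J F A B : R).

Lemma exceed_numeric (n : nat) B A x y : (0 < n)%N -> 0 <= B -> y <= A -> 1 <= x ->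
  n%:R * B * expR y / (expR x - 1) <= 2 * B * expR (ln n%:R + A - x).
Proof.
move=> n0 B0 yA x1; have n1 : 0 < n%:R :> R by rewrite ltr0n.
have ex : 2 <= expR x by apply: le_trans (expR_ge1Dx x); lra.
have h1 : 0 < expR x - 1 by lra.
rewrite !expRD expRN lnK ?posrE // ler_pdivrMr //.
have e0 := expR_gt0 x; have nB : 0 <= n%:R * B by rewrite mulr_ge0 // ltW.
have hA : n%:R * B * expR y <= n%:R * B * expR A by rewrite ler_wpM2l // ler_expR.
apply: le_trans hA _.
have -> : 2 * B * (n%:R * expR A / expR x) * (expR x - 1) =
   n%:R * B * expR A * (2 * (expR x - 1) / expR x) by field; rewrite gt_eqF.
rewrite ler_peMr ?mulr_ge0 ?expR_ge0 // ler_pdivlMr //; lra.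
Qed.

(** Multiplying the dual inequality by t L gives L + t L J <= s (t L F): the threshold pays for the
    union over about n places and for the cumulant, and the factor (1 + e)^2 leaves 2 e L over. *)
Lemma upper_numeric e t s L J F A : 0 < e -> 0 < t -> 1 <= L -> 0 <= J -> t^-1 + J <= s * F ->
  A <= t * L * ((1 + e) * J) ->
  1 <= s * ((1 + e) ^+ 2 * (t * L * F)) /\ L + A - s * ((1 + e) ^+ 2 * (t * L * F)) <= - (2 * e) * L.
Proof.
move=> e0 t0 L1 J0 h hA; have L0 : 0 < L by lra.
have tL : 0 <= t * L by rewrite mulr_ge0 // ltW.
have h1 : L + t * L * J <= t * L * (s * F).
  have := ler_wpM2l tL h; rewrite mulrDr; have -> : t * L * t^-1 = L by field; rewrite gt_eqF.
  by [].
have E : s * ((1 + e) ^+ 2 * (t * L * F)) = (1 + e) ^+ 2 * (t * L * (s * F)) by ring.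
have tLJ : 0 <= t * L * J by rewrite mulr_ge0.
have e2 : 0 <= (1 + e) ^+ 2 by rewrite sqr_ge0.
have h2 := ler_wpM2l e2 h1.
rewrite E; move: h2; set Y := (1 + e) ^+ 2 * (t * L * (s * F)) => h2.
have h3 : (1 + e) ^+ 2 * (L + t * L * J) >= (1 + 2 * e) * L + (1 + e) * (t * L * J) by nra.
have hA' : A <= (1 + e) * (t * L * J) by rewrite mulrCA in hA.
split; last by lra.
have : e * L >= 0 by rewrite mulr_ge0 // ltW.
have : e * (t * L * J) >= 0 by rewrite mulr_ge0 // ltW.
lra.
Qed.

Lemma expR_sub1_small e : 0 < e -> exists2 s, 0 < s & expR s - 1 <= (1 + e) * s.
Proof.
move=> e0; have e1 : 0 < 1 + e by lra.
exists (e / (1 + e)); first by rewrite divr_gt0.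
have h := expR_ge1Dx (- (e / (1 + e))); rewrite expRN in h.
have E1 : 1 + - (e / (1 + e)) = (1 + e)^-1 by field; rewrite gt_eqF.
have E2 : (1 + e) * (e / (1 + e)) = e by field; rewrite gt_eqF.
rewrite E1 lef_pV2 ?posrE ?expR_gt0 // in h.
by rewrite E2; lra.
Qed.

Lemma pow_1D_le n e : 0 <= e <= 1 -> (1 + e) ^+ n <= 1 + (2 ^+ n - 1) * e.
Proof.
move=> /andP[e0 e1]; elim: n => [|n IH]; first by rewrite !expr0; lra.
rewrite !exprS; have p : 1 <= 2 ^+ n :> R by rewrite exprn_ege1 // ler1n.
have e1' : 0 <= 1 + e by lra.
have h := ler_wpM2l e1' IH; apply: le_trans h _; set u := 2 ^+ n in p *.
have h2 : 0 <= (u - 1) * (e * (1 - e)) by rewrite mulr_ge0 ?mulr_ge0 //; lra.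
nra.
Qed.

Lemma pow_1B_ge n e : 0 <= e <= 1 -> 1 - n%:R * e <= (1 - e) ^+ n.
Proof.
move=> /andP[e0 e1]; elim: n => [|n IH]; first by rewrite expr0; lra.
rewrite exprS -natr1; have e1' : 0 <= 1 - e by lra.
have := ler_wpM2l e1' IH; have : 0 <= n%:R * e * e by rewrite !mulr_ge0.
nra.
Qed.

Lemma radius_exists (d : nat) (c : R) : (0 < d)%N -> 0 < c -> exists2 r : R, 0 < r & r ^+ d = c.
Proof.
move=> d0 c0; exists (c `^ d%:R^-1); first exact: powR_gt0.
rewrite -powR_mulrn ?powR_ge0 // -powRrM mulVf ?powRr1 ?ltW //.
by rewrite pnatr_eq0 -lt0n.
Qed.

(** Telescoping. The terms j = 0, where ln 0 = 0 by convention, and j = 1 contribute 1 each, the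
    rest at most 1. *)
Lemma sum_inverse_squares n : \sum_(0 <= j < n) expR (- 2 * ln (j%:R : R)) <= 3.
Proof.
suff H : forall n, \sum_(0 <= j < n.+2) expR (- 2 * ln (j%:R : R)) <= 3 - (n.+1%:R)^-1.
  case: n => [|[|n]]; first by rewrite big_nil.
    by rewrite big_nat1 ln0 // mulr0 expR0; lra.
  by apply: le_trans (H n) _; rewrite gerBl invr_ge0.
elim=> [|m IH]; first by rewrite big_nat_recr //= big_nat1 ln0 // ln1 mulr0 expR0 invr1; lra.
rewrite big_nat_recr //=.
have m0 : 0 < m.+1%:R :> R by rewrite ltr0n.
have -> : expR (- 2 * ln (m.+2%:R : R)) = (m.+2%:R ^+ 2)^-1.
  by rewrite mulNr expRN mulrC expRM_natr lnK // posrE.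
rewrite -[m.+2%:R]natr1; set x := m.+1%:R in m0 IH *.
have x1 : 0 < x + 1 by lra.
have : ((x + 1) ^+ 2)^-1 <= x^-1 - (x + 1)^-1.
  have -> : x^-1 - (x + 1)^-1 = (x * (x + 1))^-1 by field; rewrite !gt_eqF.
  by rewrite lef_pV2 ?posrE ?exprn_gt0 ?mulr_gt0 // expr2 ler_pM2r //; lra.
by move=> h; apply: le_trans (lerD IH h) _; rewrite addrA subrK.
Qed.

Lemma root_bracket k n : (0 < k)%N -> (0 < n)%N -> exists j, (0 < j)%N /\ (j ^ k <= n < j.+1 ^ k)%N.
Proof.
move=> k0 n0; pose Q j := (j ^ k <= n)%N.
have ub j : Q j -> (j <= n)%N.
  by move=> h; apply: leq_trans h; case: j => // j; rewrite -{1}(expn1 j.+1) leq_pexp2l.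
have ex : exists j, Q j by exists 1%N; rewrite /Q exp1n.
case: (ex_maxnP ex ub) => j Qj jmax; exists j; split.
  by apply: leq_trans (jmax 1%N _); rewrite // /Q exp1n.
apply/andP; split; first exact: Qj.
by rewrite ltnNge; apply/negP => /jmax; rewrite ltnn.
Qed.

(** Consecutive k-th powers have ratio tending to 1, so a property known along powers encloses every
    large n from both sides, with n and ln n changed by a factor 1 + e at most. *)
Lemma near_powers k e (Q : nat -> Prop) : (0 < k)%N -> 0 < e -> (\forall j \near \oo, Q j) ->
  \forall n \near \oo, exists j, [/\ Q j, Q j.+1, (j ^ k <= n)%N, (n <= j.+1 ^ k)%N &
    [/\ (0 < j ^ k)%N, (j.+1 ^ k)%:R <= (1 + e) * (j ^ k)%:R &
    1 <= ln ((j ^ k)%:R : R) /\ ln ((j.+1 ^ k)%:R : R) <= (1 + e) * ln ((j ^ k)%:R : R)]].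
Proof.
move=> k0 e0 [J _ hJ].
have e1 : 0 < 1 + e by lra.
have le0 : 0 < ln (1 + e) by rewrite ln_gt0 //; lra.
pose J1 := maxn J (maxn (Num.truncn (expR 1 : R)).+1 (Num.truncn (k%:R / ln (1 + e))).+1).
exists (J1.+1 ^ k)%N => // n /= hn.
have n0 : (0 < n)%N by apply: leq_trans hn; rewrite expn_gt0.
have [j [j0 /andP[jn nj]]] := root_bracket k0 n0.
have Jj : (J1 <= j)%N.
  have : (J1.+1 ^ k < j.+1 ^ k)%N by apply: leq_ltn_trans hn nj.
  by rewrite ltn_exp2r // ltnS => /ltnW.
have j3 : expR 1 <= j%:R :> R.
  have /andP[_ /ltW h] := truncn_itv (expR_ge0 (1 : R)).
  by apply: le_trans h _; rewrite ler_nat; apply: leq_trans Jj; rewrite /J1 !leq_max leqnn !orbT.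
have jk : k%:R / ln (1 + e) <= j%:R.
  have /andP[_ /ltW h] := truncn_itv (divr_ge0 (ler0n R k) (ltW le0)).
  by apply: le_trans h _; rewrite ler_nat; apply: leq_trans Jj; rewrite /J1 !leq_max leqnn !orbT.
have jr : 0 < j%:R :> R by rewrite ltr0n.
have jkr : 0 < (j ^ k)%:R :> R by rewrite ltr0n expn_gt0 j0.
have step : (j.+1 ^ k)%:R <= (1 + e) * (j ^ k)%:R.
  rewrite !natrX -ler_pdivrMr ?exprn_gt0 // -expr_div_n.
  have -> : j.+1%:R / j%:R = 1 + j%:R^-1 :> R by rewrite -natr1 mulrDl divff ?gt_eqF // div1r.
  apply: (@le_trans _ _ (expR (k%:R * j%:R^-1))).
    rewrite expRM_natl; apply: lerXn2r; rewrite ?nnegrE ?expR_ge0 ?addr_ge0 ?invr_ge0 //.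
    exact: expR_ge1Dx.
  rewrite -[leRHS]lnK ?posrE // ler_expR ler_pdivrMr // mulrC -ler_pdivrMr //.
exists j; split=> //; [apply: hJ|apply: hJ|exact: ltnW|].
- by apply: leq_trans Jj; rewrite leq_max leqnn.
- by apply: leqW; apply: leq_trans Jj; rewrite leq_max leqnn.
split=> //; first by rewrite expn_gt0 j0.
have l1 : 1 <= ln ((j ^ k)%:R : R).
  rewrite -[X in X <= _]expRK ler_ln ?posrE ?expR_gt0 //; apply: le_trans j3 _.
  by rewrite ler_nat -{1}(expn1 j) leq_pexp2l.
split=> //.
apply: (@le_trans _ _ (ln ((1 + e) * (j ^ k)%:R))).
  by rewrite ler_ln ?posrE ?mulr_gt0 // ltr0n expn_gt0.
rewrite lnM ?posrE // mulrDl mul1r addrC lerD2l.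
have : ln (1 + e) <= e by have := @le_ln1Dx R e; apply; lra.
by move=> h; apply: le_trans h _; rewrite ler_peMr // ltW.
Qed.

Lemma tail_numeric e s m mu T A L : 0 < e < 1 -> 0 < s -> 0 < m -> 1 <= L ->
  3 / (e * s * m) <= T -> T * L <= mu -> A <= mu * ((1 + e) ^+ 2 * (s * m)) ->
  1 <= s * ((1 + e) ^+ 3 * (mu * m)) /\ L + A - s * ((1 + e) ^+ 3 * (mu * m)) <= - 2 * L.
Proof.
move=> /andP[e0 e1] s0 m0 L1 hT hmu hA.
have D0 : 0 < e * s * m by rewrite !mulr_gt0.
have h3 : 3 * L <= e * (s * m * mu).
  have : 3 * L <= T * L * (e * s * m).
    rewrite mulrAC ler_wpM2r //; first by lra.
    by move: hT; rewrite ler_pdivrMr.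
  move=> h; apply: le_trans h _.
  have -> : e * (s * m * mu) = mu * (e * s * m) by ring.
  by rewrite ler_pM2r.
set Y := s * m * mu in h3.
have Y0 : 0 <= Y by nra.
have E : s * ((1 + e) ^+ 3 * (mu * m)) = (1 + e) ^+ 3 * Y by rewrite /Y; ring.
have hA' : A <= (1 + e) ^+ 2 * Y by apply: le_trans hA _; rewrite /Y le_eqVlt; apply/orP; left; apply/eqP; ring.
have q1 : 1 <= (1 + e) ^+ 2 by rewrite exprn_ege1 // lerDl ltW.
have h4 : (1 + e) ^+ 2 * Y + e * Y <= (1 + e) ^+ 3 * Y.
  have -> : (1 + e) ^+ 3 * Y = (1 + e) ^+ 2 * Y + (1 + e) ^+ 2 * (e * Y) by ring.
  by rewrite lerD2l; apply: ler_peMl => //; exact: mulr_ge0 (ltW e0) Y0.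
have h5 : e * Y <= (1 + e) ^+ 2 * Y.
  rewrite ler_wpM2r //; nra.
rewrite E; split; lra.
Qed.

Lemma low_radius_numeric (q t e s n m Lj Ln : R) : 0 <= q -> 0 < t -> 0 < e -> 0 <= s -> Lj <= Ln ->
  n <= (1 + e) * m -> t * Ln <= s * n * q -> t / (1 + e) * Lj <= s * m * q.
Proof.
move=> q0 t0 e0 s0 hL hn h; have e1 : 0 < 1 + e by lra.
rewrite mulrAC ler_pdivrMr //.
have h1 : t * Lj <= t * Ln by rewrite ler_pM2l.
have h2 : s * q * n <= s * q * ((1 + e) * m) by rewrite ler_wpM2l // mulr_ge0.
have -> : s * m * q * (1 + e) = s * q * ((1 + e) * m) by ring.
by apply: le_trans h1 (le_trans h (le_trans _ h2)); rewrite mulrAC.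
Qed.

Lemma up_radius_numeric (q t e s n m Lm Ln : R) : 0 <= q -> 0 < t -> 0 < e -> 0 <= s -> Ln <= Lm ->
  m <= (1 + e) * n -> s * n * q <= t * Ln -> s * m * q <= t * (1 + e) * Lm.
Proof.
move=> q0 t0 e0 s0 hL hn h; have e1 : 0 < 1 + e by lra.
have h2 : s * q * m <= s * q * ((1 + e) * n) by rewrite ler_wpM2l // mulr_ge0.
have h3 : (1 + e) * (s * n * q) <= (1 + e) * (t * Ln) by rewrite ler_pM2l.
have h1 : (1 + e) * (t * Ln) <= (1 + e) * (t * Lm) by rewrite ler_pM2l // ler_pM2l.
have -> : s * m * q = s * q * m by ring.
have -> : t * (1 + e) * Lm = (1 + e) * (t * Lm) by ring.
apply: le_trans h2 (le_trans _ h1); apply: le_trans h3.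
by rewrite le_eqVlt; apply/orP; left; apply/eqP; ring.
Qed.

Lemma low_rate_numeric e t F Lj Ln : 0 < e < 1 -> 0 <= t -> 0 <= F -> 0 <= Lj -> Ln <= (1 + e) * Lj ->
  (1 - e) ^+ 4 * (t * Ln * F) <= (1 - e) ^+ 2 * (t / (1 + e) * Lj * F).
Proof.
move=> /andP[e0 e1] t0 F0 L0 h; have e1' : 0 < 1 + e by lra.
have -> : (1 - e) ^+ 4 * (t * Ln * F) = (1 - e) ^+ 2 * (t * F * ((1 - e) ^+ 2 * Ln)) by ring.
have -> : t / (1 + e) * Lj * F = t * F * (Lj / (1 + e)) by ring.
rewrite ler_wpM2l ?sqr_ge0 // ler_wpM2l ?mulr_ge0 // ler_pdivlMr //.
have h2 : (1 - e) ^+ 2 * Ln <= (1 - e) ^+ 2 * ((1 + e) * Lj) by rewrite ler_wpM2l ?sqr_ge0.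
apply: (@le_trans _ _ ((1 - e) ^+ 2 * ((1 + e) * Lj) * (1 + e))); first by rewrite ler_pM2r.
have -> : (1 - e) ^+ 2 * ((1 + e) * Lj) * (1 + e) = (1 - e ^+ 2) ^+ 2 * Lj by ring.
have p : 0 <= e ^+ 2 <= 1 by rewrite sqr_ge0 expr_le1 // ltW.
rewrite ler_piMl //; move: p; set u := e ^+ 2 => /andP[u0 u1]; nra.
Qed.

Lemma up_rate_numeric e t F F' Lm Ln : 0 < e < 1 -> 0 <= t -> 0 <= F -> F <= F' -> 0 <= Ln ->
  Lm <= (1 + e) * Ln ->
  (1 + e) ^+ 4 * (t * (1 + e) * Lm * F) <= (1 + e) ^+ 6 * (t * Ln * F').
Proof.
move=> /andP[e0 e1] t0 F0 FF L0 h; have e1' : 0 < 1 + e by lra.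
have -> : (1 + e) ^+ 6 * (t * Ln * F') = (1 + e) ^+ 4 * (t * (1 + e) * ((1 + e) * Ln) * F') by ring.
rewrite ler_pM2l ?exprn_gt0 //.
have te : 0 <= t * (1 + e) by rewrite mulr_ge0 // ltW.
apply: (@le_trans _ _ (t * (1 + e) * ((1 + e) * Ln) * F)).
  by rewrite ler_wpM2r // ler_wpM2l.
by rewrite ler_wpM2l // !mulr_ge0 // ltW.
Qed.

Lemma geometric_exceeds T t e : 0 < t -> 0 < e -> exists I, T < t * (1 + e) ^+ I.
Proof.
move=> t0 e0; pose I := (Num.truncn (`|T| / (t * e))).+1; exists I.
have te : 0 < t * e by rewrite mulr_gt0.
have /andP[_] := truncn_itv (divr_ge0 (normr_ge0 T) (ltW te)); rewrite -/I ltr_pdivrMr // => h.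
apply: le_lt_trans (ler_norm T) (lt_le_trans h _).
have B n : 1 + n%:R * e <= (1 + e) ^+ n.
  elim: n => [|n IH]; first by rewrite expr0; lra.
  rewrite exprS -natr1; have e1' : 0 <= 1 + e by lra.
  have := ler_wpM2l e1' IH; have : 0 <= n%:R * e * e by rewrite !mulr_ge0 // ltW.
  nra.
have -> : I%:R * (t * e) = t * (I%:R * e) by ring.
by rewrite ler_pM2l //; have := B I; lra.
Qed.

Lemma low_grid_numeric e t' F L t F' : 0 < e < 1 -> 0 <= t' -> 0 <= F -> 0 <= L ->
  t <= (1 + e) * t' -> F <= F' ->
  (1 - e) ^+ 5 * (t * L * F) <= (1 - e) ^+ 4 * (t' * L * F').
Proof.
move=> /andP[e0 e1] t0 F0 L0 h hF; rewrite exprSr -mulrA.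
rewrite ler_wpM2l ?exprn_ge0 ?subr_ge0 ?(ltW e1) //.
apply: (@le_trans _ _ (t' * L * F)); last by rewrite ler_wpM2l // mulr_ge0.
rewrite !mulrA ler_wpM2r // ler_wpM2r //.
apply: (@le_trans _ _ ((1 - e) * ((1 + e) * t'))); first by rewrite ler_wpM2l ?subr_ge0 ?(ltW e1).
have : 0 <= e * e * t' by rewrite !mulr_ge0 // ltW.
nra.
Qed.

Lemma up_grid_numeric e t F' L t' F : 0 < e < 1 -> 0 <= t -> 0 <= F' -> 0 <= L ->
  t' <= (1 + e) * t -> F' <= F ->
  (1 + e) ^+ 6 * (t' * L * F') <= (1 + e) ^+ 7 * (t * L * F).
Proof.
move=> /andP[e0 e1] t0 F0 L0 h hF; have e1' : 0 <= 1 + e by lra.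
have -> : (1 + e) ^+ 7 * (t * L * F) = (1 + e) ^+ 6 * ((1 + e) * t * L * F) by ring.
rewrite ler_wpM2l ?exprn_ge0 //.
apply: (@le_trans _ _ ((1 + e) * t * L * F')).
  by rewrite ler_wpM2r // ler_wpM2r.
by rewrite ler_wpM2l // !mulr_ge0.
Qed.

Lemma low_tail_numeric e mu m F : 0 < e < 1 -> 0 <= mu -> 0 <= m -> F <= (1 + e) ^+ 2 * m ->
  (1 - e) ^+ 5 * (mu * F) <= (1 - e) ^+ 2 * (mu * m).
Proof.
move=> /andP[e0 e1] mu0 m0 hF; have e1' : 0 <= 1 - e by lra.
have -> : (1 - e) ^+ 5 * (mu * F) = (1 - e) ^+ 2 * (mu * ((1 - e) ^+ 3 * F)) by ring.
rewrite ler_wpM2l ?exprn_ge0 // ler_wpM2l //.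
apply: (@le_trans _ _ ((1 - e) ^+ 3 * ((1 + e) ^+ 2 * m))); first by rewrite ler_wpM2l ?exprn_ge0.
have -> : (1 - e) ^+ 3 * ((1 + e) ^+ 2 * m) = ((1 - e) * (1 - e ^+ 2) ^+ 2) * m by ring.
rewrite ler_piMl //; have p : 0 <= e ^+ 2 <= 1 by rewrite sqr_ge0 expr_le1 // ltW.
apply: mulr_ile1; [lra|exact: sqr_ge0|lra|].
by move: p; set u := e ^+ 2 => /andP[u0 u1]; nra.
Qed.

Lemma up_tail_numeric e mu m F : 0 < e < 1 -> 0 <= mu -> 0 <= m -> m <= F ->
  (1 + e) ^+ 5 * (mu * m) <= (1 + e) ^+ 7 * (mu * F).
Proof.
move=> /andP[e0 e1] mu0 m0 hF; have e1' : 0 <= 1 + e by lra.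
apply: ler_pM; rewrite ?exprn_ge0 ?mulr_ge0 //; last by rewrite ler_wpM2l.
by rewrite ler_weXn2l // lerDl ltW.
Qed.

Lemma slack_numeric k e S Y C : 0 <= e -> 0 <= Y -> S <= (1 + e) ^+ k * Y -> C <= e * Y ->
  (1 + e) * S + C <= (1 + e) ^+ k.+2 * Y.
Proof.
move=> e0 Y0 hS hC; have e1 : 0 <= 1 + e by lra.
have h1 := ler_wpM2l e1 hS.
have q : 1 <= (1 + e) ^+ k.+1 by rewrite exprn_ege1 // lerDl.
have h2 : e * Y <= (1 + e) ^+ k.+1 * (e * Y) by rewrite ler_peMl ?mulr_ge0.
have -> : (1 + e) ^+ k.+2 * Y = (1 + e) ^+ k.+1 * Y + (1 + e) ^+ k.+1 * (e * Y) by rewrite [in LHS]exprSr; ring.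
by apply: lerD; [rewrite exprS -mulrA|apply: le_trans hC h2].
Qed.

End RateNumerics.

(** * Almost sure asymptotics of a monotone parameter governed by a class of weights *)

Section Asymptotics.
Variables (R : realType) (d : nat) (leb : {measure set (d.-tuple R) -> \bar R}).
Variables (d0 : measure_display) (Omega : measurableType d0) (P : probability Omega R).
Variables (X : nat -> Omega -> d.-tuple R) (nu : {measure set (d.-tuple R) -> \bar R}).
Variables (sigma : R) (F : R -> set (d.-tuple R)).
Hypothesis hS : sampling leb P X nu sigma F.

(** With k delta >= 2, the bound n^(-delta) at n = j^k is at most j^(-2), which is summable. *)
Lemma ae_powers (B : nat -> set Omega) C delta : 0 < delta ->
  (\forall n \near \oo, Pbound P (B n) (C * expR (- delta * ln n%:R))) ->
  exists2 k, (0 < k)%N & {ae P, forall w, \forall j \near \oo, ~ B (j ^ k)%N w}.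
Proof.
move=> dl0 [n0 _ hB]; pose k := (Num.truncn (2 / delta)).+1; exists k => //.
have kd : 2 <= k%:R * delta.
  have /andP[_ /ltW] := truncn_itv (divr_ge0 (ler0n R 2) (ltW dl0)).
  by rewrite ler_pdivrMr.
pose C' := Num.max C 0; have C0 : 0 <= C' by rewrite le_max lexx orbT.
apply: (@Pbound_borel_cantelli _ _ _ _ _ (fun j => C' * expR (- 2 * ln (j%:R : R))) (C' * 3)).
- exists (maxn n0 1) => // j /=; rewrite geq_max => /andP[n0j j0].
  have jk : (j <= j ^ k)%N by rewrite -{1}(expn1 j) leq_pexp2l.
  apply: Pbound_le (hB (j ^ k)%N (leq_trans n0j jk)) => //.
  have lnk : ln ((j ^ k)%:R : R) = k%:R * ln j%:R.
    by rewrite natrX lnXn ?ltr0n // mulr_natl.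
  apply: (@le_trans _ _ (C' * expR (- delta * ln (j ^ k)%:R))).
    by rewrite ler_wpM2r ?expR_ge0 // le_max lexx.
  rewrite ler_wpM2l // ler_expR lnk !mulNr lerN2 mulrA ler_wpM2r ?ln_ge0 ?ler1n //.
  by rewrite mulrC.
- by move=> n; rewrite mulr_ge0 ?expR_ge0.
- by move=> n; rewrite -mulr_sumr ler_wpM2l // sum_inverse_squares.
Qed.

Lemma window_exceed_prob n l s a A (V : seq {ffun 'I_d -> int}) (psi : {ffun 'I_d -> int} -> R) :
  (0 < n)%N -> 0 < l -> 0 < s -> 1 <= s * a -> uniq V -> (forall v, 0 <= psi v) ->
  (forall v, v \notin V -> psi v = 0) ->
  let B := \sum_(v <- V) (expR (s * psi v) - 1) in
  sigma * n%:R * (l ^+ d * B) <= A ->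
  Pbound P [set w | exists z, a <= \sum_(i < n) psi (cidx l (X i w) - z)]
    (2 * B * expR (ln n%:R + A - s * a)).
Proof.
move=> n0 l0 s0 sa uV psi0 psiV B hA.
have a0 : 0 < a by rewrite -(pmulr_rgt0 _ s0); apply: lt_le_trans sa; rewrite ltr01.
have := @exceedance_bound R d d0 Omega P X (samp_meas hS) nu (samp_law hS) (samp_indep hS) leb
  (samp_leb hS) sigma (samp_le hS) n l s a V psi l0 s0 a0 uV psi0 psiV.
rewrite -/B; apply: Pbound_le => //; apply: exceed_numeric => //.
  apply: sumr_ge0 => v _; rewrite subr_ge0 -expR0 ler_expR mulr_ge0 //; exact: ltW.
apply: le_trans hA; rewrite le_eqVlt; apply/orP; left; apply/eqP; ring.
Qed.

Variables (G : set (d.-tuple R -> R)) (Cm : R).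
Hypothesis Gw : forall phi, G phi -> weight leb phi /\ \int[leb]_x phi x <= Cm.
Hypothesis Gpos : exists2 phi, G phi & 0 < \int[leb]_x phi x.
Variable U : (nat -> d.-tuple R) -> nat -> R -> R.
Hypothesis U_low : forall (x : nat -> d.-tuple R) n r u phi, 0 < r -> G phi ->
  \sum_(i < n) phi (aff r^-1 u (x i)) <= U x n r.
Hypothesis U_mono : forall x n n' r r', (n <= n')%N -> 0 < r -> r <= r' -> U x n r <= U x n' r'.
(** The list of test functions depends neither on the points nor on n and r, so a union over it
    costs a constant. Cells have side c r, and c^d times the sum over cells is an exponential
    integral at unit scale. *)
Hypothesis U_up : forall e, 0 < e -> exists (c C : R) (K : nat)
  (V : nat -> seq {ffun 'I_d -> int}) (psi : nat -> {ffun 'I_d -> int} -> R),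
  [/\ 0 < c, 0 <= C,
      forall k, (k < K)%N -> [/\ uniq (V k), forall v, 0 <= psi k v,
        forall v, v \notin V k -> psi k v = 0 &
        exists2 phi, G phi & forall s, 0 <= s ->
          c ^+ d * \sum_(v <- V k) (expR (s * psi k v) - 1) <= (1 + e) * Jint leb phi s] &
      forall x n r, 0 < r -> exists2 k, (k < K)%N &
        exists z, U x n r <= (1 + e) * (\sum_(i < n) psi k (cidx (c * r) (x i) - z)) + C].

Local Notation FG t := (xi_sup leb G t).
Local Notation UX w n r := (U (fun i => X i w) n r).

(** The exponent of [xi_sup_dual] makes each test function exceed (1 + e)^2 times its target with
    probability of order n^(-2e). Two further factors 1 + e absorb the factor and the additive
    constant of [U_up]. *)
Lemma mid_up_prob t e : 0 < t -> 0 < e < 1 -> exists C, \forall n \near \oo, forall r, 0 < r ->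
  sigma * n%:R * r ^+ d = t * ln n%:R ->
  Pbound P [set w | (1 + e) ^+ 4 * (t * ln n%:R * FG t) < UX w n r] (C * expR (- (2 * e) * ln n%:R)).
Proof.
move=> t0 /andP[e0 e1]; have [c [C0 [K [V [psi [c0 C00 hk hU]]]]]] := U_up e0.
pose a n := (1 + e) ^+ 2 * (t * ln (n%:R : R) * FG t).
have H k : exists C, (k < K)%N -> forall n r, 1 <= ln (n%:R : R) -> 0 < r ->
    sigma * n%:R * r ^+ d = t * ln n%:R ->
    Pbound P [set w | exists z, a n <= \sum_(i < n) psi k (cidx (c * r) (X i w) - z)]
      (C * expR (- (2 * e) * ln n%:R)).
  have [kK|kK] := ltnP k K; last first.
    by exists 0.
  have [uV p0 pV [phi Gphi hJ]] := hk k kK.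
  have [s s0 hs] := xi_sup_dual Gw Gpos t0 Gphi.
  exists (2 * \sum_(v <- V k) (expR (s * psi k v) - 1)) => _ n r L1 r0 hr.
  have [wphi _] := Gw Gphi.
  have hA : sigma * n%:R * ((c * r) ^+ d * \sum_(v <- V k) (expR (s * psi k v) - 1)) <=
      t * ln n%:R * ((1 + e) * Jint leb phi s).
    have -> : sigma * n%:R * ((c * r) ^+ d * \sum_(v <- V k) (expR (s * psi k v) - 1)) =
        sigma * n%:R * r ^+ d * (c ^+ d * \sum_(v <- V k) (expR (s * psi k v) - 1)).
      by rewrite exprMn; ring.
    rewrite hr ler_wpM2l ?mulr_ge0 ?(ltW t0) ?(le_trans ler01 L1) //.
    exact: hJ (ltW s0).
  have [sa ex] := upper_numeric e0 t0 L1 (Jint_ge0 wphi (ltW s0)) hs (lexx _).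
  have n0 : (0 < n)%N.
    by rewrite lt0n; apply/eqP => n0; move: L1; rewrite n0 ln0 // ler10.
  apply: Pbound_le (window_exceed_prob n0 (mulr_gt0 c0 r0) s0 sa uV p0 pV hA) => //.
  rewrite ler_wpM2l ?ler_expR //.
  by rewrite mulr_ge0 // sumr_ge0 // => v _; rewrite subr_ge0 -expR0 ler_expR mulr_ge0 // ltW.
have [C hC] := choice H.
exists (\sum_(k <- iota 0 K) C k); near=> n => r r0 hr.
have L1 : 1 <= ln (n%:R : R) by near: n; exact: near_ln_ge.
have FG0 : 0 < FG t := xi_sup_gt0 Gw Gpos t0.
have L2 : C0 / (e * (t * FG t)) <= ln (n%:R : R) by near: n; exact: near_ln_ge.
rewrite mulr_suml.
have PB := @Pbound_big _ _ _ P _ (iota 0 K)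
  (fun k => [set w | exists z, a n <= \sum_(i < n) psi k (cidx (c * r) (X i w) - z)])
  (fun k => C k * expR (- (2 * e) * ln n%:R)).
apply: Pbound_le (PB _) => // [w /= hw|k]; last by rewrite mem_iota => /andP[_ kK]; exact: hC.
have [k kK [z hz]] := hU (fun i => X i w) n r r0.
exists k; rewrite ?mem_iota //; exists z.
rewrite leNgt; apply/negP => lt.
move: hw; apply/negP; rewrite -leNgt; apply: le_trans hz _.
have tLF : 0 <= t * ln (n%:R : R) * FG t by rewrite !mulr_ge0 ?(ltW t0) ?(ltW FG0) ?(le_trans ler01 L1).
apply: (slack_numeric (ltW e0) tLF (ltW lt)).
by move: L2; rewrite ler_pdivrMr ?mulr_gt0 // => /le_trans; apply; rewrite le_eqVlt; apply/orP; left; apply/eqP; ring.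
Unshelve. all: by end_near. Qed.

(** For large t one fixed small exponent [s] with e^s - 1 <= (1 + e) s is good enough for all t, and
    the tail is as small as n^(-2). *)
Lemma large_up_prob e : 0 < e < 1 -> exists T C : R, 0 < T /\ forall n r, 0 < r ->
  1 <= ln (n%:R : R) -> T * ln n%:R <= sigma * n%:R * r ^+ d ->
  Pbound P [set w | (1 + e) ^+ 5 * (sigma * n%:R * r ^+ d * mass_sup leb G) < UX w n r]
    (C * expR (- 2 * ln n%:R)).
Proof.
move=> e01; have /andP[e0 e1] := e01.
have [c [C0 [K [V [psi [c0 C00 hk hU]]]]]] := U_up e0.
have [s s0 hs] := expR_sub1_small e0.
set m := mass_sup leb G; have m0 : 0 < m := mass_sup_gt0 Gw Gpos.
(* The first summand makes the excess e s m mu at least 3 ln n, the second makes e m mu absorb the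
   additive constant [C0]. *)
pose T := 3 / (e * s * m) + C0 / (e * m).
have T1 : 0 < 3 / (e * s * m) by rewrite divr_gt0 // !mulr_gt0.
have T2 : 0 <= C0 / (e * m) by rewrite divr_ge0 // ltW // mulr_gt0.
exists T, (\sum_(k <- iota 0 K) 2 * \sum_(v <- V k) (expR (s * psi k v) - 1)).
split=> [|n r r0 L1 hT]; first by rewrite ltr_wpDr.
have L0 : 0 < ln (n%:R : R) := lt_le_trans ltr01 L1.
have n0 : (0 < n)%N by rewrite lt0n; apply/eqP => n0; move: L1; rewrite n0 ln0 // ler10.
set mu := sigma * n%:R * r ^+ d in hT *.
have mu0 : 0 <= mu by rewrite !mulr_ge0 ?exprn_ge0 ?(ltW r0) ?(ltW (samp_gt0 hS)).
pose a := (1 + e) ^+ 3 * (mu * m).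
have H k : (k < K)%N -> Pbound P [set w | exists z, a <= \sum_(i < n) psi k (cidx (c * r) (X i w) - z)]
    (2 * (\sum_(v <- V k) (expR (s * psi k v) - 1)) * expR (- 2 * ln n%:R)).
  move=> kK; have [uV p0 pV [phi Gphi hJ]] := hk k kK; have [wphi _] := Gw Gphi.
  have hA : sigma * n%:R * ((c * r) ^+ d * \sum_(v <- V k) (expR (s * psi k v) - 1)) <=
      mu * ((1 + e) ^+ 2 * (s * m)).
    have -> : sigma * n%:R * ((c * r) ^+ d * \sum_(v <- V k) (expR (s * psi k v) - 1)) =
        mu * (c ^+ d * \sum_(v <- V k) (expR (s * psi k v) - 1)) by rewrite exprMn /mu; ring.
    rewrite ler_wpM2l //; apply: le_trans (hJ s (ltW s0)) _.
    have e1' : 0 <= 1 + e by rewrite addr_ge0 // ltW.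
    have -> : (1 + e) ^+ 2 * (s * m) = (1 + e) * ((1 + e) * s * m) by ring.
    rewrite ler_wpM2l //; apply: le_trans (Jint_le wphi (ltW s0)) _.
    apply: ler_pM => //; [by rewrite subr_ge0 -expR0 ler_expR ltW| |exact: (mass_sup_ge Gw)].
    by apply: Rintegral_ge0 => x _; have [_ h _] := wphi; case/andP: (h x).
  have T3 : 3 / (e * s * m) <= T by rewrite lerDl.
  have [sa ex] := tail_numeric e01 s0 m0 L1 T3 hT hA.
  apply: Pbound_le (window_exceed_prob n0 (mulr_gt0 c0 r0) s0 sa uV p0 pV (lexx _)) => //.
  rewrite ler_wpM2l ?ler_expR //.
    by rewrite mulr_ge0 // sumr_ge0 // => v _; rewrite subr_ge0 -expR0 ler_expR mulr_ge0 // ltW.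
rewrite mulr_suml.
have PB := @Pbound_big _ _ _ P _ (iota 0 K)
  (fun k => [set w | exists z, a <= \sum_(i < n) psi k (cidx (c * r) (X i w) - z)])
  (fun k => 2 * (\sum_(v <- V k) (expR (s * psi k v) - 1)) * expR (- 2 * ln n%:R)).
apply: Pbound_le (PB _) => // [w /= hw|k]; last by rewrite mem_iota => /andP[_ kK]; exact: H.
have [k kK [z hz]] := hU (fun i => X i w) n r r0.
exists k; rewrite ?mem_iota //; exists z.
rewrite leNgt; apply/negP => lt.
move: hw; apply/negP; rewrite -leNgt; apply: le_trans hz _.
apply: (slack_numeric (ltW e0) (mulr_ge0 mu0 (ltW m0)) (ltW lt)).
have em : 0 < e * m by rewrite mulr_gt0.
have : C0 / (e * m) <= mu.
  apply: le_trans hT; apply: (@le_trans _ _ (T * 1)); last by rewrite ler_wpM2l // addr_ge0 // ltW.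
  by rewrite mulr1 lerDr ltW.
by rewrite ler_pdivrMr // mulrCA.
Qed.

(** A near-maximiser and its exponent are taken at [t] but used at t / (1 + e): there t G becomes 1
    / (1 + e), and the strict inequality needed for a power of n many successes holds. *)
Lemma mid_low_prob t e : 0 < t -> 0 < e < 1 -> exists C delta : R, 0 < delta /\
  \forall n \near \oo, forall r, 0 < r -> sigma * n%:R * r ^+ d = t / (1 + e) * ln n%:R ->
  Pbound P [set w | UX w n r < (1 - e) ^+ 2 * (t / (1 + e) * ln n%:R * FG t)]
    (C * expR (- delta * ln n%:R)).
Proof.
move=> t0 e01; have /andP[e0 e1] := e01; have e1' : 0 < 1 + e by rewrite addr_gt0.
have FG0 : 0 < FG t := xi_sup_gt0 Gw Gpos t0.
have [phi Gphi hphi] := xi_sup_approx Gw Gpos t0 e0.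
have [wphi _] := Gw Gphi.
have xi0 : 0 < xi leb phi t by apply: lt_trans hphi; rewrite mulr_gt0 // subr_gt0.
have int0 : 0 < \int[leb]_x phi x.
  rewrite lt_neqAle; apply/andP; split.
    by apply/eqP => h; move: xi0; rewrite (xi_null t wphi (esym h)) ltxx.
  by apply: Rintegral_ge0 => x _; have [_ h _] := wphi; case/andP: (h x).
have [s s0 [xiE hs]] := xi_attained wphi int0 t0.
have tp : 0 < t / (1 + e) by rewrite divr_gt0.
have I0 : 0 < Iint leb phi s by rewrite -xiE.
have tG : t / (1 + e) * Gint leb phi s < 1.
  rewrite (GintE wphi (ltW s0)) hs addrK mulrAC divff ?gt_eqF // div1r invf_lt1 //; lra.
have [C [delta [dl0 H]]] := weight_lower_mid hS wphi (ltW s0) tp I0 tG e01.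
exists C, delta; split=> //; near=> n => r r0 hr.
have L0 : 0 <= ln (n%:R : R) by near: n; exact: near_ln_ge.
have Hn : forall r, 0 < r -> sigma * n%:R * r ^+ d = t / (1 + e) * ln n%:R ->
  Pbound P [set w | forall u, \sum_(i < n) phi (aff r^-1 u (X i w)) <
      (1 - e) * (t / (1 + e) * ln n%:R * Iint leb phi s)] (C * expR (- delta * ln n%:R)).
  by near: n; exact: H.
apply: Pbound_le (Hn r r0 hr) => // w /= hw u.
apply: le_lt_trans (U_low _ _ _ r0 Gphi) (lt_le_trans hw _).
rewrite -xiE expr2 -mulrA ler_wpM2l ?subr_ge0 ?(ltW e1) //.
by have := ler_wpM2l (mulr_ge0 (ltW tp) L0) (ltW hphi); rewrite mulrCA.
Unshelve. all: by end_near. Qed.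

Lemma large_low_prob e : 0 < e < 1 -> exists T r0 : R, [/\ 0 < T, 0 < r0 &
  forall n r, 0 < r <= r0 -> 0 < ln (n%:R : R) -> T * ln n%:R <= sigma * n%:R * r ^+ d ->
  Pbound P [set w | UX w n r < (1 - e) ^+ 2 * (sigma * n%:R * r ^+ d * mass_sup leb G)]
    (expR (- 2 * ln n%:R))].
Proof.
move=> e01; have /andP[e0 e1] := e01.
set m := mass_sup leb G; have m0 : 0 < m := mass_sup_gt0 Gw Gpos.
have [phi Gphi hphi] := mass_sup_approx Gw Gpos e0; have [wphi _] := Gw Gphi.
have int0 : 0 < \int[leb]_x phi x by apply: lt_trans hphi; rewrite mulr_gt0 // subr_gt0.
have [T [r0 [T0 r00 H]]] := weight_lower_large hS wphi int0 e01.
exists T, r0; split=> // n r rr L0 hT; have r1 : 0 < r by case/andP: rr.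
apply: Pbound_le (H n r rr L0 hT) => // w /= hw u.
apply: le_lt_trans (U_low _ _ _ r1 Gphi) (lt_le_trans hw _).
rewrite expr2 -mulrA ler_wpM2l ?subr_ge0 ?(ltW e1) //.
by rewrite mulrCA ler_wpM2l ?(ltW hphi) // !mulr_ge0 ?exprn_ge0 ?(ltW r1) ?(ltW (samp_gt0 hS)).
Qed.

Lemma ler_radius (r r' : R) : 0 < r -> 0 < r' -> r ^+ d <= r' ^+ d -> r <= r'.
Proof.
by move=> r0 r0' h; rewrite -(@ler_pXn2r _ d) ?nnegrE ?(ltW r0) ?(ltW r0') // (samp_dim hS).
Qed.

(** The random bound is proved at n = j^k for a single radius; every larger n and r inherits it by
    monotonicity, hence the quantifier over [r] inside the almost sure event. *)
Lemma low_ae t e : 0 < t -> 0 < e < 1 ->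
  {ae P, forall w, \forall n \near \oo, forall r, 0 < r -> t * ln n%:R <= sigma * n%:R * r ^+ d ->
    (1 - e) ^+ 4 * (t * ln n%:R * FG t) <= UX w n r}.
Proof.
move=> t0 e01; have /andP[e0 e1] := e01; have e1' : 0 < 1 + e by rewrite addr_gt0.
have FG0 : 0 < FG t := xi_sup_gt0 Gw Gpos t0.
have [C [delta [dl0 H]]] := mid_low_prob t0 e01.
have sg0 := samp_gt0 hS.
(* The radius with mu = t / (1 + e) ln n. For ln n < 1 the value 1 is a placeholder. *)
have /choice[rad hrad] : forall n, exists r : R, 0 < r /\
    (1 <= ln (n%:R : R) -> sigma * n%:R * r ^+ d = t / (1 + e) * ln n%:R).
  move=> n; have [L1|L1] := boolP (1 <= ln (n%:R : R)); last by exists 1.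
  have n0 : 0 < n%:R :> R by rewrite ltr0n lt0n; apply/eqP => n0; move: L1; rewrite n0 ln0 // ler10.
  have c0 : 0 < t / (1 + e) * ln n%:R / (sigma * n%:R).
    by rewrite divr_gt0 ?mulr_gt0 ?invr_gt0 // (lt_le_trans ltr01).
  have [r r0 rE] := radius_exists (samp_dim hS) c0; exists r; split=> // _.
  by rewrite rE mulrC divfK // gt_eqF // mulr_gt0.
pose B n := [set w | UX w n (rad n) < (1 - e) ^+ 2 * (t / (1 + e) * ln n%:R * FG t)].
have HB : \forall n \near \oo, Pbound P (B n) (C * expR (- delta * ln n%:R)).
  near=> n; have L1 : 1 <= ln (n%:R : R) by near: n; exact: near_ln_ge.
  have [r0 hr] := hrad n.
  have Hn : forall r, 0 < r -> sigma * n%:R * r ^+ d = t / (1 + e) * ln n%:R ->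
    Pbound P [set w | UX w n r < (1 - e) ^+ 2 * (t / (1 + e) * ln n%:R * FG t)]
     (C * expR (- delta * ln n%:R)) by near: n; exact: H.
  exact: Hn r0 (hr L1).
have [k k0] := ae_powers dl0 HB.
apply: filterS => w hw; have hp := near_powers k0 e0 hw.
apply: filterS hp => n [j [hj _ jn nj [jk0 step [L1 LN]]]] r r0 hr.
have [rr0 /(_ L1) hrr] := hrad (j ^ k)%N.
have nj1 : n%:R <= (1 + e) * (j ^ k)%:R :> R by apply: le_trans step; rewrite ler_nat.
have jn1 : (j ^ k)%:R <= n%:R :> R by rewrite ler_nat.
have j1 : 0 < (j ^ k)%:R :> R by rewrite ltr0n.
have n1 : 0 < n%:R :> R := lt_le_trans j1 jn1.
have LL : ln (j ^ k)%:R <= ln n%:R :> R by rewrite ler_ln ?posrE.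
have LL2 : ln n%:R <= (1 + e) * ln (j ^ k)%:R :> R.
  have nN : n%:R <= (j.+1 ^ k)%:R :> R by rewrite ler_nat.
  by apply: le_trans LN; rewrite ler_ln ?posrE //; exact: lt_le_trans n1 nN.
have rrr : rad (j ^ k)%N <= r.
  apply: ler_radius => //; rewrite -(ler_pM2l (mulr_gt0 sg0 j1)) hrr.
  exact: low_radius_numeric (exprn_ge0 _ (ltW r0)) t0 e0 (ltW sg0) LL nj1 hr.
apply: le_trans (U_mono _ jn rr0 rrr).
have := hj; rewrite /B /= => /negP; rewrite -leNgt; apply: le_trans.
exact: low_rate_numeric e01 (ltW t0) (ltW FG0) (le_trans ler01 L1) LL2.
Unshelve. all: by end_near. Qed.

Lemma up_ae t e : 0 < t -> 0 < e < 1 ->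
  {ae P, forall w, \forall n \near \oo, forall r, 0 < r -> sigma * n%:R * r ^+ d <= t * ln n%:R ->
    UX w n r <= (1 + e) ^+ 6 * (t * ln n%:R * FG t)}.
Proof.
move=> t0 e01; have /andP[e0 e1] := e01; have e1' : 0 < 1 + e by rewrite addr_gt0.
have te0 : 0 < t * (1 + e) by rewrite mulr_gt0.
have tte : t <= t * (1 + e) by rewrite ler_peMr ?(ltW t0) // lerDl ltW.
have FG0 : 0 < FG (t * (1 + e)) := xi_sup_gt0 Gw Gpos te0.
have FGle : FG (t * (1 + e)) <= FG t := xi_sup_antitone Gw Gpos t0 tte.
have [C H] := mid_up_prob te0 e01.
have sg0 := samp_gt0 hS.
have dl0 : 0 < 2 * e by rewrite mulr_gt0.
have /choice[rad hrad] : forall n, exists r : R, 0 < r /\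
    (1 <= ln (n%:R : R) -> sigma * n%:R * r ^+ d = t * (1 + e) * ln n%:R).
  move=> n; have [L1|L1] := boolP (1 <= ln (n%:R : R)); last by exists 1.
  have n0 : 0 < n%:R :> R by rewrite ltr0n lt0n; apply/eqP => n0; move: L1; rewrite n0 ln0 // ler10.
  have c0 : 0 < t * (1 + e) * ln n%:R / (sigma * n%:R).
    by rewrite divr_gt0 ?mulr_gt0 // (lt_le_trans ltr01).
  have [r r0 rE] := radius_exists (samp_dim hS) c0; exists r; split=> // _.
  by rewrite rE mulrC divfK // gt_eqF // mulr_gt0.
pose B n := [set w | (1 + e) ^+ 4 * (t * (1 + e) * ln n%:R * FG (t * (1 + e))) < UX w n (rad n)].
have HB : \forall n \near \oo, Pbound P (B n) (C * expR (- (2 * e) * ln n%:R)).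
  near=> n; have L1 : 1 <= ln (n%:R : R) by near: n; exact: near_ln_ge.
  have [r0 hr] := hrad n.
  have Hn : forall r, 0 < r -> sigma * n%:R * r ^+ d = t * (1 + e) * ln n%:R ->
    Pbound P [set w | (1 + e) ^+ 4 * (t * (1 + e) * ln n%:R * FG (t * (1 + e))) < UX w n r]
     (C * expR (- (2 * e) * ln n%:R)) by near: n; exact: H.
  exact: Hn r0 (hr L1).
have [k k0] := ae_powers dl0 HB.
apply: filterS => w hw; have hp := near_powers k0 e0 hw.
apply: filterS hp => n [j [_ hj jn nj [jk0 step [L1 LN]]]] r r0 hr.
have j1 : 0 < (j ^ k)%:R :> R by rewrite ltr0n.
have jn1 : (j ^ k)%:R <= n%:R :> R by rewrite ler_nat.
have n1 : 0 < n%:R :> R := lt_le_trans j1 jn1.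
have nN : n%:R <= (j.+1 ^ k)%:R :> R by rewrite ler_nat.
have N1 : 0 < (j.+1 ^ k)%:R :> R := lt_le_trans n1 nN.
have LL : ln (j ^ k)%:R <= ln n%:R :> R by rewrite ler_ln ?posrE.
have LL3 : ln n%:R <= ln (j.+1 ^ k)%:R :> R by rewrite ler_ln ?posrE.
have LL2 : ln (j.+1 ^ k)%:R <= (1 + e) * ln n%:R :> R.
  by apply: le_trans LN _; rewrite ler_pM2l.
have [rr0 /(_ (le_trans L1 (le_trans LL LL3))) hrr] := hrad (j.+1 ^ k)%N.
have Nn : (j.+1 ^ k)%:R <= (1 + e) * n%:R :> R by apply: le_trans step _; rewrite ler_pM2l.
have rrr : r <= rad (j.+1 ^ k)%N.
  apply: ler_radius => //; rewrite -(ler_pM2l (mulr_gt0 sg0 N1)) hrr.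
  exact: up_radius_numeric (exprn_ge0 _ (ltW r0)) t0 e0 (ltW sg0) LL3 Nn hr.
apply: le_trans (U_mono _ nj r0 rrr) _.
have := hj; rewrite /B /= => /negP; rewrite -leNgt => hle; apply: le_trans hle _.
exact: up_rate_numeric e01 (ltW t0) (ltW FG0) FGle (le_trans ler01 (le_trans L1 LL)) LL2.
Unshelve. all: by end_near. Qed.

(** A finite geometric grid of values of t covers [tau, T]. Between neighbours t changes by a factor
    1 + e, and the supremum, being antitone, errs on the favourable side at either end. *)
Lemma mid_ae tau T e : 0 < tau -> 0 < e < 1 ->
  {ae P, forall w, \forall n \near \oo, forall r, 0 < r ->
    let mu := sigma * n%:R * r ^+ d in tau * ln n%:R <= mu <= T * ln n%:R ->
    (1 - e) ^+ 5 * (mu * FG (mu / ln n%:R)) <= UX w n r <= (1 + e) ^+ 7 * (mu * FG (mu / ln n%:R))}.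
Proof.
move=> tau0 e01; have /andP[e0 e1] := e01; have e1' : 0 < 1 + e by rewrite addr_gt0.
pose tt i : R := tau * (1 + e) ^+ i.
have tt0 i : 0 < tt i by rewrite mulr_gt0 // exprn_gt0.
have [I hI] := geometric_exceeds T tau0 e0.
have /ae_foralln := fun i => low_ae (tt0 i) e01.
have /ae_foralln := fun i => up_ae (tt0 i) e01.
apply: filterS2 => w hup hlow.
have H1 := filter_forall (F := \oo) ltac:(typeclasses eauto) (fun i : 'I_I.+1 => hlow (nat_of_ord i)).
have H2 := filter_forall (F := \oo) ltac:(typeclasses eauto) (fun i : 'I_I.+1 => hup (nat_of_ord i).+1).
have H3 := near_ln_ge (1 : R).
near=> n => r r0; set mu := sigma * n%:R * r ^+ d; move=> /andP[hlo hhi].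
have L1 : 1 <= ln (n%:R : R) by near: n.
have H1n : forall i : 'I_I.+1, forall r, 0 < r -> tt i * ln n%:R <= sigma * n%:R * r ^+ d ->
    (1 - e) ^+ 4 * (tt i * ln n%:R * FG (tt i)) <= UX w n r by near: n.
have H2n : forall i : 'I_I.+1, forall r, 0 < r -> sigma * n%:R * r ^+ d <= tt i.+1 * ln n%:R ->
    UX w n r <= (1 + e) ^+ 6 * (tt i.+1 * ln n%:R * FG (tt i.+1)) by near: n.
have L0 : 0 < ln (n%:R : R) := lt_le_trans ltr01 L1.
pose t := mu / ln n%:R; have muE : mu = t * ln n%:R by rewrite /t divfK // gt_eqF.
have ht1 : tau <= t by rewrite /t ler_pdivlMr.
have ht2 : t <= T by rewrite /t ler_pdivrMr.
have t0 : 0 < t := lt_le_trans tau0 ht1.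
have [i [iI hi1 hi2]] : exists i, [/\ (i < I.+1)%N, tt i <= t & t <= tt i.+1].
  have ex : exists i, t < tt i.+1.
    exists I; apply: le_lt_trans ht2 (lt_le_trans hI _).
    by rewrite /tt exprS mulrCA ler_peMl ?(ltW (tt0 I)) // lerDl ltW.
  case: (ex_minnP ex) => i hi himin; exists i; split; [|case: i hi himin => [|i] hi himin|exact: ltW].
  - rewrite ltnS himin //; apply: le_lt_trans ht2 (lt_le_trans hI _).
    by rewrite /tt exprS mulrCA ler_peMl ?(ltW (tt0 I)) // lerDl ltW.
  - by rewrite /tt expr0 mulr1.
  - by rewrite leNgt; apply/negP => /himin; rewrite ltnn.
have tS : tt i.+1 = (1 + e) * tt i by rewrite /tt exprS mulrCA.
rewrite -/t; apply/andP; split.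
  apply: le_trans (H1n (Ordinal iI) r r0 _); last by rewrite -/mu muE ler_pM2r.
  rewrite /= muE; apply: low_grid_numeric e01 (ltW (tt0 i)) _ (ltW L0) _ _.
  - exact: ltW (xi_sup_gt0 Gw Gpos t0).
  - by rewrite -tS.
  - by have := xi_sup_antitone Gw Gpos (tt0 i) hi1.
apply: le_trans (H2n (Ordinal iI) r r0 _) _; first by rewrite -/mu muE ler_pM2r.
rewrite /= muE; apply: up_grid_numeric e01 (ltW t0) _ (ltW L0) _ _.
- exact: ltW (xi_sup_gt0 Gw Gpos (tt0 i.+1)).
- by rewrite tS ler_pM2l.
- by have := xi_sup_antitone Gw Gpos t0 hi2.
Unshelve. all: by end_near. Qed.

Lemma large_ae e (r : nat -> R) : 0 < e < 1 -> (forall n, 0 < r n) -> r @ \oo --> 0 ->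
  exists2 T : R, 0 < T & {ae P, forall w, \forall n \near \oo,
    let mu := sigma * n%:R * r n ^+ d in T * ln n%:R <= mu ->
    (1 - e) ^+ 5 * (mu * FG (mu / ln n%:R)) <= UX w n (r n) <= (1 + e) ^+ 7 * (mu * FG (mu / ln n%:R))}.
Proof.
move=> e01 r0 rlim; have /andP[e0 e1] := e01; have e1' : 0 < 1 + e by rewrite addr_gt0.
set m := mass_sup leb G; have m0 : 0 < m := mass_sup_gt0 Gw Gpos.
have [s s0 hs] := expR_sub1_small e0.
have [T1 [C [T10 Hup]]] := large_up_prob e01.
have [T2 [rho [T20 rho0 Hlow]]] := large_low_prob e01.
(* The third summand gives 1 / (s t) <= e m, so that beyond [T] the supremum is at most (1 + e)^2
   [m] and may be replaced by its limit. *)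
pose T := T1 + T2 + (s * (e * m))^-1.
have sem : 0 < s * (e * m) by rewrite !mulr_gt0.
have T0 : 0 < T by rewrite addr_gt0 ?addr_gt0 // invr_gt0.
exists T => //; pose mu n := sigma * n%:R * r n ^+ d.
have sg0 := samp_gt0 hS.
pose B n := [set w | T * ln n%:R <= mu n /\
  (UX w n (r n) < (1 - e) ^+ 2 * (mu n * m) \/ (1 + e) ^+ 5 * (mu n * m) < UX w n (r n))].
have hr : \forall n \near \oo, 0 < r n <= rho.
  by near=> n; rewrite r0 /=; near: n; exact: (cvgr_le _ rlim).
pose C' := Num.max C 0 + 1; have C'0 : 0 <= C' by rewrite addr_ge0 // le_max lexx orbT.
have HB : \forall n \near \oo, Pbound P (B n) (C' * expR (- 2 * ln n%:R)).
  near=> n; have L1 : 1 <= ln (n%:R : R) by near: n; exact: near_ln_ge.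
  have L0 : 0 < ln (n%:R : R) := lt_le_trans ltr01 L1.
  have rr : 0 < r n <= rho by near: n.
  have E0 := expR_ge0 (- 2 * ln n%:R : R).
  have [hT|hT] := boolP (T * ln n%:R <= mu n); last first.
    exists set0; split; [exact: measurable0|by move=> w [h]; move: hT; rewrite h|].
    by rewrite measure0 lee_fin mulr_ge0.
  have h1 : T1 * ln n%:R <= mu n.
    by apply: le_trans hT; rewrite ler_pM2r // /T -addrA lerDl addr_ge0 ?(ltW T20) // invr_ge0 ltW.
  have h2 : T2 * ln n%:R <= mu n.
    by apply: le_trans hT; rewrite ler_pM2r // /T addrAC lerDr addr_ge0 ?(ltW T10) // invr_ge0 ltW.
  have [E1 [mE1 BE1 PE1]] := Hup n (r n) (r0 n) L1 h1.
  have [E2 [mE2 BE2 PE2]] := Hlow n (r n) rr L0 h2.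
  exists (E1 `|` E2); split; first exact: measurableU.
    by move=> w [_ [hw|hw]]; [right; exact: BE2|left; exact: BE1].
  apply: le_trans (measureU2 _ mE1 mE2) _.
  rewrite /C' mulrDl mul1r EFinD; apply: leeD => //.
  by apply: le_trans PE1 _; rewrite lee_fin ler_wpM2r // le_max lexx.
apply: filterS (Pbound_borel_cantelli HB (fun n => mulr_ge0 C'0 (expR_ge0 _)) (c := C' * 3) _); last first.
  by move=> n; rewrite -mulr_sumr ler_wpM2l // sum_inverse_squares.
move=> w hw; near=> n; set mun := sigma * n%:R * r n ^+ d => hT.
have L1 : 1 <= ln (n%:R : R) by near: n; exact: near_ln_ge.
have L0 : 0 < ln (n%:R : R) := lt_le_trans ltr01 L1.
have hB : ~ B n w by near: n.
have mu0 : 0 < mun by apply: lt_le_trans hT; rewrite mulr_gt0.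
pose t := mun / ln n%:R.
have tT : T <= t by rewrite /t ler_pdivlMr.
have t0 : 0 < t := lt_le_trans T0 tT.
have Fm : m <= FG t := mass_sup_le_xi_sup Gw Gpos t0.
have Fle : FG t <= (1 + e) ^+ 2 * m.
  apply: le_trans (xi_sup_le_mass Gw Gpos s0 t0) _.
  have ems : (s * t)^-1 <= e * m.
    have h0 : (s * (e * m))^-1 <= t by apply: le_trans tT; rewrite /T lerDr addr_ge0 // ltW.
    rewrite -div1r (ler_pdivrMr _ _ sem) in h0.
    rewrite -div1r (ler_pdivrMr _ _ (mulr_gt0 s0 t0)).
    by rewrite (_ : e * m * (s * t) = t * (s * (e * m))) //; ring.
  have sm : (expR s - 1) / s * m <= (1 + e) * m by rewrite ler_pM2r // ler_pdivrMr.
  by apply: le_trans (lerD ems sm) _; rewrite -mulrDl ler_pM2r // expr2; nra.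
have lo : (1 - e) ^+ 2 * (mun * m) <= UX w n (r n).
  by rewrite leNgt; apply/negP => h; apply: hB; split=> //; left.
have hi : UX w n (r n) <= (1 + e) ^+ 5 * (mun * m).
  by rewrite leNgt; apply/negP => h; apply: hB; split=> //; right.
rewrite -/t; apply/andP; split.
  apply: le_trans lo; exact: low_tail_numeric e01 (ltW mu0) (ltW m0) Fle.
apply: le_trans hi _; exact: up_tail_numeric e01 (ltW mu0) (ltW m0) Fm.
Unshelve. all: by end_near. Qed.

Lemma asymptotic_ratio tau e (r : nat -> R) : 0 < tau -> 0 < e < 1 ->
  (forall n, 0 < r n) -> r @ \oo --> 0 ->
  {ae P, forall w, \forall n \near \oo,
    let mu := sigma * n%:R * r n ^+ d in tau * ln n%:R <= mu ->
    (1 - e) * (mu * FG (mu / ln n%:R)) <= UX w n (r n) <= (1 + e) * (mu * FG (mu / ln n%:R))}.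
Proof.
move=> tau0 /andP[e0 e1] r0 rlim.
(* The accumulated errors are (1 - b)^5 and (1 + b)^7, and (1 + b)^7 <= 1 + (2^7 - 1) b for b <=
   1. *)
pose b := e / 2 ^+ 7; have b0 : 0 < b by rewrite divr_gt0 // exprn_gt0.
have b27 : 2 ^+ 7 * b = e by rewrite /b mulrC divfK // gt_eqF // exprn_gt0.
have b1 : b < 1 by move: b27; rewrite -natrX; lra.
have b01 : 0 < b < 1 by rewrite b0.
have b01' : 0 <= b <= 1 by rewrite !ltW.
have [T T0 Hl] := large_ae b01 r0 rlim.
apply: filterS2 Hl (mid_ae T tau0 b01) => w hl hm.
near=> n; set mu := sigma * n%:R * r n ^+ d => htau.
have L1 : 1 <= ln (n%:R : R) by near: n; exact: near_ln_ge.
have L0 : 0 < ln (n%:R : R) := lt_le_trans ltr01 L1.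
have hl' : let mu := sigma * n%:R * r n ^+ d in T * ln n%:R <= mu ->
    (1 - b) ^+ 5 * (mu * FG (mu / ln n%:R)) <= UX w n (r n) <= (1 + b) ^+ 7 * (mu * FG (mu / ln n%:R)).
  by near: n.
have hm' : forall r, 0 < r -> let mu := sigma * n%:R * r ^+ d in tau * ln n%:R <= mu <= T * ln n%:R ->
    (1 - b) ^+ 5 * (mu * FG (mu / ln n%:R)) <= UX w n r <= (1 + b) ^+ 7 * (mu * FG (mu / ln n%:R)).
  by near: n.
have : (1 - b) ^+ 5 * (mu * FG (mu / ln n%:R)) <= UX w n (r n) <= (1 + b) ^+ 7 * (mu * FG (mu / ln n%:R)).
  have [h|h] := lerP (T * ln n%:R) mu; first exact: hl'.
  by apply: hm' => //; rewrite htau ltW.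
have mu0 : 0 < mu by apply: lt_le_trans htau; rewrite mulr_gt0.
have F0 : 0 < FG (mu / ln n%:R) by apply: (xi_sup_gt0 Gw Gpos); rewrite divr_gt0.
have muF := mulr_ge0 (ltW mu0) (ltW F0).
move=> /andP[h1 h2]; apply/andP; split.
  apply: le_trans h1; rewrite ler_wpM2r //; apply: le_trans (pow_1B_ge 5 b01').
  by rewrite lerD2l lerN2 -b27 ler_pM2r // -natrX ler_nat.
apply: le_trans h2 _; rewrite ler_wpM2r //; apply: le_trans (pow_1D_le 7 b01') _.
by rewrite lerD2l mulrBl mul1r b27 gerBl ltW.
Unshelve. all: by end_near. Qed.

End Asymptotics.

(** * Geometric graphs *)

Section Feasible.
Variables (R : realType) (d : nat).
Hypothesis hd : (1 <= d)%N.
Variable N : 'rV[R]_d -> R.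
Hypothesis hN : is_norm N.
Variable leb : {measure set (d.-tuple R) -> \bar R}.
Hypothesis hleb : is_lebesgue leb.

Lemma feasible_sum phi (s : seq (d.-tuple R)) : feasible N phi -> uniq s ->
  (forall x y, x \in s -> y \in s -> x != y -> 1 < dist N x y) -> \sum_(x <- s) phi x <= 1.
Proof.
move=> [p0 mp hp] us hs; have /hp h : well_spread N [set` s].
  by move=> x y /= xs ys /eqP; exact: hs.
rewrite -lee_fin -sumEFin; apply: le_trans h; apply: esum_ge; exists [set` s].
  by split=> //; exact: finite_seq.
by rewrite -fsbig_seq.
Qed.

Lemma feasible_le1 phi x : feasible N phi -> phi x <= 1.
Proof.
move=> fp; have := @feasible_sum phi [:: x] fp isT; rewrite big_seq1; apply=> y z.
by rewrite !inE => /eqP -> /eqP ->; rewrite eqxx.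
Qed.

Definition translation (a : R) (z : {ffun 'I_d -> int}) : d.-tuple R := [tuple (z i)%:~R * a | i < d].

Lemma cidx_translate a z x : 0 < a -> cidx a (aff 1 (translation a z) x) = z + cidx a x.
Proof.
move=> a0; apply/ffunP => i; rewrite !ffunE !tnth_mktuple mul1r mulrDl mulfK ?gt_eqF //.
by rewrite floorDzr ?intr_int // intrKfloor.
Qed.

Lemma ge0_integral_translate (h : d.-tuple R -> \bar R) u D : measurable D ->
  measurable_fun setT h -> (forall x, (0 <= h x)%E) ->
  (\int[leb]_(x in D) h x = \int[leb]_(x in aff 1 u @^-1` D) h (aff 1 u x))%E.
Proof.
move=> mD mh h0; have ma := measurable_aff 1 u.
have := @ge0_integral_pushforward _ _ _ _ R (aff 1 u) ma leb D h mD
  (measurable_funS measurableT (@subsetT _ _) mh) (fun x _ => h0 x).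
move=> <-; apply: eq_measure_integral => A mA _.
by symmetry; have := leb_aff hleb u ltr01 mA; rewrite expr1n invr1 mul1e.
Qed.

(** With spacing 2 K, where [K] bounds coordinates by the norm, distinct lattice translates of a
    point are at distance at least 2. *)
Lemma lattice_spread : exists2 a : R, 0 < a & forall x z w, z != w ->
  1 < dist N (aff 1 (translation a z) x) (aff 1 (translation a w) x).
Proof.
have [K K0 hK] := coord_le_norm hd hN; exists (2 * K); first exact: mulr_gt0.
move=> x z w zw; have [i zwi] : exists i, z i != w i.
  by apply/existsP; rewrite -negb_forall; apply: contra zw => /forallP h; apply/eqP/ffunP => i; exact/eqP.
have := hK (tvec (aff 1 (translation (2 * K) z) x) - tvec (aff 1 (translation (2 * K) w) x)) i.
rewrite tvecB !tnth_mktuple opprD addrACA subrr addr0 -mulrBl -intrB normrM (gtr0_norm (mulr_gt0 _ K0)) // mulrCA.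
have h1 : 1 <= `|(z i - w i)%:~R : R|.
  by rewrite -intr_norm ler1z -gtz0_ge1 normr_gt0 subr_eq0.
rewrite -/(dist N _ _); set D := dist N _ _; set Z := `|_| => h.
have h2 : K * 2 <= K * D by apply: le_trans h; rewrite mulrC ler_pM2l // ler_peMl // ltW.
by rewrite ler_pM2l // in h2; apply: lt_le_trans h2; rewrite ltr1n.
Qed.

(** The lattice translates of a point form a well-spread set, so [phi] sums to at most 1 over them;
    integrating over one lattice cell bounds the total mass by the volume a^d of the cell. *)
Lemma feasible_weight : exists C, forall phi, feasible N phi ->
  weight leb phi /\ \int[leb]_x phi x <= C.
Proof.
have [a a0 ha] := lattice_spread; exists (a ^+ d) => phi fp; have [p0 mp hp] := fp.
have mE : measurable_fun setT (EFin \o phi) by exact/measurable_EFinP.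
have tr (z : {ffun 'I_d -> int}) x : cidx a x = 0 -> cidx a (aff 1 (translation a z) x) = z.
  by move=> x0; rewrite cidx_translate // x0 addr0.
have cellint (z : {ffun 'I_d -> int}) : (\int[leb]_(x in cell a z) (phi x)%:E =
    \int[leb]_(x in cell a 0%R) (phi (aff 1 (translation a z) x))%:E)%E.
  rewrite (ge0_integral_translate (translation a z) (measurable_cell z a0) mE); last first.
    by move=> x; rewrite lee_fin.
  congr integral; apply/seteqP; split=> x; rewrite /cell /= cidx_translate //.
    by move=> h; apply: (@addrI _ z); rewrite addr0.
  by move=> ->; rewrite addr0.
have bound (s : seq {ffun 'I_d -> int}) : uniq s -> (\sum_(z <- s) \int[leb]_(x in cell a z) (phi x)%:E <= (a ^+ d)%:E)%E.
  move=> us; rewrite (eq_bigr _ (fun z _ => cellint z)).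
  rewrite -ge0_integral_sum; first last.
  - by move=> z x _; rewrite lee_fin.
  - move=> z; apply/measurable_EFinP; apply: measurableT_comp => //.
    by apply: (@measurable_funS _ _ _ _ setT) => //; exact: measurable_aff.
  - exact: measurable_cell.
  apply: (@le_trans _ _ (\int[leb]_(x in cell a 0%R) 1)%E); last first.
    by rewrite integral_cst ?mul1e ?leb_cell //; exact: measurable_cell.
  apply: ge0_le_integral => //; first exact: measurable_cell.
  - by move=> x _; apply: sume_ge0 => z _; rewrite lee_fin.
  - apply: emeasurable_sum => z; apply/measurable_EFinP; apply: measurableT_comp => //.
    by apply: (@measurable_funS _ _ _ _ setT) => //; exact: measurable_aff.
  move=> x cx; rewrite sumEFin lee_fin.
  have := @feasible_sum phi [seq aff 1 (translation a z) x | z <- s] fp.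
  rewrite big_map; apply.
    rewrite map_inj_in_uniq // => z w _ _ /(congr1 (cidx a)).
    by rewrite !tr.
  move=> _ _ /mapP[z _ ->] /mapP[w _ ->] zw; apply: ha.
  by apply: contra zw => /eqP ->.
have total : (\int[leb]_x (phi x)%:E <= (a ^+ d)%:E)%E.
  have bigE : \bigcup_i @cube R d i = setT.
    by apply/seteqP; split=> x // _; have [M hM] := cube_cover x; exists M.
  have sq M M' : (M <= M')%N -> @cube R d M `<=` cube M'.
    move=> MM x /cubeP hx; apply/cubeP => i; have /andP[h1 h2] := hx i.
    have h : M%:R <= M'%:R :> R by rewrite ler_nat.
    by rewrite (le_trans _ h1) ?lerN2 // (lt_le_trans h2).
  have cvg : (\int[leb]_(x in @cube R d i) (phi x)%:E)%E @[i --> \oo] --> (\int[leb]_x (phi x)%:E)%E.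
    rewrite -bigE; apply: ge0_nondecreasing_set_cvg_integral => [M M' MM|M|M|M x _].
    - by rewrite subsetEset; exact: sq.
    - exact: measurable_box.
    - by apply: (@measurable_funS _ _ _ _ setT).
    - by rewrite lee_fin.
  rewrite -(cvg_lim _ cvg) //; apply: lime_le; first by apply/cvg_ex; exists (\int[leb]_x (phi x)%:E)%E.
  apply: nearW => M; have [s us hs] := cell_subset_finite d M a0.
  pose D := \big[setU/set0]_(z <- s) cell a z.
  have mD : measurable D by apply: bigsetU_measurable => z _; exact: measurable_cell.
  have sD : @cube R d M `<=` D.
    move=> x /cubeP hx; rewrite /D -bigcup_seq; exists (cidx a x); first exact: hs.
    by [].
  apply: (@le_trans _ _ (\int[leb]_(x in D) (phi x)%:E)%E).
    apply: ge0_subset_integral => //; first exact: measurable_box.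
    - by apply: (@measurable_funS _ _ _ _ setT).
    - by move=> x _; rewrite lee_fin.
  rewrite ge0_integral_bigsetU //; first exact: bound.
  - by move=> z; exact: measurable_cell.
  - by move=> z w _ _ [x [<- <-]].
  - by apply: (@measurable_funS _ _ _ _ setT).
  - by move=> x _; rewrite lee_fin.
have w : weight leb phi.
  split=> //; first by move=> x; rewrite p0 (feasible_le1 _ fp).
  apply/integrableP; split => //; apply: le_lt_trans (ltry (a ^+ d)).
  apply: le_trans total; rewrite le_eqVlt; apply/orP; left; apply/eqP.
  by apply: eq_integral => x _; rewrite /= ger0_norm.
split=> //; rewrite -lee_fin /Rintegral fineK //.
by have [_ _ ip] := w; exact: (integrable_fin_num measurableT ip).
Qed.

Definition ball_weight : d.-tuple R -> R := \1_(Ball N (origin R d) (1/2)).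

Lemma ball_feasible : feasible N ball_weight.
Proof.
split=> [x||S hS].
- by rewrite /ball_weight indicE ler0n.
- by apply: measurable_indic; exact: measurable_Ball.
apply: ub_ereal_sup => _ [X [fX XS] <-].
rewrite fsbig_finite //= sumEFin lee_fin.
pose s : seq (d.-tuple R) := finmap.enum_fset (fset_set X).
rewrite -/s.
have us : uniq s by exact: finmap.fset_uniq.
have inS x : x \in s -> S x by rewrite in_fset_set // inE => /XS.
have two x y : S x -> S y -> ball_weight x != 0 -> ball_weight y != 0 -> x = y.
  move=> Sx Sy; rewrite /ball_weight !indicE.
  case: (boolP (x \in _)) => [/set_mem bx _|]; last by rewrite eqxx.
  case: (boolP (y \in _)) => [/set_mem by' _|]; last by rewrite eqxx.
  apply: contrapT => /(hS _ _ Sx Sy); apply/negP; rewrite -leNgt.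
  apply: (le_trans (dist_triangle hN x (origin R d) y)).
  by move: bx by'; rewrite /Ball /= (dist_sym hN (origin R d) x); lra.
elim: s us inS => [|x t IH] /= us inS; first by rewrite big_nil.
have /andP[xt ut] := us.
rewrite big_cons; have [x0|x0] := eqVneq (ball_weight x) 0.
  by rewrite x0 add0r; apply: IH => // y yt; apply: inS; rewrite inE yt orbT.
rewrite big_seq big1 ?addr0; first by rewrite /ball_weight indicE lern1 leq_b1.
move=> y yt; apply/eqP; apply: contraT => y0.
have xy : x = y by apply: two => //; apply: inS; rewrite ?mem_head // inE yt orbT.
by move: xt; rewrite xy yt.
Qed.

End Feasible.

(** * Cyclic distribution of the points of a cell *)

Section ResidueCount.
Local Open Scope nat_scope.

Definition prefix_count (p : pred nat) n := \sum_(i < n) p i.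

Lemma prefix_countS p n : prefix_count p n.+1 = prefix_count p n + p n.
Proof. exact: big_ord_recr. Qed.

Lemma prefix_count_lt (p : pred nat) i n : i < n -> p i -> prefix_count p i < prefix_count p n.
Proof.
elim: n => // n IH; rewrite ltnS leq_eqVlt prefix_countS => /predU1P[->|lt] pi.
  by rewrite pi addn1.
by apply: leq_trans (IH lt pi) _; exact: leq_addr.
Qed.

Lemma prefix_count_inj (p : pred nat) i j : p i -> p j -> prefix_count p i = prefix_count p j -> i = j.
Proof.
move=> pi pj e; case: (ltngtP i j) => // lt.
  by have := prefix_count_lt lt pi; rewrite e ltnn.
by have := prefix_count_lt lt pj; rewrite e ltnn.
Qed.

(** If the members of [p] are dealt in turn to [k] receivers, receiver [c] gets exactly (count + k -
    1 - c) / k of them, rounded down. *)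
Lemma residue_count_le (p : pred nat) k c n : c < k ->
  prefix_count (fun i => p i && (prefix_count p i %% k == c)) n * k <= prefix_count p n + k.
Proof.
move=> ck; have k0 : 0 < k by exact: leq_ltn_trans ck.
suff -> : prefix_count (fun i => p i && (prefix_count p i %% k == c)) n =
    (prefix_count p n + (k.-1 - c)) %/ k.
  by apply: leq_trans (leq_divM _ _) _; rewrite leq_add2l (leq_trans (leq_subr _ _)) // leq_pred.
elim: n => [|n IH].
  by rewrite /prefix_count !big_ord0 add0n divn_small // (leq_ltn_trans (leq_subr _ _)) // prednK.
rewrite !prefix_countS IH; case: (p n) => /=; last by rewrite !addn0.
set m := prefix_count p n; rewrite addn1 addSn divnS // addnC; congr (nat_of_bool _ + _).
have -> : (m + (k.-1 - c)).+1 = m + k - c by lia.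
by rewrite -eqn_mod_dvd; [rewrite modnDr (modn_small ck)|lia].
Qed.

End ResidueCount.

Lemma residue_inj (P : nat) (a b : int) : (0 < P)%N ->
  `|(a %% P%:Z)%Z|%N = `|(b %% P%:Z)%Z|%N -> `|a - b| < P%:Z -> a = b.
Proof.
move=> P0 h; have Pn : P%:Z != 0 by rewrite -lt0n in P0 *; lia.
have ha := modz_ge0 a Pn; have hb := modz_ge0 b Pn.
have : (a == b %[mod P%:Z])%Z by apply/eqP; rewrite -(gez0_abs ha) -(gez0_abs hb) h.
rewrite eqz_mod_dvd => /dvdzP[c E]; rewrite ltr_norml => /andP[h1 h2].
have c0 : c = 0 by nia.
by apply/eqP; rewrite -subr_eq0 E c0 mul0r.
Qed.

Lemma offset_gap (z1 z2 : int) (v w K g : nat) : `|z1 - z2| <= g%:Z -> (v < K)%N -> (w < K)%N ->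
  `|(z1 - v%:Z) - (z2 - w%:Z)| < (K + g)%N%:Z.
Proof. lia. Qed.

Lemma offset_swap (z1 z2 v w : int) : z1 - v = z2 - w -> z1 - z2 = v - w.
Proof. lia. Qed.

Lemma offset_box_lt (z z0 : int) (g : nat) : `|z - z0| <= g%:Z -> (`|(z - z0 + g%:Z)%R|%N < (g + g).+1)%N.
Proof. lia. Qed.

Lemma offset_box_abs (z z0 : int) (g : nat) : `|z - z0| <= g%:Z -> `|(z - z0 + g%:Z)%R|%N%:Z = z - (z0 - g%:Z).
Proof. lia. Qed.

Lemma ffun_subE (T : finType) (u v : {ffun T -> int}) k : (u - v) k = u k - v k.
Proof. by rewrite !ffunE. Qed.

Lemma coloring_numeric (R : realType) (A B C0 eps ch : R) : 0 < B -> 0 < 1 + eps -> A / B <= 1 + eps ->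
  let Cc := A * (B + C0) + 1 in Cc < ch -> ch <= A * ((ch - Cc) / (1 + eps) / B + B + C0) -> False.
Proof.
move=> B0 e0 AB Cc Cch; rewrite -addrA mulrDr => h.
have : A * ((ch - Cc) / (1 + eps) / B) <= ch - Cc.
  have -> : A * ((ch - Cc) / (1 + eps) / B) = (A / B) * ((ch - Cc) / (1 + eps)) by ring.
  apply: (@le_trans _ _ ((1 + eps) * ((ch - Cc) / (1 + eps)))).
    by rewrite ler_wpM2r // divr_ge0 ?subr_ge0 // ltW.
  by rewrite mulrCA divff ?mulr1 // gt_eqF.
by move: h; rewrite /Cc; lra.
Qed.

(** * Chromatic and clique numbers enclosed by weighted counts *)

Section GeometricGraphs.
Variables (R : realType) (d : nat).
Hypothesis hd : (1 <= d)%N.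
Variable N : 'rV[R]_d -> R.
Hypothesis hN : is_norm N.
Implicit Types (n : nat) (r e : R).

Definition rgg (x : nat -> d.-tuple R) n r : rel 'I_n := fun i j => dist N (x i) (x j) <= r.
Definition chi x n r : R := (chromatic_number (@rgg x n r))%:R.
Definition clq x n r : R := (clique_number (@rgg x n r))%:R.

(** Scaled by 1/r, a colour class is a well-spread set, so each colour carries weight at most 1. *)
Lemma chi_low (x : nat -> d.-tuple R) n r u phi : 0 < r -> feasible N phi ->
  \sum_(i < n) phi (aff r^-1 u (x i)) <= chi x n r.
Proof.
move=> r0 fp; have /colorableP[c [ck hc]] := chromatic_number_colorable (@rgg x n r).
rewrite (partition_big (fun i => Ordinal (ck i)) xpredT) //=.
apply: (@le_trans _ _ (\sum_(j < chromatic_number (@rgg x n r)) 1)); last first.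
  by rewrite sumr_const card_ord.
apply: ler_sum => k _.
have far (i j : 'I_n) : Ordinal (ck i) == k -> Ordinal (ck j) == k -> i != j ->
    1 < dist N (aff r^-1 u (x i)) (aff r^-1 u (x j)).
  move=> /eqP ik /eqP jk ij; rewrite dist_aff // gtr0_norm ?invr_gt0 // mulrC ltr_pdivlMr // mul1r.
  rewrite ltNge; apply/negP => adj; have := hc i j ij adj; apply/negP; rewrite negbK.
  by apply/eqP; have := congr1 val (etrans ik (esym jk)).
have := @feasible_sum R d N phi [seq aff r^-1 u (x (nat_of_ord i)) | i <- index_enum 'I_n & Ordinal (ck i) == k] fp.
rewrite big_map big_filter; apply.
  rewrite map_inj_in_uniq ?filter_uniq ?index_enum_uniq // => i j.
  rewrite !mem_filter => /andP[ik _] /andP[jk _] eq; apply/eqP; apply: contraT => ij.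
  by have := far i j ik jk ij; rewrite eq dist_refl // ltr10.
move=> y z /mapP[i + ->] /mapP[j + ->]; rewrite !mem_filter => /andP[ik _] /andP[jk _] ne.
by apply: far => //; apply: contra ne => /eqP ->.
Qed.

(** The points in a ball of radius r/2 are pairwise adjacent. *)
Lemma clq_low (x : nat -> d.-tuple R) n r u : 0 < r ->
  \sum_(i < n) ball_weight N (aff r^-1 u (x i)) <= clq x n r.
Proof.
move=> r0; pose S := finset (fun i : 'I_n => aff r^-1 u (x i) \in Ball N (origin R d) (1/2)).
have -> : \sum_(i < n) ball_weight N (aff r^-1 u (x i)) = (#|S|)%:R.
  rewrite -sum1_card natr_sum big_mkcond /= [RHS]big_mkcond; apply: eq_bigr => i _.
  by rewrite inE /ball_weight indicE; case: (_ \in _).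
rewrite ler_nat; apply: clique_number_ge; apply/is_cliqueP => i j.
rewrite !finset.in_set => /set_mem bi /set_mem bj _; rewrite /rgg.
have : dist N (aff r^-1 u (x i)) (aff r^-1 u (x j)) <= 1.
  apply: (le_trans (dist_triangle hN _ (origin R d) _)).
  by move: bi bj; rewrite /Ball /= (dist_sym hN (origin R d) (aff r^-1 u (x i))); lra.
by rewrite dist_aff // gtr0_norm ?invr_gt0 // mulrC ler_pdivrMr // mul1r.
Qed.

Lemma chi_mono (x : nat -> d.-tuple R) n n' r r' : (n <= n')%N -> r <= r' -> chi x n r <= chi x n' r'.
Proof.
move=> nn rr; rewrite ler_nat; apply: (chromatic_number_mono (f := widen_ord nn)).
  by move=> i j /(congr1 val) /= /val_inj.
by move=> i j; rewrite /rgg /= => /le_trans; exact.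
Qed.

Lemma clq_mono (x : nat -> d.-tuple R) n n' r r' : (n <= n')%N -> r <= r' -> clq x n r <= clq x n' r'.
Proof.
move=> nn rr; rewrite ler_nat; apply: (clique_number_mono (f := widen_ord nn)).
  by move=> i j /(congr1 val) /= /val_inj.
by move=> i j; rewrite /rgg /= => /le_trans; exact.
Qed.

Section WindowColoring.
Variables (D e : R) (K g : nat).
Hypothesis hD : forall (v : 'rV[R]_d) (t : R), (forall i, `|v 0 i| <= t) -> N v <= D * t.
Hypotheses (e0 : 0 < e) (K0 : (0 < K)%N).

Let V : finType := {ffun 'I_d -> 'I_K}.
Definition embed (v : {ffun 'I_d -> 'I_K}) : {ffun 'I_d -> int} := [ffun i => (v i : nat)%:Z].
(** Lengths are in units of r. The slack D e is the error of [dist_cells], so cells containing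
    adjacent points are always close and a stable set of cells holds no edge between different
    cells. *)
Definition close_cells (v w : {ffun 'I_d -> 'I_K}) : bool :=
  e * N (zvec R (embed v) - zvec R (embed w)) <= 1 + D * e.
Definition on_cells (psi : {ffun {ffun 'I_d -> 'I_K} -> R}) (z : {ffun 'I_d -> int}) : R :=
  \sum_(v | embed v == z) psi v.

Lemma embedE v k : embed v k = (v k : nat)%:Z.
Proof. by rewrite ffunE. Qed.

Lemma embed_inj : injective embed.
Proof.
move=> v w h; apply/ffunP => i; apply/val_inj; have := congr1 (fun f : {ffun _} => f i) h.
by rewrite !ffunE => -[].
Qed.

(* The points of a cell are dealt cyclically to the [K ^ d] windows that contain it. Each window
   receives its fractional colouring, and windows congruent modulo [K + g] share a palette. *)
Lemma window_coloring (L : seq {ffun V -> R}) (C : nat) (x : nat -> d.-tuple R) n r (a : R) :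
  (forall psi, psi \in L -> (forall v, 0 <= psi v) /\
     forall S, stable close_cells S -> \sum_(v in S) psi v <= 1) ->
  (forall (m : V -> nat) (a : R), 0 <= a ->
     (forall psi, psi \in L -> \sum_v psi v * (m v)%:R <= a) ->
     exists s : seq {set V}, [/\ all (stable close_cells) s, (size s)%:R <= a + C%:R
       & forall v, (m v <= count (fun S : {set V} => v \in S) s)%N]) ->
  0 < r -> 0 <= a ->
  (forall y y' i, dist N y y' <= r -> `|cidx (e * r) y i - cidx (e * r) y' i| <= g%:Z) ->
  (forall psi, psi \in L -> forall z, \sum_(i < n) on_cells psi (cidx (e * r) (x i) - z) <= a) ->
  chi x n r <= ((K + g) ^ d)%:R * (a / (K ^ d)%:R + (K ^ d)%:R + C%:R).
Proof.
move=> hL hcol r0 a0 gap hS.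
pose P := (K + g)%N; have P0 : (0 < P)%N by rewrite addn_gt0 K0.
pose Kd := #|V|; have KdE : Kd = (K ^ d)%N by rewrite /Kd card_ffun !card_ord.
have Kd0 : (0 < Kd)%N by rewrite KdE expn_gt0 K0.
pose z i := cidx (e * r) (x i).
(* The position of [i] among the points of its cell; modulo K^d it selects [v i], the place of the
   cell within its window, and thereby the window with corner [q i]. *)
pose rank i := prefix_count (fun j => z j == z i) i.
have rk i : (rank i %% Kd < #|V|)%N by rewrite ltn_mod.
pose v i : V := enum_val (Ordinal (rk i)).
pose q i := z i - embed (v i).
pose m (c : {ffun 'I_d -> int}) (w : V) := prefix_count (fun i => (q i == c) && (v i == w)) n.
(* Dealing gives a window the share K^(-d) of each of its K^d cells, up to one extra point per cell;
   as psi <= 1, the extra points weigh at most K^d. *)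
pose a' := a / (K ^ d)%:R + (K ^ d)%:R.
have a'0 : 0 <= a' by rewrite addr_ge0 // divr_ge0.
have mle c w : (m c w * Kd <= prefix_count (fun i => z i == (c + embed w)%R) n + Kd)%N.
  have := @residue_count_le (fun i => z i == (c + embed w)%R) Kd (enum_rank w) n (ltn_ord _).
  apply: leq_trans; rewrite leq_mul2r; apply/orP; right.
  apply: leq_sum => i _; case: (boolP (_ && _)) => //= /andP[/eqP qi /eqP vi].
  have zi : z i = c + embed w by rewrite -qi -vi /q subrK.
  rewrite zi eqxx /=; have -> : prefix_count (fun j => z j == (c + embed w)%R) i = rank i.
    by rewrite /rank zi.
  by rewrite lt0b; apply/eqP; have := congr1 (fun w => nat_of_ord (enum_rank w)) vi; rewrite enum_valK.
have hm c : forall psi, psi \in L -> \sum_w psi w * (m c w)%:R <= a'.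
  move=> psi pL; have [p0 pS] := hL psi pL.
  have Kr : 0 < Kd%:R :> R by rewrite ltr0n.
  have p1 w : psi w <= 1.
    have := pS (finset.set1 w); rewrite big_set1; apply; apply/stableP => w1 w2.
    by rewrite !inE => /eqP -> /eqP ->; rewrite eqxx.
  apply: (@le_trans _ _ (\sum_w (psi w * (prefix_count (fun i => z i == (c + embed w)%R) n)%:R / Kd%:R + psi w))).
    apply: ler_sum => w _; rewrite -[X in _ + X]mulr1 -mulrA -mulrDr ler_wpM2l //.
    by rewrite -(ler_pM2r Kr) mulrDl mul1r divfK ?gt_eqF // -natrM -natrD ler_nat; exact: mle.
  rewrite big_split /= -mulr_suml /a' -KdE; apply: lerD.
    rewrite ler_pM2r ?invr_gt0 //; apply: le_trans (hS psi pL c); rewrite le_eqVlt; apply/orP; left; apply/eqP.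
    rewrite /on_cells; under [RHS]eq_bigr do rewrite big_mkcond.
    rewrite exchange_big /=; apply: eq_bigr => w _; rewrite natr_sum mulr_sumr; apply: eq_bigr => i _.
    rewrite -/(z i) [_ == z i - c]eq_sym subr_eq addrC.
    by case: eqP; rewrite ?mulr1 ?mulr0.
  apply: (@le_trans _ _ (\sum_(w : V) 1)); first by apply: ler_sum => w _.
  by rewrite sumr_const.
have /choice[s hs] : forall c, exists s : seq {set V}, [/\ all (stable close_cells) s,
    (size s)%:R <= a' + C%:R & forall w, (m c w <= count (fun S : {set V} => w \in S) s)%N].
  by move=> c; exact: (hcol (m c) a' a'0 (hm c)).
pose B := Num.truncn (a' + C%:R).
have aC : 0 <= a' + C%:R by rewrite addr_ge0.
have sB c : (size (s c) <= B)%N by have [_ h _] := hs c; rewrite /B truncn_ge_nat.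
have BE : B%:R <= a' + C%:R by rewrite /B truncn_le.
have tp i k : (`|(q i k %% P%:Z)%Z| < P)%N.
  have Pn : P%:Z != 0 by apply/eqP => h; move: P0; case: h => ->.
  by have h := ltz_mod (q i k) Pn; have h0 := modz_ge0 (q i k) Pn; lia.
(* The palette of a window is its corner modulo P = K + g. Adjacent points lie in cells at most g
   apart, so their windows differ by less than P in every coordinate and coincide if their palettes
   do. *)
pose tau i : {ffun 'I_d -> 'I_P} := [ffun k => Ordinal (tp i k)].
have tauE i k : tau i k = `|(q i k %% P%:Z)%Z|%N :> nat by rewrite ffunE.
pose kap i := prefix_count (fun j => (q j == q i) && (v j == v i)) i.
pose sl i := slot (s (q i)) (v i) (kap i).
have kapm i : (i < n)%N -> (kap i < count (fun S : {set V} => v i \in S) (s (q i)))%N.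
  move=> iN; have [_ _ h] := hs (q i); apply: leq_trans (h (v i)).
  by apply: prefix_count_lt => //; rewrite !eqxx.
have slB i : (i < n)%N -> (sl i < B)%N.
  by move=> iN; have [h _] := slotP (kapm i iN); apply: leq_trans h (sB _).
apply: (@le_trans _ _ (P ^ d * B)%:R); last by rewrite natrM ler_wpM2l.
rewrite ler_nat; apply: chromatic_number_le; apply/colorableP.
have cT : #|{ffun 'I_d -> 'I_P}| = (P ^ d)%N by rewrite card_ffun !card_ord.
exists (fun i => enum_rank (tau i) * B + sl i)%N; split=> [i|i j ij adj].
  have h : (enum_rank (tau i) < P ^ d)%N by rewrite -cT; exact: ltn_ord.
  apply: (@leq_trans ((enum_rank (tau i)).+1 * B)); last by rewrite leq_mul2r h orbT.
  by rewrite mulSn addnC ltn_add2r; exact: slB.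
apply/negP => /eqP h.
have Bp : (0 < B)%N by apply: leq_ltn_trans (slB i (ltn_ord i)).
have [et es] : enum_rank (tau i) = enum_rank (tau j) /\ sl i = sl j.
  have h1 := congr1 (fun t => t %/ B)%N h; have h2 := congr1 (fun t => t %% B)%N h.
  move: h1 h2; rewrite !divnMDl // !modnMDl !divn_small ?slB // !modn_small ?slB // !addn0.
  by move=> /val_inj.
have zz k : `|z i k - z j k| <= g%:Z by exact: gap.
have qk l k : q l k = z l k - (v l k : nat)%:Z by rewrite /q ffun_subE embedE.
have qE : q i = q j.
  apply/ffunP => k; have et' : `|(q i k %% P%:Z)%Z|%N = `|(q j k %% P%:Z)%Z|%N.
    by rewrite -!tauE (enum_rank_inj et).
  apply: (@residue_inj P) => //.
  by rewrite !qk; apply: offset_gap (zz k) (ltn_ord _) (ltn_ord _).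
have ki := kapm i (ltn_ord i); have kj := kapm j (ltn_ord j).
have [_ mi] := slotP ki; have [sj mj] := slotP kj.
rewrite -/(sl i) -/(sl j) in mi mj sj.
have [hst _ _] := hs (q i).
(* Both points now use the same stable set of the same window. In one cell different points have
   different slots; in different cells stability contradicts the closeness enforced by adjacency. *)
have [vE|vN] := eqVneq (v i) (v j).
  have kE : kap i = kap j.
    move: es; rewrite /sl qE vE; apply: slot_inj; [by rewrite -qE -vE|exact: kj].
  have := @prefix_count_inj (fun l => (q l == q i) && (v l == v i)) i j.
  rewrite !eqxx -qE -vE !eqxx => /(_ isT isT) H; move: ij; rewrite (_ : i = j) ?eqxx //.
  by apply/val_inj; apply: H; rewrite /= -/(kap i) kE /kap -qE -vE.
have hst' : stable close_cells (nth finset.set0 (s (q i)) (sl i)).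
  by apply: (allP hst); apply: mem_nth; rewrite es qE.
rewrite -qE -es in mj.
have := stableP _ _ hst' (v i) (v j) mi mj vN; rewrite /close_cells -ltNge; apply/negP; rewrite -leNgt.
have zE : zvec R (z i) - zvec R (z j) = zvec R (embed (v i)) - zvec R (embed (v j)).
  apply/rowP => k; rewrite !mxE -!intrB; congr (_%:~R).
  have := congr1 (fun f : {ffun 'I_d -> int} => f k) qE.
  rewrite !embedE /= !qk; exact: offset_swap.
have er : 0 < e * r by rewrite mulr_gt0.
have := dist_cells hN (x i) (x j) er hD; rewrite -/(z i) -/(z j) zE ler_norml => /andP[h1 _].
rewrite -(ler_pM2l r0); move: adj; rewrite /rgg => adj.
have -> : r * (1 + D * e) = r + D * (e * r) by ring.
have -> : forall u, r * (e * u) = e * r * u by move=> u; ring.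
lra.
Qed.

End WindowColoring.

Lemma floor_gap_numeric (a A b B k T : R) : A <= a -> b < B + 1 -> a - b <= k -> k < T ->
  A - B < T + 1.
Proof. lra. Qed.

Lemma cidx_gap K1 (l r : R) y y' i : 0 < l -> (forall (v : 'rV[R]_d) i, `|v 0 i| <= K1 * N v) ->
  dist N y y' <= r -> 0 <= K1 ->
  `|cidx l y i - cidx l y' i| <= (Num.truncn (K1 * r / l)).+1%:Z.
Proof.
move=> l0 hK hy K10; have := hK (tvec y - tvec y') i; rewrite tvecB => h1.
have h2 : `|tnth y i - tnth y' i| <= K1 * r by apply: le_trans h1 _; rewrite ler_wpM2l.
have Kr : 0 <= K1 * r / l by rewrite divr_ge0 ?(ltW l0) // (le_trans _ h2).
rewrite !ffunE; set a := tnth y i / l; set b := tnth y' i / l.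
have h3 : `|a - b| <= K1 * r / l.
  by rewrite /a /b -mulrBl normrM (gtr0_norm (_ : 0 < l^-1)) ?invr_gt0 // ler_pM2r ?invr_gt0.
have /andP[_ h4] := truncn_itv Kr.
have [a1 a2] := (floor_le_tmp a, floorD1_gt a); have [b1 b2] := (floor_le_tmp b, floorD1_gt b).
move: h3; rewrite ler_norml => /andP[h5 h6].
rewrite !intrD /= in a2 b2.
pose T : int := (Num.truncn (K1 * r / l)).+1%:Z.
have TE : (T%:~R : R) = (Num.truncn (K1 * r / l)).+1%:R by [].
have u1 : Num.floor a - Num.floor b < T + 1.
  rewrite -(ltr_int R) intrB intrD TE; exact: floor_gap_numeric a1 b2 h6 h4.
have u2 : Num.floor b - Num.floor a < T + 1.
  rewrite -(ltr_int R) intrB intrD TE; apply: floor_gap_numeric b1 a2 _ h4.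
  by rewrite -opprB lerNl.
by move: u1 u2; rewrite -/T !ltzD1 ler_norml lerNl opprB => -> ->.
Qed.

Section CellWeights.
Variable leb : {measure set (d.-tuple R) -> \bar R}.
Hypothesis hleb : is_lebesgue leb.

Lemma measurable_cell_function (l : R) (psi : {ffun 'I_d -> int} -> R) : 0 < l ->
  measurable_fun setT (fun x : d.-tuple R => psi (cidx l x)).
Proof.
move=> l0 _ A mA; rewrite setTI.
have := measurable_cidx_pred (fun z => `[< A (psi z) >]) l0 (fun=> measurableT).
congr measurable; apply/seteqP; split=> x /=; first by move=> [/asboolP].
by move=> h; split=> //; exact/asboolP.
Qed.

Lemma Jint_cell_function (l s : R) (V : seq {ffun 'I_d -> int}) (psi : {ffun 'I_d -> int} -> R) :
  0 < l -> uniq V -> (forall v, v \notin V -> psi v = 0) ->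
  Jint leb (fun x => psi (cidx l x)) s = l ^+ d * \sum_(v <- V) (expR (s * psi v) - 1).
Proof.
move=> l0 uV pV; rewrite /Jint.
rewrite (@Rintegral_labels _ _ _ leb _ (cidx l) V (fun v => expR (s * psi v) - 1)) //.
- rewrite mulr_sumr; apply: eq_bigr => v _; rewrite mulrC; congr (_ * _).
  by have := leb_cell hleb v l0; rewrite /cell => ->.
- by move=> v; exact: measurable_cell.
- by move=> v _; have := leb_cell hleb v l0; rewrite /cell => ->; rewrite ltry.
- by move=> x xV; rewrite pV // mulr0 expR0 subrr.
Qed.

End CellWeights.

Section StableWeights.
Variables (D e : R) (K : nat).
Hypothesis hD : forall (v : 'rV[R]_d) (t : R), (forall i, `|v 0 i| <= t) -> N v <= D * t.
Hypotheses (e0 : 0 < e) (D0 : 0 < D).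

(* Cells of side [e / (1 + 2 * D * e)] are slightly finer than those of side [e]: points of a
   well-spread set fall into pairwise distinct cells that are far apart on the coarser scale. *)
Lemma stable_feasible (psi : {ffun {ffun 'I_d -> 'I_K} -> R}) :
  (forall v, 0 <= psi v) ->
  (forall S, stable (close_cells D e (K := K)) S -> \sum_(v in S) psi v <= 1) ->
  feasible N (fun x => on_cells psi (cidx (e / (1 + 2 * D * e)) x)).
Proof.
move=> p0 pS; set l := e / _.
have De : 0 < D * e by rewrite mulr_gt0.
have q0 : 0 < 1 + 2 * D * e by rewrite -mulrA; lra.
have l0 : 0 < l by rewrite divr_gt0.
split=> [x||S hS]; [by apply: sumr_ge0|exact: measurable_cell_function|].
apply: ub_ereal_sup => _ [X [fX XS] <-].
rewrite fsbig_finite //= sumEFin lee_fin.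
pose s : seq (d.-tuple R) := finmap.enum_fset (fset_set X).
rewrite -/s; have us : uniq s by exact: finmap.fset_uniq.
have inS x : x \in s -> S x by rewrite in_fset_set // inE => /XS.
have far x y : x \in s -> y \in s -> x != y ->
    1 + D * e < e * N (zvec R (cidx l x) - zvec R (cidx l y)).
  move=> xs ys /eqP xy; have h1 := hS _ _ (inS x xs) (inS y ys) xy.
  have := dist_cells hN x y l0 hD; rewrite ler_norml => /andP[_ h2].
  have el : e = (1 + 2 * D * e) * l by rewrite /l mulrCA divff ?mulr1 // gt_eqF.
  set M := N _ in h2 *; have h3 : 1 - D * l < l * M by lra.
  have -> : e * M = (1 + 2 * D * e) * (l * M) by rewrite mulrA -el.
  have h4 : (1 + 2 * D * e) * (1 - D * l) < (1 + 2 * D * e) * (l * M) by rewrite ltr_pM2l.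
  apply: (le_lt_trans _ h4); rewrite mulrBr mulr1 mulrCA -el; lra.
have cell_inj x y : x \in s -> y \in s -> cidx l x = cidx l y -> x = y.
  move=> xs ys exy; apply/eqP; apply: contraT => xy; have := far x y xs ys xy.
  by rewrite exy subrr norm_0 // mulr0 => h; have : 1 + D * e < 0 by []; lra.
pose T := finset (fun v : {ffun 'I_d -> 'I_K} => has (fun x => cidx l x == embed v) s).
have stT : stable (close_cells D e (K := K)) T.
  apply/stableP => v w; rewrite !finset.in_set => /hasP[x xs /eqP ex] /hasP[y ys /eqP ey] vw.
  rewrite /close_cells -ltNge -ex -ey; apply: far => //.
  by apply: contra vw => /eqP xy; apply/eqP/embed_inj; rewrite -ex -ey xy.
apply: le_trans (pS T stT); rewrite /on_cells.
under eq_bigr do rewrite big_mkcond.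
rewrite exchange_big /= [leRHS]big_mkcond; apply: ler_sum => v _.
have -> : \sum_(x <- s) (if embed v == cidx l x then psi v else 0) =
    psi v * (count (fun x => cidx l x == embed v) s)%:R.
  rewrite -sum1_count natr_sum mulr_sumr [RHS]big_mkcond; apply: eq_bigr => x _.
  by rewrite eq_sym; case: eqP; rewrite ?mulr1.
rewrite finset.in_set; case: ifPn => [_|]; last by rewrite has_count -eqn0Ngt => /eqP ->; rewrite mulr0.
rewrite -[leRHS]mulr1 ler_wpM2l // (ler_nat R _ 1).
elim: (s) us cell_inj => [_ _ //|x t IH /= /andP[xt ut] inj].
case: eqP => [ex|_]; last by rewrite add0n; apply: IH => // y z yt zt; apply: inj; rewrite inE ?yt ?zt orbT.
rewrite (_ : count _ t = 0%N) ?addn0 //; apply/eqP; rewrite -leqn0 leqNgt -has_count.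
apply/hasP => -[y yt /eqP ey]; have xy : x = y.
  by apply: inj; rewrite ?mem_head // ?inE ?yt ?orbT // ex ey.
by move: xt; rewrite xy yt.
Qed.

End StableWeights.

Lemma small_power (k : nat) (eps : R) : 0 < eps -> exists2 t : R, 0 < t & (1 + t) ^+ k <= 1 + eps.
Proof.
move=> eps0; pose t := Num.min 1 (eps / 2 ^+ k).
have p0 : 0 < 2 ^+ k :> R by rewrite exprn_gt0.
have t0 : 0 < t by rewrite lt_min ltr01 divr_gt0.
have t01 : 0 <= t <= 1 by rewrite ltW // ge_min lexx.
exists t => //; apply: le_trans (pow_1D_le k t01) _; rewrite lerD2l.
apply: (@le_trans _ _ (2 ^+ k * t)); first by rewrite ler_pM2r // gerBl.
by rewrite mulrC -ler_pdivlMr // ge_min lexx orbT.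
Qed.

(** The factor (1 + t)^d comes from the finer cells of [stable_feasible] and enters the integrals;
    the factor (K + g)^d / K^d comes from the palettes and enters the sums; rounding goes into the
    constant. If no dual weight attained the bound, [window_coloring] would produce a colouring with
    too few colours. *)
Lemma chi_up (leb : {measure set (d.-tuple R) -> \bar R}) (eps : R) : is_lebesgue leb -> 0 < eps ->
  exists (c C : R) (K : nat)
  (V : nat -> seq {ffun 'I_d -> int}) (psi : nat -> {ffun 'I_d -> int} -> R),
  [/\ 0 < c, 0 <= C,
      forall k, (k < K)%N -> [/\ uniq (V k), forall v, 0 <= psi k v,
        forall v, v \notin V k -> psi k v = 0 &
        exists2 phi, feasible N phi & forall s, 0 <= s ->
          c ^+ d * \sum_(v <- V k) (expR (s * psi k v) - 1) <= (1 + eps) * Jint leb phi s] &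
      forall (x : nat -> d.-tuple R) n r, 0 < r -> exists2 k, (k < K)%N &
        exists z, chi x n r <= (1 + eps) * (\sum_(i < n) psi k (cidx (c * r) (x i) - z)) + C].
Proof.
move=> hleb eps0; have [D D0 hD] := norm_le_coord hd hN; have [K1 K10 hK1] := coord_le_norm hd hN.
have [t t0 ht] := small_power d eps0.
pose e := t / (2 * D); have e0 : 0 < e by rewrite divr_gt0 // mulr_gt0.
have De : 2 * D * e = t by rewrite /e mulrCA divff ?mulr1 // gt_eqF // mulr_gt0.
pose g := (Num.truncn (K1 / e)).+1.
pose K := (Num.truncn (g%:R / t)).+1.
have K0 : (0 < K)%N by [].
have KP : ((K + g) ^ d)%:R / (K ^ d)%:R <= 1 + eps.
  rewrite !natrX -expr_div_n; apply: le_trans ht; apply: lerXn2r; rewrite ?nnegrE ?divr_ge0 //.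
    by rewrite addr_ge0 // ltW.
  rewrite natrD mulrDl divff ?pnatr_eq0 // lerD2l ler_pdivrMr ?ltr0n // mulrC -ler_pdivrMr //.
  by have /andP[_ /ltW] := truncn_itv (divr_ge0 (ler0n R g) (ltW t0)).
have [L [C0 [hL hcol]]] := fractional_coloring R (close_cells D e (K := K)).
pose V (k : nat) := [seq embed v | v : {ffun 'I_d -> 'I_K}].
(* Index 0 is the zero function: it covers the case in which the chromatic number does not exceed
   the constant [Cc], and makes the list nonempty. *)
pose psi (k : nat) (z : {ffun 'I_d -> int}) : R :=
  if k is k'.+1 then on_cells (nth [ffun=> 0] L k') z else 0.
pose Cc : R := ((K + g) ^ d)%:R * ((K ^ d)%:R + C0%:R) + 1.
have wC : 0 <= Cc by rewrite addr_ge0 // mulr_ge0 // addr_ge0.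
exists e, Cc, (size L).+1, V, psi; split=> //.
- move=> k kL; split.
  + by rewrite map_inj_uniq ?enum_uniq //; exact: embed_inj.
  + move=> v; case: k kL => [|k] kL //=; apply: sumr_ge0 => w _.
    by have [+ _] := hL _ (mem_nth [ffun=> 0] (kL : (k < size L)%N)); exact.
  + move=> v; case: k kL => [|k] kL //= vV; apply: big1 => w /eqP ew.
    by move: vV; rewrite -ew map_f // mem_enum.
  case: k kL => [|k] kL /=.
    exists (ball_weight N); first exact: ball_feasible.
    move=> s s0; rewrite big1 => [|v _]; last by rewrite mulr0 expR0 subrr.
    rewrite mulr0.
    have [C hC] := feasible_weight hd hN hleb; have [w _] := hC _ (ball_feasible hd hN).
    by rewrite mulr_ge0 ?Jint_ge0 // addr_ge0 // ltW.
  have [p0 pS] := hL _ (mem_nth [ffun=> 0] (kL : (k < size L)%N)).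
  exists (fun x => on_cells (nth [ffun=> 0] L k) (cidx (e / (1 + 2 * D * e)) x)).
    exact: stable_feasible.
  have t1 : 0 < 1 + t by rewrite addr_gt0.
  have l0 : 0 < e / (1 + 2 * D * e) by rewrite De divr_gt0.
  move=> s s0; rewrite (@Jint_cell_function leb hleb _ s (V k.+1)) //; last first.
  - move=> v vV; apply: big1 => w /eqP ew.
    by move: vV; rewrite -ew map_f // mem_enum.
  - by rewrite map_inj_uniq ?enum_uniq //; exact: embed_inj.
  rewrite mulrA ler_wpM2r //.
    apply: sumr_ge0 => v _; rewrite subr_ge0 -expR0 ler_expR mulr_ge0 //.
    by apply: sumr_ge0 => w _; exact: p0.
  rewrite De [(e / (1 + t)) ^+ d]expr_div_n mulrCA ler_peMr ?exprn_ge0 ?(ltW e0) //.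
  by rewrite ler_pdivlMr ?exprn_gt0 // mul1r.
move=> x n r r0; apply: contrapT => hn.
have big k z : (k < (size L).+1)%N ->
    (1 + eps) * (\sum_(i < n) psi k (cidx (e * r) (x i) - z)) + Cc < chi x n r.
  by move=> kL; rewrite ltNge; apply/negP => h; apply: hn; exists k => //; exists z.
have eps1 : 0 < 1 + eps by rewrite addr_gt0.
have chiC : Cc < chi x n r.
  by have := big 0%N 0 isT; rewrite big1 ?mulr0 ?add0r.
pose a := (chi x n r - Cc) / (1 + eps).
have a0 : 0 <= a by rewrite divr_ge0 ?subr_ge0 // ltW.
have ha p : p \in L -> forall z, \sum_(i < n) on_cells p (cidx (e * r) (x i) - z) <= a.
  move=> pL z; have iL : (index p L < size L)%N by rewrite index_mem.
  have := big (index p L).+1 z iL; rewrite /psi nth_index // => h.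
  by rewrite /a ler_pdivlMr // mulrC lerBrDr ltW.
have gap y y' i : dist N y y' <= r -> `|cidx (e * r) y i - cidx (e * r) y' i| <= g%:Z.
  move=> hy; have := cidx_gap i (mulr_gt0 e0 r0) hK1 hy (ltW K10).
  by rewrite -mulf_div divff ?gt_eqF // mulr1.
have := window_coloring hD e0 K0 hL hcol r0 a0 gap ha.
by apply: coloring_numeric KP chiC; rewrite ?ltr0n ?expn_gt0.
Qed.

Lemma zvec_shift (u v z : {ffun 'I_d -> int}) : zvec R (u - z) - zvec R (v - z) = zvec R u - zvec R v.
Proof. by apply/rowP => k; rewrite !mxE !ffunE !intrB opprB addrA subrK. Qed.

Section CliqueShapes.
Variables (D e : R) (K : nat).
Hypothesis hD : forall (v : 'rV[R]_d) (t : R), (forall i, `|v 0 i| <= t) -> N v <= D * t.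
Hypotheses (e0 : 0 < e) (D0 : 0 < D).
Variable leb : {measure set (d.-tuple R) -> \bar R}.
Hypothesis hleb : is_lebesgue leb.

(* The cells indexed by W - W + {0,1}^d lie in a ball of radius slightly larger than 1. *)
Lemma clique_shape_volume (W : {set {ffun 'I_d -> 'I_K}}) :
  (forall v w, v \in W -> w \in W -> close_cells D e v w) ->
  e ^+ d * #|W|%:R <= (1 + 4 * D * e) ^+ d * fine (leb (Ball N (origin R d) (1/2))).
Proof.
move=> hW; have De : 0 < D * e by rewrite mulr_gt0.
pose s := [seq embed v | v <- enum W].
have us : uniq s by rewrite map_inj_uniq ?enum_uniq //; exact: embed_inj.
pose shift (v w : {ffun 'I_d -> int}) (b : {ffun 'I_d -> bool}) : {ffun 'I_d -> int} := [ffun i => v i - w i + (b i : nat)%:Z].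
pose U := undup [seq shift vw.1 vw.2 b | vw <- [seq (v, w) | v <- s, w <- s], b <- enum {ffun 'I_d -> bool}].
have uU : uniq U by exact: undup_uniq.
have h2 : (2 ^ d * size s <= size U)%N.
  apply: difference_set_size => // v w b vs ws; rewrite mem_undup.
  apply/allpairsP; exists ((v, w), b); split=> //=; last by rewrite mem_enum.
  by apply/allpairsP; exists (v, w).
pose rho := 1 + 4 * D * e.
have rho0 : 0 < rho by rewrite /rho -mulrA; lra.
have inB u : u \in U -> cell e u `<=` Ball N (origin R d) rho.
  rewrite mem_undup => /allpairsP[[vw b] [/= /allpairsP[[v w] [/= vs ws ->]] _ ->]] x xu.
  have [v' v'W vE] := mapP vs; have [w' w'W wE] := mapP ws.
  rewrite !mem_enum in v'W w'W.
  have vw1 : e * N (zvec R v - zvec R w) <= 1 + D * e by have := hW _ _ v'W w'W; rewrite vE wE.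
  have o0 : cidx e (origin R d) = 0.
    by apply/ffunP => i; rewrite !ffunE (tnth_nth 0) nth_nseq ltn_ord mul0r floor0.
  have := dist_cells hN (origin R d) x e0 hD; rewrite o0 xu ler_norml => /andP[_ h].
  have h3 : N (zvec R 0 - zvec R (shift v w b)) <= N (zvec R v - zvec R w) + D.
    rewrite (norm_sub hN).
    have -> : zvec R (shift v w b) - zvec R 0 = (zvec R v - zvec R w) + \row_i (b i)%:R.
      by apply/rowP => i; rewrite !mxE !ffunE subr0 intrD intrB.
    case: hN => _ _ tri; apply: (le_trans (tri _ _)); rewrite lerD2l -[leRHS]mulr1.
    by apply: hD => i; rewrite mxE ger0_norm ?ler0n // lern1 leq_b1.
  have h4 : e * N (zvec R 0 - zvec R (shift v w b)) <= e * (N (zvec R v - zvec R w) + D) by rewrite ler_pM2l.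
  move: h h4 vw1; rewrite /Ball /= mulrDr /rho.
  set a := dist _ _ _; set b1 := e * _; set c1 := e * N (_ - zvec R w) => h h4 vw1.
  clear -h h4 vw1 De; lra.
have mB r : measurable (Ball N (origin R d) r) by exact: measurable_Ball.
have [mU] := measure_cells leb e0 (mB rho) uU.
rewrite (eq_big_seq (fun=> (e ^+ d)%:E)); last first.
  move=> u uU' /=; rewrite (_ : _ `&` _ = cell e u) ?leb_cell //.
  by apply/seteqP; split=> [x []//|x xu]; split=> //; exact: (inB u uU').
rewrite sumEFin big_const_seq count_predT iter_addr_0 => hU.
have le : ((e ^+ d *+ size U)%:E <= leb (Ball N (origin R d) rho))%E.
  by rewrite -hU; apply: le_measure; rewrite ?inE.
have bE : leb (Ball N (origin R d) rho) = (((2 * rho) ^+ d)%:E * leb (Ball N (origin R d) (1/2)))%E.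
  have rE : rho = 2 * rho * (1/2) by field.
  by rewrite {1}rE (leb_Ball_scale hd hN hleb) ?mulr_gt0.
have fB : (leb (Ball N (origin R d) (1 / 2))) \is a fin_num.
  by rewrite ge0_fin_numE // (leb_Ball_fin hd hN hleb).
move: le; rewrite bE -(fineK fB) lee_fin => le.
have p2 : 0 < 2 ^+ d :> R by rewrite exprn_gt0.
rewrite -(ler_pM2l p2) mulrA -exprMn -/rho [X in _ <= X]mulrA -exprMn; apply: le_trans le.
rewrite -[_ *+ size U]mulr_natr exprMn [2 ^+ d * _]mulrC -mulrA ler_wpM2l ?exprn_ge0 ?(ltW e0) //.
rewrite -natrX -natrM ler_nat; apply: leq_trans h2.
by rewrite size_map -cardE.
Qed.

End CliqueShapes.

(** A maximum clique occupies pairwise close cells within g of the cell of one member, hence a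
    translate of one of finitely many shapes; the indicator of the shape counts at least the
    clique. *)
Lemma clq_up (leb : {measure set (d.-tuple R) -> \bar R}) (eps : R) : is_lebesgue leb -> 0 < eps ->
  exists (c C : R) (K : nat)
  (V : nat -> seq {ffun 'I_d -> int}) (psi : nat -> {ffun 'I_d -> int} -> R),
  [/\ 0 < c, 0 <= C,
      forall k, (k < K)%N -> [/\ uniq (V k), forall v, 0 <= psi k v,
        forall v, v \notin V k -> psi k v = 0 &
        exists2 phi, phi = ball_weight N & forall s, 0 <= s ->
          c ^+ d * \sum_(v <- V k) (expR (s * psi k v) - 1) <= (1 + eps) * Jint leb phi s] &
      forall (x : nat -> d.-tuple R) n r, 0 < r -> exists2 k, (k < K)%N &
        exists z, clq x n r <= (1 + eps) * (\sum_(i < n) psi k (cidx (c * r) (x i) - z)) + C].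
Proof.
move=> hleb eps0; have [D D0 hD] := norm_le_coord hd hN; have [K1 K10 hK1] := coord_le_norm hd hN.
have [t t0 ht] := small_power d eps0.
pose e := t / (4 * D); have e0 : 0 < e by rewrite divr_gt0 // mulr_gt0.
have De : 4 * D * e = t by rewrite /e mulrCA divff ?mulr1 // gt_eqF // mulr_gt0.
pose g := (Num.truncn (K1 / e)).+1.
pose K := (g + g).+1.
pose shape (W : {set {ffun 'I_d -> 'I_K}}) := [forall v in W, forall w in W, close_cells D e v w].
pose L := [seq W <- enum {set {ffun 'I_d -> 'I_K}} | shape W].
pose V (k : nat) := [seq embed v | v <- enum (nth finset.set0 L k)].
pose psi (k : nat) (z : {ffun 'I_d -> int}) : R := (z \in V k)%:R.
have shapeP (W : {set {ffun 'I_d -> 'I_K}}) : reflect (forall v w, v \in W -> w \in W -> close_cells D e v w) (shape W).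
  apply: (iffP forall_inP) => [h v w vW wW|h v vW]; first by have /forall_inP := h v vW; apply.
  by apply/forall_inP => w wW; exact: h.
exists e, 0, (size L), V, psi; split=> //.
- move=> k kL; split.
  + by rewrite map_inj_uniq ?enum_uniq //; exact: embed_inj.
  + by move=> v; rewrite ler0n.
  + by move=> v; rewrite /psi => /negbTE ->.
  exists (ball_weight N) => // s s0; rewrite /ball_weight Jint_indicator; last 2 first.
  - exact: measurable_Ball.
  - exact: (leb_Ball_fin hd hN hleb).
  rewrite (eq_big_seq (fun=> expR s - 1)); last by move=> v vV; rewrite /psi vV mulr1.
  rewrite big_const_seq count_predT iter_addr_0 size_map -cardE -[_ *+ #|_|]mulr_natr [(_ - 1) * _]mulrC !mulrA.
  have es0 : 0 <= expR s - 1 by rewrite subr_ge0 -expR0 ler_expR.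
  rewrite [leRHS]mulrAC ler_wpM2r //.
  have /shapeP hW : shape (nth finset.set0 L k).
    by have := mem_nth finset.set0 kL; rewrite mem_filter => /andP[].
  apply: le_trans (clique_shape_volume hD e0 D0 hleb hW) _.
  by rewrite De ler_wpM2r // ltW // (leb_Ball_gt0 hd hN hleb).
move=> x n r r0.
pose S : {set 'I_n} := [arg max_(S > finset.set0 | is_clique (@rgg x n r) S) #|S|].
have c0 : is_clique (@rgg x n r) finset.set0 by apply/is_cliqueP => i j; rewrite inE.
have [cS Smax] : is_clique (@rgg x n r) S /\ forall S', is_clique (@rgg x n r) S' -> (#|S'| <= #|S|)%N.
  by rewrite /S; case: arg_maxnP.
have gap y y' i : dist N y y' <= r -> `|cidx (e * r) y i - cidx (e * r) y' i| <= g%:Z.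
  move=> hy; have := cidx_gap i (mulr_gt0 e0 r0) hK1 hy (ltW K10).
  by rewrite -mulf_div divff ?gt_eqF // mulr1.
have [z0 hz0] : exists z0 : {ffun 'I_d -> int}, forall i, i \in S ->
    forall k, `|cidx (e * r) (x i) k - z0 k| <= g%:Z.
  have [->|[i0 i0S]] := finset.set_0Vmem S; first by exists 0 => i; rewrite inE.
  exists (cidx (e * r) (x i0)) => i iS k; apply: gap.
  have [->|ne] := eqVneq i i0; first by rewrite (dist_refl hN) ltW.
  by have /is_cliqueP := cS; exact.
(* The corner of the box of side K = 2 g + 1 centred at [z0], so that relative indices start at
   0. *)
pose z : {ffun 'I_d -> int} := z0 - [ffun=> g%:Z].
have bd i : i \in S -> exists v : {ffun 'I_d -> 'I_K}, embed v = cidx (e * r) (x i) - z.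
  move=> iS; have hk k : (`|(cidx (e * r) (x i) k - z0 k + g%:Z)%R|%N < K)%N.
    by move: (hz0 i iS k); rewrite /K; exact: offset_box_lt.
  exists [ffun k => Ordinal (hk k)]; apply/ffunP => k; rewrite embedE ffunE /= /z !ffun_subE ffunE.
  by move: (hz0 i iS k); exact: offset_box_abs.
pose W := finset (fun v : {ffun 'I_d -> 'I_K} => [exists i in S, embed v == cidx (e * r) (x i) - z]).
have er : 0 < e * r by rewrite mulr_gt0.
have sW : shape W.
  apply/shapeP => v w; rewrite !finset.in_set => /exists_inP[i iS /eqP vi] /exists_inP[j jS /eqP wj].
  have hij : dist N (x i) (x j) <= r.
    have [->|ne] := eqVneq i j; first by rewrite (dist_refl hN) ltW.
    by have /is_cliqueP := cS; exact.
  have zE : zvec R (embed v) - zvec R (embed w) = zvec R (cidx (e * r) (x i)) - zvec R (cidx (e * r) (x j)).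
    by rewrite vi wj zvec_shift.
  rewrite /close_cells zE; have := dist_cells hN (x i) (x j) er hD; rewrite ler_norml => /andP[h1 _].
  set A := N _ in h1 *; rewrite -(ler_pM2l r0).
  have -> : r * (1 + D * e) = r + D * (e * r) by ring.
  have -> : r * (e * A) = e * r * A by ring.
  clear -h1 hij; lra.
have WL : W \in L by rewrite mem_filter sW mem_enum.
exists (index W L); first by rewrite index_mem.
exists z; rewrite addr0.
have sum_ge : clq x n r <= \sum_(i < n) psi (index W L) (cidx (e * r) (x i) - z).
  apply: (@le_trans _ _ (#|S|)%:R); first by rewrite ler_nat; exact: clique_number_le.
  rewrite -sum1_card natr_sum big_mkcond; apply: ler_sum => i _.
  case: ifPn => [iS|_]; last by rewrite ler0n.
  have [v vE] := bd i iS; rewrite /psi /V nth_index // -vE map_f // mem_enum finset.in_set.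
  by apply/exists_inP; exists i => //; rewrite vE.
apply: le_trans sum_ge _; rewrite ler_peMl // ?lerDl ?(ltW eps0) //.
by apply: sumr_ge0 => i _; rewrite ler0n.
Qed.

End GeometricGraphs.

(** * The sparse regime *)

Section SparseNumerics.
Variable R : realType.
Implicit Types (e a c p q L C : R).

Lemma binomial_ge n k : (0 < k <= n)%N -> (n%:R / k%:R) ^+ k <= 'C(n, k)%:R :> R.
Proof.
elim: k n => // k IH [//|n]; rewrite ltnS => /andP[_ kn].
have k0 : 0 < k.+1%:R :> R by rewrite ltr0n.
rewrite exprS -(ler_pM2l k0) mulrA mulrCA divff ?gt_eqF // mulr1.
have -> : k.+1%:R * 'C(n.+1, k.+1)%:R = n.+1%:R * 'C(n, k)%:R :> R.
  by rewrite -!natrM -mul_bin_diag.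
rewrite ler_wpM2l ?ler0n //; case: k IH kn k0 => [|k] IH kn k0; first by rewrite expr0 bin0.
apply: le_trans (IH n kn); apply: lerXn2r; rewrite ?nnegrE ?divr_ge0 ?ler0n //.
rewrite ler_pdivrMr // mulrAC ler_pdivlMr ?ltr0n // -!natrM ler_nat; lia.
Qed.

Lemma exprn_1sub_ge (w x : R) n k : 0 <= w <= 1 / 4 -> w <= x -> expR (- (2 * (n%:R * x))) <= (1 - w) ^+ (n - k).
Proof.
move=> /andP[w0 w1] wx; have h : expR (- (2 * w)) <= 1 - w.
  have := expRN_quadratic (mulr_ge0 (ler0n R 2) w0); move=> /le_trans; apply.
  have : 0 <= w * (1 - 4 * w) by rewrite mulr_ge0 //; lra.
  lra.
have q1 : 0 <= 1 - w <= 1 by lra.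
apply: (@le_trans _ _ ((1 - w) ^+ n)); last first.
  by apply: ler_wiXn2l; [lra|lra|exact: leq_subr].
apply: (@le_trans _ _ (expR (- (2 * w)) ^+ n)).
  by rewrite -expRM_natl ler_expR mulrN lerN2 mulrCA ler_pM2l // ler_wpM2l.
by apply: lerXn2r; rewrite ?nnegrE ?expR_ge0 //; lra.
Qed.

Lemma radius_numeric c q : 0 < c -> q <= 1 / (8 * c) -> 2 * (c * q) <= 1 / 4.
Proof.
move=> c0; have c8 : 0 < 8 * c by rewrite mulr_gt0.
by rewrite ler_pdivlMr //; lra.
Qed.

(* [k] is the predicted clique number: with [L = ln n], the least [k] such that the expected
   number [n * (c * p / (k + 1)) ^ k] of cliques of size [k + 1] is below [n ^ (1 - a)]. *)
Lemma level_exists c p L a k0 : 0 < c * p -> 0 < L -> 0 < k0 -> 0 < a <= 1 ->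
  c * p <= k0 * expR (- k0^-1) * L ->
  exists k, [/\ (0 < k)%N, k%:R <= k0 * L + 1, a * L < k%:R * ln (k.+1%:R / (c * p)) &
    (1 < k)%N -> k.-1%:R * ln (k%:R / (c * p)) <= a * L].
Proof.
move=> cp0 L0 k00 /andP[a0 a1] hp.
pose Q k := (0 < k)%N && (a * L < k%:R * ln (k.+1%:R / (c * p))).
have kL : 0 <= k0 * L by rewrite mulr_ge0 ?ltW.
pose k1 := (Num.truncn (k0 * L)).+1.
have /andP[t1 t2] := truncn_itv kL.
have Q1 : Q k1.
  rewrite /Q /=; apply: (@le_lt_trans _ _ (k0 * L * k0^-1)).
    by rewrite mulrAC mulfV ?mul1r ?gt_eqF // ler_piMl // ltW.
  have h : k0^-1 <= ln (k1.+1%:R / (c * p)).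
    rewrite -ler_expR lnK ?posrE ?divr_gt0 ?ltr0n // ler_pdivlMr //.
    apply: (@le_trans _ _ (k0 * L)); last by apply: ltW (lt_trans t2 _); rewrite ltr_nat.
    apply: (@le_trans _ _ (expR k0^-1 * (k0 * expR (- k0^-1) * L))); first by rewrite ler_pM2l ?expR_gt0.
    rewrite expRN; have E0 := expR_gt0 k0^-1; move: E0; set E := expR _ => E0.
    by rewrite le_eqVlt; apply/orP; left; apply/eqP; field; rewrite gt_eqF.
  have ik : 0 < k0^-1 by rewrite invr_gt0.
  by apply: (@lt_le_trans _ _ (k1%:R * k0^-1)); [rewrite ltr_pM2r|rewrite ler_wpM2l].
have exQ : exists k, Q k by exists k1.
case: (ex_minnP exQ) => k /andP[k0' hk] kmin; exists k; split=> //.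
  apply: (@le_trans _ _ k1%:R); first by rewrite ler_nat kmin.
  by rewrite /k1 -natr1 lerD2r.
move=> k2; rewrite leNgt; apply/negP => h.
have := kmin k.-1; rewrite /Q prednK // h andbT -ltnS prednK // k2 => /(_ isT).
by rewrite leqNgt prednK // leqnn.
Qed.

(** Since k <= 2 k0 L with [k0] small, the logarithm [y] is large, and replacing [c] by [C] costs
    only a fraction e / 8 of it. Constant factors in the mean are therefore harmless in this
    regime. *)
Lemma level_upper c C p L e k0 k m : 0 < c -> c <= C -> 0 < p -> 1 <= k0 * L -> 0 < L -> 0 < e < 1 ->
  0 < k0 -> 2 * k0 * ln (C / c) <= e / 8 * (1 - e / 8) -> (0 < k)%N -> k%:R <= k0 * L + 1 ->
  (1 - e / 8) * L < k%:R * ln (k.+1%:R / (c * p)) -> (1 + e) * k%:R <= m%:R ->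
  C * p <= m.+1%:R /\ (C * p / m.+1%:R) ^+ m <= expR (- (1 + e / 2) * L).
Proof.
move=> c0 cC p0 kL L0 /andP[e0 e1] k00 hk0 kp kle hk hm.
have C0 : 0 < C := lt_le_trans c0 cC.
set y := ln (k.+1%:R / (c * p)) in hk *; set K := ln (C / c) in hk0 *.
have kR : 1 <= k%:R :> R by rewrite ler1n.
have K0 : 0 <= K by rewrite ln_ge0 // ler_pdivlMr // mul1r.
have aL : 0 < (1 - e / 8) * L by rewrite mulr_gt0 //; lra.
have y0 : 0 < y by rewrite -(pmulr_rgt0 _ (lt_le_trans ltr01 kR)); exact: lt_trans hk.
have km : k.+1%:R <= m.+1%:R :> R.
  by rewrite -!natr1 lerD2r; apply: le_trans hm; rewrite ler_peMl //; lra.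
have m1 : 0 < m.+1%:R :> R by rewrite ltr0n.
have Ky : K <= e / 8 * y.
  have h2 : k%:R <= 2 * (k0 * L) by lra.
  have h3 : (1 - e / 8) * L < 2 * (k0 * L) * y by apply: lt_le_trans hk _; rewrite ler_pM2r.
  have h4 : (1 - e / 8) < 2 * k0 * y.
    by rewrite -(ltr_pM2r L0); apply: lt_le_trans h3 _; rewrite le_eqVlt; apply/orP; left; apply/eqP; ring.
  have h5 : 2 * k0 * K <= 2 * k0 * (e / 8 * y).
    apply: le_trans hk0 _; rewrite mulrCA ler_pM2l; last by lra.
    exact: ltW.
  by rewrite -(ler_pM2l (mulr_gt0 (ltr0n R 2 : 0 < 2) k00)).
have x0 : 0 < C * p / m.+1%:R by rewrite divr_gt0 // mulr_gt0.
have lx : ln (C * p / m.+1%:R) <= - (1 - e / 8) * y.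
  apply: (@le_trans _ _ (ln (C / c * (k.+1%:R / (c * p))^-1))).
    rewrite ler_ln ?posrE ?mulr_gt0 ?invr_gt0 ?ltr0n //; last by rewrite divr_gt0 ?mulr_gt0 ?ltr0n.
    have -> : C / c * (k.+1%:R / (c * p))^-1 = C * p / k.+1%:R.
      by field; rewrite !gt_eqF ?ltr0n.
    by rewrite ler_wpM2l ?mulr_ge0 ?(ltW C0) ?(ltW p0) // lef_pV2 ?posrE ?ltr0n.
  rewrite lnM ?posrE ?invr_gt0 ?divr_gt0 ?mulr_gt0 ?ltr0n // lnV ?posrE ?divr_gt0 ?mulr_gt0 ?ltr0n //.
  by rewrite -/K -/y; lra.
have yn : - (1 - e / 8) * y <= 0 by rewrite mulNr oppr_le0 mulr_ge0 ?(ltW y0) //; lra.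
split.
  have : ln (C * p / m.+1%:R) <= ln 1 by rewrite ln1; exact: le_trans yn.
  by rewrite ler_ln ?posrE // ler_pdivrMr // mul1r.
rewrite -[X in X ^+ _]lnK ?posrE // -expRM_natl ler_expR.
apply: (@le_trans _ _ (m%:R * (- (1 - e / 8) * y))); first by rewrite ler_wpM2l.
apply: (@le_trans _ _ ((1 + e) * k%:R * (- (1 - e / 8) * y))).
  by rewrite -subr_ge0 -mulrBl mulr_le0 // subr_le0.
have -> : (1 + e) * k%:R * (- (1 - e / 8) * y) = - ((1 + e) * (1 - e / 8) * (k%:R * y)) by ring.
rewrite mulNr lerN2; apply: (@le_trans _ _ ((1 + e) * (1 - e / 8) * ((1 - e / 8) * L))); last first.
  by rewrite ler_wpM2l ?(ltW hk) // mulr_ge0 //; lra.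
rewrite !mulrA ler_pM2r //.
have ee : e * e <= e by rewrite ler_piMl // ltW.
have eee : 0 <= e * e * e by rewrite !mulr_ge0 // ltW.
by lra.
Qed.

(** By minimality of [k], the expected number of windows with [k] points still exceeds n^(e/8) up to
    the factors [k] and exp(-C p'), each of which costs at most n^(e/32). *)
Lemma level_lower c c' c2 C p p' L e k0 k : 0 < c -> 0 < p -> 0 < p' -> 0 < c2 -> 0 <= L -> 0 < e ->
  c * p <= c' * p' -> k0 <= e / 32 -> (1 < k)%N -> k%:R <= k0 * L + 1 ->
  k.-1%:R * ln (k%:R / (c * p)) <= (1 - e / 8) * L -> C * p' <= e / 32 * L ->
  k%:R / (c2 * expR L * (c' * p' / k%:R) ^+ k.-1 * expR (- (C * p'))) <= c2^-1 * expR (- (e / 16) * L).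
Proof.
move=> c0 p0 p'0 c20 L0 e0 cp hk0 k1 kle hk hC.
have kR : 0 < k%:R :> R by rewrite ltr0n (ltn_trans _ k1).
have cp0 : 0 < c * p by rewrite mulr_gt0.
have h1 : expR (- (1 - e / 8) * L) <= (c' * p' / k%:R) ^+ k.-1.
  apply: (@le_trans _ _ ((c * p / k%:R) ^+ k.-1)); last first.
    apply: lerXn2r; rewrite ?nnegrE ?divr_ge0 ?(ltW cp0) ?(ltW kR) ?(le_trans (ltW cp0) cp) //.
    by rewrite ler_pM2r ?invr_gt0.
  have x0 : 0 < c * p / k%:R by rewrite divr_gt0.
  rewrite -[X in X ^+ _]lnK ?posrE // -expRM_natl ler_expR -[c * p / _]invf_div lnV ?posrE ?divr_gt0 //.
  by rewrite mulrN mulNr lerN2.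
have h2 : k%:R <= expR (e / 32 * L).
  apply: (le_trans kle); apply: le_trans (expR_ge1Dx _); rewrite addrC lerD2l.
  by rewrite ler_wpM2r.
have D0 : 0 < c2 * expR L * (c' * p' / k%:R) ^+ k.-1 * expR (- (C * p')).
  by rewrite !mulr_gt0 ?expR_gt0 // exprn_gt0 // divr_gt0 // (lt_le_trans cp0).
rewrite ler_pdivrMr //; apply: (le_trans h2).
have -> : c2^-1 * expR (- (e / 16) * L) * (c2 * expR L * (c' * p' / k%:R) ^+ k.-1 * expR (- (C * p'))) =
    expR (- (e / 16) * L) * expR L * (c' * p' / k%:R) ^+ k.-1 * expR (- (C * p')).
  by set x1 := expR _; set x2 := expR _; set x3 := _ ^+ _; set x4 := expR _; field; rewrite gt_eqF.
apply: (@le_trans _ _ (expR (- (e / 16) * L) * expR L * expR (- (1 - e / 8) * L) * expR (- (e / 32 * L)))).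
  by rewrite -!expRD ler_expR; lra.
apply: ler_pM; rewrite ?mulr_ge0 ?expR_ge0 //.
  by rewrite ler_wpM2l // mulr_ge0 ?expR_ge0.
by rewrite ler_expR lerN2.
Qed.

Lemma level_le_numeric k0 e L (n : nat) : k0 <= e / 32 -> e < 1 -> 0 <= L -> L <= 1 * n%:R ->
  (2 <= n)%N -> k0 * L + 1 <= n%:R.
Proof.
move=> h e1 L0 Ln n2; have n2R : 2 <= n%:R :> R by rewrite ler_nat.
have h1 : k0 * L <= 1 / 32 * L by rewrite ler_wpM2r //; lra.
lra.
Qed.

Lemma quarter_numeric C p e tau L : 0 < C -> 0 <= L -> p <= tau * L -> tau <= e / (32 * C) ->
  C * p <= e / 32 * L.
Proof.
move=> C0 L0 hp ht; apply: (@le_trans _ _ (C * (e / (32 * C) * L))).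
  by rewrite ler_pM2l //; apply: le_trans hp _; rewrite ler_wpM2r.
by rewrite le_eqVlt; apply/orP; left; apply/eqP; field; rewrite gt_eqF.
Qed.

Lemma rate_numeric e L : 0 <= e -> 0 <= L -> L + - (1 + e / 2) * L <= - (e / 16) * L.
Proof. by move=> e0 L0; have := mulr_ge0 e0 L0; lra. Qed.

Lemma union_numeric C C' e L (I : nat) : 0 < e < 1 -> 0 <= L -> I%:R <= 3 * L ->
  I.+1%:R * (`|C| * expR (- (e / 16) * L)) + C' * expR (- L) <=
  (`|C| * (96 / e) + `|C'|) * expR (- (e / 32) * L).
Proof.
move=> /andP[e0 e1] L0 hI; rewrite mulrDl; apply: lerD.
  rewrite mulrCA -[leRHS]mulrA ler_wpM2l //.
  have h : I.+1%:R <= 96 / e * expR (e / 32 * L).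
    apply: (@le_trans _ _ (96 / e * (1 + e / 32 * L))); last first.
      by rewrite ler_wpM2l ?expR_ge1Dx // divr_ge0 // ltW.
    have -> : 96 / e * (1 + e / 32 * L) = 96 / e + 3 * L by field; rewrite gt_eqF.
    have : 96 <= 96 / e by rewrite ler_peMr // invf_ge1 // ltW.
    by rewrite -natr1; lra.
  apply: (@le_trans _ _ (96 / e * expR (e / 32 * L) * expR (- (e / 16) * L))).
    by rewrite ler_wpM2r ?expR_ge0.
  rewrite -mulrA -expRD ler_wpM2l ?divr_ge0 ?(ltW e0) // ler_expR; lra.
apply: (@le_trans _ _ (`|C'| * expR (- L))); first by rewrite ler_wpM2r ?expR_ge0 // ler_norm.
rewrite ler_wpM2l // ler_expR mulNr lerN2 ler_piMl //; lra.
Qed.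

Lemma level_scale_numeric s n q t Lj Ln : 0 < s -> 0 <= t -> s * n * q <= s * t / 2 * Ln ->
  Ln <= 2 * Lj -> n * q <= t * Lj.
Proof.
move=> s0 t0 h hL; rewrite -(ler_pM2l s0) mulrA; apply: (le_trans h).
have -> : s * (t * Lj) = s * t / 2 * (2 * Lj) by field.
by rewrite ler_wpM2l // divr_ge0 // mulr_ge0 // ltW.
Qed.

End SparseNumerics.

(** * Cliques and two-step neighbourhoods of a sparse sample *)

Section SparsePoints.
Variables (R : realType) (d : nat) (leb : {measure set (d.-tuple R) -> \bar R}).
Variables (d0 : measure_display) (Omega : measurableType d0) (P : probability Omega R).
Variables (X : nat -> Omega -> d.-tuple R) (nu : {measure set (d.-tuple R) -> \bar R}).
Variables (sigma : R) (F : R -> set (d.-tuple R)).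
Hypothesis hS : sampling leb P X nu sigma F.
Variable N : 'rV[R]_d -> R.
Hypothesis hN : is_norm N.

Lemma Pbound_setU (A B : set Omega) (x y : R) : Pbound P A x -> Pbound P B y -> Pbound P (A `|` B) (x + y).
Proof.
move=> [E [mE sE hE]] [E' [mE' sE' hE']]; exists (E `|` E'); split; first exact: measurableU.
  exact: setUSS.
by apply: le_trans (measureU2 _ _ _) _ => //; rewrite EFinD leeD.
Qed.

(** Windows of side r / D have diameter at most r, so the points in one of them form a clique. The
    bound is the inverse of the number of windows times the binomial probability of exactly [k]
    points; one factor of the [k]-th power is merged with the number r^(-d) of windows into
    [c2 * n / k]. *)
Lemma clique_low_prob : exists c c2 C r0 : R, [/\ 0 < c, 0 < c2, 0 < C, 0 < r0 &
  forall n k r, 0 < r <= r0 -> (0 < k <= n)%N ->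
    Pbound P [set w | clq N (fun i => X i w) n r < k%:R]
      (k%:R / (c2 * n%:R * (c * (n%:R * r ^+ d) / k%:R) ^+ k.-1 * expR (- (C * (n%:R * r ^+ d)))))].
Proof.
have hd := samp_dim hS; have hleb := samp_leb hS; have s0 := samp_gt0 hS.
have [D D0 hD] := norm_le_coord hd hN.
pose g (x : d.-tuple R) : 'I_2 := if x \in cube 1 then ord_max else ord0.
have mcube : measurable (@cube R d 1) by exact: measurable_box.
have gE : [set x | g x = ord_max] = cube 1.
  apply/seteqP; split=> x; rewrite /= /g; first by case: ifPn => [/set_mem|].
  by move=> /mem_set ->.
have mg (k : 'I_2) : measurable [set x | g x = k].
  have [->|k0] := eqVneq k ord_max; first by rewrite gE.
  have -> : [set x | g x = k] = ~` cube 1; last exact: measurableC.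
  apply/seteqP; split=> x /=; rewrite /g.
    by case: ifPn => [_ e|/negP h _ /mem_set]; [move: k0; rewrite -e eqxx|].
  move=> cx; rewrite (memNset cx); apply/val_inj; case: k k0 => [[|[|//]] ik] //= k0.
have gM x : g x != ord0 -> cube 1 x by rewrite /g; case: ifPn => [/set_mem|]; rewrite ?eqxx.
pose v := lam leb g ord_max.
have vE : v = 2 ^+ d.
  rewrite /v /lam gE /cube leb_box_max //= (eq_bigr (fun=> 2)) ?prodr_const ?card_ord // => i _.
  by rewrite !tnth_mktuple opprK (max_idPr _).
have v0 : 0 < v by rewrite vE exprn_gt0.
have [c1 [r1 [c10 r10 hgood]]] := @good_wins R d d0 Omega P X nu (samp_law hS) leb hleb sigma
  (ltW s0) F (samp_levels hS) (samp_ge hS) (samp_good hS) 1 1 g isT mg gM 1 (v / 2) ltr01 (divr_gt0 v0 (ltr0n R 2)).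
have D2 : 0 < 2 * D by rewrite mulr_gt0.
have Dd : 0 < (2 * D) ^+ d by rewrite exprn_gt0.
pose c := sigma * (v / 2) / (2 * D) ^+ d.
have c0 : 0 < c by rewrite divr_gt0 // mulr_gt0 // divr_gt0.
(* r <= 1 gives r^d <= r; the second bound admits the good windows of size rho = r / (2 D); the
   third keeps the mass of a window at most 1/4. *)
pose r0 := Num.min 1 (Num.min (r1 * (2 * D)) (1 / (8 * c))).
exists c, (c1 * (2 * D) ^+ d * c), (4 * c), r0; split.
- exact: c0.
- exact: mulr_gt0 (mulr_gt0 c10 Dd) c0.
- exact: mulr_gt0 (ltr0n R 4) c0.
- by rewrite /r0 !lt_min ltr01 (mulr_gt0 r10 D2) (divr_gt0 ltr01 (mulr_gt0 (ltr0n R 8) c0)).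
move=> n k r /andP[rp]; rewrite !le_min => /and3P[rle1 rle2 rle3] /andP[k0 kn].
pose rho := r / (2 * D); have rho0 : 0 < rho by rewrite divr_gt0.
have rho1 : 0 < rho <= r1 by rewrite rho0 ler_pdivrMr.
have [S [uS sS gS]] := hgood rho rho1.
have rhod : rho ^+ d = r ^+ d / (2 * D) ^+ d by rewrite expr_div_n.
have rd : 0 < r ^+ d by rewrite exprn_gt0.
pose p := n%:R * r ^+ d; have n0 : 0 < n%:R :> R by rewrite ltr0n (leq_trans k0 kn).
have p0 : 0 < p by rewrite mulr_gt0.
have kR : 0 < k%:R :> R by rewrite ltr0n.
pose q := (c * p / k%:R) ^+ k * expR (- (4 * c * p)).
have q0 : 0 < q by rewrite mulr_gt0 ?expR_gt0 // exprn_gt0 // divr_gt0 // mulr_gt0.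
have hsize : c1 * (2 * D) ^+ d * (r ^+ d)^-1 <= (size S)%:R.
  by apply: le_trans sS; rewrite rhod invf_div mulrA.
have size0 : (0 < size S)%N.
  by rewrite -(ltr0n R); apply: lt_le_trans hsize; rewrite !mulr_gt0 // invr_gt0.
have hq z : z \in S -> q <= wprob nu 1 g rho S n z k%:R.
  move=> zS; have := @window_binomial R d d0 Omega P X nu (samp_law hS) 1 1 g isT mg gM rho S n rho0 z k erefl zS.
  cbv zeta; set w := \sum_(j < 2) _ => /(le_trans _); apply.
  have wE : w = wmass nu 1 g rho z ord_max.
    rewrite /w big_ord_recl big_ord1 /= mul0r mul0r add0r divr1 mul1r; congr wmass.
    exact/val_inj.
  have wlow : c * r ^+ d <= w.
    have h01 (j : 'I_2) : 0 <= (j%:R / 1%:R : R) <= 1.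
      by rewrite divr1 ler0n lern1 -ltnS ltn_ord.
    have := gS z zS (fun j : 'I_2 => j%:R / 1%:R) (mul0r _) h01; rewrite -/w.
    rewrite big_ord_recl big_ord1 /= mul0r mul0r add0r divr1 mul1r.
    rewrite (_ : lift ord0 ord0 = ord_max); last exact/val_inj.
    rewrite -/v; apply: le_trans; rewrite rhod /c le_eqVlt; apply/orP; left; apply/eqP.
    by field; rewrite !gt_eqF.
  have wup : w <= 2 * (c * r ^+ d).
    rewrite wE; have := @wmass_le R d d0 Omega P X nu (samp_law hS) leb hleb sigma (samp_le hS) 1 1 g mg gM rho z ord_max rho0 isT.
    rewrite -/v => /le_trans; apply; rewrite rhod /c le_eqVlt; apply/orP; left; apply/eqP.
    by field; rewrite !gt_eqF.
  have w0 : 0 <= w by apply: le_trans wlow; rewrite mulr_ge0 // ltW.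
  have rdr : r ^+ d <= r.
    by case: (d) hd => // d' _; rewrite exprS ler_piMr ?(ltW rp) // exprn_ile1 // ltW.
  have w4 : 0 <= w <= 1 / 4.
    rewrite w0 (le_trans wup) //; apply: (@le_trans _ _ (2 * (c * r))); first by rewrite ler_pM2l // ler_pM2l.
    exact: radius_numeric c0 rle3.
  have cpk : 0 <= c * p / k%:R := divr_ge0 (ltW (mulr_gt0 c0 p0)) (ltW kR).
  have nk : 0 <= n%:R / k%:R :> R by rewrite divr_ge0.
  rewrite /q; apply: (ler_pM (exprn_ge0 _ cpk) (expR_ge0 _)).
    apply: (@le_trans _ _ ((n%:R / k%:R * w) ^+ k)); last first.
      by rewrite exprMn ler_wpM2r ?exprn_ge0 //; apply: binomial_ge; rewrite k0 kn.
    apply: lerXn2r; rewrite ?nnegrE //; first exact: mulr_ge0.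
    rewrite /p (_ : c * (n%:R * r ^+ d) / k%:R = n%:R / k%:R * (c * r ^+ d)); last by ring.
    by rewrite ler_wpM2l // divr_ge0 ?ler0n.
  have := exprn_1sub_ge n k w4 wup; rewrite (_ : 2 * _ = 4 * c * p) //.
  by rewrite /p; ring.
have [z0 z0S] : exists z, z \in S.
  by move: size0; case: (S) => [//|z S' _]; exists z; rewrite mem_head.
have q1 : q <= 1 by apply: (le_trans (hq z0 z0S)); exact: (@wprob_le1 R d d0 Omega P X nu (samp_law hS) 1 1 g isT mg rho S n rho0 z0 _).
have q01 : 0 <= q <= 1 by rewrite q1 ltW.
apply: Pbound_le (@windows_fail R d d0 Omega P X (samp_meas hS) nu (samp_law hS) (samp_indep hS) 1 1 g isT isT mg gM rho S n rho0 uS k%:R q q01 hq) => [w /= hw z zS|].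
  rewrite ltNge; apply/negP => hk; move: hw; apply/negP; rewrite -leNgt; apply: le_trans hk _.
  pose T := finset (fun i : 'I_n => win 1 rho z (X i w) \in cube 1).
  have -> : \sum_(i < n) step g (win 1 rho z (X i w)) = (#|T|)%:R.
    rewrite -sum1_card natr_sum [RHS]big_mkcond; apply: eq_bigr => i _.
    by rewrite finset.in_set /step /g; case: ifP => _; rewrite ?mul0r //= divr1.
  rewrite ler_nat; apply: clique_number_ge; apply/is_cliqueP => i j.
  rewrite !finset.in_set => /set_mem /(win_cube _ _ _ rho0) ci /set_mem /(win_cube _ _ _ rho0) cj _.
  have sd : 0 < side 1 rho by exact: side_gt0.
  have := dist_cells hN (X i w) (X j w) sd hD; move: (ci isT) (cj isT); rewrite /cell /= => -> ->.
  rewrite subrr (norm_0 hN) mulr0 subr0 /rgg => /(le_trans (ler_norm _)) /le_trans; apply.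
  by rewrite /side /rho -[(1.*2)%N]/2%N le_eqVlt; apply/orP; left; apply/eqP; field; rewrite gt_eqF.
have q01' : 0 < q <= 1 by rewrite q0.
apply: le_trans (exprn_1sub_le q01' size0) _.
have sq0 : 0 < (size S)%:R * q by rewrite mulr_gt0 ?ltr0n.
rewrite -[leRHS]invf_div lef_pV2 ?posrE //; last first.
  have cpk : 0 < c * (n%:R * r ^+ d) / k%:R := divr_gt0 (mulr_gt0 c0 p0) kR.
  apply: divr_gt0 kR; apply: (mulr_gt0 (mulr_gt0 _ (exprn_gt0 _ cpk)) (expR_gt0 _)).
  exact: mulr_gt0 (mulr_gt0 (mulr_gt0 c10 Dd) c0) n0.
apply: (@le_trans _ _ (c1 * (2 * D) ^+ d * (r ^+ d)^-1 * q)); last by rewrite ler_pM2r.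
rewrite /q -/p -[in leRHS](prednK k0) exprS prednK //.
set A := _ ^+ k.-1; set E := expR _.
rewrite le_eqVlt; apply/orP; left; apply/eqP; rewrite /p; field.
by rewrite !gt_eqF.
Qed.

Definition two_step (x : nat -> d.-tuple R) n r (v : 'I_n) : {set 'I_n} :=
  finset (fun w => [exists u, rgg N x r v u && rgg N x r u w]).

Lemma chi_le_two_step (x : nat -> d.-tuple R) n r m : 0 < r ->
  (forall v : 'I_n, (#|two_step x r v| <= m)%N) -> chi N x n r <= Num.max (clq N x n r) m.-1%:R.
Proof.
move=> r0 hm; rewrite -natr_max ler_nat; apply: chromatic_le_two_step => //.
  by move=> i; rewrite /rgg (dist_refl hN) ltW.
by move=> i j; rewrite /rgg (dist_sym hN).
Qed.

(** A two-step neighbourhood lies in a ball of radius 2 r, hence in a fixed box of cells around its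
    centre. Enlarging n' and r' to n and r only enlarges the count in that box, so one event serves
    all smaller parameters. *)
Lemma crowded_prob : exists C1 C : R, [/\ 0 < C1, 0 < C &
  forall n m r, (0 < n)%N -> 0 < r -> C1 * (n%:R * r ^+ d) <= m.+1%:R ->
    Pbound P [set w | exists n' r', [/\ (n' <= n)%N, 0 < r', r' <= r &
        exists v : 'I_n', (m < #|two_step (fun i => X i w) r' v|)%N]]
      (C * n%:R * (C1 * (n%:R * r ^+ d) / m.+1%:R) ^+ m)].
Proof.
have hd := samp_dim hS; have hleb := samp_leb hS; have s0 := samp_gt0 hS.
have [K1 K10 hK1] := coord_le_norm hd hN.
pose g := (Num.truncn (K1 * 2)).+1; pose K := (g + g).+1.
pose shift : {ffun 'I_d -> int} := [ffun=> g%:Z].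
pose V := [seq embed v - shift | v : {ffun 'I_d -> 'I_K}].
have uV : uniq V by rewrite map_inj_uniq ?enum_uniq // => v w /addIr /embed_inj.
pose psi (z : {ffun 'I_d -> int}) : R := (z \in V)%:R.
have hV (z : {ffun 'I_d -> int}) : (forall k, `|z k| <= g%:Z) -> z \in V.
  move=> hz; have hk k : (`|(z k - 0 + g%:Z)%R|%N < K)%N by apply: offset_box_lt; rewrite subr0.
  apply/mapP; exists [ffun k => Ordinal (hk k)]; first by rewrite mem_enum.
  apply/ffunP => k; rewrite ffun_subE embedE !ffunE /= offset_box_abs ?subr0 //.
  by rewrite sub0r opprK addrK.
pose b : R := (size V)%:R.
have b0 : 0 < b.
  by rewrite ltr0n size_map -cardE card_ffun !card_ord expn_gt0.
exists (expR 1 * (sigma * b)), (2 * b * expR 1); split; rewrite ?mulr_gt0 ?expR_gt0 //.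
move=> n m r n0 r0 hm; set p := n%:R * r ^+ d in hm *.
have p0 : 0 < p by rewrite mulr_gt0 ?ltr0n // exprn_gt0.
have m0 : 0 < m.+1%:R :> R by rewrite ltr0n.
have y0 : 0 < sigma * b * p by apply: mulr_gt0 => //; exact: mulr_gt0.
(* The optimal Chernoff exponent for a count with mean at most sigma b p to reach m + 1. *)
pose s := ln (m.+1%:R / (sigma * b * p)).
have s1 : 1 <= s.
  rewrite -ler_expR lnK ?posrE ?divr_gt0 // ler_pdivlMr //.
  by rewrite !mulrA in hm *.
have sp : 0 < s by apply: lt_le_trans s1.
have sa : 1 <= s * m.+1%:R.
  by apply: (le_trans s1); rewrite ler_peMr ?(ltW sp) // ler1n.
have es : expR s = m.+1%:R / (sigma * b * p) by rewrite lnK ?posrE ?divr_gt0.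
have BE : \sum_(v <- V) (expR (s * psi v) - 1) = b * (expR s - 1).
  rewrite (eq_big_seq (fun=> expR s - 1)); last by move=> v vV; rewrite /psi vV mulr1.
  by rewrite big_const_seq count_predT iter_addr_0 -[_ *+ _]mulr_natl.
have psi0 v : 0 <= psi v by rewrite ler0n.
have psiV v : v \notin V -> psi v = 0 by rewrite /psi => /negbTE ->.
have := @window_exceed_prob R d leb d0 Omega P X nu sigma F hS n r s m.+1%:R m.+1%:R V psi n0 r0 sp sa uV psi0 psiV.
rewrite BE; cbv zeta => /(_ _)-HB.
apply: Pbound_le (HB _) => [w /= [n' [r' [nn r'0 rr [v hv]]]]||].
- exists (cidx r (X v w)).
  apply: (@le_trans _ _ (\sum_(i < n') psi (cidx r (X i w) - cidx r (X v w)))); last first.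
    rewrite -(big_mkord xpredT (fun i => psi (cidx r (X i w) - cidx r (X v w)))).
    rewrite -(big_mkord xpredT (fun i => psi (cidx r (X i w) - cidx r (X v w)))).
    by rewrite (big_cat_nat (leq0n _) nn) /= lerDl sumr_ge0.
  apply: (@le_trans _ _ (#|two_step (fun i => X i w) r' v|)%:R); first by rewrite ler_nat.
  rewrite -sum1_card natr_sum big_mkcond; apply: ler_sum => i _.
  case: ifPn => [|_]; last exact: psi0.
  rewrite finset.in_set => /existsP[u /andP[vu ui]].
  have h2 : dist N (X i w) (X v w) <= 2 * r.
    rewrite (dist_sym hN); apply: (le_trans (dist_triangle hN _ (X u w) _)).
    by rewrite mulr_natl mulr2n; apply: lerD; apply: le_trans rr.
  rewrite /psi hV // => k; rewrite ffun_subE.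
  have := cidx_gap k r0 hK1 h2 (ltW K10); rewrite mulrA mulfK ?gt_eqF //.
- rewrite (_ : 2 * (b * (expR s - 1)) * _ = 2 * b * ((expR s - 1) * expR (ln n%:R + m.+1%:R - s * m.+1%:R))); last by ring.
  rewrite -[leRHS]mulrA -[2 * b * expR 1 * _]mulrA ler_pM2l ?mulr_gt0 //.
  apply: (@le_trans _ _ (expR s * expR (ln n%:R + m.+1%:R - s * m.+1%:R))).
    by rewrite ler_wpM2r ?expR_ge0 // gerBl.
  have -> : expR 1 * (sigma * b) * p / m.+1%:R = expR (1 - s).
    by rewrite expRD expRN es; field; rewrite !gt_eqF.
  rewrite -expRM_natl -[in leRHS](lnK (_ : n%:R \is Num.pos)) ?posrE ?ltr0n // -!expRD ler_expR.
  by rewrite -natr1; lra.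
rewrite -mulrA (_ : n%:R * (r ^+ d * (b * (expR s - 1))) = b * p * (expR s - 1)); last by rewrite /p; ring.
apply: (@le_trans _ _ (sigma * (b * p * expR s))).
  by rewrite ler_pM2l // (ler_pM2l (mulr_gt0 b0 p0)) gerBl.
by rewrite es le_eqVlt; apply/orP; left; apply/eqP; field; rewrite !gt_eqF.
Qed.

Lemma clq_ge1 (x : nat -> d.-tuple R) n r : (0 < n)%N -> 1 <= clq N x n r.
Proof. by move=> n0; rewrite ler1n clique_number_gt0. Qed.

Lemma sparse_prob e : 0 < e < 1 -> exists tau r0 C : R, [/\ 0 < tau, 0 < r0 & \forall n \near \oo,
  forall rho, 0 < rho <= r0 -> n%:R * rho ^+ d <= tau * ln n%:R ->
  Pbound P [set w | exists n' r, [/\ (n <= n' <= n.*2)%N, 0 < r, rho * expR (-1) <= r <= rho &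
      (1 + e) * clq N (fun i => X i w) n' r < chi N (fun i => X i w) n' r]]
    (C * expR (- (e / 16) * ln n%:R))].
Proof.
move=> e01; have /andP[e0 e1] := e01.
have [cl [c2 [C4 [r0 [cl0 c20 C40 r00 low]]]]] := clique_low_prob.
have [C1 [C [C10 C0 up]]] := crowded_prob.
have ed : 0 < expR (-1) ^+ d :> R by rewrite exprn_gt0 // expR_gt0.
pose c := Num.min (cl * expR (-1) ^+ d) (2 * C1).
have C12 : 0 < 2 * C1 by rewrite mulr_gt0.
have c0 : 0 < c by rewrite lt_min (mulr_gt0 cl0 ed) C12.
have cC : c <= 2 * C1 by rewrite ge_min lexx orbT.
have a0 : 0 < e / 8 * (1 - e / 8) by rewrite mulr_gt0 //; lra.
pose K := ln (2 * C1 / c); have K0 : 0 <= K by rewrite ln_ge0 // ler_pdivlMr // mul1r.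
have K2 : 0 < 2 * K + 1 by rewrite ltr_wpDl // mulr_ge0.
pose k0 := Num.min (e / 32) (e / 8 * (1 - e / 8) / (2 * K + 1)).
have k00 : 0 < k0 by rewrite lt_min divr_gt0 // (divr_gt0 a0 K2).
have k0e : k0 <= e / 32 by rewrite ge_min lexx.
have k0K : 2 * k0 * K <= e / 8 * (1 - e / 8).
  have : k0 * (2 * K + 1) <= e / 8 * (1 - e / 8) by rewrite -ler_pdivlMr // ge_min lexx orbT.
  by have := k00; lra.
have a01 : 0 < 1 - e / 8 <= 1 by lra.
(* The first bound is the hypothesis of [level_exists], the second keeps the factor exp(-C4 p') at
   least n^(-e/32). *)
pose tau := Num.min (k0 * expR (- k0^-1) / c) (e / (32 * C4)).
have tau0 : 0 < tau.
  by rewrite lt_min (divr_gt0 (mulr_gt0 k00 (expR_gt0 _)) c0) (divr_gt0 e0 (mulr_gt0 (ltr0n R 32) C40)).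
exists tau, r0, (c2^-1 + 2 * C); split=> //; near=> n => rho /andP[rho0 rhor] hp.
have L1 : k0^-1 <= ln (n%:R : R) by near: n; exact: near_ln_ge.
have Ln : ln (n%:R : R) <= 1 * n%:R by near: n; exact: near_ln_le.
have n2 : (2 <= n)%N by near: n; exact: nbhs_infty_ge.
have n0 : (0 < n)%N by apply: leq_trans n2.
have nR : 0 < n%:R :> R by rewrite ltr0n.
set L := ln _ in L1 Ln hp *.
have L0 : 0 < L by apply: lt_le_trans L1; rewrite invr_gt0.
have eL : expR L = n%:R by rewrite lnK.
pose p := n%:R * rho ^+ d; have rhod : 0 < rho ^+ d by rewrite exprn_gt0.
have p0 : 0 < p := mulr_gt0 nR rhod.
have cp0 : 0 < c * p := mulr_gt0 c0 p0.
have kL1 : 1 <= k0 * L by rewrite mulrC -ler_pdivrMr // mul1r.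
have cple : c * p <= k0 * expR (- k0^-1) * L.
  rewrite mulrC -ler_pdivlMr // mulrAC; apply: (le_trans hp); rewrite ler_pM2r //.
  by rewrite ge_min lexx.
have [k [kpos kle hk hk']] := level_exists cp0 L0 k00 a01 cple.
(* Then m - 1 <= (1 + e) k <= m: crowding by at most [m] points gives a chromatic number at most the
   maximum of the clique number and (1 + e) k. *)
pose m := (Num.truncn ((1 + e) * k%:R)).+1.
have ek0 : 0 <= (1 + e) * k%:R by rewrite mulr_ge0 // addr_ge0 // ltW.
have /andP[m1 m2] := truncn_itv ek0.
have [um1 um2] := level_upper c0 cC p0 kL1 L0 e01 k00 k0K kpos kle hk (ltW m2).
have rho'0 : 0 < rho * expR (-1) by rewrite mulr_gt0 ?expR_gt0.
have e11 : expR (-1) <= 1 :> R by rewrite expR_le1 lerN10.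
have rho'r : 0 < rho * expR (-1) <= r0.
  by rewrite rho'0 (le_trans _ rhor) // ler_piMr // ltW.
have kn : (k <= n)%N.
  rewrite -(ler_nat R); apply: (le_trans kle); exact: level_le_numeric k0e e1 (ltW L0) Ln n2.
have k0n : (0 < k <= n)%N by rewrite kpos.
pose p' := n%:R * (rho * expR (-1)) ^+ d.
have p'0 : 0 < p' by rewrite /p' mulr_gt0 // exprn_gt0.
have p'E : p' = expR (-1) ^+ d * p by rewrite /p' exprMn /p; ring.
have p'p : p' <= p by rewrite p'E ler_piMl ?(ltW p0) // exprn_ile1 ?expR_ge0.
have cp' : c * p <= cl * p'.
  by rewrite p'E mulrA ler_pM2r // ge_min lexx.
have hC4 : C4 * p' <= e / 32 * L.
  have h : tau <= e / (32 * C4) by rewrite ge_min lexx orbT.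
  exact: quarter_numeric C40 (ltW L0) (le_trans p'p hp) h.
have P1 : Pbound P [set w | clq N (fun i => X i w) n (rho * expR (-1)) < k%:R] (c2^-1 * expR (- (e / 16) * L)).
  (* For k = 1 the minimality clause says nothing, but a clique of one vertex always exists. *)
  have [k1|k1] := ltnP 1 k; last first.
    have -> : k = 1%N by apply/eqP; rewrite eqn_leq k1 kpos.
    exists set0; split=> //; last by rewrite measure0 lee_fin mulr_ge0 ?expR_ge0 // invr_ge0 ltW.
    by move=> w /=; rewrite ltNge clq_ge1.
  apply: Pbound_le (low n k _ rho'r k0n) => //; rewrite -/p' -eL.
  exact: (level_lower c0 p0 p'0 c20 (ltW L0) e0 cp' k0e k1 kle (hk' k1) hC4).
have n20 : (0 < n.*2)%N by rewrite double_gt0.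
have pE : C1 * (n.*2%:R * rho ^+ d) = 2 * C1 * p.
  by rewrite -muln2 natrM /p; ring.
have um1' : C1 * (n.*2%:R * rho ^+ d) <= m.+1%:R by rewrite pE.
have P2 := up n.*2 m rho n20 rho0 um1'.
rewrite pE in P2; rewrite mulrDl.
apply: Pbound_le (Pbound_setU P1 P2) => [w /= [n' [r [/andP[nn n'n] rpos /andP[rr1 rr2] bad]]]|]; last first.
  rewrite lerD2l; apply: (@le_trans _ _ (C * n.*2%:R * expR (- (1 + e / 2) * L))).
    by rewrite ler_wpM2l // mulr_ge0 // ltW.
  have -> : C * n.*2%:R * expR (- (1 + e / 2) * L) = 2 * C * (expR L * expR (- (1 + e / 2) * L)).
    by rewrite eL -muln2 natrM; ring.
  rewrite ler_pM2l ?mulr_gt0 // -expRD ler_expR; exact: rate_numeric (ltW e0) (ltW L0).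
apply: contrapT => /not_orP[/negP]; rewrite -leNgt => h1 h2.
have h3 : forall v : 'I_n', (#|two_step (fun i => X i w) r v| <= m)%N.
  move=> v; rewrite leqNgt; apply/negP => hv; apply: h2; exists n', r; split=> //.
  by exists v.
have cl1 : k%:R <= clq N (fun i => X i w) n' r by apply: le_trans h1 _; exact: clq_mono.
have := chi_le_two_step rpos h3; rewrite leNgt => /negP; apply; apply: le_lt_trans bad.
have cge : 0 <= clq N (fun i => X i w) n' r by exact: ler0n.
rewrite ge_max ler_peMl //=; last by rewrite lerDl ltW.
by apply: (le_trans m1); rewrite ler_wpM2l // addr_ge0 // ltW.
Unshelve. all: by end_near.
Qed.

(** For radii below n^(-3) two-step neighbourhoods are singletons with high probability. This
    disposes of all tiny radii together and leaves a number of scales proportional to ln n. *)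
Lemma tiny_prob : exists C : R, \forall n \near \oo,
  Pbound P [set w | exists n' r, [/\ (n' <= n.*2)%N, 0 < r, r <= expR (- (3 * ln n%:R)) &
      clq N (fun i => X i w) n' r < chi N (fun i => X i w) n' r]]
    (C * expR (- ln n%:R)).
Proof.
have hd := samp_dim hS; have [C1 [C [C10 C0 up]]] := crowded_prob.
exists (2 * C * C1); near=> n.
have L1 : C1 <= ln (n%:R : R) by near: n; exact: near_ln_ge.
have n0 : (0 < n)%N by near: n; exact: nbhs_infty_gt.
have nR : 0 < n%:R :> R by rewrite ltr0n.
set L := ln _ in L1 *.
have L0 : 0 < L by apply: lt_le_trans L1.
have eL : expR L = n%:R by rewrite lnK.
pose rho := expR (- (3 * L)); have rho0 : 0 < rho by exact: expR_gt0.
have rho1 : rho <= 1 by rewrite expR_le1 oppr_le0 mulr_ge0 // ltW.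
have rdr : rho ^+ d <= rho.
  by case: (d) hd => // d' _; rewrite exprS ler_piMr ?(ltW rho0) // exprn_ile1 // ltW.
have h : n%:R * rho ^+ d <= expR (- (2 * L)).
  apply: (@le_trans _ _ (n%:R * rho)); first by rewrite ler_pM2l.
  by rewrite -eL /rho -expRD ler_expR; lra.
have h' : C1 * (n.*2%:R * rho ^+ d) <= 2 * (C1 * expR (- (2 * L))).
  by rewrite -muln2 natrM (mulrC n%:R) -mulrA mulrCA ler_pM2l // ler_pM2l.
have h1 : C1 * (n.*2%:R * rho ^+ d) <= 2.
  apply: (le_trans h'); rewrite -[leRHS]mulr1 ler_pM2l //.
  apply: (@le_trans _ _ (L * expR (- (2 * L)))); first by rewrite ler_pM2r ?expR_gt0.
  rewrite expRN ler_pdivrMr ?expR_gt0 // mul1r; apply: le_trans (expR_ge1Dx _).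
  by have := ltW L0; lra.
have P1 := up n.*2 1 rho (_ : (0 < n.*2)%N) rho0 h1; rewrite double_gt0 in P1.
apply: Pbound_le (P1 n0) => [w /= [n' [r [nn rpos rr bad]]]|].
  apply: contrapT => h2; have h3 : forall v : 'I_n', (#|two_step (fun i => X i w) r v| <= 1)%N.
    move=> v; rewrite leqNgt; apply/negP => hv; apply: h2; exists n', r; split=> //.
    by exists v.
  have := chi_le_two_step rpos h3; rewrite leNgt => /negP; apply; apply: le_lt_trans bad.
  by rewrite ge_max lexx /= ler0n.
rewrite expr1; apply: (@le_trans _ _ (C * n.*2%:R * (C1 * expR (- (2 * L))))).
  by rewrite ler_pM2l ?mulr_gt0 ?ltr0n ?double_gt0 // ler_pdivrMr // [leRHS]mulrC.
have -> : C * n.*2%:R * (C1 * expR (- (2 * L))) = 2 * C * C1 * (expR L * expR (- (2 * L))).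
  by rewrite eL -muln2 natrM; ring.
by rewrite -expRD (_ : L + - (2 * L) = - L) //; ring.
Unshelve. all: by end_near.
Qed.

(* A single scale has a polynomially small failure probability, so a union over the
   logarithmically many radii [expR (- i)] and then Borel-Cantelli along powers suffice;
   monotonicity in both parameters fills in everything between two grid points. *)
Lemma sparse_ratio e : 0 < e < 1 -> exists tau r0 : R, [/\ 0 < tau, 0 < r0 &
  {ae P, forall w, \forall n \near \oo, forall r, 0 < r <= r0 ->
    sigma * n%:R * r ^+ d <= tau * ln n%:R ->
    chi N (fun i => X i w) n r <= (1 + e) * clq N (fun i => X i w) n r}].
Proof.
move=> e01; have /andP[e0 e1] := e01; have s0 := samp_gt0 hS.
have [tau [r0 [C [tau0 r00 hs]]]] := sparse_prob e01; have [C' ht] := tiny_prob.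
have ed : 0 < expR (-1) ^+ d :> R by rewrite exprn_gt0 // expR_gt0.
pose tau1 := tau * expR (-1) ^+ d; have tau10 : 0 < tau1 := mulr_gt0 tau0 ed.
(* A radius is rounded up to the next exp(-i), which can enlarge it by the factor exp(1); [r1] and
   [tau1] reserve this factor, and r <= 1 makes i nonnegative. *)
pose r1 := Num.min 1 (r0 * expR (-1)).
have r10 : 0 < r1 by rewrite lt_min ltr01 (mulr_gt0 r00 (expR_gt0 _)).
exists (sigma * tau1 / 2), r1; split=> //; first by rewrite divr_gt0 // mulr_gt0.
pose Bad n : set Omega := [set w | exists n' r, [/\ (n <= n' <= n.*2)%N, 0 < r <= r1,
  n'%:R * r ^+ d <= tau1 * ln n%:R &
  (1 + e) * clq N (fun i => X i w) n' r < chi N (fun i => X i w) n' r]].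
have hBad : \forall n \near \oo, Pbound P (Bad n) ((`|C| * (96 / e) + `|C'|) * expR (- (e / 32) * ln n%:R)).
  near=> n.
  have hn : forall rho, 0 < rho <= r0 -> n%:R * rho ^+ d <= tau * ln n%:R ->
    Pbound P [set w | exists n' r, [/\ (n <= n' <= n.*2)%N, 0 < r, rho * expR (-1) <= r <= rho &
      (1 + e) * clq N (fun i => X i w) n' r < chi N (fun i => X i w) n' r]]
    (C * expR (- (e / 16) * ln n%:R)) by near: n.
  have tn' : Pbound P [set w | exists n' r, [/\ (n' <= n.*2)%N, 0 < r, r <= expR (- (3 * ln n%:R)) &
      clq N (fun i => X i w) n' r < chi N (fun i => X i w) n' r]] (C' * expR (- ln n%:R)).
    by near: n.
  have L1 : 1 <= ln (n%:R : R) by near: n; exact: near_ln_ge.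
  have n0 : (0 < n)%N by near: n; exact: nbhs_infty_gt.
  set L := ln _ in tn' L1 *; have L0 : 0 <= L by apply: le_trans L1.
  (* Radii below exp(-3 L) belong to [tiny_prob], so scales exp(-i) with i <= 3 L suffice. *)
  pose I := (Num.truncn (3 * L)).+1.
  have L30 : 0 <= 3 * L by rewrite mulr_ge0.
  have /andP[I1 I2] := truncn_itv L30.
  pose rho i : R := expR (- i%:R).
  pose B i : set Omega := [set w | [/\ rho i <= r0, n%:R * rho i ^+ d <= tau * L &
    exists n' r, [/\ (n <= n' <= n.*2)%N, 0 < r, rho i * expR (-1) <= r <= rho i &
      (1 + e) * clq N (fun i => X i w) n' r < chi N (fun i => X i w) n' r]]].
  have hB i : i \in iota 0 I -> Pbound P (B i) (`|C| * expR (- (e / 16) * L)).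
    move=> _; have [/andP[c1 c2]|nc] := boolP ((rho i <= r0) && (n%:R * rho i ^+ d <= tau * L)).
      have rr : 0 < rho i <= r0 by rewrite expR_gt0.
      apply: Pbound_le (hn (rho i) rr c2) => [w /= []//|].
      by rewrite ler_wpM2r ?expR_ge0 // ler_norm.
    exists set0; split=> //; last by rewrite measure0 lee_fin mulr_ge0 ?expR_ge0.
    by move=> w /= [c1 c2 _]; move: nc; rewrite c1 c2.
  have PB := Pbound_big hB.
  apply: Pbound_le (Pbound_setU PB tn') => [w /= [n' [r [nn /andP[rp rr] hr bad]]]|]; last first.
    rewrite big_const_seq count_predT iter_addr_0 size_iota -[_ *+ I]mulr_natl.
    exact: union_numeric e01 L0 I1.
  have [rt|rt] := leP r (expR (- (3 * L))).
    right; exists n', r; split=> //; first by case/andP: nn.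
    by apply: le_lt_trans bad; rewrite ler_peMl ?ler0n // lerDl ltW.
  left; have r1' : r <= 1 by apply: le_trans rr _; rewrite ge_min lexx.
  have lr0 : 0 <= - ln r by rewrite oppr_ge0 ln_le0.
  have lr3 : - ln r < 3 * L by rewrite ltrNl -ltr_expR lnK.
  have /andP[i1 i2] := truncn_itv lr0.
  set i := Num.truncn _ in i1 i2.
  have ri1 : rho i * expR (-1) <= r.
    by rewrite /rho -expRD -[leRHS]lnK ?posrE // ler_expR -opprD natr1 lerNl ltW.
  have ri2 : r <= rho i by rewrite /rho -[leLHS]lnK ?posrE // ler_expR lerNr.
  have rhoe : rho i <= r * expR 1.
    by rewrite -ler_pdivrMr ?expR_gt0 // -expRN.
  have iI : i \in iota 0 I.
    by rewrite mem_iota leq0n add0n -(ltr_nat R) (le_lt_trans i1) // (lt_trans lr3).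
  exists i => //.
  split; last by exists n', r; split=> //; rewrite ri1.
    apply: (le_trans rhoe); rewrite -ler_pdivlMr ?expR_gt0 // -expRN; apply: (le_trans rr).
    by rewrite ge_min lexx orbT.
  have e1d : expR 1 ^+ d * expR (-1) ^+ d = 1 :> R by rewrite -exprMn -expRD subrr expR0 expr1n.
  have E1 : 0 < expR 1 ^+ d :> R by rewrite exprn_gt0 // expR_gt0.
  apply: (@le_trans _ _ (n%:R * (r * expR 1) ^+ d)).
    by rewrite ler_wpM2l // lerXn2r ?nnegrE ?expR_ge0 // mulr_ge0 ?expR_ge0 // ltW.
  rewrite exprMn mulrA -ler_pdivlMr //; apply: (@le_trans _ _ (n'%:R * r ^+ d)).
    by rewrite ler_wpM2r ?exprn_ge0 ?(ltW rp) // ler_nat; case/andP: nn.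
  apply: (le_trans hr); rewrite ler_pdivlMr // -/L.
  rewrite (_ : tau1 * L * expR 1 ^+ d = tau * L * (expR 1 ^+ d * expR (-1) ^+ d)); last by rewrite /tau1; ring.
  by rewrite e1d mulr1.
have [k k0 hae] := ae_powers (divr_gt0 e0 (ltr0n R 32)) hBad.
apply: filterS hae => w hw.
have := @near_powers R k 1 (fun j => ~ Bad (j ^ k)%N w) k0 ltr01 hw; apply: filterS => n [j [Bj _ jn nj [jpos j2 [lj ljS]]]] r rr hr.
rewrite leNgt; apply/negP => bad; apply: Bj; exists n, r; split=> //.
  rewrite jn /=; apply: (leq_trans nj); rewrite -(ler_nat R) (le_trans j2) //.
  by rewrite -muln2 natrM mulrC.
have ln_le : ln (n%:R : R) <= 2 * ln ((j ^ k)%:R : R).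
  apply: le_trans ljS; rewrite ler_ln ?posrE ?ltr0n ?(leq_trans jpos jn) ?ler_nat //.
  by rewrite (leq_trans jpos) // (leq_trans jn).
exact: level_scale_numeric s0 (ltW tau10) hr ln_le.
Unshelve. all: by end_near.
Qed.

End SparsePoints.

(** * The ratio of the two parameters *)

Section RatioNumerics.
Variable R : realType.
Implicit Types (e ch cl q A B mu : R).

Lemma sparse_quotient e ch cl q : 0 < e < 1 -> 0 < cl -> 1 <= q <= 1 + e -> cl <= ch <= (1 + e) * cl ->
  `|1 - ch / (cl * q)| <= 3 * e.
Proof.
move=> /andP[e0 e1] cl0 /andP[q1 qe] /andP[h1 h2].
have q0 : 0 < cl * q by rewrite mulr_gt0 //; lra.
have u : ch / (cl * q) <= 1 + e.
  rewrite ler_pdivrMr // (le_trans h2) // ler_pM2l; last by lra.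
  by rewrite ler_peMr // ltW.
have l : 1 - e <= ch / (cl * q).
  rewrite ler_pdivlMr //; apply: le_trans h1; rewrite mulrCA ler_piMr ?(ltW cl0) //.
  apply: (@le_trans _ _ ((1 - e) * (1 + e))); first by rewrite ler_wpM2l //; lra.
  have : 0 <= e * e by rewrite mulr_ge0 // ltW.
  lra.
rewrite ler_norml; lra.
Qed.

Lemma dense_quotient e ch cl A B mu : 0 < e <= 1 / 4 -> 0 < A -> 0 < B -> 0 < mu ->
  (1 - e) * (mu * A) <= ch <= (1 + e) * (mu * A) -> (1 - e) * (mu * B) <= cl <= (1 + e) * (mu * B) ->
  `|1 - ch / (cl * (A / B))| <= 3 * e.
Proof.
move=> /andP[e0 e1] A0 B0 mu0 /andP[h1 h2] /andP[h3 h4].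
have mA : 0 < mu * A by rewrite mulr_gt0.
have mB : 0 < mu * B by rewrite mulr_gt0.
have AB : 0 < A / B by rewrite divr_gt0.
have mE : mu * B * (A / B) = mu * A by field; rewrite gt_eqF.
set Y := cl * (A / B).
have y1 : (1 - e) * (mu * A) <= Y by rewrite /Y -mE [(1 - e) * _]mulrA ler_pM2r.
have y2 : Y <= (1 + e) * (mu * A) by rewrite /Y -mE [(1 + e) * _]mulrA ler_pM2r.
have Y0 : 0 < Y by apply: lt_le_trans y1; rewrite mulr_gt0 //; lra.
have ee : e * e <= e * (1 / 4) by rewrite ler_pM2l.
have ee0 : 0 <= e * e by rewrite mulr_ge0 // ltW.
have u : ch / Y <= 1 + 3 * e.
  rewrite ler_pdivrMr //; apply: (le_trans h2); apply: (@le_trans _ _ ((1 + 3 * e) * ((1 - e) * (mu * A)))).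
    by rewrite [leRHS]mulrA ler_pM2r //; lra.
  by rewrite ler_pM2l //; lra.
have l : 1 - 3 * e <= ch / Y.
  rewrite ler_pdivlMr //; apply: le_trans h1; apply: (@le_trans _ _ ((1 - 3 * e) * ((1 + e) * (mu * A)))).
    by rewrite ler_pM2l //; lra.
  by rewrite [leLHS]mulrA ler_pM2r //; lra.
rewrite ler_norml; lra.
Qed.

End RatioNumerics.

Section Ratio.
Variables (R : realType) (d : nat) (leb : {measure set (d.-tuple R) -> \bar R}).
Variables (d0 : measure_display) (Omega : measurableType d0) (P : probability Omega R).
Variable X : nat -> Omega -> d.-tuple R.

Lemma law_measure (Y : Omega -> d.-tuple R) : measurable_fun setT Y ->
  exists nu : {measure set (d.-tuple R) -> \bar R}, forall A, nu A = P (Y @^-1` A).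
Proof. by move=> mY; exists (distribution P (mfun_Sub (mem_set mY))). Qed.

Lemma sampling_of_density (f : d.-tuple R -> R) : (1 <= d)%N -> is_lebesgue leb ->
  measurable_fun setT f -> (forall x, 0 <= f x) -> (exists M : R, forall x, f x <= M) ->
  (forall i, measurable_fun setT (X i)) ->
  (forall i (A : set (d.-tuple R)), measurable A -> P (X i @^-1` A) = (\int[leb]_(x in A) (f x)%:E)%E) ->
  mutually_independent P X ->
  exists nu : {measure set (d.-tuple R) -> \bar R},
    sampling leb P X nu (ess_sigma leb f) (fun e => [set x | (1 - e) * ess_sigma leb f < f x]).
Proof.
move=> hd hleb mf f0 fbd mX hX hind; have [nu nuX] := law_measure (mX 0%N).
have nuE A : measurable A -> nu A = (\int[leb]_(x in A) (f x)%:E)%E by move=> mA; rewrite nuX hX.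
have nuT : nu setT = 1%E by rewrite nuX preimage_setT probability_setT.
have s0 := sigma_gt0 hleb mf f0 fbd nuE nuT.
exists nu; split=> //.
- by move=> i A mA; rewrite hX // nuE.
- by move=> A mA; exact: (nu_le hleb mf f0 fbd nuE).
- by move=> e; exact: measurable_superlevel.
- move=> e A /andP[e0 e1] mA; apply: (nu_ge mf f0 nuE) => //.
  by rewrite mulr_ge0 ?(ltW s0) // subr_ge0 ltW.
- by move=> e eta m e0 eta0 m0; exact: (good_windows hleb mf f0 fbd nuE nuT).
Qed.

Variables (nu : {measure set (d.-tuple R) -> \bar R}) (sigma : R) (F : R -> set (d.-tuple R)).
Hypothesis hS : sampling leb P X nu sigma F.
Variable N : 'rV[R]_d -> R.
Hypothesis hN : is_norm N.

Lemma ratio_ae e (r : nat -> R) : 0 < e <= 1 / 4 -> (forall n, 0 < r n) -> r @ \oo --> 0 ->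
  {ae P, forall w, \forall n \near \oo,
    `|1 - chi N (fun i => X i w) n (r n) /
      (clq N (fun i => X i w) n (r n) * f_rat N leb (sigma * n%:R * r n ^+ d / ln (n%:R : R)))| <= 3 * e}.
Proof.
move=> e04 rpos rlim; have hd := samp_dim hS; have hleb := samp_leb hS; have s0 := samp_gt0 hS.
have e01 : 0 < e < 1 by case/andP: e04 => ->; lra.
have [Cm hCm] := feasible_weight hd hN hleb; have fb := ball_feasible hd hN.
have mB : measurable (Ball N (origin R d) (1 / 2)) by exact: measurable_Ball.
have fB := leb_Ball_fin hd hN hleb (1 / 2).
have vB : 0 < fine (leb (Ball N (origin R d) (1 / 2))) by apply: leb_Ball_gt0.
have ipos : 0 < \int[leb]_x ball_weight N x by have [_ ->] := weight_indicator mB fB.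
have Gpos : exists2 phi, feasible N phi & 0 < \int[leb]_x phi x by exists (ball_weight N).
have Bw phi : [set ball_weight N] phi -> weight leb phi /\ \int[leb]_x phi x <= Cm.
  by move=> ->; exact: hCm.
have Bpos : exists2 phi, [set ball_weight N] phi & 0 < \int[leb]_x phi x by exists (ball_weight N).
have Blow (x : nat -> d.-tuple R) n r' u phi : 0 < r' -> [set ball_weight N] phi ->
    \sum_(i < n) phi (aff r'^-1 u (x i)) <= clq N x n r'.
  by move=> r0 ->; exact: clq_low.
have xiB t : xi_sup leb [set ball_weight N] t = xi leb (ball_weight N) t.
  by rewrite /xi_sup image_set1 ereal_sup1.
have [tau1 [r0 [tau10 r00 hsparse]]] := sparse_ratio hS hN e01.
have [tau2 tau20 hxi] := xi_le_indicator Cm mB fB vB (proj1 (andP e01)).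
(* The threshold is fixed before n, and each n is then treated according to its own t(n): above
   [tau] both parameters have their asymptotic values, below it chi is within 1 + e of omega by
   [tau1] and f_rat lies in [1, 1 + e] by [tau2]. *)
pose tau := Num.min tau1 tau2; have tau0 : 0 < tau by rewrite lt_min tau10.
have hchi := asymptotic_ratio hS hCm Gpos (fun x n r' u phi => @chi_low R d N hN x n r' u phi)
  (fun x n n' r' r'' nn _ rr => @chi_mono R d N x n n' r' r'' nn rr)
  (fun eps eps0 => chi_up hd hN hleb eps0) tau0 e01 rpos rlim.
have hclq := asymptotic_ratio hS Bw Bpos Blow
  (fun x n n' r' r'' nn _ rr => @clq_mono R d N x n n' r' r'' nn rr)
  (fun eps eps0 => clq_up hd hN hleb eps0) tau0 e01 rpos rlim.
have rsmall : \forall n \near \oo, r n <= r0.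
  by near=> n; apply: ltW; near: n; exact: (cvgr_lt 0 rlim).
move: hsparse hchi hclq; apply: filterS3 => w hw1 hw2 hw3; near=> n.
have L1 : 1 <= ln (n%:R : R) by near: n; exact: near_ln_ge.
have n0 : (0 < n)%N by near: n; exact: nbhs_infty_gt.
have rr : 0 < r n <= r0 by rewrite rpos /=; near: n.
have h1 : forall r', 0 < r' <= r0 -> sigma * n%:R * r' ^+ d <= tau1 * ln n%:R ->
    chi N (fun i => X i w) n r' <= (1 + e) * clq N (fun i => X i w) n r' by near: n.
have h2 : tau * ln n%:R <= sigma * n%:R * r n ^+ d ->
    (1 - e) * (sigma * n%:R * r n ^+ d * xi_sup leb (feasible N) (sigma * n%:R * r n ^+ d / ln n%:R)) <=
    chi N (fun i => X i w) n (r n) <=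
    (1 + e) * (sigma * n%:R * r n ^+ d * xi_sup leb (feasible N) (sigma * n%:R * r n ^+ d / ln n%:R)) by near: n.
have h3 : tau * ln n%:R <= sigma * n%:R * r n ^+ d ->
    (1 - e) * (sigma * n%:R * r n ^+ d * xi_sup leb [set ball_weight N] (sigma * n%:R * r n ^+ d / ln n%:R)) <=
    clq N (fun i => X i w) n (r n) <=
    (1 + e) * (sigma * n%:R * r n ^+ d * xi_sup leb [set ball_weight N] (sigma * n%:R * r n ^+ d / ln n%:R)) by near: n.
set L := ln _ in L1 h1 h2 h3 *; have L0 : 0 < L by apply: lt_le_trans L1.
have mu0 : 0 < sigma * n%:R * r n ^+ d by rewrite !mulr_gt0 ?ltr0n // exprn_gt0.
move: h2 h3 (h1 (r n) rr); set mu := sigma * n%:R * r n ^+ d in mu0 * => h2 h3 h1'.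
have t0 : 0 < mu / L by rewrite divr_gt0.
have A0 := xi_sup_gt0 hCm Gpos t0; have B0 := xi_sup_gt0 Bw Bpos t0.
have -> : f_rat N leb (mu / L) = xi_sup leb (feasible N) (mu / L) / xi_sup leb [set ball_weight N] (mu / L).
  by rewrite xiB.
have [le|lt] := leP (tau * L) mu.
  exact: dense_quotient e04 A0 B0 mu0 (h2 le) (h3 le).
have cl1 : 1 <= clq N (fun i => X i w) n (r n) by exact: clq_ge1.
apply: sparse_quotient e01 (lt_le_trans ltr01 cl1) _ _.
  rewrite ler_pdivlMr // mul1r ler_pdivrMr // xiB; apply/andP; split; first exact: (xi_sup_ge hCm Gpos t0 fb).
  apply: (xi_sup_le hCm Gpos t0) => phi fphi; have [wphi iphi] := hCm phi fphi.
  apply: hxi => //; rewrite t0 /= ler_pdivrMr //; apply: (le_trans (ltW lt)).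
  by rewrite ler_wpM2r ?(ltW L0) // ge_min lexx orbT.
rewrite h1' ?andbT; last by apply: (le_trans (ltW lt)); rewrite ler_wpM2r ?(ltW L0) // ge_min lexx.
rewrite ler_nat; exact: clique_le_chromatic.
Unshelve. all: by end_near.
Qed.


End Ratio.

Theorem theorem1p4
  (R : realType) (d : nat) (hd : (1 <= d)%N)
  (N : 'rV[R]_d -> R) (hN : is_norm N)
  (leb : {measure set (d.-tuple R) -> \bar R}) (hleb : is_lebesgue leb)
  (f : d.-tuple R -> R) (hf_meas : measurable_fun setT f)
  (hf_nonneg : forall x, 0 <= f x)
  (hf_bdd : exists M : R, forall x, f x <= M)
  (d0 : measure_display) (Omega : measurableType d0) (P : probability Omega R)
  (X : nat -> Omega -> d.-tuple R)
  (hX_meas : forall i, measurable_fun setT (X i))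
  (hX_law : forall i (A : set (d.-tuple R)), measurable A ->
     P (X i @^-1` A) = (\int[leb]_(x in A) (f x)%:E)%E)
  (hX_indep : mutually_independent P X)
  (r : nat -> R) (hr_pos : forall n, 0 < r n) (hr_lim : r @ \oo --> 0) :
  let sigma := ess_sigma leb f in
  let t := fun n : nat => sigma * n%:R * r n ^+ d / ln (n%:R : R) in
  let adj := fun (n : nat) (w : Omega) (i j : 'I_n) =>
    dist N (X i w) (X j w) <= r n in
  {ae P, forall w,
    (fun n : nat => (chromatic_number (adj n w))%:R /
       ((clique_number (adj n w))%:R * f_rat N leb (t n))) @ \oo --> (1 : R)}.
Proof.
move=> sigma t adj.
have [nu hS] := sampling_of_density hd hleb hf_meas hf_nonneg hf_bdd hX_meas hX_law hX_indep.
(* Convergence is the intersection of countably many almost sure events, one for each e = 1 / (k +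
   4); the shift by 4 ensures e <= 1/4. *)
have e04 k : 0 < (k.+4%:R : R)^-1 <= 1 / 4.
  by rewrite invr_gt0 ltr0n /= mul1r lef_pV2 ?posrE ?ltr0n // ler_nat.
have H := ae_foralln (fun k => ratio_ae hS hN (e04 k) hr_pos hr_lim).
apply: filterS H => w hw; apply/cvgrPdist_le => eps eps0.
pose k := Num.truncn (3 / eps).
have /andP[_ k1] := truncn_itv (divr_ge0 (ler0n R 3) (ltW eps0)).
apply: filterS (hw k) => n; rewrite /t => /le_trans; apply.
rewrite ler_pdivrMr ?ltr0n // -ler_pdivrMl // mulrC (le_trans (ltW k1)) // ler_nat.
by rewrite -/k; apply: leqW; apply: leqW.
Qed.
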